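(* The Grothendieck--Teichmüller group $\mathsf{GRT}_1=\exp(\mathfrak{grt}_1)$ acts via $\mathsf{Lie}_\infty$-automorphisms on the deformation complexes of both Lie-quasi bialgebroids and quasi-Lie bialgebroids. That is, for every vector bundle $E\to\mathscr M$ it acts via $\mathsf{Lie}_\infty$-automorphisms on the graded Lie algebras $\big(\mathcal A^E_{\text{Lie-quasi}}[2],\{\cdot,\cdot\}^E_\Omega\big)$ and $\big(\mathcal A^E_{\text{quasi-Lie}}[2],\{\cdot,\cdot\}^E_\Omega\big)$, the action being the exponentiation of $$\mathfrak{grt}_1\simeq H^0\big(\mathsf{GC}^{\mathrm{conn}}(\mathcal O^{\mathrm{black}})\big)\to H^0\big(\mathsf{CE}(\mathcal A^E_{\text{Lie-quasi}}[2]),\delta_{\mathsf S}\big),\qquad \mathfrak{grt}_1\simeq H^0\big(\mathsf{GC}^{\mathrm{conn}}(\mathcal O^{\mathrm{red}})\big)\to H^0\big(\mathsf{CE}(\mathcal A^E_{\text{quasi-Lie}}[2]),\delta_{\mathsf S}\big)$$ respectively, where the maps are induced by the action $\mathsf{Rep}^E$ of graphs on functions.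
   Context: Graded geometry. Let $\mathbb K$ be the ground field, of characteristic zero ($\mathbb K=\mathbb R$ for smooth functions). For a vector bundle $E\to\mathscr M$ over a smooth finite-dimensional manifold, let $\mathscr E=T^*[2]E[1]$, with homogeneous local coordinates $x^\mu,\xi^a,\zeta_a,p_\mu$ of degrees $0,1,1,2$, and graded symplectic form $\Omega=dx^\mu\wedge dp_\mu+d\xi^a\wedge d\zeta_a$. All formulae are local, i.e. understood in such a coordinate system. The big bracket is the Poisson bracket of degree $-2$ on $\mathscr C^\infty(\mathscr E)$ $$\{f,g\}^E_\Omega=\tfrac{\partial f}{\partial x^\mu}\tfrac{\partial g}{\partial p_\mu}-\tfrac{\partial f}{\partial p_\mu}\tfrac{\partial g}{\partial x^\mu}+(-1)^{|f|}\Big(\tfrac{\partial f}{\partial \xi^a}\tfrac{\partial g}{\partial\zeta_a}+\tfrac{\partial f}{\partial \zeta_a}\tfrac{\partial g}{\partial\xi^a}\Big).$$ $\mathcal A^E_{\text{Lie-quasi}}$ is the Poisson subalgebra of functions vanishing on $E[1]=\{p=\zeta=0\}$, and $\mathcal A^E_{\text{quasi-Lie}}$ the Poisson subalgebra of functions vanishing on $E^*[1]=\{p=\xi=0\}$. Degree $3$ elements $\mathscr H$ with $\{\mathscr H,\mathscr H\}^E_\Omega=0$ in these subalgebras are the Lie-quasi, respectively quasi-Lie, bialgebroid structures on $(E,E^* )$; the graded Lie algebras $(\mathcal A^E_{\text{Lie-quasi}}[2],\{\cdot,\cdot\}^E_\Omega)$ and $(\mathcal A^E_{\text{quasi-Lie}}[2],\{\cdot,\cdot\}^E_\Omega)$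 are the corresponding deformation complexes. $\mathsf{CE}(\mathfrak g)$ denotes the (completed) Chevalley--Eilenberg cochain space $\prod_n\mathrm{Hom}(\wedge^n\mathfrak g,\mathfrak g)$ with the Nijenhuis--Richardson bracket $[\cdot,\cdot]_{\mathsf{NR}}$ and differential $\delta_{\mathsf S}=[\{\cdot,\cdot\}^E_\Omega,\cdot]_{\mathsf{NR}}$. Degree $0$ cocycles are $\mathsf{Lie}_\infty$-derivations of the graded Lie algebra, which exponentiate to $\mathsf{Lie}_\infty$-automorphisms. Grothendieck--Teichmüller algebra. $\mathfrak{grt}_1$ is the pro-nilpotent Lie algebra (with Ihara bracket) of Lie series $\psi(x,y)$ in the completed free Lie algebra on $x,y$ satisfying $\psi(x,y)=-\psi(y,x)$; $\psi(x,y)+\psi(y,z)+\psi(z,x)=0$ for $x+y+z=0$; and $\psi(t_{12},t_{23}+t_{24})+\psi(t_{13}+t_{23},t_{34})=\psi(t_{23},t_{34})+\psi(t_{12}+t_{13},t_{24}+t_{34})+\psi(t_{12},t_{23})$ in the completed Drinfeld--Kohno Lie algebra on four strands. Graphs. A bi-directed graph is a directed graph (loops and multiple edges allowed) with vertices labelled $1,\dots,N$, $k$ labelled directed edges (the black arrows), and on each edge an additional red arrow which is either aligned with or opposite to the black arrow. Let $\mathcal D(N)$ be the graded vector space spanned by such graphs modulo relabelling of edges, each edge having degree $-2$ (edges are even). $\mathcal D$ is an operad: $\gamma\circ_i\gamma'$ is obtained by inserting $\gamma'$ in the vertex $i$ of $\gamma$ and summing over all ways of reattaching the edges of $\gamma$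 incident to $i$ to vertices of $\gamma'$ (with vertices relabelled in the usual way). $\mathcal O^{\mathrm{black}}$ (resp. $\mathcal O^{\mathrm{red}}$) is the suboperad of graphs without directed cycles of black (resp. red) arrows. For a suboperad $\mathcal P\subseteq\mathcal D$ put $\mathsf{GC}(\mathcal P)=\prod_{N\ge1}\big(\mathcal P(N)\otimes\mathrm{sgn}_N[3(1-N)]\big)^{\mathbb S_N}$, so that a graph with $N$ vertices and $k$ edges has degree $3(N-1)-2k$. It is a dg Lie algebra, namely the deformation complex of $\mathsf{Lie}\{-2\}\to\mathcal P$ ($\mathsf{Lie}\{-2\}$ being the operad of Lie algebras with bracket of degree $-2$): the bracket is the graded commutator of the pre-Lie product obtained from summing the partial compositions over all insertions, antisymmetrised over vertex labels, and the differential is $\delta=[\Upsilon_{\mathsf S},\cdot]$ with $\Upsilon_{\mathsf S}=(1\to2)-(2\to1)$, where $(1\to2)$ is the sum of the two graphs with vertices $1,2$ and one black edge from $1$ to $2$, with red arrow respectively aligned and opposite. $\mathsf{GC}^{\mathrm{conn}}(\mathcal P)$ denotes the sub-dg Lie algebra of connected graphs. It is known (Willwacher, Živković) that $H^0(\mathsf{GC}^{\mathrm{conn}}(\mathcal O^{\mathrm{black}}))\simeq H^0(\mathsf{GC}^{\mathrm{conn}}(\mathcal O^{\mathrm{red}}))\simeq\mathfrak{grt}_1$; these are the isomorphisms used in the claim. Action. $\mathsf{Rep}^E:\mathcal D\to\mathsf{End}_{\mathscr C^\infty(\mathscr E)}$ is given by $\mathsf{Rep}^E_N(\gamma)(f_1\otimes\cdots\otimes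 f_N)=\mu_N\big(\prod_{e}\Delta_e(f_1\otimes\cdots\otimes f_N)\big)$, with $\mu_N$ the multiplication, the product running over the edges $e$ of $\gamma$, and, for an edge $e$ with black arrow from $i$ to $j$, $\Delta_e=\frac{\partial}{\partial x^\mu_{(i)}}\frac{\partial}{\partial p_\mu^{(j)}}$ if the red arrow is aligned with the black one and $\Delta_e=\frac{\partial}{\partial \xi^a_{(i)}}\frac{\partial}{\partial \zeta_a^{(j)}}$ if it is opposite; the index $(i)$ means that the derivative acts on the $i$-th tensor factor. The action of $\mathcal O^{\mathrm{black}}$ preserves $\mathcal A^E_{\text{Lie-quasi}}$ and that of $\mathcal O^{\mathrm{red}}$ preserves $\mathcal A^E_{\text{quasi-Lie}}$. *)

(* Defs.v *)
From HB Require Import structures.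
From mathcomp Require Import all_boot all_order all_fingroup all_algebra.
From mathcomp Require Import finmap multiset.
From mathcomp Require Import all_classical all_reals all_analysis.
Import numFieldNormedType.Exports.

Set Implicit Arguments.
Unset Strict Implicit.
Unset Printing Implicit Defensive.

Import Order.TTheory GRing.Theory Num.Theory.
Local Open Scope classical_set_scope.
Local Open Scope ring_scope.

(* A partition of the positions of a list [s] into blocks labelled 0, 1, ...
    is a list [c] of labels, one per position; [block k c s] is the sublist of
    the entries with label [k].  The permutation that sorts [s] by blocks has
    one inversion for each pair of positions i < j with [c_j < c_i]; it costs
    the sign [(-1) ^+ chi t_i t_j], where [t] lists the parities. *)

Definition block (T : Type) (k : nat) (c : seq nat) (s : seq T) : seq T :=
  [seq x.2 | x <- zip c s & x.1 == k].

Definition shuffle_exp (chi : bool -> bool -> bool) (c : seq nat)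
    (t : seq bool) : nat :=
  (\sum_(j < size c) \sum_(i < j)
     ((nth 0 c j < nth 0 c i) && chi (nth false t i) (nth false t j)))%N.

(* signature times Koszul sign: - (-1)^(|a||b|) per inversion *)
Definition skew_chi (a b : bool) : bool := ~~ (a && b).
(* Koszul sign after a shift by one: (-1)^((|a|+1)(|b|+1)) per inversion *)
Definition sym_chi (a b : bool) : bool := ~~ a && ~~ b.

Definition labels n k (c : n.-tuple 'I_k) : seq nat := [seq val i | i <- c].

(* The data of a graded Lie algebra, realised as the subspace [gsub] of an
   ambient module; [gpar b] projects onto the part of parity [b] and [ghom d]
   is the subspace of degree [d] (bracket of degree 0). *)
Record glie (R : realType) := Glie {
  gcar :> lmodType R;
  gpar : bool -> gcar -> gcar;
  ghom : int -> set gcar;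
  gsub : set gcar;
  gbr : gcar -> gcar -> gcar
}.

Section ChevalleyEilenberg.
Context (R : realType) (L : glie R).

(* A family of maps in all arities n >= 1 at once: the value on a list of
   length n is that of the n-ary component (the value on [::] is ignored). *)
Definition family := seq L -> L.

Definition in_sub (s : seq L) : Prop := forall u, u \in s -> gsub u.

Definition feq (P Q : family) : Prop :=
  forall s, s <> [::] -> in_sub s -> P s = Q s.

Definition parts (t : seq bool) (s : seq L) : seq L :=
  [seq gpar x.1 x.2 | x <- zip t s].

(* Elements of degree [d] of prod_(n >= 1) Hom(wedge^n L, L); the n-ary
   component has degree d + 1 - n as a map of graded spaces. *)
Definition cochain (d : int) (P : family) : Prop :=
  [/\ forall s, s <> [::] -> in_sub s -> gsub (P s),
      forall s1 s2 (a : R) u v, in_sub s1 -> in_sub s2 -> gsub u -> gsub v ->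
        P (s1 ++ (a *: u + v) :: s2) = a *: P (s1 ++ u :: s2) + P (s1 ++ v :: s2),
      forall s1 s2 u v p q, in_sub s1 -> in_sub s2 -> gsub u -> gsub v ->
        gpar p u = u -> gpar q v = v ->
        P (s1 ++ u :: v :: s2) = (-1) ^+ skew_chi p q *: P (s1 ++ v :: u :: s2)
    & forall (s : seq L) (ds : seq int), s <> [::] -> in_sub s ->
        size ds = size s ->
        (forall i, (i < size s)%N -> ghom (nth 0 ds i) (nth 0 s i)) ->
        ghom (\sum_(e <- ds) e + d + 1 - (size s)%:Z) (P s)].

(* The sum over all unshuffles of P(Q(block 0), block 1), for Q of parity [d];
   non-homogeneous arguments are expanded into their parity components [t]. *)
Definition insertion (chi : bool -> bool -> bool) (d : bool) (P Q : family) :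
    family := fun s =>
  \sum_(c : (size s).-tuple 'I_2 | ord0 \in c) \sum_(t : (size s).-tuple bool)
    (-1) ^+ (shuffle_exp chi (labels c) t + d * size (block 1 (labels c) s)) *:
    P (Q (block 0 (labels c) (parts t s)) :: block 1 (labels c) (parts t s)).

(* Nijenhuis-Richardson bracket of P and Q of degrees of parity [d] and [d'] *)
Definition nr_br (d d' : bool) (P Q : family) : family :=
  insertion skew_chi d' P Q - (-1) ^+ (d && d') *: insertion skew_chi d Q P.

Definition br_family : family := fun s => if s is [:: u; v] then gbr u v else 0.

(* delta_S on cochains of degree of parity [d] *)
Definition ce_diff (d : bool) (P : family) : family :=
  nr_br true d br_family P.

Definition ce_cocycle (P : family) : Prop :=
  cochain 0 P /\ feq (ce_diff false P) 0.

Definition ce_exact (P : family) : Prop :=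
  exists2 h, cochain (-1) h & feq P (ce_diff true h).

Definition cohomologous (P Q : family) : Prop := ce_exact (P - Q).

(* Decalage Hom(wedge^n L, L) -> Hom(S^n(L[1]), L[1]), P |-> s P (s^-1)^(x n);
   it is involutive as an operation on families of maps on the vector space
   underlying L, and it turns [insertion skew_chi] into
   [insertion sym_chi false]. *)
Definition decalage (P : family) : family := fun s =>
  \sum_(t : (size s).-tuple bool)
    (-1) ^+ (\sum_(i < size s) ((size s).-1 - i) * ~~ nth false t i)%N *:
    P (parts t s).

(* Composition of coalgebra morphisms S(L[1]) -> S(L[1]), on their
   corestrictions: the sum over the (ordered, divided by k!) partitions into k
   non-empty blocks of G(F(block 0), ..., F(block k-1)). *)
Definition coalg_comp (G F : family) : family := fun s =>
  \sum_(k < (size s).+1) (k`!%:R)^-1 *: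
    \sum_(c : (size s).-tuple 'I_k | [forall j : 'I_k, j \in c])
      \sum_(t : (size s).-tuple bool)
        (-1) ^+ shuffle_exp sym_chi (labels c) t *:
        G [seq F (block j (labels c) (parts t s)) | j <- iota 0 k].

Definition id_family : family := fun s => if s is [:: u] then u else 0.

(* Lie-infinity endomorphisms of L: coalgebra morphisms of S(L[1]) that
   commute with the codifferential defined by the bracket *)
Definition linf_morph (F : family) : Prop :=
  cochain 0 F /\
  feq (insertion sym_chi false (decalage F) (decalage br_family))
      (coalg_comp (decalage br_family) (decalage F)).

Definition linf_comp (G F : family) : family :=
  decalage (coalg_comp (decalage G) (decalage F)).

Definition linf_aut (F : family) : Prop :=
  linf_morph F /\ exists G, [/\ linf_morph G,
    feq (linf_comp F G) id_family & feq (linf_comp G F) id_family].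

(* The corestriction of exp(D) = sum_j D^j / j!, D acting as a coderivation.
   Meant for D of degree 0 without unary component: then D^j vanishes on lists
   of length <= j, and the sum is finite. *)
Definition linf_exp (D : family) : family := fun s =>
  \sum_(j < size s) (j`!%:R)^-1 *:
    iter j (fun E => insertion skew_chi false E D) id_family s.

(* F and G differ by the exponential of an exact derivation; [ce_diff true h]
   never has a unary component. *)
Definition homotopic (F G : family) : Prop :=
  exists2 h, cochain (-1) h & feq F (linf_comp G (linf_exp (ce_diff true h))).

End ChevalleyEilenberg.

Section Series.
Context (R : realType).

(* Non-commutative formal power series: the coefficient of each word.  The
   completed free Lie algebra is the subspace [lie_series]. *)
Definition ser (T : Type) := seq T -> R^o.

Definition ser_mul T (f g : ser T) : ser T := fun w =>
  \sum_(i < (size w).+1) f (take i w) * g (drop i w).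

Definition ser_br T (f g : ser T) : ser T := ser_mul f g - ser_mul g f.

Definition ser_one T : ser T := fun w => (nilp w)%:R.

Definition ser_prod T (s : seq (ser T)) : ser T :=
  foldr (@ser_mul T) (@ser_one T) s.

Definition letter (T : eqType) (t : T) : ser T := fun w => (w == [:: t])%:R.

Definition hpart T (n : nat) (f : ser T) : ser T := fun w =>
  if size w == n then f w else 0.

Inductive lie_poly (T : eqType) : ser T -> Prop :=
| lie_poly_letter t : lie_poly (letter t)
| lie_poly_lin a f g : lie_poly f -> lie_poly g -> lie_poly (a *: f + g)
| lie_poly_br f g : lie_poly f -> lie_poly g -> lie_poly (ser_br f g).

Definition lie_series (T : eqType) (f : ser T) : Prop :=
  forall n, lie_poly (hpart n f).

(* f(u) for series u without constant term: only words v of f with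
   size v <= size w contribute to the coefficient of w *)
Definition subst (T : finType) T' (u : T -> ser T') (f : ser T) : ser T' :=
  fun w => \sum_(n < (size w).+1) \sum_(v : n.-tuple T)
    f v * ser_prod [seq u t | t <- v] w.

(* The letters x and y are [true] and [false]. *)
Definition subst2 T' (f : ser bool) (a b : ser T') : ser T' :=
  subst (fun t => if t then a else b) f.

Definition lX : ser bool := letter true.
Definition lY : ser bool := letter false.

(* The Drinfeld-Kohno Lie algebra on four strands is the quotient of the free
   Lie algebra on the letters t_ij by the Lie ideal [dk_ideal]. *)
Definition dk (i j : 'I_4) : ser ('I_4 * 'I_4)%type := letter (i, j).

Inductive dk_ideal : ser ('I_4 * 'I_4)%type -> Prop :=
| dk_diag i : dk_ideal (dk i i)
| dk_sym i j : dk_ideal (dk i j - dk j i)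
| dk_far i j k l : uniq [:: i; j; k; l] -> dk_ideal (ser_br (dk i j) (dk k l))
| dk_near i j k : uniq [:: i; j; k] ->
    dk_ideal (ser_br (dk i j) (dk i k + dk j k))
| dk_lin a f g : dk_ideal f -> dk_ideal g -> dk_ideal (a *: f + g)
| dk_br f g : lie_poly f -> dk_ideal g -> dk_ideal (ser_br f g).

(* Completing gives the product of the homogeneous parts. *)
Definition dk_eq (f g : ser ('I_4 * 'I_4)%type) : Prop :=
  forall n, dk_ideal (hpart n (f - g)).

(* t_ij, with strands numbered 1, ..., 4 *)
Definition t4 (i j : nat) := dk (inord i.-1) (inord j.-1).

Definition grt (psi : ser bool) : Prop :=
  [/\ lie_series psi,
      psi = - subst2 psi lY lX,
      (let z := - lX - lY in
       subst2 psi lX lY + subst2 psi lY z + subst2 psi z lX = 0)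
    & dk_eq (subst2 psi (t4 1 2) (t4 2 3 + t4 2 4)
               + subst2 psi (t4 1 3 + t4 2 3) (t4 3 4))
            (subst2 psi (t4 2 3) (t4 3 4)
               + subst2 psi (t4 1 2 + t4 1 3) (t4 2 4 + t4 3 4)
               + subst2 psi (t4 1 2) (t4 2 3))].

(* the derivation x |-> [psi, x], y |-> 0 *)
Definition ihara_der (psi f : ser bool) : ser bool := fun w =>
  \sum_(n < (size w).+1) \sum_(v : n.-tuple bool) \sum_(i < n)
    f v * ser_prod ([seq letter t | t <- take i v]
                      ++ (if tnth v i then ser_br psi lX else 0)
                      :: [seq letter t | t <- drop i.+1 v]) w.

(* Drinfeld's convention *)
Definition ihara_br (f g : ser bool) : ser bool :=
  ser_br f g + ihara_der g f - ihara_der f g.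

(* log(exp(x) exp(y)) in non-commutative series *)
Definition exp_letter (t : bool) : ser bool := fun w =>
  if all (pred1 t) w then ((size w)`!%:R)^-1 else 0.

Definition log_exp_exp : ser bool := fun w =>
  \sum_(1 <= k < (size w).+1) (-1) ^+ k.-1 / k%:R *
    ser_prod (nseq k (ser_mul (exp_letter true) (exp_letter false)
                        - @ser_one bool)) w.

Fixpoint nested_br (V : nmodType) (br : V -> V -> V) (s : seq V) : V :=
  if s is u :: s' then if s' is [::] then u else br u (nested_br br s') else 0.

(* The product of GRT_1 = exp(grt_1): the Baker-Campbell-Hausdorff series of
   the Ihara bracket, in Dynkin's form.  The Ihara bracket adds the lengths of
   words, so the terms with more than size w entries do not contribute. *)
Definition grt_mul (f g : ser bool) : ser bool := fun w =>
  \sum_(1 <= n < (size w).+1) \sum_(v : n.-tuple bool)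
    log_exp_exp v / n%:R *
    nested_br ihara_br [seq (if t then f else g) | t <- v] w.

End Series.

(* The edge (i, j, b) has black arrow i -> j, and its red arrow is aligned with
   the black one iff [b].  Vertices are numbered from 0, and a graph modulo
   relabelling of its edges is the multiset of its edges. *)
Definition edge := (nat * nat * bool)%type.
Definition graph := {mset edge}%mset.
Definition edges (G : graph) : seq edge := enum_mset G.

Inductive colour := Black | Red.

Definition arrow (c : colour) (e : edge) : nat * nat :=
  match c with
  | Black => (e.1.1, e.1.2)
  | Red => if e.2 then (e.1.1, e.1.2) else (e.1.2, e.1.1)
  end.

Definition step (c : colour) (G : graph) : rel nat := fun u v =>
  has (fun e => arrow c e == (u, v)) (edges G).

Definition acyclic (c : colour) (G : graph) : Prop :=
  forall p : seq nat, p <> [::] -> uniq p -> ~~ path.cycle (step c G) p.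

Definition graph_connected (N : nat) (G : graph) : Prop :=
  forall u v, (u < N)%N -> (v < N)%N -> exists2 p,
    path (fun i j => step Black G i j || step Black G j i) u p & last u p = v.

Definition vertices_below (N : nat) (G : graph) : bool :=
  all (fun e : edge => (e.1.1 < N)%N && (e.1.2 < N)%N) (edges G).

Definition relabel (f : nat -> nat) (G : graph) : seq edge :=
  [seq (f e.1.1, f e.1.2, e.2) | e <- edges G].

Definition perm_nat N (s : 'S_N) (i : nat) : nat :=
  if insub i is Some j then val (s j) else i.

Section GraphComplex.
Context (R : realType).

(* [gamma N G] is the coefficient of the graph G with N vertices *)
Definition gchain := nat -> graph -> R^o.

(* Elements of degree [d] of GC^conn(O^c).  The condition on the degree fixes
   the number of edges in each arity, so each component is a finite sum. *)
Definition gc (c : colour) (d : int) (gamma : gchain) : Prop :=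
  (forall N G, gamma N G <> 0 ->
    [/\ (0 < N)%N, vertices_below N G, acyclic c G, graph_connected N G
      & 3 * (N%:Z - 1) - 2 * (size (edges G))%:Z = d]) /\
  (forall N (s : 'S_N) G,
    gamma N (seq_mset (relabel (perm_nat s) G)) = (-1) ^+ odd_perm s * gamma N G).

(* All ways of reattaching the edges of a graph when its vertex 0 is replaced
   by the vertices in [I] and its vertices 1, 2, ... are renamed as in [J] *)
Definition attach (I J : seq nat) (u : nat) : seq nat :=
  if u is j.+1 then [:: nth 0%N J j] else I.

Definition reattach (I J : seq nat) (es : seq edge) : seq (seq edge) :=
  foldr (fun (e : edge) acc =>
    [seq x :: y | x <- [seq (u, v, e.2) | u <- attach I J e.1.1,
                                          v <- attach I J e.1.2],
                  y <- acc]) [:: [::]] es.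

(* The coefficient of H in the insertion of G', with vertices renamed as in
   [I], in the vertex 0 of G *)
Definition insert_coef (I J : seq nat) (G G' H : graph) : nat :=
  count (fun es => seq_mset (es ++ relabel (nth 0%N I) G') == H)
        (reattach I J (edges G)).

(* The pre-Lie product, for gamma' of degree of parity [d]: on skew elements
   the antisymmetrised sum of all partial compositions is the signed sum over
   the choices of the set [I] of the vertices coming from gamma'. *)
Definition gc_pre (d : bool) (gamma gamma' : gchain) : gchain := fun M H =>
  \sum_(c : M.-tuple 'I_2 | ord0 \in c)
    let I := block 0 (labels c) (iota 0 M) in
    let J := block 1 (labels c) (iota 0 M) in
    (-1) ^+ (shuffle_exp skew_chi (labels c) [::] + d * size J) *
    \sum_(G \in [set: graph]) \sum_(G' \in [set: graph])
      gamma (size J).+1 G * gamma' (size I) G' * (insert_coef I J G G' H)%:R.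

Definition gc_br (d d' : bool) (gamma gamma' : gchain) : gchain :=
  gc_pre d' gamma gamma' - (-1) ^+ (d && d') *: gc_pre d gamma' gamma.

Definition upsilon : gchain := fun N G =>
  if N == 2 then
    \sum_(b : bool) ((G == [mset (0%N, 1%N, b)]%mset)%:R
                       - (G == [mset (1%N, 0%N, b)]%mset)%:R)
  else 0.

(* delta on elements of degree of parity [d] *)
Definition gc_diff (d : bool) (gamma : gchain) : gchain :=
  gc_br true d upsilon gamma.

Definition gc_cocycle (c : colour) (gamma : gchain) : Prop :=
  gc c 0 gamma /\ gc_diff false gamma = 0.

Definition gc_exact (c : colour) (gamma : gchain) : Prop :=
  exists2 h, gc c (-1) h & gamma = gc_diff true h.

(* An isomorphism of pro-nilpotent Lie algebras H^0(GC^conn(O^c)) -> grt_1,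
   given on cocycles; the last clause is its continuity, for the filtrations by
   number of vertices and by length of words. *)
Definition grt_iso (c : colour) (Psi : gchain -> ser R bool) : Prop :=
  [/\ (forall gamma, gc_cocycle c gamma -> grt (Psi gamma)) /\
      (forall psi, grt psi -> exists2 gamma, gc_cocycle c gamma & Psi gamma = psi),
      forall a gamma gamma', gc_cocycle c gamma -> gc_cocycle c gamma' ->
        Psi (a *: gamma + gamma') = a *: Psi gamma + Psi gamma',
      forall gamma, gc_cocycle c gamma -> (Psi gamma = 0 <-> gc_exact c gamma),
      forall gamma gamma', gc_cocycle c gamma -> gc_cocycle c gamma' ->
        Psi (gc_br false false gamma gamma') = ihara_br (Psi gamma) (Psi gamma')
    & forall n, exists M, forall gamma, gc_cocycle c gamma ->
        (forall N G, (N < M)%N -> gamma N G = 0) ->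
        forall w, (size w <= n)%N -> Psi gamma w = 0].

End GraphComplex.

(* The chart is an open subset U of R^m over which E is trivialised with rank
   r.  Functions on U are extended by 0 to R^m. *)
Section Functions.
Context (R : realType) (m r : nat) (U : set 'rV[R]_m).

Definition partial (mu : 'I_m) (g : 'rV[R]_m -> R^o) : 'rV[R]_m -> R^o :=
  fun x => if x \in U then 'D_(delta_mx 0 mu) g x else 0.

Definition smooth (g : 'rV[R]_m -> R^o) : Prop :=
  (forall x, ~ U x -> g x = 0) /\
  forall (l : seq 'I_m) x, U x ->
    {for x, continuous (foldr partial g l)} /\
    forall mu, derivable (foldr partial g l) x (delta_mx 0 mu).

(* The odd coordinates are theta_i, i < r + r, with theta_(lshift a) = xi^a and
   theta_(rshift a) = zeta_a.  [f (a, S)] is the coefficient of p^a theta_S,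
   where theta_S is the product of the theta_i, i in S, in increasing order. *)
Definition monom := ({ffun 'I_m -> nat} * {set 'I_(r + r)})%type.
Definition gfun := monom -> 'rV[R]_m -> R^o.

Definition mdegree (q : monom) : nat := (2 * (\sum_i q.1 i) + #|q.2|)%N.

(* C^oo(T*[2]E[1]), graded by [mdegree] *)
Definition smooth_gfun (f : gfun) : Prop :=
  (forall q, smooth (f q)) /\
  (exists n, forall q, (n < mdegree q)%N -> f q = 0).

Definition parity_part (b : bool) (f : gfun) : gfun := fun q =>
  if odd #|q.2| == b then f q else 0.

(* f |-> (-1)^|f| f *)
Definition par_inv (f : gfun) : gfun := fun q => (-1) ^+ #|q.2| *: f q.

Definition gmul (f g : gfun) : gfun := fun q x =>
  \sum_(b : {ffun 'I_m -> 'I_(\sum_i q.1 i).+1} | [forall i, (b i <= q.1 i)%N])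
  \sum_(T : {set 'I_(r + r)} | T \subset q.2)
    (-1) ^+ #|[set ij : 'I_(r + r) * 'I_(r + r) |
                [&& ij.1 \in T, ij.2 \in q.2 :\: T & (ij.2 < ij.1)%N]]| *
    f ([ffun i => b i : nat], T) x *
    g ([ffun i => (q.1 i - b i)%N], q.2 :\: T) x.

Definition d_x (mu : 'I_m) (f : gfun) : gfun := fun q => partial mu (f q).

Definition d_p (mu : 'I_m) (f : gfun) : gfun := fun q =>
  (q.1 mu).+1%:R *: f ([ffun nu => q.1 nu + (nu == mu)]%N, q.2).

(* left derivative *)
Definition d_theta (i : 'I_(r + r)) (f : gfun) : gfun := fun q =>
  if i \in q.2 then 0
  else (-1) ^+ #|[set j in q.2 | (j < i)%N]| *: f (q.1, i |: q.2).

Definition d_xi (a : 'I_r) : gfun -> gfun := d_theta (lshift r a).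
Definition d_zeta (a : 'I_r) : gfun -> gfun := d_theta (rshift r a).

Definition big_bracket (f g : gfun) : gfun :=
  \sum_(mu < m) (gmul (d_x mu f) (d_p mu g) - gmul (d_p mu f) (d_x mu g))
  + \sum_(a < r) (gmul (d_xi a (par_inv f)) (d_zeta a g)
                    + gmul (d_zeta a (par_inv f)) (d_xi a g)).

(* functions vanishing on p = zeta = 0, resp. on p = xi = 0 *)
Definition lie_quasi (f : gfun) : Prop := smooth_gfun f /\
  forall S : {set 'I_(r + r)}, (forall a : 'I_r, rshift r a \notin S) ->
    f ([ffun=> 0%N], S) = 0.

Definition quasi_lie (f : gfun) : Prop := smooth_gfun f /\
  forall S : {set 'I_(r + r)}, (forall a : 'I_r, lshift r a \notin S) ->
    f ([ffun=> 0%N], S) = 0.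

(* the graded Lie algebra A[2] *)
Definition shifted_algebra (A : set gfun) : glie R :=
  @Glie R gfun parity_part
    (fun d => [set f | forall q, f q <> 0 -> (mdegree q)%:Z = d + 2])
    A big_bracket.

(* The pure tensor f_1 (x) ... (x) f_N is the list of the f_i. *)

Definition even_at (i : nat) (D : gfun -> gfun) (s : seq gfun) : seq gfun :=
  set_nth 0 s i (D (nth 0 s i)).

(* An odd derivation that acts on the factor [i] passes all previous ones. *)
Definition odd_at (i : nat) (D : gfun -> gfun) (s : seq gfun) : seq gfun :=
  [seq par_inv f | f <- take i s] ++ D (nth 0 s i) :: drop i.+1 s.

Definition mu_prod (s : seq gfun) : gfun :=
  if s is f :: s' then foldl gmul f s' else 0.

(* mu_N applied to the product of the Delta_e, e in es; the Delta_e commute *)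
Fixpoint rep_edges (es : seq edge) (s : seq gfun) : gfun :=
  if es is (i, j, b) :: es' then
    if b then
      \sum_(mu < m) rep_edges es' (even_at i (d_x mu) (even_at j (d_p mu) s))
    else
      \sum_(a < r) rep_edges es' (odd_at i (d_xi a) (odd_at j (d_zeta a) s))
  else mu_prod s.

Definition rep (gamma : gchain R) (s : seq gfun) : gfun :=
  \sum_(G \in [set: graph]) gamma (size s) G *: rep_edges (edges G) s.

End Functions.

Section Action.
Context (R : realType) (m r : nat) (U : set 'rV[R]_m).
Context (c : colour) (A : set (gfun R m r)) (Psi : gchain R -> ser R bool).

Let L := shifted_algebra U A.
Let Rep (gamma : gchain R) : family L := rep U gamma.

(* D is a cocycle in the class of the image of psi under
   grt_1 ~ H^0(GC^conn(O^c)) -> H^0(CE(A[2])). *)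
Definition induced (psi : ser R bool) (D : family L) : Prop :=
  ce_cocycle D /\
  exists gamma, [/\ gc_cocycle c gamma, Psi gamma = psi
                  & cohomologous D (Rep gamma)].

Definition induces_lie_morphism : Prop :=
  [/\ (forall gamma, gc_cocycle c gamma -> ce_cocycle (Rep gamma)) /\
      (forall gamma, gc_exact c gamma -> ce_exact (Rep gamma)),
      (forall psi, grt psi -> exists D, induced psi D) /\
      (forall psi D D', grt psi -> induced psi D -> induced psi D' ->
        cohomologous D D'),
      forall a psi psi' D D', grt psi -> grt psi' ->
        induced psi D -> induced psi' D' ->
        induced (a *: psi + psi') (a *: D + D')
    & forall psi psi' D D', grt psi -> grt psi' ->
        induced psi D -> induced psi' D' ->
        induced (ihara_br psi psi') (nr_br false false D D')].

(* The group GRT_1 acts by homotopy classes of Lie-infinity automorphisms, the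
   class of exp(psi) being that of exp(D) for any representative D of the image
   of psi. *)
Definition exponentiates_to_action : Prop :=
  exists act : ser R bool -> family L,
    [/\ forall psi, grt psi -> linf_aut (act psi),
        homotopic (act 0) (@id_family R L),
        forall psi psi', grt psi -> grt psi' ->
          grt (grt_mul psi psi') /\
          homotopic (act (grt_mul psi psi')) (linf_comp (act psi) (act psi'))
      & forall psi D, grt psi -> induced psi D ->
          [/\ forall u, A u -> D [:: u] = 0, linf_aut (linf_exp D)
            & homotopic (act psi) (linf_exp D)]].

End Action.

(* Main.v *)
From Pilot Require Import Defs.
From HB Require Import structures.
From mathcomp Require Import all_boot all_order all_fingroup all_algebra.
From mathcomp Require Import finmap multiset.
From mathcomp Require Import all_classical all_reals all_analysis.
From mathcomp Require Import zify ring lra.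
Import Pilot.Defs numFieldNormedType.Exports.
Set Implicit Arguments.
Unset Strict Implicit.
Unset Printing Implicit Defensive.
Import Order.TTheory GRing.Theory Num.Theory.
Local Open Scope classical_set_scope.
Local Open Scope ring_scope.

(** Edges act by derivations in each tensor factor, so by the Leibniz rule insertion of graphs
    becomes insertion of operators: graphs map to Nijenhuis-Richardson cochains, [Upsilon] to the
    bracket. Identities of chains are reflected from the faithful action on functions. A source of
    an acyclic graph is only hit by derivatives along the subbundle, so the ideal is preserved.
    Cocycles have no unary part, hence exponentiate; the Dynkin form of Baker-Campbell-Hausdorff
    turns the Ihara bracket into composition up to homotopy. *)

(** Signs shape the development. Families are studied on lists of pairs (parity, element), sums over
    label tuples become a recursion [Sh] on lists, and skew identities are proved after decalage,
    where every sign is a Koszul sign. The operator of a graph needs only a graded commutative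
    algebra with derivations for the two ends of each edge type ([galg]). Functions on the chart are
    one instance. A second one, polynomials with a variable per vertex and per possible edge, turns
    a graph into a monomial from which it can be read off; thus antisymmetry of products of chains
    and stability of cocycles under the bracket are inherited from operators, without composing
    graphs by hand. All infinite sums are controlled by filtrations: a derivation without unary part
    shortens lists, a cocycle without one-vertex part adds vertices, the Ihara bracket adds word
    lengths. If D' - D is exact, the Dynkin series of (-D, D') is exact with primitives that vanish
    in growing arity, which yields the homotopy between exp(D) and exp(D'). *)

Section Abelian.
Context (V : zmodType).
(** Splitting signs into cases leaves identities between integral combinations of a few terms of a
    module. They are settled by reflection: terms are reified over a list of atoms and their integer
    coefficients compared. *)
Inductive zterm := ZVar of nat | ZZero | ZAdd of zterm & zterm | ZOpp of zterm.

Fixpoint zeval (e : seq V) (t : zterm) : V :=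
  match t with
  | ZVar i => nth 0 e i
  | ZZero => 0
  | ZAdd a b => zeval e a + zeval e b
  | ZOpp a => - zeval e a
  end.

Fixpoint zcoef (t : zterm) (i : nat) : int :=
  match t with
  | ZVar j => if j == i then Posz 1 else Posz 0
  | ZZero => Posz 0
  | ZAdd a b => zcoef a i + zcoef b i
  | ZOpp a => - zcoef a i
  end.

Fixpoint zbound (t : zterm) (n : nat) : bool :=
  match t with
  | ZVar j => (j < n)%N
  | ZZero => true
  | ZAdd a b => zbound a n && zbound b n
  | ZOpp a => zbound a n
  end.

Lemma zevalE e t : zbound t (size e) -> zeval e t = \sum_(i < size e) nth 0 e i *~ zcoef t i.
Proof.
elim: t => [j||a IHa b IHb|a IHa] /=.
- move=> jn; rewrite (bigD1 (Ordinal jn)) //= eqxx big1 ?addr0 // => i ij.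
  by rewrite -val_eqE /= in ij; rewrite eq_sym (negPf ij) mulr0z.
- by rewrite big1 // => i _; rewrite mulr0z.
- case/andP=> /IHa-> /IHb->; rewrite -big_split; apply: eq_bigr => i _ /=.
  by rewrite mulrzDr.
- by move=> /IHa->; rewrite -sumrN; apply: eq_bigr => i _; rewrite mulrNz.
Qed.

Definition zcheck n (t t' : zterm) : bool :=
  [&& zbound t n, zbound t' n & all (fun i => zcoef t i == zcoef t' i) (iota 0 n)].

Lemma zcheckP e t t' : zcheck (size e) t t' -> zeval e t = zeval e t'.
Proof.
case/and3P=> bt bt' /allP E; rewrite !zevalE //; apply: eq_bigr => i _.
suff /eqP-> : zcoef t i == zcoef t' i by [].
by apply: E; rewrite mem_iota add0n leq0n ltn_ord.
Qed.
End Abelian.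

Ltac zindex a e :=
  lazymatch e with
  | a :: _ => constr:(0%N)
  | _ :: ?e' => let i := zindex a e' in constr:(S i)
  end.
Ltac zmem a e :=
  lazymatch e with
  | nil => constr:(false)
  | a :: _ => constr:(true)
  | _ :: ?e' => zmem a e'
  end.
Ltac zatoms t e :=
  lazymatch t with
  | 0%R => e
  | @Algebra.zero _ => e
  | @Algebra.add _ ?a ?b => let e1 := zatoms a e in zatoms b e1
  | @Algebra.opp _ ?a => zatoms a e
  | _ => let m := zmem t e in
         lazymatch m with true => e | false => constr:(t :: e) end
  end.
Ltac zreify t e :=
  lazymatch t with
  | @Algebra.zero _ => constr:(ZZero)
  | @Algebra.add _ ?a ?b =>
    let a' := zreify a e in let b' := zreify b e in constr:(ZAdd a' b')
  | @Algebra.opp _ ?a => let a' := zreify a e in constr:(ZOpp a')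
  | _ => let i := zindex t e in constr:(ZVar i)
  end.
(* Decides equalities of integral linear combinations in an abelian group. *)
Ltac abelian :=
  lazymatch goal with
  | |- @eq ?T ?a ?b =>
    let e0 := zatoms a (@nil T) in let e := zatoms b e0 in let a' := zreify a e in
    let b' := zreify b e in exact: (@zcheckP _ e a' b' isT)
  end.

(** * Signed sums over unshuffles *)

Lemma big_tuple_cons (V : nmodType) (T : finType) n (F : seq T -> V) :
  \sum_(c : n.+1.-tuple T) F c = \sum_x \sum_(c : n.-tuple T) F (x :: c).
Proof.
rewrite pair_big /= (reindex (fun p : T * n.-tuple T => cons_tuple p.1 p.2)) //=.
exists (fun c : n.+1.-tuple T => (thead c, behead_tuple c)) => [[x c] _|c _] /=.
  by congr pair; apply: val_inj.
by case/tupleP: c => x c; apply: val_inj.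
Qed.

Lemma big_tuple0 (V : nmodType) (T : finType) (F : seq T -> V) : \sum_(c : 0.-tuple T) F c = F [::].
Proof.
by rewrite (big_pred1 [tuple]) // => c; apply/esym/eqP; exact: tuple0.
Qed.

Lemma blk_cons T k x (a : T) c s :
  block k (x :: c) (a :: s) = if x == k then a :: block k c s else block k c s.
Proof. by rewrite /block /=; case: (x == k). Qed.

Lemma block_map T T' (f : T -> T') k c s :
  block k c [seq f x | x <- s] = [seq f x | x <- block k c s].
Proof.
elim: s c => [|a s IH] [|x c] //.
by rewrite /= !blk_cons IH; case: (x == k).
Qed.

Lemma size_block T T' k c (s : seq T) (s' : seq T') : size s = size s' ->
  size (block k c s) = size (block k c s').
Proof.
elim: s s' c => [|a s IH] [|a' s'] [|x c] // [sz].
by rewrite !blk_cons; case: (x == k) => /=; rewrite (IH s').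
Qed.

Lemma shuffle_exp_cons chi x c b t : shuffle_exp chi (x :: c) (b :: t) =
  (\sum_(j < size c) ((nth 0 c j < x) && chi b (nth false t j)) + shuffle_exp chi c t)%N.
Proof.
rewrite /shuffle_exp /= big_ord_recl big_ord0 add0n -big_split /=.
apply: eq_bigr => j _; rewrite big_ord_recl /=; congr addn.
Qed.

Section Shuffle.
Context (R : realType) (T : eqType).
Local Notation X := (bool * T)%type.

(** Parity of the cost of moving an element of parity [b] across the whole block [I]. *)
Fixpoint pass (chi : bool -> bool -> bool) (b : bool) (I : seq X) : bool :=
  if I is y :: I' then chi b y.1 (+) pass chi b I' else false.

Lemma pass_cat chi b I J : pass chi b (I ++ J) = pass chi b I (+) pass chi b J.
Proof. by elim: I => //= y I ->; rewrite addbA. Qed.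

Lemma pass_perm chi b I J : perm_eq I J -> pass chi b I = pass chi b J.
Proof.
have passE K : pass chi b K = \big[addb/false]_(y <- K) chi b y.1.
  by elim: K => [|y K IH] /=; rewrite ?big_nil // big_cons IH.
by move=> pIJ; rewrite !passE; apply: perm_big.
Qed.

Lemma pass_block chi b (c : seq nat) (s : seq X) : size c = size s -> pass chi b (block 0 c s) =
  odd (\sum_(j < size c) ((nth 0 c j < 1) && chi b (nth false [seq x.1 | x <- s] j))%N).
Proof.
elim: s c => [|y s IH] [|i c] //= => [_|[sz]]; first by rewrite big_ord0.
rewrite blk_cons big_ord_recl /= oddD -IH // ltnS leqn0 oddb.
by case: (i == 0%N).
Qed.

Section Sum.
Context (V : lmodType R) (chi : bool -> bool -> bool).
Implicit Types (Phi Psi : seq X -> seq X -> V).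

(** The head joins the first block for free, or the second block after crossing everything that
    later entries put in the first one. This recursion replaces the sum over label tuples, so that
    proofs go by induction on the list. *)
Fixpoint Sh Phi (s : seq X) : V :=
  if s is x :: s' then Sh (fun I J => Phi (x :: I) J) s' +
  Sh (fun I J => (-1) ^+ pass chi x.1 I *: Phi I (x :: J)) s' else Phi [::] [::].

Lemma Sh_tuple Phi (s : seq X) : \sum_(c : (size s).-tuple 'I_2)
  (-1) ^+ shuffle_exp chi (labels c) [seq x.1 | x <- s] *:
  Phi (block 0 (labels c) s) (block 1 (labels c) s) = Sh Phi s.
Proof.
elim: s Phi => [|x s IH] Phi.
  rewrite (big_tuple0 (fun c : seq 'I_2 => (-1) ^+ shuffle_exp chi [seq val i | i <- c] [::] *:
     Phi (block 0 [seq val i | i <- c] [::]) (block 1 [seq val i | i <- c] [::]))) /=.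
  by rewrite /shuffle_exp big_ord0 scale1r.
rewrite (big_tuple_cons _ (fun c : seq 'I_2 => (-1) ^+ shuffle_exp chi [seq val i | i <- c] [seq x.1 | x <- x :: s] *:
     Phi (block 0 [seq val i | i <- c] (x :: s)) (block 1 [seq val i | i <- c] (x :: s)))) /=.
rewrite big_ord_recl big_ord_recl big_ord0 addr0 -!IH /=.
congr (_ + _); apply: eq_bigr => c _; rewrite !blk_cons /= shuffle_exp_cons.
  by rewrite big1 ?add0n // => j _; rewrite ltn0.
rewrite /bump /= exprD -scalerA scalerA mulrC -scalerA; congr (_ *: (_ *: _)).
rewrite -signr_odd; congr (_ ^+ _).
by rewrite pass_block // size_map size_tuple.
Qed.

Lemma Sh_tuple_size n Phi (s : seq X) (t : seq bool) : size s = n -> [seq x.1 | x <- s] = t ->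
  \sum_(c : n.-tuple 'I_2) (-1) ^+ shuffle_exp chi (labels c) t *:
  Phi (block 0 (labels c) s) (block 1 (labels c) s) = Sh Phi s.
Proof. by move=> <- <-; exact: Sh_tuple. Qed.

(** The information offered to the hypothesis is what later congruences need: both blocks inherit
    the pointwise property [P], and together they rearrange [s], which controls sizes and
    parities. *)
Lemma Sh_ext (P : pred X) Phi Psi s : all P s ->
  (forall I J, all P I -> all P J -> perm_eq (I ++ J) s -> Phi I J = Psi I J) ->
  Sh Phi s = Sh Psi s.
Proof.
elim: s Phi Psi => [|x s IH] Phi Psi /=; first by move=> _; apply.
case/andP=> Px Ps E; congr (_ + _); apply: IH => // I J PI PJ pIJ.
  by apply: E => //=; rewrite ?Px ?perm_cons.
congr (_ *: _); apply: E => //=; rewrite ?Px //.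
by rewrite -cat1s perm_catCA perm_cons.
Qed.

Lemma Sh_eq Phi Psi s : (forall I J, Phi I J = Psi I J) -> Sh Phi s = Sh Psi s.
Proof. by move=> E; congr (Sh _ s); apply/funext => I; apply/funext => J. Qed.

Lemma ShP a Phi Psi s : Sh (fun I J => a *: Phi I J + Psi I J) s = a *: Sh Phi s + Sh Psi s.
Proof.
elim: s Phi Psi => //= x s IH Phi Psi.
rewrite scalerDr addrACA -!IH; congr (_ + _); apply: Sh_eq => I J.
by rewrite scalerDr !scalerA mulrC.
Qed.

Lemma Sh0 s : Sh (fun _ _ => 0) s = 0.
Proof.
elim: s => //= x s IH; rewrite IH add0r -[RHS]IH.
by apply: Sh_eq => I J; exact: scaler0.
Qed.

Lemma ShZ a Phi s : Sh (fun I J => a *: Phi I J) s = a *: Sh Phi s.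
Proof.
by rewrite -[RHS]addr0 -(Sh0 s) -ShP; apply: Sh_eq => I J; rewrite addr0.
Qed.

Lemma ShD Phi Psi s : Sh (fun I J => Phi I J + Psi I J) s = Sh Phi s + Sh Psi s.
Proof.
by rewrite -[Sh Phi s]scale1r -ShP; apply: Sh_eq => I J; rewrite scale1r.
Qed.

Lemma Sh_sum (I : Type) (r : seq I) (P : pred I) (F : I -> seq X -> seq X -> V) s :
  Sh (fun A B => \sum_(i <- r | P i) F i A B) s = \sum_(i <- r | P i) Sh (F i) s.
Proof.
elim: r => [|i r IH].
  by rewrite [RHS]big_nil -[RHS](Sh0 s); apply: Sh_eq => A B; rewrite big_nil.
rewrite [RHS]big_cons -IH; case Pi: (P i).
  by rewrite -[RHS]ShD; apply: Sh_eq => A B; rewrite big_cons Pi.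
by apply: Sh_eq => A B; rewrite big_cons Pi.
Qed.

Lemma Sh_ind (Q : V -> Prop) (P : pred X) Phi s : all P s -> Q 0 ->
  (forall a u v, Q u -> Q v -> Q (a *: u + v)) ->
  (forall I J, all P I -> all P J -> perm_eq (I ++ J) s -> Q (Phi I J)) -> Q (Sh Phi s).
Proof.
move=> Ps Q0 QP; elim: s Ps Phi => [_|x s IH /=/andP[Px Ps]] Phi E; first exact: E.
rewrite -[X in X + _]scale1r; apply: (QP); apply: IH => // I J PI PJ pIJ.
  by apply: E => //=; rewrite ?Px ?perm_cons.
rewrite -[_ *: _]addr0; apply: QP => //; apply: E => //=; rewrite ?Px //.
by rewrite -cat1s perm_catCA perm_cons.
Qed.

End Sum.

Lemma Sh_linear (V W : lmodType R) chi (f : V -> W) Phi s :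
  linear f -> f (Sh chi Phi s) = Sh chi (fun I J => f (Phi I J)) s.
Proof.
move=> lf; have fD u v : f (u + v) = f u + f v.
  by rewrite -[u]scale1r lf !scale1r.
have f0 : f 0 = 0 by apply: (addIr (f 0)); rewrite -fD !add0r.
have fZ a u : f (a *: u) = a *: f u by rewrite -[a *: u]addr0 lf f0 addr0.
elim: s Phi => //= x s IH Phi; rewrite fD !IH; congr (_ + _).
by apply: Sh_eq => I J; rewrite fZ.
Qed.

Section Coalgebra.
Context (V : lmodType R) (chi : bool -> bool -> bool).

(** Coassociativity of the unshuffle coproduct: both sides run over partitions into three blocks
    with the same crossings. *)
Lemma Sh_assoc (Phi : seq X -> seq X -> seq X -> V) s :
  Sh chi (fun I J => Sh chi (fun K L => Phi I K L) J) s =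
  Sh chi (fun A L => Sh chi (fun I K => Phi I K L) A) s.
Proof.
elim: s Phi => //= x s IH Phi.
rewrite !ShD (IH (fun I K L => Phi (x :: I) K L)) -addrA; congr (_ + _).
(* The head lands in the second or in the third block; in the third it crosses both earlier blocks,
   whence [I ++ K]. *)
rewrite (_ : Sh _ _ _ =
  Sh chi (fun I J => Sh chi (fun K L => (-1) ^+ pass chi x.1 I *: Phi I (x :: K) L) J) s +
  Sh chi (fun I J => Sh chi (fun K L =>
    (-1) ^+ pass chi x.1 (I ++ K) *: Phi I K (x :: L)) J) s); last first.
  rewrite -ShD; apply: Sh_eq => I J; rewrite scalerDr -!ShZ; congr (_ + _).
  by apply: Sh_eq => K L; rewrite pass_cat signr_addb scalerA.
rewrite (IH (fun I K L => (-1) ^+ pass chi x.1 I *: Phi I (x :: K) L)); congr (_ + _).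
rewrite (IH (fun I K L => (-1) ^+ pass chi x.1 (I ++ K) *: Phi I K (x :: L))).
apply: Sh_eq => A B; rewrite -ShZ.
apply: (@Sh_ext _ _ xpredT) => [|I J _ _ pIJ]; first exact/allP.
by rewrite (pass_perm _ _ pIJ).
Qed.

(** Cocommutativity up to sign: exchanging the blocks costs one crossing for each pair with one
    entry in either of them, which is what the nested fold counts. *)
Lemma Sh_swap (Phi : seq X -> seq X -> V) s : (forall x y, chi x y = chi y x) ->
  Sh chi Phi s = Sh chi (fun I J => (-1) ^+ foldr (fun x b => pass chi x.1 J (+) b) false I *: Phi J I) s.
Proof.
move=> sym; elim: s Phi => [|x s IH] Phi; first by rewrite /= scale1r.
rewrite /= addrC; congr (_ + _); rewrite IH; apply: Sh_eq => I J.
  rewrite /= scalerA; congr (_ *: _); rewrite -signr_addb; congr (_ ^+ _).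
  by rewrite addbC.
rewrite /= scalerA; congr (_ *: _); rewrite -signr_addb; congr (_ ^+ _); congr nat_of_bool.
elim: I => //= y I ->; rewrite sym.
by case: (chi y.1 x.1); case: (pass _ _ I); case: (pass _ _ J); case: (foldr _ _ _).
Qed.
End Coalgebra.

(** Total parity of a block after the shift of degrees by one: an entry counts when its own parity
    is even. *)
Definition spar (I : seq X) : bool := foldr (fun x b => ~~ x.1 (+) b) false I.

Lemma spar_cat I J : spar (I ++ J) = spar I (+) spar J.
Proof. by elim: I => //= x I ->; rewrite addbA. Qed.

Lemma spar_perm I J : perm_eq I J -> spar I = spar J.
Proof.
have sparE K : spar K = \big[addb/false]_(y <- K) ~~ y.1.
  by elim: K => [|y K IH] /=; rewrite ?big_nil // big_cons IH.
by move=> pIJ; rewrite !sparE; apply: perm_big.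
Qed.

Lemma pass_sym b I : pass sym_chi b I = ~~ b && spar I.
Proof. by elim: I => [|y I /= ->]; rewrite ?andbF // /sym_chi; case: b. Qed.

Lemma cross_sym I J : foldr (fun x b => pass sym_chi x.1 J (+) b) false I = spar I && spar J.
Proof. by elim: I => //= x I ->; rewrite pass_sym; case: (spar J); rewrite ?andbT ?andbF. Qed.

Lemma Sh_symC (V : lmodType R) (Phi : seq X -> seq X -> V) s :
  Sh sym_chi Phi s = Sh sym_chi (fun I J => (-1) ^+ (spar I && spar J) *: Phi J I) s.
Proof.
rewrite Sh_swap => [|x y]; last by rewrite /sym_chi andbC.
by apply: Sh_eq => I J; rewrite cross_sym.
Qed.

End Shuffle.

(** * Multilinear families, reduced to homogeneous arguments *)

(** [glie] only bundles data; these are the linear axioms behind it. The two parity projections are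
    complementary idempotents that respect the subspace. *)
Record glieok (R : realType) (L : glie R) : Prop := GlieOk { gok0 : gsub (0 : L);
  gokP : forall (a : R) (u v : L), gsub u -> gsub v -> gsub (a *: u + v);
  gok_par : forall b (u : L), gsub u -> gsub (gpar b u); gok_parP : forall b (a : R) (u v : L),
    gpar b (a *: u + v) = a *: gpar b u + gpar b v; gok_parK : forall b b' (u : L),
    gpar b (gpar b' u) = if b == b' then gpar b u else 0;
  gok_parD : forall u : L, gpar false u + gpar true u = u }.

Section Families.
Context (R : realType) (L : glie R) (Lok : glieok L).
Local Notation X := (bool * L)%type.
Implicit Types (s : seq L) (h : seq X) (P Q : family L) (Psi : seq X -> L).

(** An entry tagged with its own parity. Lists of such entries are the homogeneous arguments on
    which all sign computations take place. *)
Definition okb (x : X) : bool := `[< gsub x.2 /\ gpar x.1 x.2 = x.2 >].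
Definition us h : seq L := [seq x.2 | x <- h].

Lemma us_cat h h' : us (h ++ h') = us h ++ us h'.
Proof. exact: map_cat. Qed.

Lemma gsubD (u v : L) : gsub u -> gsub v -> gsub (u + v).
Proof. by move=> su sv; rewrite -[u]scale1r; apply: gokP. Qed.

Lemma gsubZ (a : R) (u : L) : gsub u -> gsub (a *: u).
Proof. by move=> su; rewrite -[_ *: _]addr0; apply: gokP => //; apply: gok0. Qed.

Lemma gpar0 b : gpar b (0 : L) = 0.
Proof.
have := gok_parP Lok b (-1) 0 0.
by rewrite scaler0 addr0 scaleN1r addNr.
Qed.

Lemma gparZ b (a : R) (u : L) : gpar b (a *: u) = a *: gpar b u.
Proof. by have := gok_parP Lok b a u 0; rewrite gpar0 !addr0. Qed.

Lemma gparD b (u v : L) : gpar b (u + v) = gpar b u + gpar b v.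
Proof. by have := gok_parP Lok b 1 u v; rewrite !scale1r. Qed.

Lemma in_subc (u : L) s : in_sub (u :: s) <-> gsub u /\ in_sub s.
Proof.
split=> [H|[su ss] v]; last by rewrite inE => /orP[/eqP->|/ss].
by split=> [|v vs]; apply: H; rewrite inE ?eqxx ?vs ?orbT.
Qed.

Lemma in_sub_cat s1 s2 : in_sub (s1 ++ s2) <-> in_sub s1 /\ in_sub s2.
Proof.
elim: s1 => [|u s1 IH] /=; first by split=> [|[]].
by rewrite !in_subc IH and_assoc.
Qed.

Lemma okb_sub (x : X) : okb x -> gsub x.2.
Proof. by move/asboolP => []. Qed.

Lemma okb_par (x : X) : okb x -> gpar x.1 x.2 = x.2.
Proof. by move/asboolP => []. Qed.

Lemma okbE b (u : L) : gsub u -> gpar b u = u -> okb (b, u).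
Proof. by move=> su pu; apply/asboolP. Qed.

Lemma okb_gpar b (u : L) : gsub u -> okb (b, gpar b u).
Proof. by move=> su; apply: okbE; [apply: gok_par|rewrite gok_parK // eqxx]. Qed.

Lemma okbP b (a : R) (u v : L) : okb (b, u) -> okb (b, v) -> okb (b, a *: u + v).
Proof.
move=> /asboolP[/= su pu] /asboolP[/= sv pv].
by apply: okbE; [apply: gokP|rewrite gok_parP // pu pv].
Qed.

Lemma okb0 b : okb (b, 0).
Proof. by apply: okbE; [apply: gok0|rewrite gpar0]. Qed.

Lemma ok_in h : all okb h -> in_sub (us h).
Proof.
elim: h => [|x h IH] //= /andP[ox oh].
by apply/in_subc; split; [exact: okb_sub|exact: IH].
Qed.

Definition mult P := forall s1 s2 (a : R) u v, in_sub s1 -> in_sub s2 -> gsub u -> gsub v ->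
  P (s1 ++ (a *: u + v) :: s2) = a *: P (s1 ++ u :: s2) + P (s1 ++ v :: s2).
Definition clos P := forall s, s <> [::] -> in_sub s -> gsub (P s).
Definition symm chi P := forall h1 h2 (x y : X), all okb h1 -> all okb h2 -> okb x -> okb y ->
  P (us (h1 ++ x :: y :: h2)) = (-1) ^+ (chi x.1 y.1 : bool) *: P (us (h1 ++ y :: x :: h2)).
(** The value of a family of degree parity [d] on n entries has degree (sum of the degrees) + d + 1
    - n. This is its parity: each entry contributes its degree minus one. *)
Definition lab (d : bool) h : bool := ~~ (d (+) spar h).
Definition prule d P := forall h, h <> [::] -> all okb h -> gpar (lab d h) (P (us h)) = P (us h).

(** A [cochain] with integer degrees reduced to parities, and with the exchange rule [chi] left
    open: [skew_chi] before decalage, [sym_chi] after it. *)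
Record pco chi d P : Prop := Pco { pcoC : clos P; pcoM : mult P;
  pco_symm : symm chi P; pco_prule : prule d P }.

Lemma mult0 P s1 s2 : mult P -> in_sub s1 -> in_sub s2 -> P (s1 ++ 0 :: s2) = 0.
Proof.
move=> mP i1 i2; have := mP s1 s2 (-1) 0 0 i1 i2 (gok0 Lok) (gok0 Lok).
by rewrite scaler0 addr0 scaleN1r addNr.
Qed.

Lemma multZ P s1 s2 (a : R) u : mult P -> in_sub s1 -> in_sub s2 -> gsub u ->
  P (s1 ++ a *: u :: s2) = a *: P (s1 ++ u :: s2).
Proof.
move=> mP i1 i2 su; have := mP s1 s2 a u 0 i1 i2 su (gok0 Lok).
by rewrite mult0 // !addr0.
Qed.

Lemma multD P s1 s2 u v : mult P -> in_sub s1 -> in_sub s2 -> gsub u -> gsub v ->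
  P (s1 ++ (u + v) :: s2) = P (s1 ++ u :: s2) + P (s1 ++ v :: s2).
Proof.
by move=> mP i1 i2 su sv; have := mP s1 s2 1 u v i1 i2 su sv; rewrite !scale1r.
Qed.

(** Multilinearity with the tags held fixed, because a sum of entries of different parities has no
    tag. *)
Definition hmult Psi := forall h1 h2 p (a : R) u v,
  all okb h1 -> all okb h2 -> okb (p, u) -> okb (p, v) -> Psi (h1 ++ (p, a *: u + v) :: h2) =
  a *: Psi (h1 ++ (p, u) :: h2) + Psi (h1 ++ (p, v) :: h2).

Lemma hmult0 Psi h1 h2 p : hmult Psi -> all okb h1 -> all okb h2 -> Psi (h1 ++ (p, 0) :: h2) = 0.
Proof.
move=> mP i1 i2; have := mP h1 h2 p (-1) 0 0 i1 i2 (okb0 _) (okb0 _).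
by rewrite scaler0 addr0 scaleN1r addNr.
Qed.

Lemma hmult_cons Psi x : hmult Psi -> okb x -> hmult (fun h => Psi (x :: h)).
Proof.
by move=> mP ox h1 h2 p a u v o1 o2 ou ov; rewrite -!cat_cons mP //= ox.
Qed.

Lemma hmult_us P : mult P -> hmult (fun h => P (us h)).
Proof.
move=> mP h1 h2 p a u v o1 o2 /okb_sub su /okb_sub sv; rewrite !us_cat /=.
by apply: mP => //; apply: ok_in.
Qed.

(** Extends a function of tagged lists to all lists by splitting each entry into its even and odd
    parts. This is the sum over [t] that occurs in the definitions of insertion, decalage and
    composition. *)
Fixpoint ext Psi s : L :=
  if s is u :: s' then ext (fun h => Psi ((false, gpar false u) :: h)) s' +
  ext (fun h => Psi ((true, gpar true u) :: h)) s' else Psi [::].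

Lemma ext_tuple Psi s : \sum_(t : (size s).-tuple bool) Psi (zip t (parts t s)) = ext Psi s.
Proof.
elim: s Psi => [|u s IH] Psi.
  by rewrite (big_tuple0 (fun t : seq bool => Psi (zip t (parts t [::])))).
rewrite (big_tuple_cons _ (fun t : seq bool => Psi (zip t (parts t (u :: s))))) /=.
by rewrite big_bool /= addrC -!IH.
Qed.

Lemma ext_eq Psi Psi' s : in_sub s ->
  (forall h, all okb h -> size h = size s -> Psi h = Psi' h) -> ext Psi s = ext Psi' s.
Proof.
elim: s Psi Psi' => [|u s IH] Psi Psi' /=; first by move=> _; apply.
move=> /in_subc[su ss] E; congr (_ + _); apply: IH => // h oh sh.
  by apply: E; rewrite /= ?sh ?okb_gpar.
by apply: E; rewrite /= ?sh ?okb_gpar.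
Qed.

Lemma extP (a : R) Psi Psi' s : ext (fun h => a *: Psi h + Psi' h) s = a *: ext Psi s + ext Psi' s.
Proof.
elim: s Psi Psi' => //= u s IH Psi Psi'.
by rewrite !IH scalerDr addrACA.
Qed.

Lemma ext0 s : ext (fun=> 0) s = 0.
Proof. by elim: s => //= u s ->; rewrite addr0. Qed.

Lemma extZ (a : R) Psi s : ext (fun h => a *: Psi h) s = a *: ext Psi s.
Proof.
rewrite -[RHS]addr0 -(ext0 s) -extP; congr ext.
by apply/funext => h; rewrite addr0.
Qed.

Lemma extD Psi Psi' s : ext (fun h => Psi h + Psi' h) s = ext Psi s + ext Psi' s.
Proof.
rewrite -[ext Psi s]scale1r -extP; congr ext.
by apply/funext => h; rewrite scale1r.
Qed.

Lemma ext_sum (I : Type) (r : seq I) (F : I -> seq X -> L) s :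
  ext (fun h => \sum_(i <- r) F i h) s = \sum_(i <- r) ext (F i) s.
Proof.
elim: r => [|i r IH].
  by rewrite big_nil -[RHS](ext0 s); congr ext; apply/funext => h; rewrite big_nil.
rewrite big_cons -IH -extD; congr ext.
by apply/funext => h; rewrite big_cons.
Qed.

Lemma ext_mult Psi : hmult Psi -> mult (ext Psi).
Proof.
move=> mPsi s1; elim: s1 Psi mPsi => [|w s1 IH] Psi mPsi s2 a u v /=.
  move=> _ i2 su sv; rewrite scalerDr addrACA -!extP.
  congr (_ + _); apply: ext_eq => // h oh _; rewrite gok_parP //.
    by apply: (mPsi [::]) => //; apply: okb_gpar.
  by apply: (mPsi [::]) => //; apply: okb_gpar.
move=> /in_subc[sw s1s] i2 su sv; rewrite scalerDr addrACA.
by congr (_ + _); apply: IH => //; apply: hmult_cons => //; apply: okb_gpar.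
Qed.

(** Only the tags that agree with the true parities survive: for any other tag the projected entry
    is 0. *)
Lemma ext_us Psi h : hmult Psi -> all okb h -> ext Psi (us h) = Psi h.
Proof.
elim: h Psi => [|[b u] h IH] Psi //= mPsi /andP[ou oh].
have pu := okb_par ou; rewrite /= in pu.
have E c : c != b -> ext (fun h' => Psi ((c, gpar c u) :: h')) (us h) = 0.
  move=> cb; rewrite -(ext0 (us h)); apply: ext_eq; first exact: ok_in.
  move=> h' oh' _; rewrite -pu gok_parK // (negPf cb).
  exact: (hmult0 (h1 := [::])).
have E' : ext (fun h' => Psi ((b, gpar b u) :: h')) (us h) = Psi ((b, u) :: h).
  by rewrite pu; apply: IH => //; apply: hmult_cons.
by case: b {ou pu} E E' => E ->; rewrite E // ?addr0 ?add0r.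
Qed.

Lemma mult_cons P u : mult P -> gsub u -> mult (fun s => P (u :: s)).
Proof.
move=> mP su s1 s2 a v w i1 i2 sv sw; rewrite -!cat_cons mP //.
exact/in_subc.
Qed.

Lemma mext P s : mult P -> in_sub s -> P s = ext (fun h => P (us h)) s.
Proof.
elim: s P => [|u s IH] P //= mP /in_subc[su ss].
rewrite -{1}(gok_parD Lok u) (multD (s1 := [::])) //=; try exact: gok_par.
by congr (_ + _); apply: (IH (fun s => P (_ :: s))) => //; apply: mult_cons => //; apply: gok_par.
Qed.

Lemma feq_ok P Q : mult P -> mult Q ->
  (forall h, h <> [::] -> all okb h -> P (us h) = Q (us h)) -> feq P Q.
Proof.
move=> mP mQ E s s0 ss; rewrite mext // [RHS]mext //; apply: ext_eq => // h oh sh.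
by apply: E => // h0; move: sh; rewrite h0; case: s s0 {ss}.
Qed.

Lemma feq_us P Q h : feq P Q -> h <> [::] -> all okb h -> P (us h) = Q (us h).
Proof. by move=> E h0 oh; apply: E; [case: h h0 {oh}|exact: ok_in]. Qed.

Lemma Sh_hmult chi (Phi : seq X -> seq X -> L) :
  (forall J, all okb J -> hmult (Phi^~ J)) -> (forall I, all okb I -> hmult (Phi I)) ->
  hmult (Sh chi Phi).
Proof.
move=> m1 m2 h1; elim: h1 Phi m1 m2 => [|x h1 IH] Phi m1 m2 h2 p a u v /=.
  move=> _ o2 ou ov; rewrite scalerDr addrACA -!ShP.
  congr (_ + _); apply: (@Sh_ext _ _ _ _ okb) => // I J oI oJ _.
    by apply: (m1 J oJ [::]).
  by rewrite (m2 I oI [::]) //= scalerDr !scalerA mulrC.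
move=> /andP[ox o1] o2 ou ov; rewrite scalerDr addrACA.
congr (_ + _); apply: IH => //.
- move=> J oJ k1 k2 q b w z ok1 ok2 ow oz.
  by rewrite -!cat_cons m1 //= ox.
- by move=> I oI; apply: m2; rewrite /= ox.
- move=> J oJ k1 k2 q b w z ok1 ok2 ow oz.
  rewrite m1 ?pass_cat //=; last by rewrite ox.
  by rewrite scalerDr !scalerA mulrC.
- move=> I oI k1 k2 q b w z ok1 ok2 ow oz.
  by rewrite (m2 I oI (x :: k1)) //= ?ox // scalerDr !scalerA mulrC.
Qed.

Lemma mem_block n (c : n.-tuple 'I_2) h : size h = n ->
  (ord0 \in c) = ~~ nilp (block 0 (labels c) h).
Proof.
rewrite /labels => sh; rewrite -(size_tuple c) in sh.
rewrite -[ord0 \in c]/(ord0 \in tval c); move: (tval c) sh => {}c; clear n.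
elim: h c => [|x h IH] [|i c] //= [sh].
rewrite inE blk_cons (IH c sh) eq_sym.
by case: i => -[|i] hi.
Qed.

(** Insertion on tagged lists. The test [nilp I] reproduces the condition [ord0 \in c] that the
    block fed to [Q] is not empty. *)
Definition insh chi (d : bool) P Q h : L :=
  Sh chi (fun I J => if nilp I then 0 else (-1) ^+ (d && odd (size J)) *: P (Q (us I) :: us J)) h.

Lemma insertionE chi d P Q s : insertion chi d P Q s = ext (insh chi d P Q) s.
Proof.
rewrite -ext_tuple /insertion exchange_big /=; apply: eq_bigr => t _.
have sp : size (parts t s) = size s.
  by rewrite /parts size_map size_zip size_tuple minnn.
have z1 : [seq x.1 | x <- zip t (parts t s)] = t.
  by rewrite -/(unzip1 _) unzip1_zip // sp size_tuple.
have z2 : us (zip t (parts t s)) = parts t s.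
  by rewrite /us -/(unzip2 _) unzip2_zip // sp size_tuple.
have sz : size (zip t (parts t s)) = size s.
  by rewrite size_zip sp size_tuple minnn.
rewrite /insh -(Sh_tuple_size _ _ sz z1) big_mkcond; apply: eq_bigr => c _.
have e k : block k (labels c) (parts t s) = us (block k (labels c) (zip t (parts t s))).
  by rewrite -{1}z2 block_map.
rewrite (mem_block _ sz) !e.
case: nilP => _ /=; first by rewrite scaler0.
rewrite exprD -scalerA; congr (_ *: (_ *: _)).
by rewrite (size_block _ _ (esym sz)) -signr_odd oddM; case: d.
Qed.

End Families.

(** * Insertion and its pre-Lie identity *)

Section Insertion.
Context (R : realType) (L : glie R) (Lok : glieok L).
Local Notation X := (bool * L)%type.
Implicit Types (s : seq L) (h : seq X) (P Q : Defs.family L) (Psi : seq X -> L).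
Local Notation okl := (all (@okb R L)).
Local Notation us := (@us R L).

Lemma us_nil h : h <> [::] -> us h <> [::].
Proof. by case: h. Qed.

Lemma clos_cons P u s : clos P -> gsub (u : L) -> in_sub s -> gsub (P (u :: s)).
Proof. by move=> cP sQ ss; apply: cP => //; apply/in_subc. Qed.

Lemma insh_hmult chi d P Q : mult P -> mult Q -> clos Q -> hmult (insh chi d P Q).
Proof.
move=> mP mQ cQ; apply: Sh_hmult => //.
- move=> J oJ h1 h2 p a u v o1 o2 ou ov.
  have nn w : nilp (h1 ++ (p, w) :: h2) = false by case: h1 {o1}.
  rewrite !nn (hmult_us mQ) // scalerA mulrC -scalerA -scalerDr; congr (_ *: _).
  have oo w : okb (p, w) -> gsub (Q (us (h1 ++ (p, w) :: h2))).
    move=> ow; apply: cQ; first by case: h1 {o1 nn}.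
    by apply: ok_in; rewrite all_cat /= o1 ow.
  by apply: (mP [::]) => //; [exact: ok_in|exact: oo|exact: oo].
- move=> I oI h1 h2 p a u v o1 o2 ou ov.
  case: nilP => [_|/eqP I0]; first by rewrite scaler0 addr0.
  have sz w : size (h1 ++ (p, w) :: h2) = (size h1 + size h2).+1.
    by rewrite size_cat /= addnS.
  rewrite !sz !us_cat /= scalerA mulrC -scalerA -scalerDr; congr (_ *: _).
  have sQ : gsub (Q (us I)) by apply: cQ; [exact/us_nil/eqP|exact: ok_in].
  rewrite -!cat_cons mP //; try exact: ok_in; try exact: (okb_sub ou); try exact: (okb_sub ov).
  by apply/in_subc; split => //; apply: ok_in.
Qed.

Lemma insertion_mult chi d P Q : mult P -> mult Q -> clos Q -> mult (insertion chi d P Q).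
Proof.
move=> mP mQ cQ s1 s2 a u v i1 i2 su sv; rewrite !insertionE.
by apply: (ext_mult Lok (insh_hmult chi d mP mQ cQ)).
Qed.

Lemma ins_us chi d P Q h : mult P -> mult Q -> clos Q -> okl h ->
  insertion chi d P Q (us h) = insh chi d P Q h.
Proof. by move=> mP mQ cQ oh; rewrite insertionE ext_us //; apply: insh_hmult. Qed.

Lemma gsub_Sh chi (Phi : seq X -> seq X -> L) h : okl h ->
  (forall I J, okl I -> okl J -> perm_eq (I ++ J) h -> gsub (Phi I J)) -> gsub (Sh chi Phi h).
Proof. by move=> oh E; apply: (@Sh_ind _ _ _ _ (fun u : L => gsub u) _ _ _ oh) => //; [exact: gok0|exact: gokP]. Qed.

Lemma gsub_ext Psi s : in_sub s ->
  (forall h, okl h -> size h = size s -> gsub (Psi h)) -> gsub (ext Psi s).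
Proof.
elim: s Psi => [|u s IH] Psi /=; first by move=> _; apply.
move=> /in_subc[su ss] E; apply: (gsubD Lok); apply: IH => // h oh sh.
  by apply: E; rewrite /= ?sh ?okb_gpar.
by apply: E; rewrite /= ?sh ?okb_gpar.
Qed.

Lemma insertion_clos chi d P Q : clos P -> clos Q -> clos (insertion chi d P Q).
Proof.
move=> cP cQ s s0 ss; rewrite insertionE; apply: gsub_ext => // h oh sh.
apply: gsub_Sh => // I J oI oJ _; case: nilP => [_|/eqP I0]; first exact: gok0.
apply: gsubZ => //; apply: clos_cons => //; last exact: ok_in.
by apply: cQ; [exact/us_nil/eqP|exact: ok_in].
Qed.

Lemma insh_eq chi d P Q P' Q' h : clos Q -> feq P P' -> feq Q Q' -> okl h ->
  insh chi d P Q h = insh chi d P' Q' h.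
Proof.
move=> cQ EP EQ oh; rewrite /insh; apply: (@Sh_ext _ _ _ _ (@okb R L) _ _ _ oh) => I J oI oJ _.
case: nilP => // /eqP I0; congr (_ *: _).
have I1 := us_nil (elimN eqP I0); have sI := ok_in oI.
by rewrite EP ?EQ //; apply/in_subc; split; [rewrite -EQ //; exact: cQ|exact: ok_in].
Qed.

Lemma insertion_feq chi d P Q P' Q' : clos Q -> feq P P' -> feq Q Q' ->
  feq (insertion chi d P Q) (insertion chi d P' Q').
Proof.
move=> cQ EP EQ s s0 ss; rewrite !insertionE; apply: ext_eq => // h oh _.
exact: insh_eq.
Qed.

Lemma okb_lab d Q I : clos Q -> prule d Q -> okl I -> I <> [::] -> okb (lab d I, Q (us I)).
Proof.
move=> cQ rQ oI I0; apply: okbE; last exact: rQ.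
by apply: cQ; [exact: us_nil|exact: ok_in].
Qed.

(** When the two neighbours fall in the same block, the hypotheses apply. When they fall in
    different blocks, the two summands trade places, and the sign is the crossing of x and y. *)
Lemma Sh_symm (Phi : seq X -> seq X -> L) :
  (forall J h1 h2 x y, okl J -> okl h1 -> okl h2 -> okb x -> okb y ->
  Phi (h1 ++ x :: y :: h2) J = (-1) ^+ sym_chi x.1 y.1 *: Phi (h1 ++ y :: x :: h2) J) ->
  (forall I h1 h2 x y, okl I -> okl h1 -> okl h2 -> okb x -> okb y ->
  Phi I (h1 ++ x :: y :: h2) = (-1) ^+ sym_chi x.1 y.1 *: Phi I (h1 ++ y :: x :: h2)) ->
  forall h1 h2 x y, okl h1 -> okl h2 -> okb x -> okb y -> Sh sym_chi Phi (h1 ++ x :: y :: h2) =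
  (-1) ^+ sym_chi x.1 y.1 *: Sh sym_chi Phi (h1 ++ y :: x :: h2).
Proof.
move=> s1 s2 h1; elim: h1 Phi s1 s2 => [|z h1 IH] Phi s1 s2 h2 x y.
  move=> _ o2 ox oy /=; rewrite !scalerDr -!ShZ -!ShD.
  apply: (@Sh_ext _ _ _ _ (@okb R L)) => // I J oI oJ _.
  have /= -> := s1 J [::] I x y oJ isT oI ox oy.
  have /= -> := s2 I [::] J x y oI isT oJ ox oy.
  rewrite !scalerA -!signr_addb.
  rewrite !pass_sym /sym_chi; case: x.1; case: y.1; case: (spar I) => /=;
    rewrite ?expr0 ?expr1 ?scaleN1r ?scale1r; abelian.
move=> /= /andP[oz o1] o2 ox oy; rewrite scalerDr; congr (_ + _); apply: IH => //.
- by move=> J k1 k2 w v oJ ok1 ok2 ow ov; rewrite -!cat_cons s1 //= oz.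
- by move=> I k1 k2 w v oI ok1 ok2 ow ov; rewrite s2 //= oz.
- move=> J k1 k2 w v oJ ok1 ok2 ow ov; rewrite s1 //= ?oz // !scalerA mulrC.
  congr (_ * _ *: _); congr (_ ^+ _); congr nat_of_bool; rewrite !pass_sym !spar_cat /=.
  by case: w.1; case: v.1.
- move=> I k1 k2 w v oI ok1 ok2 ow ov.
  by rewrite (s2 I (z :: k1)) //= ?oz // !scalerA mulrC.
Qed.

Lemma pco_ins p q P Q : pco sym_chi p P -> pco sym_chi q Q ->
  pco sym_chi (p (+) q) (insertion sym_chi false P Q).
Proof.
move=> [cP mP sP rP] [cQ mQ sQ rQ]; split.
- exact: insertion_clos.
- exact: insertion_mult.
- move=> h1 h2 x y o1 o2 ox oy.
  rewrite !ins_us //; try by rewrite all_cat /= o1 ox oy o2.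
  apply: Sh_symm => //.
  + move=> J k1 k2 z w oJ ok1 ok2 oz ow.
    have nn a b : nilp (k1 ++ a :: b :: k2) = false by case: k1 {ok1}.
    rewrite !nn !scale1r sQ // (multZ Lok (s1 := [::])) //; first exact: ok_in.
    by apply: cQ; [by case: k1 {ok1 nn}|apply: ok_in; rewrite all_cat /= ok1 ow oz].
  + move=> I k1 k2 z w oI ok1 ok2 oz ow; case: nilP => [_|/eqP I0].
      by rewrite scaler0.
    rewrite !scale1r; apply: (sP ((lab q I, Q (us I)) :: k1)) => //=.
    by rewrite ok1 andbT; apply: okb_lab => //; apply/eqP.
- move=> h h0 oh; rewrite ins_us //.
  rewrite (Sh_linear sym_chi (f := gpar (lab (p (+) q) h)) _ _); last first.
    by move=> a u v; apply: gok_parP.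
  rewrite /insh; apply: (@Sh_ext _ _ _ _ (@okb R L) _ _ _ oh) => I J oI oJ pIJ; case: nilP => [_|/eqP I0]; first by rewrite gpar0.
  rewrite scale1r.
  have oI' : okb (lab q I, Q (us I)) by apply: okb_lab => //; apply/eqP.
  have := rP ((lab q I, Q (us I)) :: J); rewrite /= oI' oJ => /(_ _ isT) {2}<- //.
  congr (gpar _ _); rewrite /lab /= -(spar_perm pIJ) spar_cat.
  by case: p {rP cP sP}; case: q {rQ oI' cQ sQ}; case: (spar I); case: (spar J).
Qed.

Lemma Sh_mult P s chi (Phi : seq X -> seq X -> L) h : mult P -> in_sub s -> okl h ->
  (forall I J, okl I -> okl J -> perm_eq (I ++ J) h -> gsub (Phi I J)) ->
  P (Sh chi Phi h :: s) = Sh chi (fun I J => P (Phi I J :: s)) h.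
Proof.
move=> mP ss; elim: h Phi => //= x h IH Phi /andP[ox oh] E.
have E1 I J : okl I -> okl J -> perm_eq (I ++ J) h -> gsub (Phi (x :: I) J).
  by move=> oI oJ pIJ; apply: E; rewrite /= ?ox ?perm_cons.
have E2 I J : okl I -> okl J -> perm_eq (I ++ J) h -> gsub (Phi I (x :: J)).
  move=> oI oJ pIJ; apply: E; rewrite /= ?ox //.
  by rewrite -cat1s perm_catCA perm_cons.
have E2' I J : okl I -> okl J -> perm_eq (I ++ J) h ->
    gsub ((-1) ^+ pass chi x.1 I *: Phi I (x :: J)).
  by move=> oI oJ pIJ; apply: gsubZ => //; apply: E2.
rewrite (multD (s1 := [::])) //=; try exact: gsub_Sh.
rewrite !IH //; congr (_ + _); apply: (@Sh_ext _ _ _ _ (@okb R L) _ _ _ oh) => I J oI oJ pIJ.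
by rewrite (multZ Lok (s1 := [::])) //; exact: E2.
Qed.

Local Notation "P '<<|' Q" := (insertion sym_chi false P Q) (at level 40, left associativity).

Definition associator P Q Q' : Defs.family L := (P <<| Q) <<| Q' - P <<| (Q <<| Q').

(** In the associator the terms where [Q'] sits inside [Q] cancel. What remains inserts [Q] and [Q']
    into two different arguments of [P], which is symmetric up to the Koszul sign of [Q] and
    [Q']. *)
Lemma insertion_prelie p q q' P Q Q' h :
  pco sym_chi p P -> pco sym_chi q Q -> pco sym_chi q' Q' -> h <> [::] -> okl h ->
  associator P Q Q' (us h) = (-1) ^+ (q && q') *: associator P Q' Q (us h).
Proof.
move=> cP cQ cQ' h0 oh.
(* The surviving terms: [Q'] takes the block [I], [Q] takes [K], and [M] is left over. The sign is
   that of the value of [Q'] crossing the block [K]. *)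
pose T (q : bool) Q Q' h := Sh sym_chi (fun I J => Sh sym_chi (fun K M =>
  if nilp I || nilp K then 0 else
  (-1) ^+ ((q (+) spar I) && spar K) *: P (Q (us K) :: Q' (us I) :: us M)) J) h.
have E q1 q2 Q1 Q2 : pco sym_chi q1 Q1 -> pco sym_chi q2 Q2 ->
    associator P Q1 Q2 (us h) = T q2 Q1 Q2 h.
  move=> cQ1 cQ2; have cQ12 := pco_ins cQ1 cQ2.
  have cPQ := pco_ins cP cQ1.
  rewrite /associator [LHS]/GRing.add /=; apply/eqP; rewrite subr_eq addrC; apply/eqP.
  rewrite (ins_us _ _ (pcoM cPQ) (pcoM cQ2) (pcoC cQ2)) //.
  rewrite (ins_us _ _ (pcoM cP) (pcoM cQ12) (pcoC cQ12)) //.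
  transitivity (Sh sym_chi (fun I J => Sh sym_chi (fun K M =>
      if nilp I then 0 else P (Q1 (Q2 (us I) :: us K) :: us M)) J) h + T q2 Q1 Q2 h).
    rewrite -ShD; apply: (@Sh_ext _ _ _ _ (@okb R L) _ _ _ oh) => I J oI oJ _.
    rewrite -ShD; case: nilP => [_|/eqP I0] /=.
      by rewrite -[LHS](Sh0 L sym_chi J); apply: Sh_eq => K M; rewrite addr0.
    have oy : okb (lab q2 I, Q2 (us I)).
      by apply: okb_lab; [exact: pcoC cQ2|exact: pco_prule cQ2|done|exact/eqP].
    rewrite scale1r.
    rewrite (ins_us sym_chi false (h := (lab q2 I, Q2 (us I)) :: J)
      (pcoM cP) (pcoM cQ1) (pcoC cQ1)) /= ?oy // /insh /= -ShD.
    apply: Sh_eq => K M; rewrite scale1r pass_sym /lab negbK.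
    by case: nilP => _; rewrite ?scaler0 ?scale1r.
  congr (_ + _); etransitivity; first exact: (Sh_assoc sym_chi (fun I K M =>
      if nilp I then 0 else P (Q1 (Q2 (us I) :: us K) :: us M))).
  apply: (@Sh_ext _ _ _ _ (@okb R L) _ _ _ oh) => A M oA oM _.
  case: nilP => [->|_] //; rewrite scale1r.
  rewrite (ins_us _ _ (pcoM cQ1) (pcoM cQ2) (pcoC cQ2)) // /insh.
  have sQ I K : okl I -> okl K -> I <> [::] -> gsub (Q1 (Q2 (us I) :: us K)).
    move=> oI oK I0; apply: clos_cons; [exact: pcoC cQ1| |exact: ok_in].
    by apply: (pcoC cQ2); [exact: us_nil|exact: ok_in].
  rewrite (Sh_mult sym_chi (pcoM cP)) //; last 2 first.
  - exact: ok_in.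
  - move=> I K oI oK _; case: nilP => [_|I0]; [exact: gok0|rewrite scale1r].
    exact: sQ.
  apply: Sh_eq => I K; case: nilP => _; last by rewrite scale1r.
  rewrite (mult0 Lok (s1 := [::])) //; [exact: pcoM cP|exact: ok_in].
have TE q1 Q1 Q2 : T q1 Q1 Q2 h = Sh sym_chi (fun A M => Sh sym_chi (fun I K =>
    if nilp I || nilp K then 0 else
    (-1) ^+ ((q1 (+) spar I) && spar K) *: P (Q1 (us K) :: Q2 (us I) :: us M)) A) h.
  exact: (Sh_assoc sym_chi (fun I K M => if nilp I || nilp K then 0 else
    (-1) ^+ ((q1 (+) spar I) && spar K) *: P (Q1 (us K) :: Q2 (us I) :: us M))).
rewrite (E q q') // (E q' q) // !TE.
rewrite -ShZ; apply: (@Sh_ext _ _ _ _ (@okb R L) _ _ _ oh) => A M oA oM _.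
(* Exchanging the blocks [I] and [K], and then the first two arguments of [P], turns one remainder
   into the other. *)
rewrite Sh_symC -ShZ; apply: (@Sh_ext _ _ _ _ (@okb R L) _ _ _ oA) => I K oI oK _.
rewrite orbC; case: nilP => [_|I0] /=; first by rewrite !scaler0.
case: nilP => [_|K0] /=; first by rewrite !scaler0.
have o1 : okb (lab q I, Q (us I)).
  by apply: okb_lab => //; [exact: pcoC cQ|exact: pco_prule cQ].
have o2 : okb (lab q' K, Q' (us K)).
  by apply: okb_lab => //; [exact: pcoC cQ'|exact: pco_prule cQ'].
have /= -> := @pco_symm _ _ _ _ _ cP [::] _ _ _ isT oM o1 o2.
rewrite !scalerA -!signr_addb; congr (_ ^+ _ *: _); congr nat_of_bool.
by rewrite /sym_chi /lab; case: q {o1 cQ}; case: q' {o2 cQ'}; case: (spar I); case: (spar K).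
Qed.

End Insertion.

(** * Decalage between skew and symmetric conventions *)

Section Decalage.
Context (R : realType) (L : glie R) (Lok : glieok L).
Local Notation X := (bool * L)%type.
Implicit Types (s : seq L) (h : seq X) (P Q : Defs.family L) (Psi : seq X -> L).
Local Notation okl := (all (@okb R L)).
Local Notation us := (@us R L).
Local Notation ShX := (@Sh_ext _ _ _ _ (@okb R L)).

Lemma feqR P : feq P P. Proof. by []. Qed.
Lemma feqS P Q : feq P Q -> feq Q P.
Proof. by move=> E s s0 ss; rewrite E. Qed.
Lemma feqT P Q T : feq P Q -> feq Q T -> feq P T.
Proof. by move=> E E' s s0 ss; rewrite E // E'. Qed.
Lemma feqP (a : R) P Q P' Q' : feq P P' -> feq Q Q' -> feq (a *: P + Q) (a *: P' + Q').
Proof. by move=> E E' s s0 ss; rewrite !fctE /= E // E'. Qed.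
Lemma feqD P Q P' Q' : feq P P' -> feq Q Q' -> feq (P + Q) (P' + Q').
Proof. by move=> E E' s s0 ss; rewrite !fctE /= E // E'. Qed.
Lemma feqN P P' : feq P P' -> feq (- P) (- P').
Proof. by move=> E s s0 ss; rewrite !fctE /= E. Qed.
Lemma feqZ (a : R) P P' : feq P P' -> feq (a *: P) (a *: P').
Proof. by move=> E s s0 ss; rewrite !fctE /= E. Qed.

Lemma pco_feq chi d P P' : feq P P' -> pco chi d P -> pco chi d P'.
Proof.
move=> E [cP mP sP rP].
have nn s1 (u : L) s2 : s1 ++ u :: s2 <> [::] by case: s1.
split.
- by move=> s s0 ss; have <- := E s s0 ss; apply: cP.
- move=> s1 s2 a u v i1 i2 su sv.
  have E' w : gsub w -> P' (s1 ++ w :: s2) = P (s1 ++ w :: s2).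
    by move=> sw; rewrite E //; apply/in_sub_cat; split=> //; apply/in_subc.
  by rewrite !E' ?mP //; apply: gokP.
- move=> h1 h2 x y o1 o2 ox oy.
  have E' u v : okb u -> okb v -> P' (us (h1 ++ u :: v :: h2)) = P (us (h1 ++ u :: v :: h2)).
    move=> ou ov; rewrite E //; first by case: h1 {o1}.
    by apply: ok_in; rewrite all_cat /= o1 o2 ou ov.
  by rewrite !E' // sP.
- move=> h h0 oh; have <- := feq_us E h0 oh; exact: rP.
Qed.

Lemma clos0 : clos (0 : Defs.family L). Proof. by move=> s _ _; exact: gok0. Qed.
Lemma multz : mult (0 : Defs.family L).
Proof. by move=> s1 s2 a u v _ _ _ _; rewrite scaler0 addr0. Qed.

Lemma closP (a : R) P Q : clos P -> clos Q -> clos (a *: P + Q).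
Proof. by move=> cP cQ s s0 ss; apply: gokP => //; [apply: cP|apply: cQ]. Qed.

Lemma multP (a : R) P Q : mult P -> mult Q -> mult (a *: P + Q).
Proof.
move=> mP mQ s1 s2 b u v i1 i2 su sv; rewrite !fctE mP // mQ //.
by rewrite !scalerDr !scalerA mulrC addrACA.
Qed.

Lemma pco0 chi d : pco chi d (0 : Defs.family L).
Proof.
split; [exact: clos0|exact: multz| |].
- by move=> *; rewrite scaler0.
- by move=> *; rewrite gpar0.
Qed.

Lemma pcoP chi d (a : R) P Q : pco chi d P -> pco chi d Q -> pco chi d (a *: P + Q).
Proof.
move=> [cP mP sP rP] [cQ mQ sQ rQ]; split; [exact: closP|exact: multP| |].
- by move=> h1 h2 x y o1 o2 ox oy; rewrite !fctE sP // sQ // scalerDr !scalerA mulrC.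
- by move=> h h0 oh; rewrite !fctE gok_parP // rP // rQ.
Qed.

Lemma pcoZ chi d (a : R) P : pco chi d P -> pco chi d (a *: P).
Proof. by move=> cP; rewrite -[_ *: _]addr0; apply: pcoP => //; apply: pco0. Qed.
Lemma pcoD chi d P Q : pco chi d P -> pco chi d Q -> pco chi d (P + Q).
Proof. by move=> cP cQ; rewrite -[P]scale1r; apply: pcoP. Qed.

(** The exponent of the decalage sign as a recursion: an entry counts when it is even and followed
    by an odd number of entries. *)
Fixpoint dexp h : bool :=
  if h is x :: h' then (odd (size h') && ~~ x.1) (+) dexp h' else false.

Lemma dexpE h : odd (\sum_(i < size h)
   ((size h).-1 - i) * ~~ nth false [seq x.1 | x <- h] i)%N = dexp h.
Proof.
elim: h => [|x h IH] /=; first by rewrite big_ord0.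
rewrite big_ord_recl subn0 oddD oddM -IH; congr (_ (+) _).
  by rewrite oddb.
congr odd; apply: eq_bigr => i _ /=; congr (_ * _)%N.
by rewrite /bump /= -subn1 subnDA.
Qed.

Lemma decalageE P s : decalage P s = ext (fun h => (-1) ^+ dexp h *: P (us h)) s.
Proof.
rewrite -ext_tuple /decalage; apply: eq_bigr => t _.
have sp : size (parts t s) = size s.
  by rewrite /parts size_map size_zip size_tuple minnn.
have z1 : [seq x.1 | x <- zip t (parts t s)] = t.
  by rewrite -/(unzip1 _) unzip1_zip // sp size_tuple.
have z2 : us (zip t (parts t s)) = parts t s.
  by rewrite /us -/(unzip2 _) unzip2_zip // sp size_tuple.
have sz : size (zip t (parts t s)) = size s.
  by rewrite size_zip sp size_tuple minnn.
by rewrite z2 -dexpE z1 sz signr_odd.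
Qed.

Lemma dexp_labels h h' : [seq x.1 | x <- h] = [seq x.1 | x <- h'] -> dexp h = dexp h'.
Proof.
elim: h h' => [|x h IH] [|y h'] //= [-> E]; rewrite (IH h') //.
by have := congr1 size E; rewrite !size_map => ->.
Qed.

Lemma dec_hmult P : mult P -> hmult (fun h => (-1) ^+ dexp h *: P (us h)).
Proof.
move=> mP h1 h2 p a u v o1 o2 ou ov; rewrite (hmult_us mP) // scalerDr !scalerA mulrC.
have E w w' : dexp (h1 ++ (p, w) :: h2) = dexp (h1 ++ (p, w') :: h2).
  by apply: dexp_labels; rewrite !map_cat.
by rewrite (E (a *: u + v) u) (E v u).
Qed.

Lemma dec_us P h : mult P -> okl h -> decalage P (us h) = (-1) ^+ dexp h *: P (us h).
Proof. by move=> mP oh; rewrite decalageE (ext_us Lok) //; apply: dec_hmult. Qed.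

Lemma dec_mult P : mult P -> mult (decalage P).
Proof.
move=> mP s1 s2 a u v *; rewrite !decalageE.
by apply: (ext_mult Lok (dec_hmult mP)).
Qed.

Lemma dec_clos P : clos P -> clos (decalage P).
Proof.
move=> cP s s0 ss; rewrite decalageE; apply: gsub_ext => // h oh sh.
apply: gsubZ => //; apply: cP; last exact: ok_in.
by case: h sh s0 {oh} => // /esym/size0nil->.
Qed.

Lemma dexp_cat h h' : dexp (h ++ h') = (odd (size h') && spar h) (+) dexp h (+) dexp h'.
Proof.
elim: h => [|x h IH] /=; first by rewrite andbF.
rewrite IH size_cat oddD; case: (odd (size h)); case: (odd (size h')); case: x.1;
  case: (spar h); case: (dexp h); case: (dexp h') => //.
Qed.

(** Exchanging two neighbours changes the sign of decalage by |x| + |y|, so one exchange rule is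
    carried into the other, in either direction. *)
Lemma pco_dec chi chi' d P :
  (forall x y, chi' x y = chi x y (+) x (+) y) -> pco chi d P -> pco chi' d (decalage P).
Proof.
move=> E [cP mP sP rP]; split; [exact: dec_clos|exact: dec_mult| |].
- move=> h1 h2 x y o1 o2 ox oy; rewrite !dec_us //; try by rewrite all_cat /= o1 ox oy o2.
  rewrite sP // !scalerA -!signr_addb; congr (_ ^+ _ *: _); congr nat_of_bool.
  rewrite !dexp_cat /= E; case: x.1; case: y.1; case: (odd (size h2)); case: (spar h1);
  by case: (dexp h1); case: (dexp h2); case: (chi _ _).
- move=> h h0 oh; rewrite dec_us // gparZ // rP //.
Qed.

Lemma decK P : mult P -> feq (decalage (decalage P)) P.
Proof.
move=> mP; apply: (feq_ok Lok) => //; first by apply: dec_mult; apply: dec_mult.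
move=> h h0 oh; rewrite !dec_us //; last exact: dec_mult.
by rewrite scalerA -signr_addb addbb scale1r.
Qed.

Lemma dec_feq P Q : feq P Q -> feq (decalage P) (decalage Q).
Proof.
move=> E s s0 ss; rewrite !decalageE; apply: ext_eq => // h oh sh.
by rewrite (feq_us E) // => h0; move: sh; rewrite h0; case: s s0 {ss}.
Qed.

Lemma dec_P (a : R) P Q : decalage (a *: P + Q) = a *: decalage P + decalage Q.
Proof.
apply/funext => s; rewrite !fctE !decalageE -extP; congr ext; apply/funext => h.
by rewrite scalerDr !scalerA mulrC.
Qed.

Lemma skew_symE x y : sym_chi x y = skew_chi x y (+) x (+) y.
Proof. by case: x; case: y. Qed.
Lemma sym_skewE x y : skew_chi x y = sym_chi x y (+) x (+) y.
Proof. by case: x; case: y. Qed.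

Lemma pass_skew b h : pass skew_chi b h = pass sym_chi b h (+) (odd (size h) && ~~ b) (+) spar h.
Proof.
elim: h => [|x h IH]; first by [].
rewrite [LHS]/= IH /= sym_skewE; case: (pass _ _ _); case: (odd _); case: b {IH}; case: x.1;
  by case: (spar h); rewrite /= ?addbT ?addbF ?negbK.
Qed.

(** Decalage absorbs the signature contained in [skew_chi]: the sign of the whole list splits into
    those of the two blocks and a crossing of the first block with the length of the second. *)
Lemma Sh_skew_sym (Phi : seq X -> seq X -> L) h : (-1) ^+ dexp h *: Sh skew_chi Phi h =
  Sh sym_chi (fun I J => (-1) ^+ (dexp I (+) dexp J (+) (odd (size J) && spar I)) *: Phi I J) h.
Proof.
elim: h Phi => [|x h IH] Phi; first by rewrite /= scale1r.
rewrite /= signr_addb -scalerA scalerDr !IH scalerDr -!ShZ.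
congr (_ + _).
  apply: (@Sh_ext _ _ _ _ xpredT) => [|I J _ _ pIJ]; first exact/allP.
  rewrite scalerA -signr_addb -(perm_size pIJ) size_cat oddD; congr (_ ^+ _ *: _).
  congr nat_of_bool; case: (odd (size I)); case: (odd (size J)); case: x.1; case: (dexp I);
  by case: (dexp J); case: (spar I).
apply: (@Sh_ext _ _ _ _ xpredT) => [|I J _ _ pIJ]; first exact/allP.
rewrite !scalerA -!signr_addb -(perm_size pIJ) size_cat oddD pass_skew; congr (_ ^+ _ *: _).
congr nat_of_bool; case: (odd (size I)); case: (odd (size J)); case: x.1; case: (dexp I);
  by case: (dexp J); case: (spar I); case: (pass _ _ _).
Qed.

(** The sign [d * size] of the second block in the definition of [insertion] is exactly what makes
    up the difference once decalage has turned skew crossings into symmetric ones. *)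
Lemma dec_insertion chi q P Q : mult P -> pco chi q Q -> feq (decalage (insertion skew_chi q P Q))
  (insertion sym_chi false (decalage P) (decalage Q)).
Proof.
move=> mP [cQ mQ _ rQ]; apply: (feq_ok Lok).
- by apply: dec_mult; apply: insertion_mult.
- by apply: insertion_mult; [|apply: dec_mult|apply: dec_mult|apply: dec_clos].
move=> h h0 oh; rewrite dec_us ?ins_us //; last 4 first.
- exact: dec_mult.
- exact: dec_mult.
- exact: dec_clos.
- exact: insertion_mult.
rewrite /insh Sh_skew_sym; apply: (ShX oh) => I J oI oJ _.
case: nilP => [_|/eqP/eqP I0]; first by rewrite scaler0.
rewrite scale1r (dec_us mQ) // (multZ Lok (s1 := [::])) //; last 3 first.
- exact: dec_mult.
- exact: ok_in.
- by apply: cQ; [exact: us_nil|exact: ok_in].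
have oI' : okb (lab q I, Q (us I)) by apply: okb_lab.
have := dec_us (h := (lab q I, Q (us I)) :: J) mP; rewrite /= oI' => /(_ oJ) ->.
rewrite !scalerA -!signr_addb; congr (_ ^+ _ *: _); congr nat_of_bool.
rewrite /lab; case: (odd (size J)); case: q {rQ oI'}; case: (dexp I);
  by case: (dexp J); case: (spar I).
Qed.

Lemma pco_inskew p q P Q : pco skew_chi p P -> pco skew_chi q Q ->
  pco skew_chi (p (+) q) (insertion skew_chi q P Q).
Proof.
move=> cP cQ; have mi : mult (insertion skew_chi q P Q).
  by apply: insertion_mult; [|exact: pcoM cP|exact: pcoM cQ|exact: pcoC cQ].
apply: (pco_feq (decK mi)); apply: (pco_dec sym_skewE).
apply: pco_feq (feqS (dec_insertion (pcoM cP) cQ)) _.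
by apply: pco_ins => //; apply: (pco_dec skew_symE).
Qed.

Lemma insertionPl chi d (a : R) P P' Q :
  insertion chi d (a *: P + P') Q = a *: insertion chi d P Q + insertion chi d P' Q.
Proof.
apply/funext => s; rewrite !fctE !insertionE -extP; congr ext; apply/funext => h.
rewrite /insh -ShP; apply: Sh_eq => I J; case: nilP => _.
  by rewrite scaler0 addr0.
by rewrite scalerDr !scalerA mulrC.
Qed.

Lemma insertionPr chi d (a : R) P Q Q' : mult P -> clos Q -> clos Q' ->
  feq (insertion chi d P (a *: Q + Q')) (a *: insertion chi d P Q + insertion chi d P Q').
Proof.
move=> mP cQ cQ' s s0 ss; rewrite !fctE !insertionE -extP; apply: ext_eq => // h oh _.
rewrite /insh -ShP; apply: (ShX oh) => I J oI oJ _; case: nilP => [_|/eqP/eqP I0].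
  by rewrite scaler0 addr0.
have I1 := us_nil I0; have sI := ok_in oI.
rewrite (mP [::]) //=; [|exact: ok_in|exact: cQ|exact: cQ'].
by rewrite scalerDr !scalerA mulrC.
Qed.

End Decalage.

(** * The Nijenhuis-Richardson bracket *)

Section Bracket.
Context (R : realType) (L : glie R) (Lok : glieok L).
Local Notation X := (bool * L)%type.
Implicit Types (s : seq L) (h : seq X) (P Q : Defs.family L).
Local Notation okl := (all (@okb R L)).
Local Notation us := (@us R L).

Lemma famD P Q s : (P + Q) s = P s + Q s. Proof. by []. Qed.
Lemma famN P s : (- P) s = - P s. Proof. by []. Qed.
Lemma famZ (a : R) P s : (a *: P) s = a *: P s. Proof. by []. Qed.
Definition famE := (famD, famN, famZ).

Lemma decZ (a : R) P : decalage (a *: P) = a *: decalage P.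
Proof.
apply/funext => s; transitivity (a *: decalage P s) => //.
rewrite !decalageE -extZ; congr ext; apply/funext => h.
by rewrite !scalerA mulrC.
Qed.

(** Transported from the symmetric side through decalage, which is involutive on multilinear
    families; no skew sign has to be computed again. *)
Lemma skew_prelie p q q' P Q Q' : pco skew_chi p P -> pco skew_chi q Q -> pco skew_chi q' Q' ->
  feq (insertion skew_chi q' (insertion skew_chi q P Q) Q' -
  insertion skew_chi (q (+) q') P (insertion skew_chi q' Q Q')) ((-1) ^+ (q && q') *:
  (insertion skew_chi q (insertion skew_chi q' P Q') Q -
  insertion skew_chi (q (+) q') P (insertion skew_chi q Q' Q))).
Proof.
move=> cP cQ cQ'.
have E q1 q2 Q1 Q2 : pco skew_chi q1 Q1 -> pco skew_chi q2 Q2 ->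
  feq (decalage (insertion skew_chi q2 (insertion skew_chi q1 P Q1) Q2 -
       insertion skew_chi (q1 (+) q2) P (insertion skew_chi q2 Q1 Q2)))
    (associator (decalage P) (decalage Q1) (decalage Q2)).
  move=> c1 c2; have cP1 := pco_inskew Lok cP c1.
  have c12 := pco_inskew Lok c1 c2.
  have -> (T T' : Defs.family L) : decalage (T - T') = decalage T - decalage T'.
    by have := dec_P (-1) T' T; rewrite !scaleN1r addrC => ->; rewrite addrC.
  apply: feqD; [|apply: feqN].
    apply: feqT (dec_insertion Lok (pcoM cP1) c2) _.
    apply: insertion_feq => //; first exact: (dec_clos Lok (pcoC c2)).
    exact: (dec_insertion Lok (pcoM cP) c1).
  apply: feqT (dec_insertion Lok (pcoM cP) c12) _.
  apply: insertion_feq => //; first exact: (dec_clos Lok (pcoC c12)).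
  exact: (dec_insertion Lok (pcoM c1) c2).
have cA q1 q2 Q1 Q2 : pco skew_chi q1 Q1 -> pco skew_chi q2 Q2 ->
  mult (insertion skew_chi q2 (insertion skew_chi q1 P Q1) Q2 -
       insertion skew_chi (q1 (+) q2) P (insertion skew_chi q2 Q1 Q2)).
  move=> c1 c2; rewrite -[X in _ - X]scale1r -scaleNr addrC; apply: multP.
    exact: (pcoM (pco_inskew Lok cP (pco_inskew Lok c1 c2))).
  exact: (pcoM (pco_inskew Lok (pco_inskew Lok cP c1) c2)).
have -> : q (+) q' = q' (+) q by rewrite addbC.
have m1 := cA q q' Q Q' cQ cQ'; have m2 := cA q' q Q' Q cQ' cQ.
rewrite (addbC q q') in m1; have E1 := E q q' Q Q' cQ cQ'; rewrite (addbC q q') in E1.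
apply: feqT (feqS (decK Lok m1)) _.
apply: feqT (feqZ _ (decK Lok m2)).
rewrite -decZ; apply: (dec_feq Lok); apply: feqT E1 _.
apply: feqT (feqZ _ (feqS (E q' q Q' Q cQ' cQ))).
have c12 := pco_dec Lok skew_symE cP; have c1 := pco_dec Lok skew_symE cQ.
have c2 := pco_dec Lok skew_symE cQ'.
have cas q1 q2 Q1 Q2 : pco sym_chi q1 Q1 -> pco sym_chi q2 Q2 ->
   mult (associator (decalage P) Q1 Q2).
  move=> d1 d2; rewrite /associator -scaleN1r addrC; apply: multP.
    exact: (pcoM (pco_ins Lok c12 (pco_ins Lok d1 d2))).
  exact: (pcoM (pco_ins Lok (pco_ins Lok c12 d1) d2)).
apply: (feq_ok Lok); [exact: (cas _ _ _ _ c1 c2)| |].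
  rewrite -[_ *: _]addr0; apply: multP; [exact: (cas _ _ _ _ c2 c1)|exact: multz].
by move=> h h0 oh; apply: (insertion_prelie Lok c12 c1 c2).
Qed.

Lemma pco_nr p q P Q : pco skew_chi p P -> pco skew_chi q Q ->
  pco skew_chi (p (+) q) (nr_br p q P Q).
Proof.
move=> cP cQ; rewrite /nr_br -scaleNr addrC; apply: pcoP => //.
  by rewrite addbC; apply: pco_inskew.
exact: pco_inskew.
Qed.

Lemma nr_feq p q P Q P' Q' : clos P -> clos Q -> feq P P' -> feq Q Q' ->
  feq (nr_br p q P Q) (nr_br p q P' Q').
Proof.
by move=> cP cQ EP EQ; apply: feqD; [|apply: feqN; apply: feqZ]; apply: insertion_feq.
Qed.

Lemma nrPr p q (a : R) P Q Q' : mult P -> clos P -> clos Q -> clos Q' ->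
  feq (nr_br p q P (a *: Q + Q')) (a *: nr_br p q P Q + nr_br p q P Q').
Proof.
move=> mP cP cQ cQ' s s0 ss; rewrite /nr_br !famE (insertionPr Lok) // insertionPl !famE.
by rewrite !scalerDr !scalerA opprD scalerN addrACA scalerA mulrC.
Qed.

Lemma nr_anti p q P Q : nr_br p q P Q = - ((-1) ^+ (p && q) *: nr_br q p Q P).
Proof.
by rewrite /nr_br scalerDr scalerN scalerA andbC -signr_addb addbb scale1r opprD opprK addrC.
Qed.

Lemma nrPl p q (a : R) P P' Q : mult Q -> clos Q -> clos P -> clos P' ->
  feq (nr_br p q (a *: P + P') Q) (a *: nr_br p q P Q + nr_br p q P' Q).
Proof.
move=> mQ cQ cP cP'; rewrite !(nr_anti p q) => s s0 ss; rewrite !famE nrPr // !famE.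
by rewrite scalerDr opprD !scalerN !scalerA mulrC.
Qed.

Lemma nr_jacobi p q r P Q T : pco skew_chi p P -> pco skew_chi q Q -> pco skew_chi r T ->
  feq (nr_br p (q (+) r) P (nr_br q r Q T)) (nr_br (p (+) q) r (nr_br p q P Q) T +
  (-1) ^+ (p && q) *: nr_br q (p (+) r) Q (nr_br p r P T)).
Proof.
move=> cP cQ cT.
have cl d (W : Defs.family L) : pco skew_chi d W -> clos W by case.
have ml d (W : Defs.family L) : pco skew_chi d W -> mult W by case.
have ci d e W W' (c : pco skew_chi d W) (c' : pco skew_chi e W') :=
  pco_inskew Lok c c'.
have addl (d : bool) (b : R) W W' Z s : insertion skew_chi d (W - b *: W') Z s =
    insertion skew_chi d W Z s - b *: insertion skew_chi d W' Z s.
  have -> : W - b *: W' = (- b) *: W' + W by rewrite scaleNr addrC.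
  by rewrite insertionPl !famE scaleNr addrC.
have addr (d : bool) (b : R) W Z Z' s : s <> [::] -> in_sub s -> mult W -> clos Z -> clos Z' ->
    insertion skew_chi d W (Z - b *: Z') s =
    insertion skew_chi d W Z s - b *: insertion skew_chi d W Z' s.
  move=> s0 ss mW cZ cZ'; have -> : Z - b *: Z' = (- b) *: Z' + Z by rewrite scaleNr addrC.
  by rewrite (insertionPr Lok) // !famE scaleNr addrC.
move=> s s0 ss; rewrite !famE /nr_br !famE.
rewrite !addl !addr //;
  try solve [exact: (ml _ _ cP)|exact: (ml _ _ cQ)|exact: (ml _ _ cT)|exact: (cl _ _ cP)
   |exact: (cl _ _ cQ)|exact: (cl _ _ cT)|exact: (cl _ _ (ci _ _ _ _ cP cQ))
   |exact: (cl _ _ (ci _ _ _ _ cP cT))|exact: (cl _ _ (ci _ _ _ _ cQ cT))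
   |exact: (cl _ _ (ci _ _ _ _ cQ cP))|exact: (cl _ _ (ci _ _ _ _ cT cP))
   |exact: (cl _ _ (ci _ _ _ _ cT cQ))].
have A1 := skew_prelie cP cQ cT s0 ss; have A2 := skew_prelie cQ cP cT s0 ss.
have A3 := skew_prelie cT cP cQ s0 ss.
rewrite !famE in A1 A2 A3.
move/eqP: A1; rewrite subr_eq => /eqP A1.
move/eqP: A2; rewrite subr_eq => /eqP A2.
move/eqP: A3; rewrite subr_eq => /eqP A3.
move: A1 A2 A3; case: p {cP}; case: q {cQ}; case: r {cT} => /=;
  rewrite ?expr0 ?expr1 ?scaleN1r ?scale1r => -> -> ->; abelian.
Qed.

End Bracket.

(** * Integer degrees *)

Definition oddz (d : int) : bool := odd `|d|%N.

Lemma oddzD a b : oddz (a + b) = oddz a (+) oddz b.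
Proof. by rewrite /oddz; lia. Qed.

Lemma oddzN a : oddz (- a) = oddz a.
Proof. by rewrite /oddz; lia. Qed.

(** The last axiom decomposes an element of given parity in the subspace into finitely many elements
    of integer degrees of that parity. It is how degree conditions are turned into parity
    conditions. *)
Record glie_deg_ok (R : realType) (L : glie R) : Prop := GlieDegOk {
  ghom0 : forall d, ghom d (0 : L);
  ghomP : forall d (a : R) (u v : L), ghom d u -> ghom d v -> ghom d (a *: u + v);
  ghom_par : forall d (u : L), ghom d u -> gpar (oddz d) u = u;
  ghom_dec : forall p (u : L), gsub u -> gpar p u = u -> exists2 g : seq (int * L),
    (forall x, x \in g -> [/\ gsub x.2, ghom x.1 x.2 & oddz x.1 = p]) & u = \sum_(x <- g) x.2 }.

Lemma Sh_map (R : realType) (V : lmodType R) (T T' : eqType) (f : T' -> T) chi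
  (Phi : seq (bool * T) -> seq (bool * T) -> V) (s : seq (bool * T')) :
  Sh chi Phi [seq (x.1, f x.2) | x <- s] =
  Sh chi (fun I J => Phi [seq (x.1, f x.2) | x <- I] [seq (x.1, f x.2) | x <- J]) s.
Proof.
elim: s Phi => //= x s IH Phi; rewrite !IH; congr (_ + _); apply: Sh_eq => I J.
by congr (_ ^+ _ *: _); congr nat_of_bool; elim: I => //= y I ->.
Qed.

Section Degree.
Context (R : realType) (L : glie R) (Lok : glieok L) (Ldeg : glie_deg_ok L).
Local Notation X := (bool * L)%type.
Implicit Types (s : seq L) (h : seq X) (P Q : Defs.family L) (g : seq (int * L)).
Local Notation okl := (all (@okb R L)).
Local Notation us := (@us R L).

Definition hgood (x : int * L) : bool := `[< gsub x.2 /\ ghom x.1 x.2 >].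
Definition drule (d : int) P := forall g, g <> [::] -> all hgood g ->
  ghom (\sum_(x <- g) x.1 + d + 1 - (size g)%:Z) (P [seq x.2 | x <- g]).

Definition hlab g : seq X := [seq (oddz x.1, x.2) | x <- g].

Lemma hgood_ok g : all hgood g -> okl (hlab g).
Proof.
elim: g => //= x g IH /andP[/asboolP[sx hx] /IH->]; rewrite andbT.
by apply/asboolP; split => //; exact: ghom_par.
Qed.

Lemma us_hlab g : us (hlab g) = [seq x.2 | x <- g].
Proof. by rewrite /us /hlab -map_comp. Qed.

Lemma lab_hlab d g : lab (oddz d) (hlab g) = oddz (\sum_(x <- g) x.1 + d + 1 - (size g)%:Z).
Proof.
rewrite /lab; elim: g => [|x g IH]; first by rewrite big_nil /= !oddzD oddzN /=; case: oddz.
rewrite big_cons /= (_ : x.1 + _ + _ + _ - _ = (x.1 + -1) +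
  (\sum_(j <- g) j.1 + d + 1 - (size g)%:Z)); last by rewrite intS; ring.
by rewrite oddzD -IH oddzD oddzN /=; case: (oddz x.1); case: (oddz d); case: spar.
Qed.

Lemma ghom_sum (I : Type) (r : seq I) d (F : I -> L) :
  (forall i, ghom d (F i)) -> ghom d (\sum_(i <- r) F i).
Proof.
move=> hF; elim: r => [|i r IH]; rewrite ?big_nil ?big_cons; first exact: ghom0.
by rewrite -[F i]scale1r; apply: ghomP.
Qed.

Lemma gsub_sum (I : eqType) (r : seq I) (F : I -> L) :
  (forall i, i \in r -> gsub (F i)) -> gsub (\sum_(i <- r) F i).
Proof.
elim: r => [|i r IH] hF; rewrite ?big_nil ?big_cons; first exact: gok0.
apply: (gsubD Lok); first by apply: hF; rewrite inE eqxx.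
by apply: IH => j jr; apply: hF; rewrite inE jr orbT.
Qed.

Lemma mult_sum (I : eqType) (r : seq I) (F : I -> L) P s1 s2 :
  mult P -> in_sub s1 -> in_sub s2 -> (forall i, i \in r -> gsub (F i)) ->
  P (s1 ++ (\sum_(i <- r) F i) :: s2) = \sum_(i <- r) P (s1 ++ F i :: s2).
Proof.
move=> mP i1 i2; elim: r => [|i r IH] hF; rewrite ?big_nil ?big_cons.
  exact: mult0.
have hr j : j \in r -> gsub (F j) by move=> jr; apply: hF; rewrite inE jr orbT.
rewrite multD ?IH //; first by apply: hF; rewrite inE eqxx.
exact: gsub_sum.
Qed.

(** Each entry is a finite sum of elements of integer degrees with the right parity, and on such
    entries the degree of the value is known; multilinearity adds the pieces up. *)
Lemma drule_prule d P : mult P -> drule d P -> prule (oddz d) P.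
Proof.
move=> mP dP h h0 oh.
suff: forall b (h' : seq X) (Q : Defs.family L), mult Q -> okl h' ->
    (forall g, [seq x.1 | x <- hlab g] = [seq x.1 | x <- h'] -> all hgood g ->
      gpar b (Q [seq x.2 | x <- g]) = Q [seq x.2 | x <- g]) -> gpar b (Q (us h')) = Q (us h').
  apply=> // g Eg gg.
  have -> : lab (oddz d) h = lab (oddz d) (hlab g).
    congr (~~ (_ (+) _)); elim: h (hlab g) Eg {gg dP h0 oh} => [|x h IH] [|y k] //= [-> E].
    by rewrite (IH k).
  rewrite lab_hlab; apply: ghom_par => //; apply: dP => //.
  by move=> g0; move: h0 Eg; rewrite g0; case: (h).
move=> b; elim=> [|[p u] h' IH] Q mQ; first by move=> _ /(_ [::]) /=; apply.
rewrite /= => /andP[ou oh'] E.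
have [g gh /= ->] := ghom_dec Ldeg (okb_sub ou) (okb_par ou).
have sg x : x \in g -> gsub x.2 by move=> /gh[].
rewrite (mult_sum (s1 := [::]) mQ) //=; last exact: ok_in.
have gparS (r : seq (int * L)) (F : int * L -> L) :
    gpar b (\sum_(i <- r) F i) = \sum_(i <- r) gpar b (F i).
  by elim: r => [|i r IHr]; rewrite ?big_nil ?big_cons ?(gpar0 Lok) // (gparD Lok) IHr.
rewrite gparS !big_seq; apply: eq_bigr => x /gh[sx hx ex].
apply: (IH (fun s => Q (x.2 :: s))) => //; first exact: mult_cons.
move=> g' Eg' gg'; apply: (E (x :: g')); first by rewrite /= ex Eg'.
by rewrite /= gg' andbT; apply/asboolP.
Qed.

Lemma mult_catl P s2 : mult P -> in_sub s2 -> mult (fun s1 => P (s1 ++ s2)).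
Proof.
move=> mP i2 t1 t2 a u v j1 j2 su sv; rewrite -!catA /= mP //.
exact/in_sub_cat.
Qed.

Lemma mult_catr P s1 : mult P -> in_sub s1 -> mult (fun s2 => P (s1 ++ s2)).
Proof.
move=> mP i1 t1 t2 a u v j1 j2 su sv; rewrite !catA mP //.
exact/in_sub_cat.
Qed.

(** Separates the conditions visible on parities, where signs are computed, from the bookkeeping of
    integer degrees. *)
Lemma cochainE d P : cochain d P <-> pco skew_chi (oddz d) P /\ drule d P.
Proof.
split=> [[cP mP sP dP]|[[cP mP sP rP] dP]].
  have dr : drule d P.
    move=> g g0 gg; rewrite -(big_map (fun x : int * L => x.1) xpredT id).
    rewrite -[size g](size_map snd); apply: dP.
    - by case: (g) g0.
    - by rewrite -us_hlab; apply: ok_in; apply: hgood_ok.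
    - by rewrite !size_map.
    - rewrite size_map => i ig; have x0 : int * L by exact: (0, 0).
      rewrite !(nth_map x0) //.
      by have /asboolP[] := allP gg _ (mem_nth x0 ig).
  split=> //; split=> //; last exact: drule_prule.
  move=> h1 h2 x y o1 o2 ox oy; rewrite !us_cat /=.
  apply: sP; try exact: ok_in; try exact: okb_sub; exact: okb_par.
split=> //.
- move=> s1 s2 u v p q i1 i2 su sv pu pv.
  have ou : okb (p, u) by apply/asboolP.
  have ov : okb (q, v) by apply/asboolP.
  have i2' w z : gsub w -> gsub z -> in_sub (w :: z :: s2).
    by move=> sw sz; do 2 (apply/in_subc; split => //).
  rewrite (mext Lok (mult_catl mP (i2' _ _ su sv))) //.
  rewrite (mext Lok (P := fun s1 => P (s1 ++ [:: v, u & s2])) (mult_catl mP (i2' _ _ sv su))) //.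
  rewrite -extZ; apply: ext_eq => // h1 o1 _.
  have E w z : gsub w -> gsub z ->
     P (us h1 ++ [:: w, z & s2]) = ext (fun h2 => P (us h1 ++ [:: w; z] ++ us h2)) s2.
    move=> sw sz; apply: (mext (P := fun s => P (us h1 ++ [:: w; z] ++ s)) Lok) => //.
    have -> : (fun s => P (us h1 ++ [:: w; z] ++ s)) = (fun s => P ((us h1 ++ [:: w; z]) ++ s)).
      by apply/funext => s; rewrite -catA.
    apply: mult_catr => //; apply/in_sub_cat; split; first exact: ok_in.
    by do 2 (apply/in_subc; split => //).
  rewrite !E // -extZ; apply: ext_eq => // h2 o2 _.
  by have := sP _ _ _ _ o1 o2 ou ov; rewrite !us_cat.
- move=> s ds s0 ss sz hds.
  have gg : all hgood (zip ds s).
    apply/(all_nthP (0, 0)) => i; rewrite size_zip sz minnn => iz.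
    rewrite nth_zip //; apply/asboolP; split=> /=; last exact: hds.
    by apply: ss; rewrite mem_nth.
  have g0 : zip ds s <> [::] by case: s ds s0 sz {ss hds gg} => [|u s] [|d' ds].
  have := dP _ g0 gg; rewrite -/(unzip2 _) unzip2_zip ?sz // size_zip sz minnn.
  by rewrite -(big_map (fun x : int * L => x.1) xpredT id) -/(unzip1 _) unzip1_zip ?sz.
Qed.

Lemma drule0 d : drule d 0. Proof. by move=> *; exact: ghom0. Qed.
Lemma druleP d (a : R) P Q : drule d P -> drule d Q -> drule d (a *: P + Q).
Proof. by move=> dP dQ g g0 gg; apply: ghomP => //; [apply: dP|apply: dQ]. Qed.

Lemma cochain0 d : cochain d (0 : Defs.family L).
Proof. by apply/cochainE; split; [exact: pco0|exact: drule0]. Qed.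

Lemma cochainP d (a : R) P Q : cochain d P -> cochain d Q -> cochain d (a *: P + Q).
Proof.
move=> /cochainE[pP dP] /cochainE[pQ dQ]; apply/cochainE.
by split; [exact: pcoP|exact: druleP].
Qed.

Lemma drule_insertion b d d' P Q : mult P -> mult Q -> clos Q -> drule d P -> drule d' Q ->
  drule (d + d') (insertion skew_chi b P Q).
Proof.
move=> mP mQ cQ dP dQ g g0 gg; have oh := hgood_ok gg.
rewrite -us_hlab ins_us // /insh.
(* Each entry keeps its integer degree next to its parity, so that the blocks of an unshuffle
   remember the degrees. *)
pose G := [seq (oddz x.1, x) | x <- g].
have -> : hlab g = [seq (y.1, y.2.2) | y <- G] by rewrite /G -map_comp.
rewrite (Sh_map (fun x : int * L => x.2)).
pose Pg (y : bool * (int * L)) := hgood y.2 && (y.1 == oddz y.2.1).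
apply: (@Sh_ind _ _ _ _ (fun u : L => ghom _ u) Pg).
- by rewrite all_map; apply/allP => x xg; rewrite /Pg /= eqxx andbT; exact: (allP gg).
- exact: ghom0.
- exact: ghomP.
move=> I J aI aJ pIJ.
have E (K : seq (bool * (int * L))) : us [seq (x.1, x.2.2) | x <- K] = [seq x.2 | x <- [seq x.2 | x <- K]].
  by rewrite /us -!map_comp.
have gK (K : seq (bool * (int * L))) : all Pg K -> all hgood [seq x.2 | x <- K].
  by rewrite all_map; apply: sub_all => y /andP[].
case: nilP => [_|/eqP/eqP I0]; first exact: ghom0.
rewrite -[_ *: _]addr0; apply: ghomP => //; last exact: ghom0.
rewrite !E; set I' := [seq x.2 | x <- I]; set J' := [seq x.2 | x <- J].
have I'0 : I' <> [::] by move: I0; rewrite /I'; case: (I).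
have hQ := dQ I' I'0 (gK _ aI).
have gQ : hgood (\sum_(x <- I') x.1 + d' + 1 - (size I')%:Z, Q [seq x.2 | x <- I']).
  apply/asboolP; split => //=; apply: cQ; first by case: (I') I'0.
  by rewrite -us_hlab; apply: ok_in; apply: hgood_ok; exact: gK.
have := dP ((\sum_(x <- I') x.1 + d' + 1 - (size I')%:Z, Q [seq x.2 | x <- I']) :: J').
rewrite [X in _ -> X -> _]/= gQ (gK _ aJ) => /(_ _ isT) -/(_ (fun e => match e with end)).
rewrite big_cons /=; congr (ghom _ _).
have -> : \sum_(x <- g) x.1 = \sum_(x <- I') x.1 + \sum_(x <- J') x.1.
  rewrite -big_cat /= -map_cat; apply: perm_big.
  have -> : g = [seq x.2 | x <- G] by rewrite /G -map_comp map_id.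
  by rewrite perm_sym; apply: perm_map.
have -> : size g = (size I' + size J')%N.
  by rewrite /I' /J' !size_map -size_cat (perm_size pIJ) /G size_map.
by rewrite intS PoszD; ring.
Qed.

Lemma cochain_insertion d d' P Q : cochain d P -> cochain d' Q ->
  cochain (d + d') (insertion skew_chi (oddz d') P Q).
Proof.
move=> /cochainE[pP dP] /cochainE[pQ dQ]; apply/cochainE; split.
  by rewrite oddzD; apply: pco_inskew.
apply: drule_insertion => //; [exact: pcoM pP|exact: pcoM pQ|exact: pcoC pQ].
Qed.

Lemma cochain_nr d d' P Q : cochain d P -> cochain d' Q ->
  cochain (d + d') (nr_br (oddz d) (oddz d') P Q).
Proof.
move=> cP cQ; rewrite /nr_br -scaleNr [X in cochain _ X]addrC; apply: cochainP.
  by rewrite addrC; apply: cochain_insertion.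
exact: cochain_insertion.
Qed.

End Degree.

(** * Partitions into several blocks *)

Section ManyBlocks.
Context (R : realType) (V : lmodType R) (T : eqType) (chi : bool -> bool -> bool).
Local Notation X := (bool * T)%type.
Implicit Types (Phi : seq (seq X) -> V) (s : seq X) (bs : seq (seq X)).

(** The analogue of [Sh] for [k] ordered blocks: an entry that goes to block [i] crosses the
    contents of the blocks before it. *)
Fixpoint ShK (k : nat) Phi s : V :=
  if s is x :: s' then
  \sum_(i < k) ShK k (fun bs => (-1) ^+ foldr (fun b e => pass chi x.1 b (+) e) false (take i bs) *:
  Phi (set_nth [::] bs i (x :: nth [::] bs i))) s' else Phi (nseq k [::]).

Lemma ShK_eq k Phi Psi s : (forall bs, size bs = k -> Phi bs = Psi bs) -> ShK k Phi s = ShK k Psi s.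
Proof.
elim: s Phi Psi => [|x s IH] Phi Psi E /=; first by apply: E; rewrite size_nseq.
apply: eq_bigr => i _; apply: IH => bs sb; rewrite E // size_set_nth sb.
by apply/maxn_idPr.
Qed.

Lemma ShKZ k (a : R) Phi s : ShK k (fun bs => a *: Phi bs) s = a *: ShK k Phi s.
Proof.
elim: s Phi => [|x s IH] Phi //=; rewrite scaler_sumr; apply: eq_bigr => i _.
by rewrite -IH; apply: ShK_eq => bs _; rewrite !scalerA mulrC.
Qed.

(** Peeling off the first block reduces statements on many blocks to two-block sums. *)
Lemma ShK_Sh k Phi s : ShK k.+1 Phi s = Sh chi (fun I J => ShK k (fun bs => Phi (I :: bs)) J) s.
Proof.
elim: s Phi => [|x s IH] Phi //=.
rewrite big_ord_recl; congr (_ + _).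
  rewrite IH; apply: Sh_eq => I J; apply: ShK_eq => bs _.
  by rewrite /= scale1r.
under eq_bigr => i _ do rewrite IH.
rewrite -Sh_sum; apply: Sh_eq => I J; rewrite scaler_sumr; apply: eq_bigr => i _.
rewrite -ShKZ; apply: ShK_eq => bs _.
by rewrite /= scalerA -signr_addb.
Qed.

Definition blocks k (c : seq nat) s : seq (seq X) := [seq block j c s | j <- iota 0 k].

Lemma blocks_cons k (i : 'I_k) c x s : size c = size s -> blocks k ((i : nat) :: c) (x :: s) =
  set_nth [::] (blocks k c s) i (x :: nth [::] (blocks k c s) i).
Proof.
move=> sz; have ik := ltn_ord i.
have sb c' s' : size (blocks k c' s') = k by rewrite /blocks size_map size_iota.
apply: (@eq_from_nth _ [::]).
  by rewrite size_set_nth !sb; apply/esym/maxn_idPr.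
move=> j; rewrite sb => jk; rewrite nth_set_nth /= /blocks.
rewrite !(nth_map 0%N) ?size_iota // !nth_iota // !add0n blk_cons.
by rewrite eq_sym; case: eqP => [->|].
Qed.

Lemma sum_pass k (i : 'I_k) b (c : seq nat) s : size c = size s ->
  odd (\sum_(j < size c) ((nth 0 c j < i) && chi b (nth false [seq x.1 | x <- s] j))%N) =
  foldr (fun b' e => pass chi b b' (+) e) false (take i (blocks k c s)).
Proof.
move=> sz; have -> : take i (blocks k c s) = blocks i c s.
  by rewrite /blocks -map_take take_iota; move/minn_idPl: (ltnW (ltn_ord i)) => ->.
rewrite /blocks; elim: (nat_of_ord i) => [|n IH].
  by rewrite big1 // => j _; rewrite ltn0.
rewrite -addn1 iotaD /= add0n map_cat foldr_cat /=.
have fE (l : seq (seq X)) e : foldr (fun b' e => pass chi b b' (+) e) e l =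
    foldr (fun b' e => pass chi b b' (+) e) false l (+) e.
  by elim: l => //= a l ->; rewrite addbA.
rewrite fE -IH addbF {IH fE}.
elim: s c sz => [|y s IH] [|x c] //= => [_|[sz]]; first by rewrite !big_ord0.
rewrite !big_ord_recl /= !oddD IH // blk_cons addn1 ltnS leq_eqVlt.
case: (ltngtP x n) => _ /=; rewrite ?eqxx ?oddb ?addbA //=.
by congr (_ (+) _); exact: addbC.
Qed.

Lemma ShK_tuple k Phi s : \sum_(c : (size s).-tuple 'I_k)
  (-1) ^+ shuffle_exp chi (labels c) [seq x.1 | x <- s] *: Phi (blocks k (labels c) s) =
  ShK k Phi s.
Proof.
elim: s Phi => [|x s IH] Phi.
  rewrite (big_tuple0 (fun c : seq 'I_k => (-1) ^+ shuffle_exp chi [seq val i | i <- c] [::] *: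
     Phi (blocks k [seq val i | i <- c] [::]))) /=.
  rewrite /shuffle_exp big_ord0 scale1r /blocks; congr Phi.
  rewrite (eq_map (g := fun=> [::])) //.
  by elim: k 0%N {Phi} => //= k IH n; rewrite IH.
rewrite (big_tuple_cons _ (fun c : seq 'I_k => (-1) ^+ shuffle_exp chi [seq val i | i <- c] [seq x.1 | x <- x :: s] *:
     Phi (blocks k [seq val i | i <- c] (x :: s)))) /=.
apply: eq_bigr => i _; rewrite -IH; apply: eq_bigr => c _.
have sz : size [seq val i | i <- c] = size s by rewrite size_map size_tuple.
rewrite blocks_cons // shuffle_exp_cons exprD -scalerA scalerA mulrC -scalerA.
congr (_ *: (_ *: _)); rewrite -[LHS]signr_odd; congr (_ ^+ _); congr nat_of_bool.
exact: sum_pass.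
Qed.

End ManyBlocks.

(** Rearrangement of a Cauchy product: the vanishing hypothesis lets the triangle of index pairs be
    completed to a square. *)
Lemma big_triangle (V : nmodType) (N : nat) (g : nat -> nat -> V) :
  (forall i l, (N <= i + l)%N -> g i l = 0) ->
  \sum_(n < N) \sum_(i < n.+1) g i (n - i)%N = \sum_(i < N) \sum_(l < N) g i l.
Proof.
move=> g0.
transitivity (\sum_(n < N) \sum_(i < N | (i <= n)%N) g i (n - i)%N).
  apply: eq_bigr => n _.
  by rewrite (big_ord_widen _ (fun i => g i (n - i)%N) (ltn_ord n)).
rewrite (exchange_big_dep xpredT) //=; apply: eq_bigr => i _.
have -> : \sum_(l < N) g i l = \sum_(0 <= l < N - i) g i l.
  rewrite big_mkord (big_ord_widen _ (fun l => g i l) (leq_subr i N)) /=.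
  rewrite [LHS](bigID (fun l : 'I_N => (l < N - i)%N)) /= [X in _ + X]big1 ?addr0 // => l.
  by rewrite -leqNgt leq_subLR => /g0.
rewrite -[in RHS](add0n i) ; rewrite (eq_bigr (fun n : 'I_N => g i (n - i)%N)) //.
rewrite -(big_mkord (fun n => (i <= n)%N) (fun n => g i (n - i)%N)).
rewrite (@big_cat_nat _ _ _ i) //=; last exact: ltnW.
rewrite big_nat_cond big1 ?add0r; last first.
  by move=> n /andP[/andP[_ ni]]; rewrite leqNgt ni.
rewrite -{1}[nat_of_ord i]add0n big_addn big_nat_cond [RHS]big_nat_cond add0n.
apply: eq_big => [n|n _]; first by rewrite leq_addl andbT.
by rewrite addnK.
Qed.

(** * Exponentials of coderivations *)

Section Exponential.
Context (R : realType) (L : glie R) (Lok : glieok L).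
Local Notation X := (bool * L)%type.
Implicit Types (s : seq L) (h : seq X) (P Q G : Defs.family L) (Psi F : seq X -> L).
Implicit Types (T : L -> seq X -> L).
Local Notation okl := (all (@okb R L)).
Local Notation us := (@us R L).
Local Notation ShX := (@Sh_ext _ _ _ _ (@okb R L)).

Definition hclos F := forall h, h <> [::] -> okl h -> gsub (F h).
Definition tlin T := forall (a : R) u v h, gsub u -> gsub v -> okl h ->
  T (a *: u + v) h = a *: T u h + T v h.
(** The value of [F] on the non-empty first block is handed to [T] together with the rest of the
    list. Iterating this builds composites with several blocks, as in [hcmp]. *)
Definition hcup F T h : L := Sh sym_chi (fun I J => if nilp I then 0 else T (F I) J) h.

Section Coderivation.
Context (D : Defs.family L) (cD : clos D) (rD : prule false D).

(** Precomposition with the coderivation induced by [D]. Blocks of length at most one are dropped,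
    which encodes that [D] has no unary part and makes every application shorten the list. *)
Definition hrho Psi h : L := Sh sym_chi (fun I J =>
  if (size I <= 1)%N then 0 else Psi ((lab false I, D (us I)) :: J)) h.

Lemma okb_D I : okl I -> (1 < size I)%N -> okb (lab false I, D (us I)).
Proof. by move=> oI sI; apply: okb_lab => //; case: I sI {oI}. Qed.

Lemma hrho_eq n Psi Psi' : (forall h, h <> [::] -> okl h -> (size h <= n)%N -> Psi h = Psi' h) ->
  forall h, okl h -> (size h <= n)%N -> hrho Psi h = hrho Psi' h.
Proof.
move=> E h oh sh; apply: (ShX oh) => I J oI oJ pIJ.
case: leqP => // sI; apply: E => //=; first by rewrite okb_D.
have := perm_size pIJ; rewrite size_cat => e.
by apply: leq_trans sh; rewrite -e -[X in (X <= _)%N]add1n leq_add2r ltnW.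
Qed.

Lemma hrhoP (a : R) Psi Psi' h : hrho (a *: Psi + Psi') h = a *: hrho Psi h + hrho Psi' h.
Proof.
rewrite /hrho -ShP; apply: Sh_eq => I J; case: leqP => // _.
by rewrite scaler0 addr0.
Qed.

Lemma hrho0 h : hrho 0 h = 0.
Proof. by rewrite -[RHS](Sh0 L sym_chi h); apply: Sh_eq => I J; case: leqP. Qed.

Lemma hrho_sum (I : Type) (r : seq I) (a : I -> R) (Psi : I -> seq X -> L) h :
  hrho (fun h => \sum_(i <- r) a i *: Psi i h) h = \sum_(i <- r) a i *: hrho (Psi i) h.
Proof.
elim: r => [|i r IH].
  rewrite big_nil -[RHS](hrho0 h); congr hrho; apply/funext => k.
  by rewrite big_nil.
rewrite big_cons -IH -hrhoP; congr hrho; apply/funext => k.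
by rewrite big_cons.
Qed.

Lemma hrho_clos F : hclos F -> hclos (hrho F).
Proof.
move=> cF h _ oh; apply: gsub_Sh => // I J oI oJ _; case: leqP => sI; first exact: gok0.
by apply: cF => //=; rewrite okb_D.
Qed.

Lemma hrho_tlin T : tlin T -> tlin (fun u => hrho (T u)).
Proof.
move=> lT a u v h su sv oh; rewrite /hrho -ShP; apply: (ShX oh) => I J oI oJ _.
case: leqP => sI; first by rewrite scaler0 addr0.
by apply: lT => //=; rewrite okb_D.
Qed.

Lemma tlin0 T h : tlin T -> okl h -> T 0 h = 0.
Proof.
move=> lT oh; have := lT (-1) 0 0 h (gok0 Lok) (gok0 Lok) oh.
by rewrite scaler0 addr0 scaleN1r addNr.
Qed.

Lemma Sh_tlin chi T (Phi : seq X -> seq X -> L) h k : tlin T -> okl h -> okl k ->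
  (forall I J, okl I -> okl J -> perm_eq (I ++ J) h -> gsub (Phi I J)) ->
  T (Sh chi Phi h) k = Sh chi (fun I J => T (Phi I J) k) h.
Proof.
move=> lT oh ok; elim: h Phi oh => //= x h IH Phi /andP[ox oh] E.
have E1 I J : okl I -> okl J -> perm_eq (I ++ J) h -> gsub (Phi (x :: I) J).
  by move=> oI oJ pIJ; apply: E; rewrite /= ?ox ?perm_cons.
have E2 I J : okl I -> okl J -> perm_eq (I ++ J) h -> gsub (Phi I (x :: J)).
  move=> oI oJ pIJ; apply: E; rewrite /= ?ox //.
  by rewrite -cat1s perm_catCA perm_cons.
have E2' I J : okl I -> okl J -> perm_eq (I ++ J) h ->
    gsub ((-1) ^+ pass chi x.1 I *: Phi I (x :: J)).
  by move=> oI oJ pIJ; apply: gsubZ => //; apply: E2.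
rewrite -[X in X + _]scale1r lT ?scale1r //; try exact: gsub_Sh.
rewrite !IH //; congr (_ + _); apply: (ShX oh) => I J oI oJ pIJ.
have := lT ((-1) ^+ pass chi x.1 I) (Phi I (x :: J)) 0 k (E2 _ _ oI oJ pIJ) (gok0 Lok) ok.
by rewrite !addr0 tlin0 // addr0.
Qed.

(** Leibniz rule for the coderivation: the block taken by [D] lies either in the part seen by [F] or
    in the rest. Coassociativity and cocommutativity of unshuffles bring both cases to the required
    form. *)
Lemma hrho_cup F T h : hclos F -> tlin T -> okl h ->
  hrho (hcup F T) h = hcup (hrho F) T h + hcup F (fun u => hrho (T u)) h.
Proof.
move=> cF lT oh; pose y I := (lab false I, D (us I)).
transitivity (Sh sym_chi (fun I J => Sh sym_chi (fun K M =>
     if (size I <= 1)%N then 0 else T (F (y I :: K)) M) J) h +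
   Sh sym_chi (fun I J => Sh sym_chi (fun K M => if (size I <= 1)%N || nilp K then 0 else
     (-1) ^+ (spar I && spar K) *: T (F K) (y I :: M)) J) h).
  rewrite -ShD; apply: (ShX oh) => I J oI oJ _; rewrite -ShD.
  case: leqP => sI /=.
    by rewrite -[LHS](Sh0 L sym_chi J); apply: Sh_eq => K M; rewrite addr0.
  rewrite /hcup /= -ShD; apply: Sh_eq => K M; rewrite pass_sym /lab negbK.
  by case: nilP => _; rewrite ?scaler0.
congr (_ + _).
  etransitivity; first exact: (Sh_assoc sym_chi (fun I K M =>
     if (size I <= 1)%N then 0 else T (F (y I :: K)) M)).
  apply: (ShX oh) => A M oA oM _; case: nilP => [->|_] //.
  rewrite /hrho Sh_tlin //; last first.
    move=> I J oI oJ _; case: leqP => sI; first exact: gok0.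
    by apply: cF => //=; rewrite okb_D.
  by apply: Sh_eq => I J; case: leqP => // _; rewrite tlin0.
etransitivity; first exact: (Sh_assoc sym_chi (fun I K M => if (size I <= 1)%N || nilp K then 0 else
     (-1) ^+ (spar I && spar K) *: T (F K) (y I :: M))).
transitivity (Sh sym_chi (fun A M => Sh sym_chi (fun I K =>
    if nilp I || (size K <= 1)%N then 0 else T (F I) (y K :: M)) A) h).
  apply: (ShX oh) => A M oA oM _; rewrite Sh_symC; apply: (ShX oA) => I K oI oK _.
  rewrite orbC; case: ifP => _; first by rewrite scaler0.
  by rewrite scalerA -signr_addb [spar K && _]andbC addbb scale1r.
etransitivity; first exact/esym/(Sh_assoc sym_chi (fun I K M =>
    if nilp I || (size K <= 1)%N then 0 else T (F I) (y K :: M))).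
apply: (ShX oh) => I J oI oJ _; case: nilP => _ //=.
exact: Sh0.
Qed.

Lemma hcup_eq F F' T T' h : okl h ->
  (forall I, I <> [::] -> okl I -> (size I <= size h)%N -> F I = F' I) ->
  hclos F -> (forall u J, gsub u -> okl J -> (size J <= size h)%N -> T u J = T' u J) ->
  hcup F T h = hcup F' T' h.
Proof.
move=> oh EF cF ET; apply: (ShX oh) => I J oI oJ pIJ; case: nilP => // I0.
have := perm_size pIJ; rewrite size_cat => e.
rewrite -EF //; last by rewrite -e leq_addr.
by apply: ET => //; [exact: cF|rewrite -e leq_addl].
Qed.

Definition hiter j Psi := iter j hrho Psi.

Lemma hiter_clos F j : hclos F -> hclos (hiter j F).
Proof. by move=> cF; elim: j => //= j IH; apply: hrho_clos. Qed.

Lemma hiter_tlin T j : tlin T -> tlin (fun u => hiter j (T u)).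
Proof. by move=> lT; elim: j => //= j IH; apply: (hrho_tlin IH). Qed.

Lemma hiter_eq n Psi Psi' j : (forall h, h <> [::] -> okl h -> (size h <= n)%N -> Psi h = Psi' h) ->
  forall h, h <> [::] -> okl h -> (size h <= n)%N -> hiter j Psi h = hiter j Psi' h.
Proof. by move=> E; elim: j => //= j IH h _; apply: hrho_eq. Qed.

(** Iterated Leibniz rule; Pascal's rule [binS] is the induction step. *)
Lemma hiter_cup F T n h : hclos F -> tlin T -> okl h -> hiter n (hcup F T) h =
  \sum_(i < n.+1) 'C(n, i)%:R *: hcup (hiter i F) (fun u => hiter (n - i) (T u)) h.
Proof.
move=> cF lT; elim: n h => [|n IH] h oh.
  by rewrite big_ord_recl big_ord0 addr0 bin0 scale1r.
rewrite /hiter iterS -/(hiter n _).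
rewrite (@hrho_eq (size h) _ (fun h => \sum_(i < n.+1) 'C(n, i)%:R *:
   hcup (hiter i F) (fun u => hiter (n - i) (T u)) h)) //; last by move=> k _ ok _; exact: IH.
rewrite hrho_sum.
under eq_bigr => i _ do rewrite (hrho_cup (hiter_clos _ cF) (hiter_tlin _ lT) oh) scalerDr.
pose b i l := hcup (hiter i F) (fun u => hiter l (T u)) h.
rewrite -[RHS]/(\sum_(i < n.+2) 'C(n.+1, i)%:R *: b i (n.+1 - i)%N).
rewrite big_split /= -/(b _ _).
rewrite [RHS]big_ord_recl /=.
under [X in _ = _ + X]eq_bigr => i _ do rewrite /bump /= add1n binS natrD scalerDl subSS.
rewrite big_split /= addrA addrC; congr (_ + _).
rewrite big_ord_recl [in RHS]big_ord_recr /= (@bin_small n n.+1) // mulr0n scale0r addr0 !bin0 subn0.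
congr (_ + _); apply: eq_bigr => i _; rewrite /bump /= add1n.
by rewrite /b -(subnSK (ltn_ord i)).
Qed.

(** Each application replaces at least two entries by one. *)
Lemma hiter_vanish j Psi h : okl h -> (size h < j)%N -> hiter j Psi h = 0.
Proof.
elim: j h => // j IH h oh sh.
rewrite -[RHS](Sh0 L sym_chi h); apply: (ShX oh) => I J oI oJ pIJ.
case: leqP => // sI; apply: IH => /=; first by rewrite okb_D.
move: sh; rewrite -(perm_size pIJ) size_cat ltnS => sh.
by apply: leq_trans sh; rewrite -add2n leq_add2r.
Qed.

(** The exponential truncated at [N]; by [hiter_vanish] it is the full series on lists shorter than
    [N]. *)
Definition hexp N Psi h : L := \sum_(j < N) (j`!%:R)^-1 *: hiter j Psi h.

Lemma hexp_clos N F : hclos F -> hclos (hexp N F).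
Proof.
move=> cF h h0 oh; rewrite /hexp; elim/big_ind: _ => [|u v|i _].
- exact: gok0.
- exact: gsubD.
- by apply: gsubZ => //; apply: hiter_clos.
Qed.

(** The exponential of a derivation is multiplicative: the binomial coefficients of [hiter_cup]
    cancel against the factorials, and the double sum factors. *)
Lemma hexp_cup N F T h : hclos F -> tlin T -> okl h -> (size h < N)%N ->
  hexp N (hcup F T) h = hcup (hexp N F) (fun u => hexp N (T u)) h.
Proof.
move=> cF lT oh sh.
pose b i l := hcup (hiter i F) (fun u => hiter l (T u)) h.
pose g i l := ((i`!%:R)^-1 * (l`!%:R)^-1 : R) *: b i l.
transitivity (\sum_(n < N) \sum_(i < n.+1) g i (n - i)%N).
  apply: eq_bigr => n _; rewrite hiter_cup // scaler_sumr; apply: eq_bigr => i _.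
  rewrite scalerA; congr (_ *: _).
  have ni : (i <= n)%N by rewrite -ltnS.
  apply: (mulfI (x := n`!%:R)); first by rewrite pnatr_eq0 -lt0n fact_gt0.
  rewrite mulVKf ?pnatr_eq0 -?lt0n ?fact_gt0 // -(bin_fact ni) !natrM.
  rewrite -mulrA mulrACA mulfV ?mul1r ?mulfV ?mulr1 // pnatr_eq0 -lt0n fact_gt0 //.
(* A term with i + l at least N vanishes: either the first block is shorter than [i], or the second
   is shorter than [l]. *)
rewrite big_triangle; last first.
  move=> i l Nil; rewrite /g [b i l](_ : _ = 0) ?scaler0 //.
  rewrite -[RHS](Sh0 L sym_chi h); apply: (ShX oh) => I J oI oJ pIJ.
  case: nilP => // I0; move: sh; rewrite -(perm_size pIJ) size_cat => e.
  have [lI|iI] := ltnP (size I) i.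
    by rewrite (hiter_vanish _ oI lI); exact: (tlin0 (hiter_tlin l lT) oJ).
  by rewrite hiter_vanish // -(ltn_add2l (size I)) (leq_trans e) // (leq_trans Nil) // leq_add2r.
rewrite /hcup.
transitivity (Sh sym_chi (fun I J => \sum_(i < N) \sum_(l < N) (i`!%:R^-1 * l`!%:R^-1 : R) *:
   (if nilp I then 0 else hiter l (T (hiter i F I)) J)) h).
  rewrite Sh_sum; apply: eq_bigr => i _; rewrite Sh_sum; apply: eq_bigr => l _.
  by rewrite ShZ.
apply: (ShX oh) => I J oI oJ _; case: nilP => I0.
  by rewrite big1 // => i _; rewrite big1 // => l _; rewrite scaler0.
rewrite exchange_big /= /hexp; apply: eq_bigr => l _.
have lTl := hiter_tlin l lT.
have sE (r : seq 'I_N) : hiter l (T (\sum_(j <- r) (j`!%:R)^-1 *: hiter j F I)) J =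
    \sum_(j <- r) (j`!%:R)^-1 *: hiter l (T (hiter j F I)) J.
  have sF j : gsub (hiter j F I) by apply: hiter_clos.
  elim: r => [|j r IH]; rewrite ?big_nil ?big_cons; first exact: (tlin0 lTl).
  rewrite (lTl _ _ _ J) //; first by rewrite -IH.
  elim: (r) => [|i r' IH']; rewrite ?big_nil ?big_cons; first exact: gok0.
  exact: gokP.
by rewrite sE scaler_sumr; apply: eq_bigr => i _; rewrite scalerA mulrC.
Qed.

End Coderivation.
End Exponential.

(** * Coalgebra morphisms *)

Section CoalgebraMorphism.
Context (R : realType) (L : glie R) (Lok : glieok L).
Local Notation X := (bool * L)%type.
Implicit Types (s : seq L) (h : seq X) (P Q G : Defs.family L) (Psi F : seq X -> L).
Local Notation okl := (all (@okb R L)).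
Local Notation us := (@us R L).
Local Notation ShX := (@Sh_ext _ _ _ _ (@okb R L)).

(** Ordered partitions into [k] non-empty blocks; the values of [F] on the blocks are fed to [G] one
    at a time, so that [hcup] can be reused. *)
Fixpoint hcmp k (G : Defs.family L) F h : L :=
  if k is k'.+1 then hcup F (fun u => hcmp k' (fun s => G (u :: s)) F) h
  else if nilp h then G [::] else 0.

Lemma hcmp_lin k (a : R) G G1 G2 F h : hclos F -> okl h ->
  (forall s, in_sub s -> G s = a *: G1 s + G2 s) ->
  hcmp k G F h = a *: hcmp k G1 F h + hcmp k G2 F h.
Proof.
move=> cF; elim: k G G1 G2 h => [|k IH] G G1 G2 h oh E /=.
  by case: nilP => _; [exact: E|rewrite scaler0 addr0].
rewrite /hcup -ShP; apply: (ShX oh) => I J oI oJ _; case: nilP => I0.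
  by rewrite scaler0 addr0.
apply: IH => // s ss; apply: E; apply/in_subc; split=> //; exact: cF.
Qed.

Lemma hcmp_tlin k G F : mult G -> hclos F -> tlin (fun u => hcmp k (fun s => G (u :: s)) F).
Proof.
move=> mG cF a u v h su sv oh; apply: hcmp_lin => // s ss.
exact: (mG [::]).
Qed.

(** By induction on the number of blocks from the two-block case [hexp_cup]; in effect exp(D) is a
    morphism of coalgebras. *)
Lemma hcmp_hexp (D : Defs.family L) N k G F h : clos D -> prule false D ->
  hclos F -> mult G -> okl h -> (size h < N)%N -> hexp D N (hcmp k G F) h = hcmp k G (hexp D N F) h.
Proof.
move=> cD rD cF; elim: k G h => [|k IH] G h mG oh sh.
  case: N sh => // N _; rewrite /hexp big_ord_recl /= invr1 scale1r big1 ?addr0 // => i _.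
  suff E j : hiter D j.+1 (hcmp 0 G F) h = 0.
    by have := E i; rewrite /= => ->; rewrite scaler0.
  elim: j h oh => [|j IHj] h oh.
    rewrite /hiter /= -[RHS](Sh0 L sym_chi h); apply: Sh_eq => I J.
    by case: leqP.
  rewrite /hiter iterS -[RHS](hrho0 D h).
  by apply: (@hrho_eq _ _ _ cD rD (size h)) => // k _ ok _; exact: IHj.
rewrite [hcmp k.+1 G F](_ : _ = hcup F (fun u => hcmp k (fun s => G (u :: s)) F)) //.
rewrite hexp_cup //; last exact: hcmp_tlin.
apply: hcup_eq => //; first exact: hexp_clos.
move=> u J su oJ sJ; apply: IH => //; first exact: mult_cons.
exact: leq_ltn_trans sJ sh.
Qed.

Definition hid h : L := if h is [:: x] then x.2 else 0.

Lemma hid_clos : hclos hid.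
Proof. by case=> [|x [|y h]] //= _; [rewrite andbT => /okb_sub|move=> _; exact: gok0]. Qed.

Lemma Sh_nil (V : lmodType R) (f : seq X -> V) h :
  Sh sym_chi (fun I J => if nilp I then f J else 0) h = f h.
Proof.
elim: h f => //= x h IH f.
rewrite (_ : Sh _ _ _ = 0) ?add0r; last exact: Sh0.
rewrite -[RHS](IH (fun J => f (x :: J))); apply: Sh_eq => I J.
by case: I => [|y I] /=; rewrite ?scale1r ?scaler0.
Qed.

(** Bringing any one entry to the front gives the same value by symmetry, and there are [size h]
    choices. *)
Lemma Sh_single G h : mult G -> symm sym_chi G -> okl h ->
  Sh sym_chi (fun I J => if size I == 1%N then G (us (I ++ J)) else 0) h = (size h)%:R *: G (us h).
Proof.
elim: h G => [|x h IH] G mG sG /=; first by rewrite scale0r.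
case/andP=> ox oh.
have -> : Sh sym_chi (fun I J => if (size I).+1 == 1%N then G (x.2 :: us (I ++ J)) else 0) h =
    G (x.2 :: us h).
  rewrite -[RHS](Sh_nil (fun J => G (x.2 :: us J))); apply: Sh_eq => I J.
  by case: I.
rewrite mulrS scalerDl scale1r; congr (_ + _).
rewrite -(IH (fun s => G (x.2 :: s))) //; last 2 first.
- exact: mult_cons mG (okb_sub ox).
- by move=> h1 h2 y z o1 o2 oy oz; apply: (sG (x :: h1)) => //=; rewrite ox.
apply: (ShX oh) => I J oI oJ _; case: I oI => [|y [|z I]] /=; rewrite ?scaler0 //.
rewrite andbT addbF => oy; have /= -> := sG [::] J y x isT oJ oy ox.
by rewrite scalerA -signr_addb /sym_chi andbC addbb scale1r.
Qed.

Lemma hcmp0 k F h : hcmp k (fun=> 0) F h = 0.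
Proof.
elim: k h => [|k IH] h /=; first by case: nilP.
rewrite -[RHS](Sh0 L sym_chi h); apply: Sh_eq => I J; case: nilP => // _; exact: IH.
Qed.

Lemma hcmp_eq k G G' F F' h : hclos F -> okl h ->
  (forall I, I <> [::] -> okl I -> (size I <= size h)%N -> F I = F' I) ->
  (forall s, in_sub s -> G s = G' s) -> hcmp k G F h = hcmp k G' F' h.
Proof.
move=> cF; elim: k G G' h => [|k IH] G G' h oh EF EG /=.
  by case: nilP => // _; apply: EG.
apply: hcup_eq => // u J su oJ sJ; apply: IH => //.
  by move=> I I0 oI sI; apply: EF => //; exact: leq_trans sI sJ.
by move=> s ss; apply: EG; apply/in_subc.
Qed.

(** With the identity only blocks of length one survive, and the k! orderings agree by symmetry. *)
Lemma hcmp_hid k G h : mult G -> symm sym_chi G -> okl h ->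
  hcmp k G hid h = if size h == k then k`!%:R *: G (us h) else 0.
Proof.
elim: k G h => [|k IH] G h mG sG oh.
  by case: h oh => //= _; rewrite scale1r.
transitivity (Sh sym_chi (fun I J => if size I == 1%N then
    (if size h == k.+1 then k`!%:R else 0) *: G (us (I ++ J)) else 0) h).
  apply: (ShX oh) => I J oI oJ pIJ; case: I oI pIJ => [|x [|y I]] //= oI pIJ.
    rewrite andbT in oI; rewrite -/(hcmp k (fun s => G (x.2 :: s)) hid J) (IH (fun s => G (x.2 :: s))) //; last 2 first.
    - exact: mult_cons mG (okb_sub oI).
    - by move=> h1 h2 y z o1 o2 oy oz; apply: (sG (x :: h1)) => //=; rewrite oI.
    have /= <- := perm_size pIJ; rewrite eqSS.
    by case: (_ == _) => //; rewrite scale0r.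
  rewrite -[LHS]/(hcmp k (fun s => G (0 :: s)) hid J) -[RHS](hcmp0 k hid J); apply: hcmp_eq => //; first exact: hid_clos.
  by move=> s ss; apply: (mult0 Lok (s1 := [::])).
transitivity ((if size h == k.+1 then k`!%:R else 0 : R) *:
   Sh sym_chi (fun I J => if size I == 1%N then G (us (I ++ J)) else 0) h).
  by rewrite -ShZ; apply: Sh_eq => I J; case: (size I == 1%N) => //; rewrite scaler0.
rewrite Sh_single //; case: eqP => [->|_]; last by rewrite scale0r.
by rewrite scalerA -natrM mulnC -factS.
Qed.

Lemma hcmp_sum_hid G N h : mult G -> symm sym_chi G -> okl h -> (size h < N)%N ->
  \sum_(k < N) (k`!%:R)^-1 *: hcmp k G hid h = G (us h).
Proof.
move=> mG sG oh sh; rewrite (bigD1 (Ordinal sh)) //= [X in _ + X]big1 ?addr0.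
  by rewrite hcmp_hid // eqxx scalerA mulVf ?scale1r // pnatr_eq0 -lt0n fact_gt0.
move=> i ih; rewrite hcmp_hid //; case: eqP => [e|_]; last by rewrite scaler0.
by case/eqP: ih; apply: val_inj.
Qed.

Lemma iter_sum (D : Defs.family L) N j (a : 'I_N -> R) (Psi : 'I_N -> seq X -> L) h :
  hiter D j (fun h => \sum_(k < N) a k *: Psi k h) h = \sum_(k < N) a k *: hiter D j (Psi k) h.
Proof.
elim: j h => //= j IH h.
rewrite -hrho_sum; congr hrho; apply/funext => k; exact: IH.
Qed.

(** Substituting exp(D) for the arguments of [G] is letting exp(D) act on [G]: pull the exponential
    out of [hcmp], exchange the sums, and collapse the blocks by [hcmp_sum_hid]. *)
Lemma sum_hcmp_hexp (D : Defs.family L) G N h : clos D -> prule false D ->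
  mult G -> symm sym_chi G -> okl h -> (size h < N)%N ->
  \sum_(k < N) (k`!%:R)^-1 *: hcmp k G (hexp D N hid) h = hexp D N (fun h => G (us h)) h.
Proof.
move=> cD rD mG sG oh sh.
have h0 : h = [::] \/ h <> [::] by case: (h); [left|right].
case: h0 => [->|h0].
  case: N sh => // N _; rewrite /hexp big_ord_recl [in RHS]big_ord_recl /= invr1 !scale1r.
  rewrite !big1 // => i _; rewrite /bump /= ?add1n.
  by rewrite /hcup /= scaler0.
under eq_bigr => k _ do rewrite -(hcmp_hexp k cD rD hid_clos mG oh sh) scaler_sumr.
rewrite exchange_big /=; apply: eq_bigr => j _.
under eq_bigr => k _ do rewrite scalerA mulrC -scalerA.
rewrite -scaler_sumr -(iter_sum D j (fun k : 'I_N => (k`!%:R)^-1) (fun k => hcmp k G hid)).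
congr (_ *: _); apply: (hiter_eq cD rD (n := size h)) => // k k0 ok sk.
by apply: hcmp_sum_hid => //; exact: leq_ltn_trans sk sh.
Qed.

Lemma labels_nilp n k (c : n.-tuple 'I_k) h : size h = n ->
  [forall j : 'I_k, j \in c] = all (fun b => ~~ nilp b) (blocks k (labels c) h).
Proof.
move=> sh.
have E (j : 'I_k) : (j \in c) = ~~ nilp (block j (labels c) h).
  rewrite /labels; rewrite -(size_tuple c) in sh.
  rewrite -[j \in c]/(j \in tval c); move: (tval c) sh => {}c; clear n.
  elim: h c => [|x h IH] [|i c] //= [sh].
  rewrite inE blk_cons (IH c sh) eq_sym -val_eqE.
  by case: (_ == _).
apply/forallP/allP => [H b /mapP[j]|H j].
  by rewrite mem_iota add0n => jk ->; rewrite -(E (Ordinal jk)).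
by rewrite E; apply: H; apply/mapP; exists (nat_of_ord j) => //; rewrite mem_iota /=.
Qed.

Lemma ShK_hcmp k G P h : ShK sym_chi k (fun bs => if all (fun b => ~~ nilp b) bs
  then G [seq P (us b) | b <- bs] else 0) h = hcmp k G (fun h => P (us h)) h.
Proof.
elim: k G h => [|k IH] G h /=.
  by case: h => //= x h; rewrite big_ord0.
rewrite ShK_Sh; apply: Sh_eq => -[|x I] J /=.
  have -> : (fun=> 0) = (fun bs : seq (seq X) => (0 : R) *: (0 : L)).
    by apply/funext => bs; rewrite scale0r.
  by rewrite ShKZ scale0r.
exact: (IH (fun s => G (P (us (x :: I)) :: s))).
Qed.

Lemma coalg_compE G P s : coalg_comp G P s =
  ext (fun h => \sum_(k < (size s).+1) (k`!%:R)^-1 *: hcmp k G (fun h => P (us h)) h) s.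
Proof.
rewrite ext_sum; apply: eq_bigr => k _; rewrite extZ; congr (_ *: _).
rewrite -ext_tuple exchange_big /=; apply: eq_bigr => t _.
have sp : size (parts t s) = size s.
  by rewrite /parts size_map size_zip size_tuple minnn.
have z1 : [seq x.1 | x <- zip t (parts t s)] = t.
  by rewrite -/(unzip1 _) unzip1_zip // sp size_tuple.
have z2 : us (zip t (parts t s)) = parts t s.
  by rewrite /us -/(unzip2 _) unzip2_zip // sp size_tuple.
have sz : size (zip t (parts t s)) = size s.
  by rewrite size_zip sp size_tuple minnn.
rewrite -ShK_hcmp -{1}z2; move: (zip t (parts t s)) z1 sz => h <-; clear.
move: (nat_of_ord k) => {}k; move: (size s) => n hn; case: _ / hn.
rewrite -ShK_tuple big_mkcond; apply: eq_bigr => c _; rewrite (labels_nilp _ (erefl (size h))).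
case: ifP => _; last by rewrite scaler0.
congr (_ *: G _); rewrite /blocks -map_comp; apply: eq_map => j /=.
by rewrite block_map.
Qed.

End CoalgebraMorphism.

(** * Non-commutative power series, exponential and logarithm *)

Section SeriesRing.
Context (R : realType) (T : Type).
Implicit Types (f g h : ser R T) (w : seq T).

Definition dshift (x : T) f : ser R T := fun w => f (x :: w).

Lemma ser_mul_nil f g : ser_mul f g [::] = f [::] * g [::].
Proof. by rewrite /ser_mul big_ord_recl big_ord0 addr0. Qed.

Lemma ser_mul_cons f g x w : ser_mul f g (x :: w) = f [::] * g (x :: w) + ser_mul (dshift x f) g w.
Proof. by rewrite /ser_mul big_ord_recl. Qed.

Lemma ser_mulPl (a : R) f f' g w : ser_mul (a *: f + f') g w = a * ser_mul f g w + ser_mul f' g w.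
Proof.
rewrite mulr_sumr -big_split; apply: eq_bigr => i _.
by rewrite -[(a *: f + f') _]/(a * f _ + f' _) mulrDl mulrA.
Qed.

Lemma ser_mulPr (a : R) f g g' w : ser_mul f (a *: g + g') w = a * ser_mul f g w + ser_mul f g' w.
Proof.
rewrite mulr_sumr -big_split; apply: eq_bigr => i _.
by rewrite -[(a *: g + g') _]/(a * g _ + g' _) mulrDr mulrCA.
Qed.

Lemma ser_mulA f g h : ser_mul f (ser_mul g h) = ser_mul (ser_mul f g) h.
Proof.
apply/funext => w; elim: w f g h => [|x w IH] f g h.
  by rewrite !ser_mul_nil mulrA.
rewrite ser_mul_cons [RHS]ser_mul_cons ser_mul_nil IH.
have -> : dshift x (ser_mul f g) = f [::] *: dshift x g + ser_mul (dshift x f) g.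
  by apply/funext => v; rewrite /dshift ser_mul_cons.
by rewrite ser_mulPl ser_mul_cons mulrDr mulrA addrA.
Qed.

Lemma ser_mul1 f : ser_mul (@ser_one R T) f = f.
Proof.
apply/funext => w; elim: w => [|x w IH]; first by rewrite ser_mul_nil mul1r.
rewrite ser_mul_cons mul1r /ser_mul big1 ?addr0 // => i _.
by rewrite /dshift /ser_one mul0r.
Qed.

Lemma ser_mulr1 f : ser_mul f (@ser_one R T) = f.
Proof.
apply/funext => w; elim: w f => [|x w IH] f; first by rewrite ser_mul_nil mulr1.
by rewrite ser_mul_cons mulr0 add0r IH.
Qed.
End SeriesRing.

(** A separate name for series, on which the concatenation product is the ring structure, so that
    ring theory and evaluation of polynomials apply. *)
Definition nser (R : realType) (T : Type) : Type := seq T -> R^o.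
HB.instance Definition _ (R : realType) (T : Type) := GRing.Lmodule.on (nser R T).

Section NserRing.
Context (R : realType) (T : Type).

Let mulDl (f g h : nser R T) : ser_mul (f + g) h = ser_mul f h + ser_mul g h :> nser R T.
Proof. by apply/funext => w; rewrite -[f]scale1r ser_mulPl mul1r scale1r. Qed.
Let mulDr (h f g : nser R T) : ser_mul h (f + g) = ser_mul h f + ser_mul h g :> nser R T.
Proof. by apply/funext => w; rewrite -[f]scale1r ser_mulPr mul1r scale1r. Qed.
Let one_neq0 : @ser_one R T != 0 :> nser R T.
Proof.
apply/eqP => /(congr1 (fun f : nser R T => f [::])) /eqP.
by rewrite /ser_one /= oner_eq0.
Qed.
HB.instance Definition _ := GRing.Zmodule_isNzRing.Build (nser R T)
  (@ser_mulA R T) (@ser_mul1 R T) (@ser_mulr1 R T) mulDl mulDr one_neq0.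

Let scaleAl (a : R) (f g : nser R T) : a *: (f * g) = (a *: f) * g.
Proof.
apply/funext => w; have := ser_mulPl a f 0 g w.
rewrite addr0 => E; rewrite -[(a *: f) * g]/(ser_mul (a *: f) g) E.
have -> : ser_mul 0 g w = 0 by apply: big1 => i _; rewrite mul0r.
by rewrite addr0.
Qed.
HB.instance Definition _ := GRing.Lmodule_isLalgebra.Build R (nser R T) scaleAl.
Let scaleAr (a : R) (f g : nser R T) : a *: (f * g) = f * (a *: g).
Proof.
apply/funext => w; have := ser_mulPr a f g 0 w.
rewrite addr0 => E; rewrite -[f * (a *: g)]/(ser_mul f (a *: g)) E.
have -> : ser_mul f 0 w = 0 by apply: big1 => i _; rewrite mulr0.
by rewrite addr0.
Qed.
HB.instance Definition _ := GRing.Lalgebra_isAlgebra.Build R (nser R T) scaleAr.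
End NserRing.

Section Truncation.
Context (R : realType) (T : Type).
Implicit Types (f g h u Z : nser R T) (w : seq T).

Lemma nserM f g : f * g = ser_mul f g. Proof. by []. Qed.
Lemma nserD f g w : (f + g) w = f w + g w. Proof. by []. Qed.
Lemma nserN f w : (- f) w = - f w. Proof. by []. Qed.
Lemma nserB f g w : (f - g) w = f w - g w. Proof. by []. Qed.
Lemma nserZ (a : R) f w : (a *: f) w = a * f w. Proof. by []. Qed.
Lemma nser1 w : (1 : nser R T) w = (nilp w)%:R. Proof. by []. Qed.
Lemma nser_sum (I : Type) (r : seq I) (P : pred I) (F : I -> nser R T) w :
  (\sum_(i <- r | P i) F i) w = \sum_(i <- r | P i) F i w.
Proof. exact: (big_morph (fun f : nser R T => f w)). Qed.

Lemma ser_prodE (s : seq (nser R T)) : ser_prod s = \prod_(f <- s) f.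
Proof. by elim: s => [|f s IH]; rewrite ?big_nil ?big_cons //= IH. Qed.

(** The filtration by word length; series are compared modulo long words. *)
Definition ord n f : Prop := forall w, (size w < n)%N -> f w = 0.

Lemma ord_mul n m f g : ord n f -> ord m g -> ord (n + m) (f * g).
Proof.
move=> nf mg w sw; apply: big1 => i _; have iw : (i <= size w)%N by rewrite -ltnS.
have [lti|lei] := ltnP i n; first by rewrite nf ?mul0r // size_takel.
by rewrite mg ?mulr0 // size_drop ltn_subLR // (leq_trans sw) // leq_add2r.
Qed.

Lemma ord_exp f k : ord 1 f -> ord k (f ^+ k).
Proof.
move=> of1; elim: k => [|k IH] w //; rewrite exprS => sw.
exact: (ord_mul of1 IH).
Qed.

Lemma ordP n (a : R) f g : ord n f -> ord n g -> ord n (a *: f + g).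
Proof. by move=> nf ng w sw; rewrite nserD nserZ nf // ng // mulr0 addr0. Qed.

Lemma ord_sum n (I : Type) (r : seq I) (F : I -> nser R T) :
  (forall i, ord n (F i)) -> ord n (\sum_(i <- r) F i).
Proof. by move=> nF w sw; rewrite nser_sum big1 // => i _; exact: nF. Qed.

Lemma ord_eq n f g w : ord n (f - g) -> (size w < n)%N -> f w = g w.
Proof. by move=> o sw; apply/eqP; rewrite -subr_eq0 -nserB o. Qed.

Lemma eq_ord f g : (forall n, ord n (f - g)) -> f = g.
Proof. by move=> o; apply/funext => w; exact: (ord_eq (o (size w).+1)). Qed.

Lemma ord_le n m f : (n <= m)%N -> ord m f -> ord n f.
Proof. by move=> nm om w sw; apply: om; exact: leq_trans nm. Qed.

(* the sum of c_k Z^k, for Z without constant term *)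
Definition psum (c : nat -> R) Z : nser R T := fun w => \sum_(k < (size w).+1) c k * (Z ^+ k) w.

Lemma psum_trunc N c Z w : ord 1 Z -> (size w < N)%N -> psum c Z w = (\sum_(k < N) c k *: Z ^+ k) w.
Proof.
move=> oZ sw; rewrite nser_sum /psum (big_ord_widen _ (fun k => c k * (Z ^+ k) w) sw).
rewrite [RHS](bigID (fun k : 'I_N => (k < (size w).+1)%N)) /= [X in _ = _ + X]big1 ?addr0 // => k.
by rewrite -leqNgt => kw; rewrite nserZ (ord_exp (k := k) oZ) ?mulr0.
Qed.

Lemma psum_ord N c Z : ord 1 Z -> ord N (psum c Z - \sum_(k < N) c k *: Z ^+ k).
Proof. by move=> oZ w sw; rewrite nserB (psum_trunc c oZ sw) subrr. Qed.

Definition ec (k : nat) : R := (k`!%:R)^-1.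
Definition lc (k : nat) : R := if k is k'.+1 then (-1) ^+ k' / k'.+1%:R else 0.

Definition nexp Z := psum ec Z.
Definition nlog u := psum lc (u - 1).

Lemma ord1 Z : ord 1 Z <-> Z [::] = 0.
Proof. by split=> [H|z0]; [exact: H|case]. Qed.

Lemma ord_expB N f g k : ord 1 f -> ord 1 g -> ord N (f - g) -> ord N (f ^+ k - g ^+ k).
Proof.
move=> of1 og1 o; elim: k => [|k IH]; first by move=> w _; rewrite !expr0 subrr.
have -> : f ^+ k.+1 - g ^+ k.+1 = (f - g) * f ^+ k + g * (f ^+ k - g ^+ k).
  by rewrite mulrBl mulrBr -!exprS addrA subrK.
rewrite -[X in ord _ (X + _)]scale1r; apply: ordP.
  by rewrite -[N]addn0; apply: ord_mul.
by apply: ord_le (ord_mul og1 IH); rewrite add1n.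
Qed.

(** Modulo long words a power series in [Z] is a polynomial evaluated at [Z], so the identities
    between exponential and logarithm reduce to one commuting variable. *)
Lemma psum_poly N c Z : ord 1 Z -> ord N (psum c Z - horner_alg Z (\poly_(k < N) c k)).
Proof.
move=> oZ; suff -> : horner_alg Z (\poly_(k < N) c k) = \sum_(k < N) c k *: Z ^+ k.
  exact: psum_ord.
rewrite poly_def raddf_sum; apply: eq_bigr => k _ /=.
by rewrite -mul_polyC rmorphM /= horner_algC rmorphXn /= horner_algX mulr_algl.
Qed.

End Truncation.

Section ExpLog.
Context (R : realType).
Implicit Types p q : {poly R}.

Definition low n p : Prop := forall k, (k < n)%N -> p`_k = 0.

Lemma low_mul n m p q : low n p -> low m q -> low (n + m) (p * q).
Proof.
move=> np mq k kn; rewrite coefM big1 // => i _; have ik : (i <= k)%N by rewrite -ltnS.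
have [lti|lei] := ltnP i n; first by rewrite np ?mul0r.
by rewrite mq ?mulr0 // ltn_subLR // (leq_trans kn) // leq_add2r.
Qed.

Lemma lowMr n p q : low n p -> low n (p * q).
Proof. by move=> np; rewrite -[n]addn0; apply: low_mul. Qed.
Lemma lowMl n p q : low n p -> low n (q * p).
Proof. by rewrite mulrC; apply: lowMr. Qed.
Lemma lowD n p q : low n p -> low n q -> low n (p + q).
Proof. by move=> np nq k kn; rewrite coefD np // nq // addr0. Qed.
Lemma lowN n p : low n p -> low n (- p).
Proof. by move=> np k kn; rewrite coefN np // oppr0. Qed.
Lemma low_exp p n : p`_0 = 0 -> low n (p ^+ n).
Proof.
move=> p0; elim: n => [|n IH] //; rewrite exprS; apply: (low_mul (n := 1)) => //.
by case.
Qed.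

Definition epoly n : {poly R} := \poly_(k < n) ec R k.
Definition lpoly n : {poly R} := \poly_(k < n) lc R k.

Lemma low_deriv n p q : low n (p^`() - q^`()) -> p`_0 = q`_0 -> low n.+1 (p - q).
Proof.
move=> d0 p0 [|k] kn; first by rewrite coefB p0 subrr.
apply/eqP; have := d0 k kn; rewrite -derivB coef_deriv => /eqP.
by rewrite mulrn_eq0.
Qed.

Lemma deriv_sum_exp n (c : nat -> R) p :
  (\sum_(j < n.+1) c j *: p ^+ j)^`() = p^`() * \sum_(j < n) (j.+1%:R * c j.+1) *: p ^+ j.
Proof.
rewrite raddf_sum big_ord_recl /= expr0 derivZ derivC scaler0 add0r mulr_sumr.
apply: eq_bigr => j _; rewrite /bump /= add1n derivZ deriv_exp /=.
by rewrite -[RHS]scalerAr -scaler_nat scalerA mulrC.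
Qed.

Lemma coef0_sum n (c : nat -> R) p : p`_0 = 0 -> (\sum_(j < n.+1) c j *: p ^+ j)`_0 = c 0%N.
Proof.
move=> p0; rewrite big_ord_recl expr0 coefD coefZ coef1 mulr1 coef_sum big1 ?addr0 // => j _.
by rewrite coefZ (low_exp p0) // mulr0.
Qed.

Lemma ecS j : j.+1%:R * ec R j.+1 = ec R j.
Proof.
by rewrite /ec factS natrM invfM mulrA mulfV ?mul1r // pnatr_eq0.
Qed.

Lemma lcS j : j.+1%:R * lc R j.+1 = (-1) ^+ j.
Proof. by rewrite /lc mulrC divfK // pnatr_eq0. Qed.

Lemma poly_powers n (c : nat -> R) : \poly_(k < n) c k = \sum_(k < n) c k *: 'X ^+ k.
Proof. by rewrite poly_def. Qed.

Lemma geom_sum n p : (1 - p) * \sum_(j < n) p ^+ j = 1 - p ^+ n.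
Proof. by rewrite -[RHS]opprB subrX1 -mulNr opprB. Qed.

Lemma expNp p j : (- p) ^+ j = (-1) ^+ j *: p ^+ j.
Proof. elim: j => [|j IH]; first by rewrite !expr0 scale1r.
by rewrite !exprS IH !mulNr mul1r scaleNr scalerAr. Qed.

(** Both sides solve (1 + X) P' = P modulo X^n with P(0) = 1, and this equation determines the
    coefficients recursively. *)
Lemma exp_log n : low n.+1 (\sum_(j < n.+1) ec R j *: lpoly n.+1 ^+ j - (1 + 'X)).
Proof.
set L := lpoly n.+1; set P := \sum_(j < _) _; set Q := P - _.
have L0 : L`_0 = 0 by rewrite /L /lpoly coef_poly.
have dL : (1 + 'X) * L^`() = 1 - (- 'X) ^+ n.
  rewrite /L /lpoly poly_powers deriv_sum_exp derivX mul1r.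
  rewrite -geom_sum opprK; congr (_ * _); apply: eq_bigr => j _.
  by rewrite lcS expNp.
(* The error consists of the top term of the exponential, a multiple of [L ^+ n], and of
   [(- 'X) ^+ n] from the geometric sum; both are divisible by X^n. *)
have dP : low n ((1 + 'X) * P^`() - P).
  rewrite {1}/P deriv_sum_exp mulrA dL /P big_ord_recr /= opprD addrA.
  apply: lowD; last by apply: lowN; rewrite -mul_polyC; apply: lowMl; apply: low_exp.
  have -> : \sum_(j < n) (j.+1%:R * ec R j.+1) *: L ^+ j = \sum_(j < n) ec R j *: L ^+ j.
    by apply: eq_bigr => j _; rewrite ecS.
  rewrite mulrBl mul1r addrAC subrr add0r; apply: lowN; apply: lowMr; apply: low_exp.
  by rewrite coefN coefX oppr0.
have dQ : low n ((1 + 'X) * Q^`() - Q).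
  rewrite /Q derivB derivD derivC derivX add0r mulrBr mulr1 opprB.
  by rewrite (addrA _ (1 + 'X)) subrK.
have Q0 : Q`_0 = 0.
  by rewrite /Q coefB coefD coef1 coefX addr0 coef0_sum // /ec invr1 subrr.
elim=> [|k IH] kn //.
have := dQ k kn; rewrite mulrDl mul1r coefB coefD coefXM !coef_deriv IH ?subr0; last exact: ltnW.
have -> : (if k == 0%N then 0 else Q`_k.-1.+1 *+ k.-1.+1) = 0.
  by case: k kn IH => //= k kn IH; rewrite IH ?mul0rn // ltnW.
by rewrite addr0 => /eqP; rewrite mulrn_eq0 /= => /eqP.
Qed.

(** The derivative of the left side is E'/E, where 1/E is a geometric sum in 1 - E, and E' differs
    from E only in the top coefficient; hence it is 1 modulo X^n. *)
Lemma log_exp n : low n.+1 (\sum_(j < n.+1) lc R j *: (epoly n.+1 - 1) ^+ j - 'X).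
Proof.
set E := epoly n.+1; have E0 : (E - 1)`_0 = 0.
  by rewrite coefB coef1 /E /epoly coef_poly /ec invr1 subrr.
apply: low_deriv; last by rewrite coef0_sum // coefX.
have dE : E^`() = E - ec R n *: 'X ^+ n.
  rewrite /E /epoly !poly_powers deriv_sum_exp derivX mul1r big_ord_recr /= addrK.
  by apply: eq_bigr => j _; rewrite ecS.
rewrite deriv_sum_exp derivX derivB derivC subr0.
have -> : \sum_(j < n) (j.+1%:R * lc R j.+1) *: (E - 1) ^+ j = \sum_(j < n) (1 - E) ^+ j.
  by apply: eq_bigr => j _; rewrite lcS -[1 - E]opprB expNp.
set S := \sum_(j < n) _; have SE : E * S = 1 - (1 - E) ^+ n.
  by rewrite -geom_sum opprB addrCA subrr addr0.
rewrite dE mulrBl SE -scalerAl addrAC (addrAC 1) subrr add0r.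
apply: lowD; apply: lowN; first by apply: low_exp; rewrite -opprB coefN E0 oppr0.
rewrite -mul_polyC; apply: lowMl; apply: lowMr; apply: low_exp.
by rewrite coefX.
Qed.

End ExpLog.

Section ExpLogSeries.
Context (R : realType) (T : Type).
Implicit Types (f g h u Z : nser R T) (w : seq T).

Lemma ord_horner n Z (p : {poly R}) : ord 1 Z -> low n p -> ord n (horner_alg Z p).
Proof.
move=> oZ lp; rewrite -[p]coefK poly_def raddf_sum; apply: ord_sum => i w sw /=.
rewrite -mul_polyC rmorphM /= horner_algC rmorphXn /= horner_algX mulr_algl nserZ.
have [ni|im] := ltnP i n; first by rewrite lp ?mul0r.
by rewrite (ord_exp (k := i) oZ) ?mulr0 // (leq_trans sw).
Qed.

Lemma psum_ord1 c Z : c 0%N = 0 -> ord 1 (psum c Z).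
Proof.
by move=> c0; apply/ord1; rewrite /psum big_ord_recl big_ord0 c0 mul0r addr0.
Qed.

Lemma nexp_ord1 Z : ord 1 (nexp Z - 1).
Proof.
apply/ord1; rewrite nserB /nexp /psum big_ord_recl big_ord0 /= expr0 addr0.
by rewrite /ec invr1 mul1r subrr.
Qed.

Lemma ord_trans n f g h : ord n (f - g) -> ord n (g - h) -> ord n (f - h).
Proof.
by move=> H1 H2; rewrite -(subrK g f) -addrA -[f - g]scale1r; apply: ordP.
Qed.

Lemma ord_sym n f g : ord n (f - g) -> ord n (g - f).
Proof. by move=> H w sw; rewrite -opprB nserN H // oppr0. Qed.

Lemma ord_psum n c f g : ord 1 f -> ord 1 g -> ord n (f - g) -> ord n (psum c f - psum c g).
Proof.
move=> of1 og1 H. apply: ord_trans (psum_ord (N := n) c of1) _.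
apply: ord_trans (ord_sym (psum_ord (N := n) c og1)) => w sw.
rewrite -sumrB nser_sum big1 // => k _.
by rewrite -scalerBr nserZ (ord_expB k of1 og1 H) // mulr0.
Qed.

Lemma nexp_nlog g : ord 1 (g - 1) -> nexp (nlog g) = g.
Proof.
move=> og; have oL : ord 1 (nlog g) by apply: psum_ord1.
apply: eq_ord => -[|n] //; rewrite /nexp.
pose Lp := horner_alg (g - 1) (lpoly R n.+1).
have oLp : ord n.+1 (nlog g - Lp) := psum_poly (N := n.+1) (lc R) og.
have oLp1 : ord 1 Lp.
  apply: ord_horner => // k; rewrite ltnS leqn0 => /eqP->.
  by rewrite /lpoly coef_poly.
apply: ord_trans (ord_psum (ec R) oL oLp1 oLp) _.
apply: ord_trans (psum_ord (N := n.+1) (ec R) oLp1) _.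
have -> : \sum_(k < n.+1) ec R k *: Lp ^+ k =
    horner_alg (g - 1) (\sum_(j < n.+1) ec R j *: lpoly R n.+1 ^+ j).
  rewrite raddf_sum; apply: eq_bigr => j _ /=.
  by rewrite -mul_polyC rmorphM /= horner_algC rmorphXn mulr_algl.
have {2}<- : horner_alg (g - 1) (1 + 'X) = g.
  by rewrite rmorphD rmorph1 /= horner_algX addrC subrK.
rewrite -rmorphB; apply: ord_horner og _; exact: exp_log.
Qed.

Lemma nlog_nexp Z : ord 1 Z -> nlog (nexp Z) = Z.
Proof.
move=> oZ; have oE := nexp_ord1 Z.
apply: eq_ord => -[|n] //; rewrite /nlog.
pose Ep := horner_alg Z (epoly R n.+1 - 1).
have oEp : ord n.+1 (nexp Z - 1 - Ep).
  rewrite /Ep rmorphB rmorph1 /= opprB addrA subrK.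
  exact: (psum_poly (N := n.+1) (ec R) oZ).
have oEp1 : ord 1 Ep.
  apply: ord_horner => // k; rewrite ltnS leqn0 => /eqP->.
  by rewrite coefB coef1 /epoly coef_poly /ec invr1 subrr.
apply: ord_trans (ord_psum (lc R) oE oEp1 oEp) _.
apply: ord_trans (psum_ord (N := n.+1) (lc R) oEp1) _.
have -> : \sum_(k < n.+1) lc R k *: Ep ^+ k =
    horner_alg Z (\sum_(j < n.+1) lc R j *: (epoly R n.+1 - 1) ^+ j).
  rewrite raddf_sum; apply: eq_bigr => j _ /=.
  by rewrite -mul_polyC rmorphM /= horner_algC rmorphXn mulr_algl.
have {2}<- : horner_alg Z 'X = Z by rewrite horner_algX.
rewrite -rmorphB; apply: ord_horner oZ _; exact: log_exp.
Qed.

End ExpLogSeries.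

(** * Operators substituted into series *)

Section TupleSums.
Context (V : nmodType).

Definition tsum k (F : seq bool -> V) : V := \sum_(w : k.-tuple bool) F w.

Lemma tsum0 F : tsum 0 F = F [::].
Proof. exact: big_tuple0. Qed.

Lemma tsumS k F : tsum k.+1 F = \sum_b tsum k (fun w => F (b :: w)).
Proof. exact: big_tuple_cons. Qed.

Lemma eq_tsum k F G : (forall w, size w = k -> F w = G w) -> tsum k F = tsum k G.
Proof. by move=> E; apply: eq_bigr => w _; apply: E; rewrite size_tuple. Qed.

Lemma tsum_split i n (F : seq bool -> seq bool -> V) : (i <= n)%N ->
  tsum n (fun u => F (take i u) (drop i u)) = tsum i (fun w => tsum (n - i) (F w)).
Proof.
elim: i n F => [|i IH] [|n] F //.
- by rewrite !tsum0.
- by move=> _; rewrite [RHS]tsum0 subn0; apply: eq_tsum => w _; rewrite take0 drop0.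
rewrite ltnS => le_in; rewrite !tsumS; apply: eq_bigr => b _ /=.
exact: (IH n (fun w => F (b :: w))).
Qed.
End TupleSums.

Section Action.
Context (R : realType) (Y : Type) (sz : Y -> nat) (V : lmodType R).
(** Letters act by operators whose value at [y] depends only on arguments of smaller size
    ([alpha_loc]). A series then acts through finitely many words at each argument. *)
Variable alpha : bool -> (Y -> V) -> (Y -> V).
Hypothesis alpha_lin : forall t (a : R) (P Q : Y -> V),
  alpha t (a *: P + Q) = a *: alpha t P + alpha t Q.
Hypothesis alpha_loc : forall t n (P Q : Y -> V), (forall y, (sz y < n)%N -> P y = Q y) ->
  forall y, (sz y < n.+1)%N -> alpha t P y = alpha t Q y.
Implicit Types (P Q : Y -> V) (f g Z : nser R bool) (w : seq bool).

Definition actw w P : Y -> V := foldr alpha P w.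
Definition act f P : Y -> V := fun y => \sum_(k < (sz y).+1) tsum k (fun w => f w *: actw w P y).

Lemma actw_loc n w P Q : (forall y, (sz y < n)%N -> P y = Q y) ->
  forall y, (sz y < n + size w)%N -> actw w P y = actw w Q y.
Proof.
elim: w => [|t w IH] E y /=; first by rewrite addn0; apply: E.
by rewrite addnS; apply: alpha_loc; apply: IH.
Qed.

Lemma alpha0 t : alpha t 0 = 0.
Proof.
have := alpha_lin t (-1) 0 0; rewrite scaler0 addr0 => E.
by rewrite {1}E scaleN1r addNr.
Qed.

Lemma actw_0 w : actw w 0 = 0.
Proof. by elim: w => //= t w ->; exact: alpha0. Qed.

Lemma actw_vanish w P y : (sz y < size w)%N -> actw w P y = 0.
Proof.
move=> yw; rewrite (@actw_loc 0 w P 0) //.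
by rewrite actw_0.
Qed.

Lemma actw_lin w (a : R) P Q : actw w (a *: P + Q) = a *: actw w P + actw w Q.
Proof. by elim: w => //= t w ->; exact: alpha_lin. Qed.

Lemma actw_cat w w' P : actw (w ++ w') P = actw w (actw w' P).
Proof. exact: foldr_cat. Qed.

Lemma act_trunc N f P y : (sz y < N)%N ->
  act f P y = \sum_(k < N) tsum k (fun w => f w *: actw w P y).
Proof.
move=> yN; rewrite /act (big_ord_widen _ (fun k => tsum k (fun w => f w *: actw w P y)) yN).
rewrite [RHS](bigID (fun k : 'I_N => (k < (sz y).+1)%N)) /= [X in _ = _ + X]big1 ?addr0 // => k.
rewrite -leqNgt => yk; apply: big1 => w _; rewrite actw_vanish ?scaler0 //.
by rewrite size_tuple.
Qed.

Lemma act_ext N f g P Q : (forall w, (size w < N)%N -> f w = g w) ->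
  (forall y, (sz y < N)%N -> P y = Q y) -> forall y, (sz y < N)%N -> act f P y = act g Q y.
Proof.
move=> Ef EP y yN; rewrite !(act_trunc _ _ yN); apply: eq_bigr => k _.
apply: eq_tsum => w sw; rewrite Ef ?sw ?ltn_ord //; congr (_ *: _).
by apply: (actw_loc EP); rewrite (leq_trans yN) // leq_addr.
Qed.

Lemma act_linl (a : R) f g P : act (a *: f + g) P = a *: act f P + act g P.
Proof.
apply/funext => y; transitivity (a *: act f P y + act g P y) => //.
rewrite scaler_sumr -big_split; apply: eq_bigr => k _ /=.
rewrite scaler_sumr -big_split; apply: eq_bigr => w _ /=.
by rewrite nserD nserZ scalerDl scalerA.
Qed.

Lemma act1 P : act 1 P = P.
Proof.
apply/funext => y; rewrite /act big_ord_recl tsum0 /= nser1 scale1r big1 ?addr0 // => k _.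
apply: big1 => w _; rewrite nser1 /nilp size_tuple /= mulr0n.
exact: scale0r.
Qed.

Lemma act_letter t P : act (letter R t : nser R bool) P = alpha t P.
Proof.
apply/funext => y; rewrite (@act_trunc (sz y).+2) // big_ord_recl big_ord_recl tsum0 /=.
rewrite {1}/letter /= scale0r add0r tsumS big_bool !tsum0 /= big1 ?addr0.
  by rewrite /letter /= !eqseq_cons /= !andbT; case: t; rewrite /= ?eqxx scale1r scale0r ?addr0 ?add0r.
move=> k _; apply: big1 => w _; rewrite /letter.
have -> : (tval w == [:: t]) = false by apply/negP => /eqP /(congr1 size); rewrite size_tuple.
exact: scale0r.
Qed.

(** Words of the product are cut at every position; since long words act by 0, the sum over cuts
    becomes a double sum over pairs of words. *)
Lemma act_mul f g P : act (f * g) P = act f (act g P).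
Proof.
apply/funext => y; set N := (sz y).+1.
have yN : (sz y < N)%N by [].
pose G i l := tsum i (fun w => tsum l (fun v => (f w * g v) *: actw (w ++ v) P y)).
transitivity (\sum_(n < N) \sum_(i < n.+1) G i (n - i)%N).
  apply: eq_bigr => n _; rewrite -[f * g]/(ser_mul f g) /ser_mul.
  transitivity (tsum n (fun w => \sum_(i < n.+1) (f (take i w) * g (drop i w)) *: actw w P y)).
    by apply: eq_tsum => w sw; rewrite sw scaler_suml.
  rewrite /tsum exchange_big /=; apply: eq_bigr => i _.
  rewrite /G -(tsum_split (fun w v => (f w * g v) *: actw (w ++ v) P y)); last by rewrite -ltnS.
  by apply: eq_bigr => w _; rewrite cat_take_drop.
rewrite big_triangle; last first.
  move=> i l Nil; apply: big1 => w _; apply: big1 => v _.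
  by rewrite actw_vanish ?scaler0 // size_cat !size_tuple; exact: leq_trans Nil.
apply: eq_bigr => i _; rewrite -/(act g P).
rewrite /G [RHS](_ : _ = tsum i (fun w => f w *: actw w (fun y' => \sum_(l < N) tsum l (fun v => g v *: actw v P y')) y)).
  rewrite exchange_big /=; apply: eq_bigr => w _.
  transitivity (f w *: \sum_(l < N) tsum l (fun v => g v *: actw w (actw v P) y)).
    rewrite scaler_sumr; apply: eq_bigr => l _; rewrite scaler_sumr.
    by apply: eq_bigr => v _; rewrite scalerA actw_cat.
  congr (_ *: _).
  have actw_sum (I : Type) (r : seq I) (a : I -> R) (F : I -> Y -> V) :
      actw w (fun y' => \sum_(j <- r) a j *: F j y') y = \sum_(j <- r) a j *: actw w (F j) y.
    elim: r => [|j r IH].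
      rewrite big_nil (_ : (fun y' => _) = 0) ?actw_0 //; apply/funext => y'.
      by rewrite big_nil.
    rewrite big_cons -IH -[RHS]/((a j *: actw w (F j) + actw w _) y) -actw_lin.
    by congr (actw w _ y); apply/funext => y'; rewrite big_cons.
  rewrite (_ : (fun y' => _) = (fun y' => \sum_(l <- index_enum 'I_N)
     1 *: (fun y'' => tsum l (fun v => g v *: actw v P y'')) y')); last first.
    by apply/funext => y'; apply: eq_bigr => l _; rewrite scale1r.
  rewrite actw_sum; apply: eq_bigr => l _.
  by rewrite scale1r (actw_sum _ _ (fun v : l.-tuple bool => g v) (fun v => actw v P)).
apply: eq_tsum => w _; congr (_ *: _); apply: (@actw_loc N) => [y' y'N|].
  exact: act_trunc.
by rewrite leq_addr.
Qed.

Lemma act_sum (I : Type) (r : seq I) (F : I -> nser R bool) P y :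
  act (\sum_(i <- r) F i) P y = \sum_(i <- r) act (F i) P y.
Proof.
have act0 : act 0 P = 0.
  by apply/funext => z; apply: big1 => k _; apply: big1 => w _; exact: scale0r.
elim: r => [|i r IH]; rewrite ?big_nil ?big_cons ?act0 //.
by rewrite -[F i]scale1r act_linl scale1r -IH scale1r.
Qed.

Lemma act_exp Z k P : act (Z ^+ k) P = iter k (act Z) P.
Proof. by elim: k => [|k IH]; rewrite ?expr0 ?act1 // exprS act_mul IH. Qed.

Lemma act_psum N c Z P y : ord 1 Z -> (sz y < N)%N ->
  act (psum c Z) P y = \sum_(k < N) c k *: iter k (act Z) P y.
Proof.
move=> oZ yN.
rewrite (@act_ext N _ (\sum_(k < N) c k *: Z ^+ k) _ P) //; last first.
  by move=> w wN; apply: psum_trunc.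
rewrite act_sum; apply: eq_bigr => k _.
have := act_linl (c k) (Z ^+ k) 0 P; rewrite addr0 => ->.
rewrite act_exp -[LHS]/(c k *: iter k (act Z) P y + act 0 P y).
rewrite [act 0 P y]big1 ?addr0 // => i _; apply: big1 => w _; exact: scale0r.
Qed.

End Action.

(** * Conjugation by exponentials *)

Section Conjugation.
Context (R : realType) (T : Type).
Implicit Types (a Z : nser R T) (w : seq T).

Definition comm Z a : nser R T := Z * a - a * Z.

(** Hadamard's formula: ad(Z)^k / k! expands into the products Z^i a (-Z)^l / (i! l!) with i + l =
    k. *)
Lemma nexp_conj N Z a w : ord 1 Z -> (size w < N)%N ->
  (nexp Z * a * nexp (- Z)) w = \sum_(k < N) ec R k *: iter k (comm Z) a w.
Proof.
move=> oZ wN; have oNZ : ord 1 (- Z).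
  by rewrite -[- Z]addr0 -scaleN1r; apply: ordP.
pose b i l : nser R T := (ec R i * ec R l) *: (Z ^+ i * a * (- Z) ^+ l).
have bk k : ec R k *: iter k (comm Z) a = \sum_(i < k.+1) b i (k - i)%N.
  elim: k => [|k IH].
    by rewrite big_ord_recl big_ord0 addr0 /b !expr0 mul1r mulr1 /ec invr1 mulr1.
  have -> : ec R k.+1 *: iter k.+1 (comm Z) a = k.+1%:R^-1 *: comm Z (ec R k *: iter k (comm Z) a).
    rewrite [RHS](_ : _ = k.+1%:R^-1 *: (ec R k *: comm Z (iter k (comm Z) a))).
      by rewrite scalerA -(ecS R k) mulrA mulVf ?mul1r // pnatr_eq0.
    by rewrite {1}/comm -scalerAr -scalerAl -scalerBr.
  rewrite IH /comm mulr_sumr mulr_suml -sumrB.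
  apply: (scalerI (a := k.+1%:R)); first by rewrite pnatr_eq0.
  rewrite scalerA mulfV ?pnatr_eq0 // scale1r scaler_sumr.
  have bl i l : Z * b i l = i.+1%:R *: b i.+1 l.
    rewrite /b -scalerAr !mulrA -exprS scalerA; congr (_ *: _).
    by rewrite mulrA ecS.
  have br i l : - (b i l * Z) = l.+1%:R *: b i l.+1.
    rewrite /b -scalerAl -scalerN -mulrN -(mulrA (Z ^+ i * a)) -exprSr scalerA; congr (_ *: _).
    by rewrite mulrCA ecS.
  under eq_bigr => i _ do rewrite bl br.
  rewrite big_split /= [RHS](eq_bigr (fun i : 'I_k.+2 =>
     (i : nat)%:R *: b i (k.+1 - i)%N + (k.+1 - i)%:R *: b i (k.+1 - i)%N)); last first.
    by move=> i _; rewrite -scalerDl -natrD subnKC // -ltnS.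
  rewrite [RHS]big_split /= [X in _ = X + _]big_ord_recl [X in _ = _ + X]big_ord_recr /=.
  rewrite scale0r add0r subnn scale0r addr0; congr (_ + _); apply: eq_bigr => i _.
  by rewrite subSn // -ltnS.
transitivity ((\sum_(k < N) \sum_(i < k.+1) b i (k - i)%N) w); last first.
  by rewrite nser_sum; apply: eq_bigr => k _; rewrite -bk.
transitivity (((\sum_(k < N) ec R k *: Z ^+ k) * a * (\sum_(k < N) ec R k *: (- Z) ^+ k)) w).
  apply: (ord_eq (n := N)) => //.
  set e := nexp Z; set e' := nexp (- Z); set s := \sum_(k < N) _; set s' := \sum_(k < N) _.
  have -> : e * a * e' - s * a * s' = (e - s) * (a * e') + (s * a) * (e' - s').
    by rewrite mulrBl mulrBr !mulrA addrA subrK.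
  rewrite -[X in ord _ (X + _)]scale1r; apply: ordP.
    by rewrite -[N]addn0; apply: ord_mul => //; apply: psum_ord.
  by rewrite -[N]add0n; apply: ord_mul => //; apply: psum_ord.
rewrite nser_sum (eq_bigr (fun k : 'I_N => \sum_(i < k.+1) (b i (k - i)%N) w)); last first.
  by move=> k _; rewrite nser_sum.
rewrite (big_triangle (g := fun i l => b i l w)); last first.
  move=> i l Nil; rewrite /b nserZ; have -> : (Z ^+ i * a * (- Z) ^+ l) w = 0.
    have oi := ord_exp (k := i) oZ; have ol := ord_exp (k := l) oNZ.
    have := ord_mul (ord_mul oi (n := i) (m := 0) (g := a) (fun _ e => False_ind _ (Bool.diff_false_true e))) ol.
    by rewrite addn0; apply; exact: leq_trans Nil.
  by rewrite mulr0.
rewrite mulr_suml mulr_suml nser_sum; apply: eq_bigr => i _.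
rewrite mulr_sumr nser_sum; apply: eq_bigr => l _.
by rewrite /b -!scalerAl -scalerAr scalerA mulrC.
Qed.

(** Conjugation of 1, whose commutator with Z vanishes. *)
Lemma nexpK Z : ord 1 Z -> nexp Z * nexp (- Z) = 1.
Proof.
move=> oZ; apply/funext => w; rewrite -[nexp Z]mulr1 (nexp_conj (N := (size w).+1)) //.
rewrite big_ord_recl /= /ec invr1 scale1r big1 ?addr0 // => k _.
suff -> : comm Z (iter k (comm Z) 1) = 0 by exact: scaler0.
elim: (nat_of_ord k) => [|j /= ->]; first by rewrite /= /comm mulr1 mul1r subrr.
by rewrite /comm mulr0 mul0r subrr.
Qed.

End Conjugation.

Section Letters.
Context (R : realType) (T : eqType).
Implicit Types (f g : nser R T) (w : seq T).
Local Notation lt t := (letter R t : nser R T).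

Lemma ord_letter t : ord 1 (lt t).
Proof. exact/ord1. Qed.

Lemma letterM_cons t f x w : (lt t * f) (x :: w) = (x == t)%:R * f w.
Proof.
rewrite nserM ser_mul_cons [letter R t [::]]/letter /= mul0r add0r.
have -> : dshift x (lt t) = (x == t)%:R *: (1 : nser R T).
  apply/funext => v; rewrite nserZ nser1 /dshift /letter eqseq_cons.
  by case: v => [|y v] /=; rewrite ?andbT ?andbF ?mulr1 ?mulr0.
rewrite -[ser_mul _ f w]/(((x == t)%:R *: 1 * f : nser R T) w).
by rewrite -scalerAl mul1r.
Qed.

Lemma letterM_nil t f : (lt t * f) [::] = 0.
Proof. by rewrite nserM ser_mul_nil /letter /= mul0r. Qed.

Lemma Mletter_rcons t f w x : (f * lt t) (rcons w x) = f w * (x == t)%:R.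
Proof.
elim: w f => [|y w IH] f.
  rewrite /= nserM ser_mul_cons ser_mul_nil {2}/letter /= mulr0 addr0.
  by rewrite /letter /= eqseq_cons andbT.
rewrite rcons_cons nserM ser_mul_cons -[ser_mul _ _ _]/((_ * lt t) _) IH.
rewrite {1}/letter eqseq_cons.
by case: w {IH} => [|z w]; rewrite /= ?andbF mulr0 add0r.
Qed.

Lemma Mletter_nil t f : (f * lt t) [::] = 0.
Proof. by rewrite nserM ser_mul_nil /letter /= mulr0. Qed.

Lemma letterX t k w : (lt t ^+ k) w = ((size w == k) && all (pred1 t) w)%:R.
Proof.
elim: k w => [|k IH] [|x w].
- by rewrite expr0 nser1.
- by rewrite expr0 nser1.
- by rewrite exprS letterM_nil.
- by rewrite exprS letterM_cons IH /= eqSS; case: eqP => _; rewrite ?mul1r ?mul0r ?andbF.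
Qed.

Lemma nexp_letter t w : nexp (lt t) w = if all (pred1 t) w then ((size w)`!%:R)^-1 else 0.
Proof.
rewrite /nexp /psum big_ord_recr /= letterX eqxx /= big1 ?add0r => [|k _].
  by rewrite /ec; case: all; rewrite ?mulr1 ?mulr0.
by rewrite letterX gtn_eqF ?mulr0.
Qed.

End Letters.

Section CommLoc.
Context (R : realType) (T : Type).
Implicit Types (Z A B : nser R T).

Lemma comm_loc Z n A B : ord 1 Z -> (forall w, (size w < n)%N -> A w = B w) ->
  forall w, (size w < n.+1)%N -> comm Z A w = comm Z B w.
Proof.
move=> oZ E; have oAB : ord n (A - B).
  by move=> w wn; rewrite nserB E // subrr.
suff H : ord n.+1 (comm Z A - comm Z B) by move=> w wn; exact: (ord_eq H wn).
have -> : comm Z A - comm Z B = (- 1) *: ((A - B) * Z) + Z * (A - B).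
  rewrite /comm mulrBr mulrBl scaleN1r [RHS]addrC !opprB.
  by rewrite [X in _ = _ + X]addrC [RHS]addrACA [X in _ = _ + X]addrC.
apply: ordP; last by rewrite -add1n; apply: ord_mul.
by rewrite -addn1; apply: ord_mul.
Qed.

Lemma comm_lin Z (a : R) A B : comm Z (a *: A + B) = a *: comm Z A + comm Z B.
Proof.
by rewrite /comm mulrDr mulrDl -scalerAr -scalerAl scalerBr opprD addrACA.
Qed.
End CommLoc.

(** * Dynkin form of the Baker-Campbell-Hausdorff series *)

Section Dynkin.
Context (R : realType).
Local Notation S2 := (nser R bool).
Local Notation S3 := (nser R (option bool)).

(** The alphabet gets a third letter t, encoded as [None]. The two old letters act on series in
    three letters by commutators ([ad]). *)
Definition x3 (b : bool) : S3 := letter R (Some b).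
Definition t3 : S3 := letter R None.
Definition ad (b : bool) (A : seq (option bool) -> R^o) : seq (option bool) -> R^o :=
  comm (x3 b) A.

Lemma ord_x3 b : ord 1 (x3 b). Proof. exact: ord_letter. Qed.
Lemma ad_lin b (a : R) (A B : S3) : ad b (a *: A + B) = a *: ad b A + ad b B.
Proof. exact: comm_lin. Qed.
Lemma ad_loc b n (A B : seq (option bool) -> R^o) : (forall w, (size w < n)%N -> A w = B w) ->
  forall w, (size w < n.+1)%N -> ad b A w = ad b B w.
Proof. exact: comm_loc (ord_x3 b). Qed.

Definition expexp : S2 := ser_mul (exp_letter R true) (exp_letter R false).

Lemma exp_letterE b : exp_letter R b = nexp (letter R b : S2).
Proof. by apply/funext => w; rewrite nexp_letter. Qed.

Lemma log_exp_expE : log_exp_exp R = nlog expexp.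
Proof.
apply/funext => w; rewrite /log_exp_exp /nlog /psum.
rewrite -(big_mkord xpredT (fun k => lc R k * ((expexp - 1) ^+ k) w)).
rewrite [RHS]big_ltn // [X in _ = X + _]mul0r [RHS]add0r.
apply: eq_big_nat => -[|k] // _.
congr (_ * _); rewrite ser_prodE.
suff E (u : S2) j : \prod_(f <- nseq j u) f = u ^+ j.
  exact: (congr1 (fun f : S2 => f w) (E (expexp - 1) k.+1)).
by elim: j => [|j IH]; rewrite ?big_nil ?expr0 //= big_cons exprS IH.
Qed.

Lemma ord_expexp : ord 1 (expexp - 1).
Proof.
apply/ord1; rewrite nserB /expexp ser_mul_nil /exp_letter /= invr1 mulr1.
by rewrite nser1 subrr.
Qed.

Local Notation act3 := (act size ad).

Lemma act3_exp b A : act3 (nexp (letter R b : S2)) A = nexp (x3 b) * A * nexp (- x3 b).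
Proof.
apply/funext => w.
rewrite (act_psum ad_lin ad_loc (N := (size w).+1)) //; last exact: ord_letter.
rewrite (nexp_conj (N := (size w).+1)) //; last exact: ord_x3.
apply: eq_bigr => k _; congr (_ *: _); congr (_ w).
elim: (nat_of_ord k) => //= j ->; exact: (act_letter ad_lin ad_loc).
Qed.

Definition G3 : S3 := nexp (x3 true) * nexp (x3 false).
Definition Z3 : S3 := nlog G3.

(** exp(ad x) exp(ad y) is conjugation by exp(x) exp(y), and the inverse of this product is
    exp(-Z). *)
Lemma act_expexp A : act3 expexp A = G3 * A * nexp (- Z3).
Proof.
rewrite /expexp !exp_letterE (act_mul ad_lin ad_loc) !act3_exp /G3 !mulrA.
have oG : ord 1 (G3 - 1).
  have -> : G3 - 1 = (nexp (x3 true) - 1) * nexp (x3 false) + (nexp (x3 false) - 1).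
    by rewrite mulrBl mul1r addrA subrK.
  rewrite -[X in ord _ (X + _)]scale1r; apply: ordP; last exact: nexp_ord1.
  by rewrite -[1%N]addn0; apply: ord_mul => //; exact: nexp_ord1.
have oZ : ord 1 Z3 by apply: psum_ord1.
have inv1 b : nexp (x3 b) * nexp (- x3 b) = 1 by apply: nexpK; exact: ord_x3.
have oNx b : ord 1 (- x3 b) by rewrite -[- _]addr0 -scaleN1r; apply: ordP => //; exact: ord_x3.
have inv2 b : nexp (- x3 b) * nexp (x3 b) = 1.
  by have := nexpK (oNx b); rewrite opprK.
have eZ : G3 * nexp (- Z3) = 1.
  by have := nexpK oZ; rewrite /Z3 nexp_nlog.
have -> : nexp (- Z3) = nexp (- x3 false) * nexp (- x3 true).
  have e : nexp (- x3 false) * nexp (- x3 true) * G3 = 1.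
    by rewrite /G3 mulrA -(mulrA (nexp (- x3 false))) inv2 mulr1 inv2.
  by rewrite -[LHS]mul1r -e -mulrA eZ mulr1.
by rewrite !mulrA.
Qed.

(** exp(ad Z) and exp(ad x) exp(ad y) are the same conjugation, so their logarithms agree as
    operators. *)
Lemma act_log A : act3 (nlog expexp) A = comm Z3 A.
Proof.
have oG : ord 1 (G3 - 1).
  have -> : G3 - 1 = (nexp (x3 true) - 1) * nexp (x3 false) + (nexp (x3 false) - 1).
    by rewrite mulrBl mul1r addrA subrK.
  rewrite -[X in ord _ (X + _)]scale1r; apply: ordP; last exact: nexp_ord1.
  by rewrite -[1%N]addn0; apply: ord_mul => //; exact: nexp_ord1.
have oZ : ord 1 Z3 by apply: psum_ord1.
(* An auxiliary action in which a letter acts by ad Z, so that exp(ad Z) and its logarithm are again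
   actions of series and [act_psum] applies to both sides. *)
pose al (b : bool) (A : seq (option bool) -> R^o) : seq (option bool) -> R^o := comm Z3 A.
have al_lin b (a : R) (P Q : S3) : al b (a *: P + Q) = a *: al b P + al b Q by exact: comm_lin.
have al_loc b n (P Q : seq (option bool) -> R^o) : (forall w, (size w < n)%N -> P w = Q w) ->
  forall w, (size w < n.+1)%N -> al b P w = al b Q w by exact: comm_loc oZ.
have E P : act size al (nexp (letter R true : S2)) P = act3 expexp P.
  rewrite act_expexp; apply/funext => w.
  rewrite (act_psum al_lin al_loc (N := (size w).+1)) //; last exact: ord_letter.
  rewrite -[G3](nexp_nlog oG) -/Z3 (nexp_conj (N := (size w).+1)) //.
  apply: eq_bigr => k _; congr (_ *: _); congr (_ w).
  elim: (nat_of_ord k) => //= j ->; exact: (act_letter al_lin al_loc).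
transitivity (act size al (nlog (nexp (letter R true : S2))) A); last first.
  by rewrite nlog_nexp ?(act_letter al_lin al_loc) //; exact: ord_letter.
apply/funext => w; rewrite /nlog.
rewrite (act_psum ad_lin ad_loc (N := (size w).+1)) //; last exact: ord_expexp.
rewrite (act_psum al_lin al_loc (N := (size w).+1)) //; last exact: nexp_ord1.
apply: eq_bigr => k _; congr (_ *: _); congr (_ w).
have B al' f P : act size al' (f - 1) P = act size al' f P - P.
  have -> : f - 1 = (-1) *: 1 + f by rewrite scaleN1r addrC.
  by rewrite act_linl act1 scaleN1r addrC.
by elim: (nat_of_ord k) => //= j ->; rewrite !B E.
Qed.

(** Keeps the words with exactly one t and erases it, weighted by a function of the number of
    letters before t. The constant weight 1 and the weight i compare ad(Z)(t) with nested
    brackets. *)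
Definition tpos (A : S3) (c : nat -> R) : S2 := fun z =>
  \sum_(i < (size z).+1) c i * A ([seq Some b | b <- take i z] ++ None :: [seq Some b | b <- drop i z]).

Lemma tpos_l c b A : tpos (x3 b * A) c = (letter R b : S2) * tpos A (fun i => c i.+1).
Proof.
apply/funext => -[|b' z].
  by rewrite letterM_nil /tpos big_ord_recl big_ord0 letterM_cons mul0r mulr0 addr0.
rewrite letterM_cons /tpos big_ord_recl letterM_cons /= mul0r mulr0 add0r mulr_sumr.
apply: eq_bigr => i _; rewrite /= letterM_cons mulrCA; congr (_ * _).
Qed.

Lemma tpos_r c b A : tpos (A * x3 b) c = tpos A c * (letter R b : S2).
Proof.
apply/funext => z; case: (lastP z) => [|{}z b'].
  by rewrite Mletter_nil /tpos big_ord_recl big_ord0 /= (Mletter_rcons _ _ [::]) mulr0 mulr0 addr0.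
rewrite Mletter_rcons /tpos size_rcons big_ord_recr /=.
have -> : drop (size z).+1 (rcons z b') = [::] by rewrite drop_oversize // size_rcons.
rewrite [X in _ + c _ * X](_ : _ = 0) ?mulr0 ?addr0; last first.
  by rewrite /= cats1 Mletter_rcons mulr0.
rewrite -cats1 mulr_suml; apply: eq_bigr => i _; have iz : (i <= size z)%N by rewrite -ltnS.
rewrite takel_cat // drop_cat; case: ltngtP iz => // [iz|->] _.
  by rewrite map_cat /= -cat_cons catA cats1 Mletter_rcons mulrA.
by rewrite subnn drop_size /= -[[:: None; Some b']]/([:: None] ++ [:: Some b']) catA cats1
  Mletter_rcons mulrA.
Qed.

Lemma tposB A B c : tpos (A - B) c = tpos A c - tpos B c.
Proof.
apply/funext => z; rewrite nserB /tpos -sumrB; apply: eq_bigr => i _.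
by rewrite nserB mulrBr.
Qed.

Lemma tpos_D A c d : tpos A (fun i => c i + d i) = tpos A c + tpos A d.
Proof.
apply/funext => z; rewrite nserD /tpos -big_split; apply: eq_bigr => i _ /=.
by rewrite mulrDl.
Qed.

Definition nested (w : seq bool) : S2 := nested_br (@ser_br R bool) [seq letter R t | t <- w].

Lemma nested_cons b w : w <> [::] -> nested (b :: w) = comm (letter R b : S2) (nested w).
Proof. by case: w. Qed.

Lemma tpos_t3 c : tpos t3 c = c 0%N *: 1.
Proof.
apply/funext => -[|b z]; rewrite nserZ nser1 /tpos /=.
  by rewrite big_ord_recl big_ord0 addr0 /t3 /letter eqxx.
rewrite mulr0 big1 // => i _; rewrite /t3 /letter.
by case: i => -[|i] hi //=; rewrite mulr0.
Qed.

(** A letter put in front raises the count by one, so for the weight i the series xA - Ax gives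
    x(A_i + A_1) - A_i x, with A_i and A_1 the images of A for the two weights. The extra term x A_1
    starts the nested bracket at ad(x)(t) and vanishes from then on. *)
Lemma tpos_ad w : w <> [::] ->
  tpos (actw ad w t3) (fun=> 1) = 0 /\ tpos (actw ad w t3) (fun i => i%:R) = nested w.
Proof.
have S A : tpos A (fun i => i.+1%:R) = tpos A (fun i => i%:R) + tpos A (fun=> 1).
  by rewrite -tpos_D; congr tpos; apply/funext => i; rewrite natr1.
elim: w => [|b w IH] // _.
have -> : actw ad (b :: w) t3 = x3 b * (actw ad w t3 : S3) - (actw ad w t3 : S3) * x3 b by [].
rewrite !tposB !tpos_l !tpos_r S.
case: w IH => [|b' w] IH.
  by rewrite /= !tpos_t3 scale1r scale0r add0r mulr1 mul0r mul1r subrr subr0.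
have [|-> ->] := IH; first by [].
by rewrite mulr0 mul0r subr0 addr0.
Qed.

Lemma nested_hom w z : size z != size w -> nested w z = 0.
Proof.
elim: w z => [|b [|b' w] IH] z // zw.
  rewrite /nested /= /letter; case: eqP => // e; by rewrite e eqxx in zw.
rewrite nested_cons // /comm nserB.
have -> : ((letter R b : S2) * nested (b' :: w)) z = 0.
  case: z zw => [|c z] zw; first exact: letterM_nil.
  by rewrite letterM_cons IH ?mulr0 // -eqSS.
have -> : (nested (b' :: w) * (letter R b : S2)) z = 0; last by rewrite subrr.
case: (lastP z) zw => [|{}z c] zw; first exact: Mletter_nil.
by rewrite Mletter_rcons IH ?mul0r // -eqSS -(size_rcons z c).
Qed.

Definition res3 (A : S3) : S2 := fun w => A [seq Some b | b <- w].

Lemma res3M A B : res3 (A * B) = res3 A * res3 B.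
Proof.
apply/funext => w; rewrite /res3 nserM /ser_mul size_map; apply: eq_bigr => i _.
by rewrite map_take map_drop.
Qed.

Lemma res3_1 : res3 1 = 1.
Proof. by apply/funext => -[|b w]. Qed.

Lemma res3_psum c A : res3 (psum c A) = psum c (res3 A).
Proof.
apply/funext => w; rewrite /res3 /psum size_map; apply: eq_bigr => k _; congr (_ * _).
rewrite -/(res3 (A ^+ k) w); congr (_ w); elim: (nat_of_ord k) => [|j IH].
  by rewrite !expr0 res3_1.
by rewrite !exprS res3M IH.
Qed.

Lemma res3_Z3 : res3 Z3 = nlog expexp.
Proof.
have rB A B : res3 (A - B) = res3 A - res3 B by [].
have rx b : res3 (x3 b) = letter R b.
  apply/funext => w; rewrite /res3 /x3 /letter; congr (_ %:R); congr nat_of_bool.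
  by apply/eqP/eqP => [|->//]; case: w => [|c [|d w]] //= [->].
rewrite /Z3 /nlog res3_psum rB res3_1 /G3 res3M !res3_psum !rx.
by rewrite /expexp !exp_letterE.
Qed.

(* Dynkin-Specht-Wever for the Baker-Campbell-Hausdorff series: with a third
   letter t, ad_Z(t) = Zt - tZ, and counting the letters before t turns the left
   side into the nested brackets and the right side into the degree times Z. *)
Lemma dynkin z : (size z)%:R * log_exp_exp R z =
  tsum (size z) (fun w => log_exp_exp R w * nested w z).
Proof.
rewrite log_exp_expE; set Z := nlog expexp.
have Z0 : Z [::] = 0 by apply: (psum_ord1 (c := lc R)).
have := congr1 (fun A => tpos A (fun i => i%:R) z) (act_log t3); rewrite /= -/Z.
(* In Zt - tZ the weight is the full length for words that end with t and 0 for words that start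
   with it. *)
have -> : tpos (comm Z3 t3) (fun i => i%:R) z = (size z)%:R * Z z.
  rewrite /comm tposB nserB.
  have -> : tpos (t3 * Z3) (fun i => i%:R) z = 0.
    rewrite /tpos big1 // => -[[|i] iz] _; rewrite ?mul0r //=.
    case: z iz => [|b z] //= iz; rewrite letterM_cons mul0r mulr0 //.
  rewrite subr0 /tpos big_ord_recr /= take_size drop_size cats1 Mletter_rcons eqxx mulr1.
  rewrite -[Z3 _]/(res3 Z3 z) res3_Z3 big1 ?add0r // => i _.
  have iz := ltn_ord i.
  have [z1 [b ->]] : exists z1 b, drop i z = rcons z1 b.
    case: (lastP (drop i z)) (size_drop i z) => [/=|z1 b _]; last by exists z1, b.
    by move=> e; move: iz; rewrite -subn_gt0 -e.
  by rewrite map_rcons -rcons_cons -rcons_cat Mletter_rcons mulr0 mulr0.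
move=> <-.
transitivity (\sum_(k < (size z).+2) tsum k (fun w => Z w * tpos (actw ad w t3) (fun i => i%:R) z)).
  rewrite /tpos.
  transitivity (\sum_(i < (size z).+1) \sum_(k < (size z).+2) tsum k (fun w => Z w *
    (i%:R * actw ad w t3 ([seq Some b | b <- take i z] ++ None :: [seq Some b | b <- drop i z])))).
    apply: eq_bigr => i _; rewrite (act_trunc ad_lin ad_loc _ _ (N := (size z).+2)); last first.
      by rewrite size_cat /= !size_map addnS -size_cat cat_take_drop.
    rewrite mulr_sumr; apply: eq_bigr => k _; rewrite mulr_sumr; apply: eq_bigr => w _.
    by rewrite mulrCA.
  rewrite exchange_big /=; apply: eq_bigr => k _; rewrite exchange_big /=.
  by apply: eq_bigr => w _; rewrite mulr_sumr.
(* Nested brackets are homogeneous, so only words of the length of [z] contribute. *)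
have kE k : k != size z -> tsum k (fun w => Z w * tpos (actw ad w t3) (fun i => i%:R) z) = 0.
  move=> kz; apply: big1 => w _; case: (tval w =P [::]) => [->|w0].
    by rewrite Z0 mul0r.
  by rewrite (tpos_ad w0).2 nested_hom ?mulr0 // size_tuple eq_sym.
rewrite (bigD1 (Ordinal (leqnSn (size z).+1))) //= [X in _ + X]big1 ?addr0 => [|k kz]; last first.
  exact: kE.
apply: eq_tsum => w sw; case: w sw => [|b w] sw; first by rewrite Z0 !mul0r.
by have [|_ ->] := @tpos_ad (b :: w).
Qed.

End Dynkin.

(** * Exponentials as Lie-infinity morphisms *)

Section LinfExp.
Context (R : realType) (L : glie R) (Lok : glieok L).
Local Notation X := (bool * L)%type.
Implicit Types (s : seq L) (h : seq X) (D P Q G : Defs.family L) (Psi F : seq X -> L).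
Local Notation okl := (all (@okb R L)).
Local Notation us := (@us R L).
Local Notation ShX := (@Sh_ext _ _ _ _ (@okb R L)).

Definition unary0 D := forall u, gsub u -> D [:: u] = 0.
Definition rho D P : Defs.family L := insertion skew_chi false P D.
(** The derivations that can be exponentiated: even, and without unary part, so that iterates vanish
    on short lists. *)
Definition good D := pco skew_chi false D /\ unary0 D.

Lemma pco_rho p D P : good D -> pco skew_chi p P -> pco skew_chi p (rho D P).
Proof. by move=> [gD _] gP; have := pco_inskew Lok gP gD; rewrite addbF. Qed.

Lemma pco_iter p j D P : good D -> pco skew_chi p P -> pco skew_chi p (iter j (rho D) P).
Proof. by move=> gD gP; elim: j => //= j; apply: pco_rho. Qed.

Lemma rho_feq D P P' : good D -> feq P P' -> feq (rho D P) (rho D P').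
Proof. by move=> [gD _] E; apply: insertion_feq => //; exact: pcoC gD. Qed.

Lemma iter_feq j D P P' : good D -> feq P P' -> feq (iter j (rho D) P) (iter j (rho D) P').
Proof. by move=> gD E; elim: j => //= j; apply: rho_feq. Qed.

Lemma good_dec D : good D -> clos (decalage D) /\ prule false (decalage D).
Proof. by move=> [gD _]; have [] := pco_dec Lok skew_symE gD. Qed.

Lemma hrho_insertion p D P h : good D -> pco skew_chi p P -> okl h ->
  insertion sym_chi false (decalage P) (decalage D) (us h) =
  hrho (decalage D) (fun h => decalage P (us h)) h.
Proof.
move=> [gD uD] gP oh; have c1 := pco_dec Lok skew_symE gD.
have c2 := pco_dec Lok skew_symE gP.
rewrite ins_us //; [|exact: pcoM c2|exact: pcoM c1|exact: pcoC c1].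
apply: (ShX oh) => I J oI oJ _; case: I oI => [|x [|y I]] //= oI; last by rewrite scale1r.
rewrite scale1r (_ : decalage D [:: x.2] = 0).
  by apply: (mult0 Lok (s1 := [::])); [exact: pcoM c2| |exact: ok_in].
have /= -> := dec_us Lok (h := [:: x]) (pcoM gD) oI.
rewrite uD ?scaler0 //; apply: okb_sub; by case/andP: oI.
Qed.

Lemma dec_iter p j D P h : good D -> pco skew_chi p P -> h <> [::] -> okl h ->
  decalage (iter j (rho D) P) (us h) = hiter (decalage D) j (fun h => decalage P (us h)) h.
Proof.
move=> gD gP; have [cD rD] := good_dec gD; elim: j h => //= j IH h h0 oh.
have gj := pco_iter j gD gP.
rewrite (feq_us (dec_insertion Lok (pcoM gj) gD.1)) // (hrho_insertion gD gj) //.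
by apply: (hrho_eq cD rD (n := size h)) => // k k0 ok _; exact: IH.
Qed.

(** Sharper than [hiter_vanish] by one: the last application still needs two entries, so j
    applications need j + 1. This matches the range of the sum in [linf_exp]. *)
Lemma hiter_vanish1 D j Psi h : clos D -> prule false D -> okl h -> (0 < j)%N ->
  (size h <= j)%N -> hiter D j Psi h = 0.
Proof.
move=> cD rD; case: j => // j oh _; elim: j h oh => [|j IH] h oh sh.
all: rewrite -[RHS](Sh0 L sym_chi h); apply: (ShX oh) => I J oI oJ pIJ.
all: case: leqP => // sI; move: sh; rewrite -(perm_size pIJ) size_cat => sh.
  by have := leq_trans (leq_addr (size J) (size I)) sh; rewrite leqNgt sI.
apply: (IH ((lab false I, D (us I)) :: J)) => /=; first by rewrite (okb_D cD rD).
exact: (leq_trans (leq_add sI (leqnn (size J))) sh).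
Qed.

Lemma iter_vanish p j D P s : good D -> pco skew_chi p P -> (0 < j)%N -> s <> [::] ->
  in_sub s -> (size s <= j)%N -> iter j (rho D) P s = 0.
Proof.
move=> gD gP j0 s0 ss sj; have gj := pco_iter j gD gP; have [cD rD] := good_dec gD.
rewrite (mext Lok (pcoM gj) ss) -[RHS](ext0 s); apply: (ext_eq Lok) => // h oh sh.
have h0 : h <> [::] by move=> h0; move: sh s0; rewrite h0; case: (s).
have := dec_iter j gD gP h0 oh; rewrite dec_us //; last exact: pcoM gj.
rewrite (hiter_vanish1 _ cD rD) //; last by rewrite sh.
by move/eqP; rewrite scaler_eq0 signr_eq0 /= => /eqP.
Qed.

(** The exponential acting on an arbitrary family. The sum goes one term further than in [linf_exp];
    that term vanishes for good [D] by [iter_vanish]. *)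
Definition cexp D P : Defs.family L := fun s => \sum_(j < (size s).+1) ec R j *: iter j (rho D) P s.

(** For families defined by sums whose length grows with the arity: each condition in [pco] concerns
    a single arity, hence can be checked on one finite sum. *)
Lemma sum_feq_pco p N (F : nat -> Defs.family L) P : (forall j, pco skew_chi p (F j)) ->
  (forall n s, s <> [::] -> in_sub s -> (size s <= n)%N ->
  P s = \sum_(j < N n) F j s) -> pco skew_chi p P.
Proof.
move=> pF E.
have pS n : pco skew_chi p (\sum_(j < N n) F j).
  by elim/big_ind: _ => [|u v|i _]; [exact: pco0|exact: pcoD|exact: pF].
have ES n s : (\sum_(j < N n) F j) s = \sum_(j < N n) F j s.
  exact: (big_morph (fun f : Defs.family L => f s)).
have nn (T : Type) (t1 : seq T) (u : T) (t2 : seq T) : t1 ++ u :: t2 <> [::] by case: t1.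
split.
- move=> s s0 ss; rewrite (E (size s)) // -ES.
  by apply: (pcoC (pS _)).
- move=> s1 s2 a u v i1 i2 su sv.
  have ii w : gsub w -> in_sub (s1 ++ w :: s2).
    by move=> sw; apply/in_sub_cat; split=> //; apply/in_subc.
  rewrite !(E (size s1 + (size s2).+1)%N) ?size_cat //; try exact: ii; last first.
    by apply: ii; apply: gokP.
  by rewrite -!ES; apply: (pcoM (pS _)).
- move=> h1 h2 x y o1 o2 ox oy.
  have ii w z : okb w -> okb z -> in_sub (us (h1 ++ w :: z :: h2)).
    by move=> ow oz; apply: ok_in; rewrite all_cat /= o1 ow oz o2.
  have sz w z : size (us (h1 ++ w :: z :: h2)) = (size h1 + (size h2).+2)%N.
    by rewrite size_map size_cat.
  rewrite !(E (size h1 + (size h2).+2)%N) ?sz //; try exact: ii; try by rewrite us_cat; exact: nn.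
  by rewrite -!ES; apply: (pco_symm (pS _)).
- move=> h h0 oh; rewrite (E (size h)) ?size_map //; last 2 first.
  + exact: us_nil.
  + exact: ok_in.
  by rewrite -ES; apply: (pco_prule (pS _)).
Qed.

Lemma cexp_trunc p N D P s : good D -> pco skew_chi p P -> s <> [::] -> in_sub s ->
  (0 < N)%N -> (size s <= N)%N -> cexp D P s = \sum_(j < N) ec R j *: iter j (rho D) P s.
Proof.
move=> gD gP s0 ss N0 sN.
have V j : (size s <= j)%N -> (0 < j)%N -> ec R j *: iter j (rho D) P s = 0.
  by move=> sj j0; rewrite (iter_vanish gD gP) ?scaler0.
have s1 : (0 < size s)%N by case: (s) s0.
have aux M : (size s <= M)%N -> \sum_(j < M) ec R j *: iter j (rho D) P s =
    \sum_(j < size s) ec R j *: iter j (rho D) P s.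
  move=> sM; rewrite [RHS](big_ord_widen _ (fun j => ec R j *: iter j (rho D) P s) sM).
  rewrite [LHS](bigID (fun j : 'I_M => (j < size s)%N)) /= [X in _ + X]big1 ?addr0 // => j.
  by rewrite -leqNgt => sj; apply: V => //; exact: leq_trans sj.
by rewrite /cexp !aux.
Qed.

Lemma pco_cexp p D P : good D -> pco skew_chi p P -> pco skew_chi p (cexp D P).
Proof.
move=> gD gP; apply: (@sum_feq_pco p S (fun j => ec R j *: iter j (rho D) P)).
  by move=> j; apply: pcoZ => //; apply: pco_iter.
by move=> n s s0 ss sn; rewrite (cexp_trunc (N := n.+1) gD gP) // ltnW.
Qed.

Lemma id_hid h : id_family (us h) = hid h.
Proof. by case: h => [|x [|y h]]. Qed.

Lemma pco_id : pco skew_chi false (@id_family R L).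
Proof.
split.
- by case=> [|u [|v s]] //= _; [move/in_subc => []|move=> _; exact: gok0].
- move=> s1 s2 a u v _ _ _ _; case: s1 => [|w [|w' s1]]; case: s2 => [|w2 s2] //=;
  by rewrite ?scaler0 ?addr0.
- move=> h1 h2 x y _ _ _ _; case: h1 => [|z [|z' h1]] /=; by rewrite scaler0.
- case=> [|x [|y h]] //= _; last by rewrite (gpar0 Lok).
  by rewrite andbT /lab /= addbF negbK => /okb_par.
Qed.

Lemma linf_expE D : good D -> feq (linf_exp D) (cexp D (@id_family R L)).
Proof.
move=> gD s s0 ss; rewrite (cexp_trunc (N := size s) gD pco_id) //.
by case: (s) s0.
Qed.

Lemma pco_linf_exp D : good D -> pco skew_chi false (linf_exp D).
Proof. by move=> gD; apply: pco_feq (feqS (linf_expE gD)) _ => //; exact: pco_cexp pco_id. Qed.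

Lemma dec_cexp p D P h N : good D -> pco skew_chi p P -> h <> [::] -> okl h ->
  (size h <= N)%N -> (0 < N)%N ->
  decalage (cexp D P) (us h) = hexp (decalage D) N (fun h => decalage P (us h)) h.
Proof.
move=> gD gP h0 oh hN N0; rewrite dec_us //; last exact: pcoM (pco_cexp gD gP).
rewrite (cexp_trunc (N := N) gD gP) ?size_map //; last 2 first.
- exact: us_nil.
- exact: ok_in.
rewrite scaler_sumr; apply: eq_bigr => j _; rewrite -(dec_iter j gD gP) //.
by rewrite dec_us ?scalerA 1?mulrC //; exact: pcoM (pco_iter j gD gP).
Qed.

Lemma dec_id h : okl h -> decalage (@id_family R L) (us h) = hid h.
Proof.
move=> oh; rewrite dec_us //; last exact: pcoM pco_id.
by rewrite id_hid; case: h oh => [|x [|y h]] _; rewrite /= ?scaler0 ?scale1r.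
Qed.

(** An application of [sum_hcmp_hexp] to the decalage of [G], with a truncation common to all
    sublists of the argument. *)
Lemma coalg_comp_exp p D G : good D -> pco skew_chi p G ->
  feq (coalg_comp (decalage G) (decalage (linf_exp D))) (decalage (cexp D G)).
Proof.
move=> gD gG s s0 ss; have gc := pco_cexp gD gG; have [cD rD] := good_dec gD.
have gc' := pco_dec Lok skew_symE gc; have gG' := pco_dec Lok skew_symE gG.
rewrite coalg_compE [RHS](mext Lok (pcoM gc') ss).
apply: ext_eq => // h oh sh; have h0 : h <> [::].
  by move=> h0; move: sh s0; rewrite h0; case: (s).
have hN : (size h < (size s).+1)%N by rewrite sh.
rewrite (dec_cexp (N := (size s).+1) gD gG) //; last by rewrite sh.
rewrite -(sum_hcmp_hexp Lok cD rD (pcoM gG') (pco_symm gG') oh hN).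
apply: eq_bigr => k _; congr (_ *: _); apply: hcmp_eq => //.
- have := pcoC (pco_dec Lok skew_symE (pco_linf_exp gD)).
  by move=> cl k' k0 ok'; apply: cl; [exact: us_nil|exact: ok_in].
- move=> I I0 oI sI; have NI : (size I <= (size s).+1)%N by rewrite ltnW // -sh.
  have -> : decalage (linf_exp D) (us I) = decalage (cexp D (@id_family R L)) (us I).
    by apply: (feq_us (dec_feq Lok (linf_expE gD))).
  rewrite (dec_cexp (N := (size s).+1) gD pco_id) //.
  apply: eq_bigr => j _; congr (_ *: _).
  by apply: (hiter_eq cD rD (n := size I)) => // k' k0' ok' _; apply: dec_id.
Qed.

Lemma linf_comp_feq G G' P P' : clos P -> feq G G' -> feq P P' ->
  feq (linf_comp G P) (linf_comp G' P').
Proof.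
move=> cP EG EP; apply: (dec_feq Lok) => s s0 ss; rewrite !coalg_compE.
apply: ext_eq => // h oh sh; apply: eq_bigr => k _; congr (_ *: _).
have h0 : h <> [::] by move=> h0; move: sh s0; rewrite h0; case: (s).
have E1 := dec_feq Lok EG; have E2 := dec_feq Lok EP.
have cP' := dec_clos Lok cP.
case: k => -[|k] hk /=; first by case: h h0 {oh sh}.
apply: (ShX oh) => I J oI oJ _; case: nilP => // /eqP/eqP I0.
rewrite (feq_us E2) //.
have sI : gsub (decalage P' (us I)).
  by rewrite -(feq_us E2) //; apply: cP'; [exact: us_nil|exact: ok_in].
clear hk sh; move: (decalage P' (us I)) sI => u su.
have hc (F : Defs.family L) : clos F -> hclos (fun h => F (us h)).
  by move=> cF k0 k0' ok0; apply: cF; [exact: us_nil|exact: ok_in].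
apply: (hcmp_eq (h := J) _ (hc _ cP') oJ) => [I' I'0 oI' _|s' ss'].
  exact: (feq_us E2).
by apply: E1 => //; apply/in_subc.
Qed.

Lemma linf_comp_exp p D G : good D -> pco skew_chi p G -> feq (linf_comp G (linf_exp D)) (cexp D G).
Proof.
move=> gD gG; apply: feqT (dec_feq Lok (coalg_comp_exp gD gG)) _.
by apply: (decK Lok); exact: pcoM (pco_cexp gD gG).
Qed.

End LinfExp.

(** * The Baker-Campbell-Hausdorff formula for derivations *)

Section Reverse.
Context (R : realType).
Implicit Types (f g Z : nser R bool).

(** Inserting a derivation into a family is an action from the right, so words of derivations act in
    reversed order. *)
Definition rv f : nser R bool := fun w => f (rev w).

Lemma rvM f g : rv (f * g) = rv g * rv f.
Proof.
apply/funext => w; rewrite /rv !nserM /ser_mul size_rev.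
rewrite (reindex_inj rev_ord_inj) /=; apply: eq_bigr => i _.
have iw : (i <= size w)%N by rewrite -ltnS.
by rewrite subSS mulrC take_rev drop_rev subKn.
Qed.

Lemma rv1 : rv 1 = 1.
Proof. by apply/funext => w; rewrite /rv !nser1 /nilp size_rev. Qed.

Lemma rv_letter t : rv (letter R t) = letter R t.
Proof.
apply/funext => w; rewrite /rv /letter; congr (_ %:R); congr nat_of_bool.
by apply/eqP/eqP => [E|->//]; rewrite -[w]revK E.
Qed.

Lemma rv_psum c Z : rv (psum c Z) = psum c (rv Z).
Proof.
apply/funext => w; rewrite /rv /psum size_rev; apply: eq_bigr => k _; congr (_ * _).
rewrite -/(rv (Z ^+ k) w); congr (_ w); elim: (nat_of_ord k) => [|j IH].
  by rewrite !expr0 rv1.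
by rewrite exprS rvM IH exprSr.
Qed.
End Reverse.

Section FamilyBCH.
Context (R : realType) (L : glie R) (Lok : glieok L).
Local Notation X := (bool * L)%type.
Implicit Types (s : seq L) (h : seq X) (D P Q G : Defs.family L) (Psi : seq X -> L).
Local Notation okl := (all (@okb R L)).
Local Notation us := (@us R L).
Local Notation ShX := (@Sh_ext _ _ _ _ (@okb R L)).
Local Notation idf := (@id_family R L).

Lemma insh_local chi d P Q P' Q' n h : clos Q -> okl h -> (size h <= n)%N ->
  (forall s, s <> [::] -> in_sub s -> (size s <= n)%N -> P s = P' s) ->
  (forall s, s <> [::] -> in_sub s -> (size s <= n)%N -> Q s = Q' s) ->
  insh chi d P Q h = insh chi d P' Q' h.
Proof.
move=> cQ oh hn EP EQ; apply: (ShX oh) => I J oI oJ pIJ; case: nilP => // /eqP/eqP I0.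
have := perm_size pIJ; rewrite size_cat => e.
have sI : (size (us I) <= n)%N by rewrite size_map (leq_trans _ hn) // -e leq_addr.
have I1 := us_nil I0; have oI' := ok_in oI.
rewrite -EQ // EP //=.
  by apply/in_subc; split; [exact: cQ|exact: ok_in].
rewrite size_map (leq_trans _ hn) // -e -add1n leq_add2r lt0n.
by apply/eqP => /size0nil.
Qed.

Lemma insertion_local chi d P Q P' Q' n s : clos Q -> in_sub s -> (size s <= n)%N ->
  (forall s, s <> [::] -> in_sub s -> (size s <= n)%N -> P s = P' s) ->
  (forall s, s <> [::] -> in_sub s -> (size s <= n)%N -> Q s = Q' s) ->
  insertion chi d P Q s = insertion chi d P' Q' s.
Proof.
move=> cQ ss sn EP EQ; rewrite !insertionE; apply: (ext_eq Lok) => // h oh sh.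
by apply: (@insh_local _ _ _ _ _ _ n) => //; rewrite sh.
Qed.

(** The identity accepts one argument only, so the inserted family must take every entry. *)
Lemma insertion_id d P : clos P -> mult P -> feq (insertion skew_chi d idf P) P.
Proof.
move=> cP mP; apply: (feq_ok Lok) => //.
  by apply: insertion_mult => //; exact: pcoM (pco_id Lok).
move=> h h0 oh; rewrite ins_us //; last exact: pcoM (pco_id Lok).
have E (f : seq X -> L) k : Sh skew_chi (fun I J => if nilp J then f I else 0) k = f k.
  elim: k f => //= x k IH f; rewrite (IH (fun I => f (x :: I))).
  rewrite (_ : Sh _ _ _ = 0) ?addr0 // -[RHS](Sh0 L skew_chi k).
  by apply: Sh_eq => I J; rewrite scaler0.
rewrite -[RHS](E (fun I => P (us I))) -/(_ h) /insh.
have hne : forall I J, perm_eq (I ++ J) h -> nilp J -> nilp I = false.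
  move=> I J pIJ /nilP J0; move: pIJ; rewrite J0 cats0; case: I => // /perm_size /esym/size0nil.
  by move=> e; case: h0.
apply: (ShX oh) => I J oI oJ pIJ; have := hne I J pIJ.
case: J {oJ pIJ} => [|y J] /= H; last by case: ifP => // _; rewrite scaler0.
by rewrite (H isT) andbF scale1r.
Qed.

(** A cocycle commutes with the bracket, hence so do the powers of its coderivation, and hence the
    exponential. *)
Lemma linf_morph_exp D : glie_deg_ok L -> cochain 1 (@br_family R L) ->
  good D -> cochain 0 D -> feq (ce_diff false D) 0 -> linf_morph (linf_exp D).
Proof.
move=> Ldeg cbr gD cD eD; have /(cochainE Lok Ldeg)[pbr _] := cbr.
have /(cochainE Lok Ldeg)[pD dD] := cD.
have gE := pco_linf_exp Lok gD.
split.
  apply/(cochainE Lok Ldeg); split => //.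
  have di j : drule 0 (iter j (rho D) idf).
    elim: j => [|j IH]; last first.
      rewrite -[0]addr0; apply: drule_insertion => //; [|exact: pcoM pD|exact: pcoC pD].
      exact: pcoM (pco_iter Lok j gD (pco_id Lok)).
    move=> g g0 gg /=; case: g g0 gg => [|x [|y g]] //= _.
      rewrite andbT => /asboolP[_]; rewrite big_seq1; congr (ghom _ _).
      by rewrite addr0 addrK.
    by move=> _; exact: ghom0.
  move=> g g0 gg; apply: (ghom_sum Ldeg) => j.
  by rewrite -[_ *: _]addr0; apply: ghomP => //; [exact: di|exact: ghom0].
have com j : feq (insertion skew_chi true (iter j (rho D) idf) (@br_family R L))
                 (iter j (rho D) (@br_family R L)).
  elim: j => [|j IH]; first by apply: insertion_id; [exact: pcoC pbr|exact: pcoM pbr].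
  have pj := pco_iter Lok j gD (pco_id Lok).
  apply: feqT (rho_feq Lok gD IH) => /=.
  (* In the pre-Lie identity for the iterate, [D] and the bracket, the terms with the bracket inside
     [D] and with [D] inside the bracket agree by the cocycle condition and cancel. *)
  have E := skew_prelie Lok pj pD pbr; rewrite /= scale1r in E.
  have eb : feq (insertion skew_chi true D (@br_family R L)) (insertion skew_chi false (@br_family R L) D).
    move=> s s0 ss; have := eD s s0 ss; rewrite /ce_diff /nr_br /= scale1r => /eqP.
    by rewrite subr_eq0 => /eqP.
  have cb : clos (insertion skew_chi true D (@br_family R L)).
    exact: pcoC (pco_inskew Lok pD pbr).
  have e2 := insertion_feq Lok skew_chi true cb (feqR (iter j (rho D) idf)) eb.
  move=> s s0 ss; have := E s s0 ss; rewrite !famE e2 // => /addIr; exact.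
apply: feqT (feqS (dec_insertion Lok (pcoM gE) pbr)) _.
apply: feqT (feqS (coalg_comp_exp Lok gD pbr)).
apply: (dec_feq Lok) => s s0 ss; set n := size s.
(* The argument has fixed length, so the exponential may be replaced by a finite sum, on which
   insertion is linear. *)
pose S := \sum_(j < n.+1) ec R j *: iter j (rho D) idf.
have ES t : S t = \sum_(j < n.+1) ec R j *: iter j (rho D) idf t.
  exact: (big_morph (fun f : Defs.family L => f t)).
rewrite (@insertion_local _ _ _ _ S (@br_family R L) n) //; last 2 first.
- exact: pcoC pbr.
- move=> t t0 tt tn; rewrite (linf_expE Lok gD) // ES.
  by rewrite (cexp_trunc Lok (N := n.+1) gD (pco_id Lok)) // ltnW.
have lin (r : seq 'I_n.+1) : insertion skew_chi true (\sum_(j <- r) ec R j *: iter j (rho D) idf) (@br_family R L) s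
   = \sum_(j <- r) ec R j *: insertion skew_chi true (iter j (rho D) idf) (@br_family R L) s.
  elim: r => [|j r IH].
    rewrite !big_nil; have := insertionPl skew_chi true (-1) (0 : Defs.family L) 0 (@br_family R L).
    by rewrite scaler0 addr0 scaleN1r addNr => ->.
  by rewrite !big_cons insertionPl famE IH.
by rewrite lin; apply: eq_bigr => j _; rewrite com.
Qed.

(** The action of [D] with skew signs, on arbitrary functions of tagged lists: in this generality it
    is linear and local, as the substitution [act] requires. *)
Definition hrs D Psi h : L := Sh skew_chi (fun I J =>
  if (size I <= 1)%N then 0 else Psi ((lab false I, D (us I)) :: J)) h.

Lemma hrs_lin D (a : R) Psi Psi' : hrs D (a *: Psi + Psi') = a *: hrs D Psi + hrs D Psi'.
Proof.
apply/funext => h; transitivity (a *: hrs D Psi h + hrs D Psi' h) => //.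
rewrite /hrs -ShP; apply: Sh_eq => I J; case: leqP => // _.
by rewrite scaler0 addr0.
Qed.

Lemma hrs_loc D n Psi Psi' : (forall h, (size h < n)%N -> Psi h = Psi' h) ->
  forall h, (size h < n.+1)%N -> hrs D Psi h = hrs D Psi' h.
Proof.
move=> E h; rewrite ltnS => sh.
apply: (@Sh_ext _ _ _ _ xpredT) => [|I J _ _ pIJ]; first exact/allP.
case: leqP => // sI; apply: E => /=; apply: leq_trans sh.
by rewrite -(perm_size pIJ) size_cat -add2n leq_add2r.
Qed.

Lemma hrs_eq D Psi Psi' : good D -> (forall h, h <> [::] -> okl h -> Psi h = Psi' h) ->
  forall h, okl h -> hrs D Psi h = hrs D Psi' h.
Proof.
move=> [[cD _ _ rD] _] E h oh; apply: (ShX oh) => I J oI oJ _.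
by case: leqP => // sI; apply: E => //=; rewrite (okb_D cD rD).
Qed.

Lemma hrs_rho p D P h : good D -> pco skew_chi p P -> okl h ->
  hrs D (fun h => P (us h)) h = rho D P (us h).
Proof.
move=> [gD uD] gP oh; rewrite /rho ins_us //; first last.
- exact: pcoC gD.
- exact: pcoM gD.
- exact: pcoM gP.
apply: (ShX oh) => I J oI oJ _; case: I oI => [|x [|y I]] //=; last by rewrite scale1r.
rewrite andbT => ox; rewrite uD ?scale1r; last exact: okb_sub.
by rewrite (mult0 Lok (s1 := [::])) //; [exact: pcoM gP|exact: ok_in].
Qed.

End FamilyBCH.

Section FamilyBCH2.
Context (R : realType) (L : glie R) (Lok : glieok L).
Local Notation X := (bool * L)%type.
Implicit Types (s : seq L) (h : seq X) (D P Q G : Defs.family L) (Psi : seq X -> L).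
Implicit Types (f g Z : nser R bool) (w v : seq bool).
Local Notation okl := (all (@okb R L)).
Local Notation us := (@us R L).
Local Notation idf := (@id_family R L).

Lemma insertion0l chi d Q : insertion chi d 0 Q = 0 :> Defs.family L.
Proof.
have := insertionPl chi d (-1) (0 : Defs.family L) 0 Q.
by rewrite scaler0 addr0 scaleN1r addNr => ->.
Qed.

Lemma insertion0r chi d P : mult P -> feq (insertion chi d P (0 : Defs.family L)) 0.
Proof.
move=> mP s s0 ss.
have := @insertionPr _ _ Lok chi d (-1) P 0 0 mP (clos0 Lok) (clos0 Lok) s s0 ss.
by rewrite scaler0 addr0 famE scaleN1r famE addNr.
Qed.

Lemma insertion_sumr chi d P (I : Type) (r : seq I) (a : I -> R) (F : I -> Defs.family L) :
  mult P -> (forall i, clos (F i)) -> feq (insertion chi d P (\sum_(i <- r) a i *: F i))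
  (\sum_(i <- r) a i *: insertion chi d P (F i)).
Proof.
move=> mP cF; elim: r => [|i r IH]; first by rewrite !big_nil; apply: insertion0r.
have cS : clos (\sum_(i <- r) a i *: F i).
  elim: (r) => [|j r' IHr]; rewrite ?big_nil ?big_cons; first exact: (clos0 Lok).
  exact: closP.
rewrite !big_cons; apply: feqT (insertionPr Lok _ _ _ mP (cF i) cS) _.
exact: feqD.
Qed.

Lemma fam_sum (I : Type) (r : seq I) (F : I -> Defs.family L) s :
  (\sum_(i <- r) F i) s = \sum_(i <- r) F i s.
Proof. exact: (big_morph (fun f : Defs.family L => f s)). Qed.

Definition van n P := forall s, s <> [::] -> in_sub s -> (size s <= n)%N -> P s = 0.

(** On a list of length at most p + q, either [Q] receives a block of length at most q, or [P] is
    left with at most p arguments, the value of [Q] included. *)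
Lemma van_insertion chi d p q P Q : mult P -> clos Q -> van p P -> van q Q ->
  van (p + q) (insertion chi d P Q).
Proof.
move=> mP cQ vP vQ s s0 ss sn; rewrite insertionE -[RHS](ext0 s).
apply: (ext_eq Lok) => // h oh sh.
rewrite -[RHS](Sh0 L chi h); apply: (@Sh_ext _ _ _ _ (@okb R L) _ _ _ oh) => I J oI oJ pIJ.
case: nilP => // /eqP/eqP I0; have I1 := us_nil I0; have sI := ok_in oI.
have sJ := ok_in oJ; have [Iq|qI] := leqP (size I) q.
  by rewrite vQ ?size_map // (mult0 Lok (s1 := [::])) ?scaler0.
rewrite vP ?scaler0 //=; first by apply/in_subc; split => //; exact: cQ.
rewrite size_map -(leq_add2l q) [X in (_ <= X)%N]addnC (leq_trans _ sn) // -sh -(perm_size pIJ) size_cat.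
by rewrite addnS -addSn leq_add2r.
Qed.

Variables (D1 D2 : Defs.family L) (g1 : good D1) (g2 : good D2).
Definition D_ (t : bool) := if t then D1 else D2.
Lemma gD_ t : good (D_ t). Proof. by case: t. Qed.

Let al t := hrs (D_ t).
Lemma al_lin t (a : R) (Psi Psi' : seq X -> L) : al t (a *: Psi + Psi') = a *: al t Psi + al t Psi'.
Proof. exact: hrs_lin. Qed.
Lemma al_loc t n (Psi Psi' : seq X -> L) : (forall h, (size h < n)%N -> Psi h = Psi' h) ->
  forall h, (size h < n.+1)%N -> al t Psi h = al t Psi' h.
Proof. exact: hrs_loc. Qed.

Definition actr f Psi := act size al (rv f) Psi.

Lemma act_ok f Psi Psi' : (forall h, h <> [::] -> okl h -> Psi h = Psi' h) ->
  forall h, h <> [::] -> okl h -> act size al f Psi h = act size al f Psi' h.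
Proof.
move=> E h h0 oh; apply: eq_bigr => k _; apply: eq_bigr => w _; congr (_ *: _).
move: (tval w) => v; clear k w; elim: v h h0 oh => [|t v IH] h h0 oh /=; first exact: E.
by apply: (hrs_eq (gD_ t)).
Qed.

Lemma act_exp_letter p t P h : pco skew_chi p P -> h <> [::] -> okl h ->
  act size al (nexp (letter R t : nser R bool)) (fun h => P (us h)) h = cexp (D_ t) P (us h).
Proof.
move=> gP h0 oh; rewrite (act_psum al_lin al_loc (N := (size h).+1)) //; last exact: ord_letter.
rewrite /cexp size_map; apply: eq_bigr => k _; congr (_ *: _).
move: (nat_of_ord k) => j; clear k; elim: j h h0 oh => //= j IH h h0 oh.
rewrite (act_letter al_lin al_loc) -(hrs_rho Lok (gD_ t) (pco_iter Lok j (gD_ t) gP) oh).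
by apply: (hrs_eq (gD_ t)).
Qed.

Lemma unary0_rho p D P : good D -> pco skew_chi p P -> unary0 (rho D P).
Proof.
by move=> gD gP u su; apply: (iter_vanish Lok (j := 1) gD gP) => //; apply/in_subc.
Qed.

Lemma good_nr P Q : good P -> good Q -> good (nr_br false false P Q).
Proof.
move=> gP gQ; split; first exact: pco_nr gP.1 gQ.1.
move=> u su; rewrite /nr_br scale1r !famE.
by rewrite [insertion _ _ P Q _](unary0_rho gQ gP.1 su) [insertion _ _ Q P _](unary0_rho gP gQ.1 su) subrr.
Qed.

Definition nestedF v : Defs.family L := nested_br (nr_br false false) [seq D_ t | t <- v].

Lemma nestedF_cons b v : v <> [::] -> nestedF (b :: v) = nr_br false false (D_ b) (nestedF v).
Proof. by case: v. Qed.

Lemma good_nestedF v : v <> [::] -> good (nestedF v).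
Proof.
elim: v => [|b [|c v] IH] // _; first exact: gD_.
by rewrite nestedF_cons //; apply: good_nr; [exact: gD_|exact: IH].
Qed.

Lemma pco_nestedF v : pco skew_chi false (nestedF v).
Proof. by case: v => [|b v]; [exact: pco0|have [] := @good_nestedF (b :: v)]. Qed.

(** The pre-Lie identity, read as: insertion on the right is an anti-representation of the
    commutator bracket. *)
Lemma rho_nr p P D Q : good D -> good Q -> pco skew_chi p P ->
  feq (rho (nr_br false false D Q) P) (rho Q (rho D P) - rho D (rho Q P)).
Proof.
move=> gD gQ gP s s0 ss; have E := skew_prelie Lok gP gD.1 gQ.1 s0 ss.
rewrite /nr_br scale1r /rho famE.
have -> : insertion skew_chi false D Q - insertion skew_chi false Q D =
  (-1) *: insertion skew_chi false Q D + insertion skew_chi false D Q.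
  by rewrite scaleN1r addrC.
rewrite (insertionPr Lok) //; last 3 first.
- exact: pcoM gP.
- exact: pcoC (pco_inskew Lok gQ.1 gD.1).
- exact: pcoC (pco_inskew Lok gD.1 gQ.1).
move: E; rewrite /= scale1r !famE scaleN1r => /eqP.
rewrite subr_eq => /eqP ->; abelian.
Qed.

Lemma actr_nested p v P h : v <> [::] -> pco skew_chi p P -> h <> [::] -> okl h ->
  actr (nested R v) (fun h => P (us h)) h = rho (nestedF v) P (us h).
Proof.
move=> v0 gP; elim: v v0 P gP h => [|b v IH] // _ P gP h h0 oh.
case: v IH => [|c v] IH.
  rewrite /actr rv_letter (act_letter al_lin al_loc).
  exact: (hrs_rho Lok (gD_ b) gP oh).
set N := c :: v in IH *; have gN : good (nestedF N) by apply: good_nestedF.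
rewrite nested_cons // nestedF_cons // /actr.
have -> : rv (comm (letter R b : nser R bool) (nested R N)) =
    (-1) *: ((letter R b : nser R bool) * rv (nested R N)) + rv (nested R N) * letter R b.
  have rvB f g : rv (f - g) = rv f - rv g by [].
  rewrite /comm rvB !rvM rv_letter scaleN1r; exact: addrC.
rewrite act_linl !(act_mul al_lin al_loc) !(act_letter al_lin al_loc).
rewrite -[LHS]/((-1) *: al b (actr (nested R N) (fun h => P (us h))) h +
  actr (nested R N) (al b (fun h => P (us h))) h).
have eb k : k <> [::] -> okl k -> al b (fun h => P (us h)) k = rho (D_ b) P (us k).
  by move=> _ ok; exact: (hrs_rho Lok (gD_ b) gP ok).
rewrite [X in _ + X](act_ok _ eb h0 oh) -/(actr _ _) (IH _ _ (pco_rho Lok (gD_ b) gP)) //.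
have eN k : k <> [::] -> okl k -> actr (nested R N) (fun h => P (us h)) k = rho (nestedF N) P (us k).
  by move=> k0 ok; exact: IH.
have -> : al b (actr (nested R N) (fun h => P (us h))) h = rho (D_ b) (rho (nestedF N) P) (us h).
  rewrite -(hrs_rho Lok (gD_ b) (pco_rho Lok gN gP) oh); exact: (hrs_eq (gD_ b) eN oh).
rewrite (feq_us (rho_nr (gD_ b) gN gP)) // !famE scaleN1r addrC.
by [].
Qed.

(** Coefficient of a word in Dynkin's form: that of log(exp(x) exp(y)), divided by the length. The
    empty word gets 0, by the convention on division by zero. *)
Definition bchc v : R := log_exp_exp R v / (size v)%:R.
Definition bch : Defs.family L := fun s =>
  \sum_(k < (size s).+1) tsum k (fun v => bchc v *: nestedF v s).
Definition bchp k : Defs.family L := \sum_(v : k.-tuple bool) bchc v *: nestedF v.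

Lemma pco_bch_part k : pco skew_chi false (bchp k).
Proof.
rewrite /bchp; elim/big_ind: _ => [|P Q|v _]; [exact: pco0|exact: pcoD|].
by apply: pcoZ => //; exact: pco_nestedF.
Qed.

Lemma van_nestedF v : van (size v) (nestedF v).
Proof.
elim: v => [|b [|c v] IH] //.
  move=> s s0 ss s1; have [_ u0] := gD_ b; case: s s0 ss s1 => [|u [|u' s]] //= _ ss _.
  by apply: u0; case/in_subc: ss.
have gN := pco_nestedF (c :: v); have gb := (gD_ b).1.
have vb : van 1 (D_ b).
  move=> s s0 ss s1; have [_ u0] := gD_ b; case: s s0 ss s1 => [|u [|u' s]] //= _ ss _.
  by apply: u0; case/in_subc: ss.
rewrite nestedF_cons // => s s0 ss sn; rewrite /nr_br scale1r !famE.
rewrite (van_insertion _ _ (pcoM gb) (pcoC gN) vb IH) //.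
by rewrite (van_insertion _ _ (pcoM gN) (pcoC gb) IH vb) ?subrr // addn1.
Qed.

Lemma bchE n s : s <> [::] -> in_sub s -> (size s <= n)%N -> bch s = \sum_(k < n.+1) bchp k s.
Proof.
move=> s0 ss sn; rewrite /bch.
have E k : tsum k (fun v => bchc v *: nestedF v s) = bchp k s by rewrite /bchp fam_sum.
rewrite (eq_bigr _ (fun k _ => E (nat_of_ord k))).
rewrite (big_ord_widen n.+1 (fun k => bchp k s)) // [RHS](bigID (fun k : 'I_n.+1 => (k < (size s).+1)%N)) /=.
rewrite [X in _ = _ + X]big1 ?addr0 // => k; rewrite -leqNgt => sk.
rewrite /bchp fam_sum; apply: big1 => v _; rewrite famE van_nestedF ?scaler0 //.
by rewrite size_tuple ltnW.
Qed.

Lemma good_bch : good bch.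
Proof.
split; first by apply: (@sum_feq_pco _ _ Lok _ S bchp); [exact: pco_bch_part|exact: bchE].
move=> u su; have iu : in_sub [:: u] by apply/in_subc.
rewrite (bchE (n := 1)) // big_ord_recl big_ord1 /bchp !fam_sum.
rewrite !big1 ?addr0 // => v _; rewrite famE; first by rewrite van_nestedF ?size_tuple ?scaler0.
have : size v = 0%N by rewrite size_tuple.
by move/size0nil => ->; rewrite scaler0.
Qed.

(** Nested brackets of derivations act as the nested brackets of the letters, and by [dynkin] these
    add up to the series log(exp(x) exp(y)) itself. *)
Lemma bch_act p P h : pco skew_chi p P -> h <> [::] -> okl h ->
  rho bch P (us h) = actr (log_exp_exp R) (fun h => P (us h)) h.
Proof.
move=> gP h0 oh; set n := size h.
pose S := \sum_(k < n.+1) \sum_(v : k.-tuple bool) bchc v *: nestedF v.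
have E1 : rho bch P (us h) = insertion skew_chi false P S (us h).
  apply: (@insertion_local _ _ Lok _ _ _ _ _ _ n) => //.
  - exact: pcoC good_bch.1.
  - exact: ok_in.
  - by rewrite size_map.
  - by move=> s s0 ss sn; rewrite (bchE (n := n)) // /S fam_sum.
have mP := pcoM gP.
have E2 : feq (insertion skew_chi false P S)
  (\sum_(k < n.+1) \sum_(v : k.-tuple bool) bchc v *: rho (nestedF v) P).
  have -> : S = \sum_(k < n.+1) (1 : R) *: bchp k by apply: eq_bigr => k _; rewrite scale1r.
  apply: feqT (insertion_sumr _ _ _ _ mP _) _ => [k|]; first exact: pcoC (pco_bch_part k).
  move=> s s0 ss; rewrite !fam_sum; apply: eq_bigr => k _; rewrite famE scale1r.
  by apply: insertion_sumr => // v; exact: pcoC (pco_nestedF _).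
rewrite E1 (feq_us E2) // fam_sum.
pose Lp : nser R bool := \sum_(k < n.+1) \sum_(v : k.-tuple bool) bchc v *: nested R v.
(* On words of length at most [n] the series equals its expansion in nested brackets; this is
   [dynkin] read at the reversed word. *)
have -> : actr (log_exp_exp R) (fun h => P (us h)) h = actr Lp (fun h => P (us h)) h.
  apply: (act_ext al_lin al_loc (N := n.+1)) => // w; rewrite ltnS => sw; rewrite /rv.
  have -> : Lp (rev w) = tsum (size w) (fun v => bchc v * nested R v (rev w)).
    rewrite /Lp nser_sum (bigD1 (inord (size w))) //= inordK // nser_sum.
    rewrite [X in _ + X]big1 ?addr0 // => k kw; rewrite nser_sum big1 // => v _.
    rewrite nserZ nested_hom ?mulr0 // size_rev size_tuple; apply: contra kw => /eqP kw.
    by apply/eqP/val_inj; rewrite /= inordK.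
  have [->|w0] := eqVneq w [::].
    rewrite tsum0 (_ : nested R [::] (rev [::]) = 0) // mulr0.
    by rewrite /log_exp_exp big_geq.
  have sw0 : ((size w)%:R : R) != 0 by rewrite pnatr_eq0 size_eq0.
  apply: (mulfI sw0); have := dynkin R (rev w); rewrite size_rev => ->.
  rewrite /tsum mulr_sumr; apply: eq_bigr => v _; rewrite /bchc size_tuple.
  by rewrite mulrA mulrCA divff // mulr1.
have lin (I : Type) (r : seq I) (F : I -> nser R bool) :
    actr (\sum_(i <- r) F i) (fun h => P (us h)) h = \sum_(i <- r) actr (F i) (fun h => P (us h)) h.
  rewrite /actr; have -> : rv (\sum_(i <- r) F i) = \sum_(i <- r) rv (F i).
    by apply/funext => w; rewrite /rv !nser_sum.
  exact: act_sum.
rewrite lin; apply: eq_bigr => k _; rewrite fam_sum lin; apply: eq_bigr => v _.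
have -> : actr (bchc v *: nested R v) (fun h => P (us h)) h =
   bchc v *: actr (nested R v) (fun h => P (us h)) h.
  rewrite /actr /act scaler_sumr; apply: eq_bigr => j _.
  rewrite /tsum scaler_sumr; apply: eq_bigr => u _; by rewrite scalerA.
rewrite famE; have [v0|v0] := eqVneq (tval v) [::]; last by rewrite (actr_nested (p := p)) //; exact/eqP.
by rewrite v0 /bchc /= invr0 mulr0 !scale0r.
Qed.

Lemma bch_iter_act p j P h : pco skew_chi p P -> h <> [::] -> okl h ->
  iter j (rho bch) P (us h) = iter j (act size al (rv (log_exp_exp R))) (fun h => P (us h)) h.
Proof.
move=> gP; elim: j h => //= j IH h h0 oh.
rewrite (bch_act (pco_iter Lok j good_bch gP)) //; exact: act_ok.
Qed.

Lemma ord_rv f : ord 1 f -> ord 1 (rv f).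
Proof. by move=> of1 w sw; apply: of1; rewrite size_rev. Qed.

Lemma cexp_bch p P : pco skew_chi p P -> feq (cexp D2 (cexp D1 P)) (cexp bch P).
Proof.
move=> gP; have p1 := pco_cexp Lok g1 gP.
apply: (feq_ok Lok); [exact: pcoM (pco_cexp Lok g2 p1)|exact: pcoM (pco_cexp Lok good_bch gP)|].
move=> h h0 oh; rewrite -(act_exp_letter false p1) //.
have e1 k : k <> [::] -> okl k -> cexp D1 P (us k) =
    act size al (nexp (letter R true : nser R bool)) (fun h => P (us h)) k.
  by move=> k0 ok; rewrite -(act_exp_letter true gP).
rewrite (act_ok _ e1 h0 oh) -(act_mul al_lin al_loc).
have oL : ord 1 (rv (log_exp_exp R)).
  by apply: ord_rv; rewrite log_exp_expE; apply: psum_ord1.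
(* Reversal exchanges the two factors: exp(y) exp(x) is the reversal of exp(x) exp(y), hence the
   exponential of the reversed series. *)
have -> : (nexp (letter R false) : nser R bool) * nexp (letter R true) = psum (ec R) (rv (log_exp_exp R)).
  rewrite -rv_psum -/(nexp _) log_exp_expE nexp_nlog; last exact: ord_expexp.
  by rewrite /expexp -nserM rvM !exp_letterE /nexp !rv_psum !rv_letter.
rewrite (act_psum al_lin al_loc (N := (size h).+1)) // /cexp size_map.
by apply: eq_bigr => j _; rewrite (bch_iter_act _ gP).
Qed.

Lemma linf_exp_bch : feq (linf_comp (linf_exp D1) (linf_exp D2)) (linf_exp bch).
Proof.
have pid := pco_id Lok; have p1 := pco_linf_exp Lok g1.
apply: feqT (linf_comp_exp Lok g2 p1) _.
apply: feqT (feqS (linf_expE Lok good_bch)).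
apply: feqT (cexp_bch pid).
move=> s s0 ss; apply: eq_bigr => j _; congr (_ *: _).
exact: (iter_feq Lok j g2 (linf_expE Lok g1)).
Qed.

End FamilyBCH2.

(** * Inverses and homotopies of exponentials *)

Section Gauge.
Context (R : realType) (L : glie R) (Lok : glieok L) (Ldeg : glie_deg_ok L).
Local Notation X := (bool * L)%type.
Implicit Types (s : seq L) (h D P Q G : Defs.family L).
Local Notation okl := (all (@okb R L)).
Local Notation us := (@us R L).
Local Notation idf := (@id_family R L).
Local Notation br := (@br_family R L).

Lemma iter_feqD D D' P P' j : good D -> feq D D' -> feq P P' ->
  feq (iter j (rho D) P) (iter j (rho D') P').
Proof.
move=> gD E EP; elim: j => //= j IH.
by apply: insertion_feq => //; exact: pcoC gD.1.
Qed.

Lemma linf_exp_feq D D' : good D -> feq D D' -> feq (linf_exp D) (linf_exp D').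
Proof.
move=> gD E s s0 ss; apply: eq_bigr => j _; congr (_ *: _).
exact: (iter_feqD j gD E (feqR _)).
Qed.

Lemma cexp_feq D P P' : good D -> feq P P' -> feq (cexp D P) (cexp D P').
Proof.
move=> gD E s s0 ss; apply: eq_bigr => j _; congr (_ *: _); exact: (iter_feq Lok j gD E).
Qed.

Lemma good0 : good (0 : Defs.family L).
Proof. by split; [exact: pco0|]. Qed.

Lemma goodP (a : R) D D' : good D -> good D' -> good (a *: D + D').
Proof.
move=> [g u] [g' u']; split; first exact: pcoP.
by move=> w sw; rewrite !famE u // u' // scaler0 addr0.
Qed.

Lemma goodN D : good D -> good (- D).
Proof. by move=> gD; rewrite -scaleN1r -[_ *: _]addr0; apply: goodP => //; exact: good0. Qed.

Lemma linf_exp0 D : good D -> feq D 0 -> feq (linf_exp D) idf.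
Proof.
move=> gD E s s0 ss; rewrite /linf_exp.
case E0: (size s) => [|n]; first by move/size0nil: E0 s0 => ->.
rewrite big_ord_recl /= invr1 scale1r big1 ?addr0 // => j _ /=.
rewrite [X in _ *: X](_ : _ = 0) ?scaler0 //.
have e := @insertion_feq _ _ Lok skew_chi false _ _ _ _ (pcoC gD.1)
  (feqR (iter (bump 0 j).-1 (rho D) idf)) E.
rewrite -[LHS]/(insertion skew_chi false (iter (bump 0 j).-1 (rho D) idf) D s) e //.
by apply: (insertion0r Lok) => //; exact: pcoM (pco_iter Lok _ gD (pco_id Lok)).
Qed.

Lemma nr_feq0 p q P Q : pco skew_chi p P -> pco skew_chi q Q -> feq Q 0 -> feq (nr_br p q P Q) 0.
Proof.
move=> gP gQ E; have z : pco skew_chi q (0 : Defs.family L) by exact: pco0.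
apply: feqT (nr_feq Lok p q (pcoC gP) (pcoC gQ) (feqR P) E) _.
move=> s s0 ss; rewrite /nr_br !famE insertion0l insertion0r //; last exact: pcoM gP.
by rewrite scaler0 subrr.
Qed.

Lemma nrN D P : good D -> pco skew_chi false P ->
  feq (nr_br false false (- D) P) (- nr_br false false D P).
Proof.
move=> [gD _] gP; have := @nrPl _ _ Lok false false (-1) D 0 P (pcoM gP) (pcoC gP) (pcoC gD) (clos0 Lok).
rewrite !scaleN1r addr0 => E; apply: feqT E _ => s s0 ss; rewrite !famE.
have -> : nr_br false false 0 P = - nr_br false false P 0 by rewrite nr_anti scale1r.
by rewrite famE (nr_feq0 gP (pco0 Lok _ _) (feqR _)) // oppr0 addr0.
Qed.

Section Ideal.
(** An abstract filtered ideal: once [D1 + D2] and the bracket of [D1] and [D2] lie in it, so does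
    the whole series. It is used for the zero ideal, to invert exponentials, and for exact
    derivations, to produce homotopies. *)
Variable J : nat -> Defs.family L -> Prop.
Hypothesis J_feq : forall n P Q, feq P Q -> J n P -> J n Q.
Hypothesis J_0 : forall n, J n 0.
Hypothesis J_lin : forall n (a : R) P Q, pco skew_chi false P -> pco skew_chi false Q ->
  J n P -> J n Q -> J n (a *: P + Q).
Variables (D1 D2 : Defs.family L) (g1 : good D1) (g2 : good D2).
Hypothesis J_nr : forall n b P, pco skew_chi false P -> J n P -> J n.+1 (nr_br false false (D_ D1 D2 b) P).
Hypothesis J_sum : forall (F : nat -> Defs.family L), (forall k, pco skew_chi false (F k)) ->
  (forall k, van k (F k)) -> (forall k, J k (F k)) -> J 0 (fun s => \sum_(k < (size s).+1) F k s).
Hypothesis J_D : J 0 (D1 + D2).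
Hypothesis J_12 : J 1 (nr_br false false D1 D2).

(** A nested bracket of two letters is 0 or, up to sign, the bracket of [D1] and [D2]; longer ones
    stay in the ideal. Words of length one are exempt because only the sum of the two letters is
    assumed to lie in it. *)
Lemma J_nested v : J (size v).-1 (nestedF D1 D2 v) \/ size v = 1%N.
Proof.
elim: v => [|b [|c v] IH]; [by left; exact: J_0|by right|left].
rewrite nestedF_cons //; case: IH => [|[/size0nil ->]]; first exact: (J_nr _ (pco_nestedF Lok g1 g2 _)).
have nn P : nr_br false false P P = 0 by rewrite /nr_br scale1r subrr.
rewrite -[nestedF _ _ [:: c]]/(D_ D1 D2 c); case: b; case: c => /=; rewrite ?nn //.
rewrite nr_anti scale1r -scaleN1r -[_ *: _]addr0; apply: J_lin => //.
  exact: pco_nr g1.1 g2.1.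
exact: pco0.
Qed.

Lemma lee1 b : log_exp_exp R [:: b] = 1.
Proof.
rewrite /log_exp_exp /= big_nat1 /= expr0 divr1 mul1r ser_mulr1.
rewrite -[LHS]/(ser_mul _ _ [:: b] - _) ser_mul_cons ser_mul_nil /dshift /exp_letter /ser_one /=.
by case: b; rewrite /= !invr1 /=; ring.
Qed.

Lemma J_bch : J 0 (bch D1 D2).
Proof.
(* Words of length k + 1 are placed at index k, since their brackets lie in step k of the
   filtration. The linear part [D1 + D2] is treated apart, so index 0 holds 0. *)
pose F k := if k is k'.+1 then bchp D1 D2 k'.+2 else 0 : Defs.family L.
have pF k : pco skew_chi false (F k) by case: k => [|k]; [exact: pco0|exact: pco_bch_part].
have vp k : van k (bchp D1 D2 k).
  move=> s s0 ss sk; rewrite /bchp fam_sum big1 // => v _.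
  by rewrite famE (van_nestedF Lok g1 g2) ?size_tuple ?scaler0.
have vF k : van k (F k).
  by case: k => [|k] s s0 ss sk //; apply: vp => //; exact: leq_trans sk _.
apply: (J_feq (P := 1 *: (D1 + D2) + (fun s => \sum_(k < (size s).+1) F k s))); last first.
  apply: J_lin => //; [exact: pcoD g1.1 g2.1| |apply: J_sum => //].
    apply: (@sum_feq_pco _ _ Lok _ S F) => // n s s0 ss sn.
    rewrite (big_ord_widen n.+1 (fun k => F k s)) // [RHS](bigID (fun k : 'I_n.+1 => (k < (size s).+1)%N)) /=.
    rewrite [X in _ = _ + X]big1 ?addr0 // => k; rewrite -leqNgt => sk.
    by rewrite vF // ltnW.
  move=> [|k]; first exact: J_0.
  rewrite /F /bchp.
  suff : pco skew_chi false (bchp D1 D2 k.+2) /\ J k.+1 (bchp D1 D2 k.+2) by case.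
  rewrite /bchp; elim/big_ind: _ => [|P Q [p1 j1] [p2 j2]|v _].
  - by split; [exact: pco0|].
  - by split; [exact: pcoD|rewrite -[P]scale1r; exact: J_lin].
  - split; first by apply: pcoZ => //; exact: pco_nestedF.
    rewrite -[_ *: _]addr0; apply: J_lin => //; [exact: pco_nestedF|exact: pco0|].
    by case: (J_nested v); rewrite size_tuple.
move=> s s0 ss; rewrite !famE scale1r (bchE Lok g1 g2 (n := (size s).+1)) //.
rewrite [RHS]big_ord_recl [X in _ = X + _](_ : _ = 0); last first.
  rewrite /bchp fam_sum big1 // => v _; rewrite famE.
  have /size0nil -> : size v = 0%N by rewrite size_tuple.
  by rewrite scaler0.
rewrite add0r [RHS]big_ord_recl; congr (_ + _).
  rewrite /bchp fam_sum -[LHS]/(D1 s + D2 s).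
  rewrite -[RHS]/(tsum 1 (fun v => bchc R v *: nestedF D1 D2 v s)) tsumS big_bool !tsum0.
  by rewrite /bchc !lee1 divr1 !scale1r.
by rewrite big_ord_recl /= add0r.
Qed.

End Ideal.

(** The series of (D, -D) has linear part 0 and starts with a vanishing bracket, so it lies in the
    zero ideal and its exponential is the identity. *)
Lemma linf_exp_inv D : good D -> feq (linf_comp (linf_exp D) (linf_exp (- D))) idf.
Proof.
move=> gD; have gN := goodN gD.
apply: feqT (linf_exp_bch Lok gD gN) _.
apply: linf_exp0; first exact: good_bch.
apply: (@J_bch (fun _ F => feq F 0)) => //.
- by move=> _ P Q E; apply: feqT; exact: feqS.
- move=> _ a P Q _ _ EP EQ s s0 ss; by rewrite !famE EP // EQ // scaler0 addr0.
- by move=> _ b P gP E; apply: nr_feq0 => //; case: b; case: gD => // ? _; case: gN.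
- by move=> F _ _ EF s s0 ss; apply: big1 => k _; exact: EF.
- by rewrite subrr.
- have nn P : nr_br false false P P = 0 by rewrite /nr_br scale1r subrr.
  rewrite nr_anti scale1r; move=> s s0 ss; rewrite famE (nrN gD gD.1) // famE nn.
  by rewrite !oppr0.
Qed.

Lemma linf_aut_exp D : cochain 1 br -> good D -> cochain 0 D -> feq (ce_diff false D) 0 ->
  linf_aut (linf_exp D).
Proof.
move=> cbr gD cD eD; have gN := goodN gD; have /(cochainE Lok Ldeg)[pb _] := cbr.
have cN : cochain 0 (- D).
  by rewrite -scaleN1r -[_ *: _]addr0; apply: cochainP => //; exact: cochain0.
split; first exact: linf_morph_exp.
exists (linf_exp (- D)); split; [|exact: linf_exp_inv|]; last first.
  by have := linf_exp_inv gN; rewrite opprK.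
apply: linf_morph_exp => // s s0 ss.
have := @nrPr _ _ Lok true false (-1) br D 0 (pcoM pb) (pcoC pb) (pcoC gD.1) (clos0 Lok) s s0 ss.
rewrite !scaleN1r addr0 => E; rewrite /ce_diff E famE famN [nr_br _ _ _ D s]eD // oppr0 add0r.
exact: (nr_feq0 pb (pco0 Lok _ _) (feqR _)).
Qed.

Section Exact.
Hypothesis cbr : cochain 1 br.
Let pb : pco skew_chi true br. Proof. by have /(cochainE Lok Ldeg)[] := cbr. Qed.

(** The differential is a bracket with the structure, so Jacobi makes it a derivation; the term with
    the differential of [P] vanishes. *)
Lemma nr_exact P h : pco skew_chi false P -> pco skew_chi true h -> feq (ce_diff false P) 0 ->
  feq (nr_br false false P (ce_diff true h)) (ce_diff true (nr_br false true P h)).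
Proof.
move=> gP gh E s s0 ss; have := nr_jacobi Lok pb gP gh s0 ss; rewrite /= scale1r famE.
rewrite -!/(ce_diff _ _) => e; rewrite [RHS]e; symmetry.
rewrite nr_anti famE famE [X in _ *: X](nr_feq0 gh _ E) // ?scaler0 ?oppr0 ?add0r //.
exact: (pco_nr Lok pb gP).
Qed.

Lemma ce_diffP p (a : R) P Q : clos P -> clos Q ->
  feq (ce_diff p (a *: P + Q)) (a *: ce_diff p P + ce_diff p Q).
Proof. by move=> cP cQ; apply: nrPr => //; [exact: pcoM pb|exact: pcoC pb]. Qed.

Lemma ce_diff0 p : feq (ce_diff p (0 : Defs.family L)) 0.
Proof. exact: (nr_feq0 pb (pco0 Lok _ p) (feqR _)). Qed.

Lemma ce_diff_local p P Q n s : clos P -> clos Q -> in_sub s -> (size s <= n)%N ->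
  (forall s, s <> [::] -> in_sub s -> (size s <= n)%N -> P s = Q s) ->
  ce_diff p P s = ce_diff p Q s.
Proof.
move=> cP cQ ss sn E; rewrite /ce_diff /nr_br !famE; congr (_ - _ *: _).
  exact: (@insertion_local _ _ Lok _ _ _ _ _ _ n).
by apply: (@insertion_local _ _ Lok _ _ _ _ _ _ n) => //; exact: pcoC pb.
Qed.

(** The bound on the arity of the primitive is what allows infinitely many primitives to be added:
    in each arity only finitely many are non-zero. *)
Definition Jex n (F : Defs.family L) := exists h, [/\ cochain (-1) h, van n h & feq F (ce_diff true h)].

Lemma pcoh h : cochain (-1) h -> pco skew_chi true h.
Proof. by move/(cochainE Lok Ldeg) => []. Qed.

Lemma Jex_sum (F : nat -> Defs.family L) : (forall k, van k (F k)) -> (forall k, Jex k (F k)) ->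
  Jex 0 (fun s => \sum_(k < (size s).+1) F k s).
Proof.
move=> vF /choice[h hP].
have ph k : pco skew_chi true (h k) by have [/pcoh] := hP k.
have vh k : van k (h k) by have [] := hP k.
have wide (G : nat -> Defs.family L) n s : (forall k, van k (G k)) -> s <> [::] -> in_sub s -> (size s <= n)%N ->
    \sum_(k < (size s).+1) G k s = \sum_(k < n.+1) G k s.
  move=> vG s0 ss sn.
  rewrite (big_ord_widen n.+1 (fun k => G k s)) // [RHS](bigID (fun k : 'I_n.+1 => (k < (size s).+1)%N)) /=.
  rewrite [X in _ = _ + X]big1 ?addr0 // => k; rewrite -leqNgt => sk.
  by rewrite vG // ltnW.
pose H : Defs.family L := fun s => \sum_(k < (size s).+1) h k s.
have pH : pco skew_chi true H.
  by apply: (@sum_feq_pco _ _ Lok _ S h) => // n s s0 ss sn; exact: wide.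
exists H; split.
- apply/(cochainE Lok Ldeg); split => // g g0 gg; apply: (ghom_sum Ldeg) => k.
  by have [/(cochainE Lok Ldeg)[_ dh] _ _] := hP k; exact: dh.
- by move=> s s0 ss; case: s s0 ss.
move=> s s0 ss; set n := size s.
pose S := \sum_(k < n.+1) h k.
have pS : pco skew_chi true S.
  by rewrite /S; elim/big_ind: _ => [|u v|k _]; [exact: pco0|exact: pcoD|exact: ph].
rewrite [RHS](@ce_diff_local _ _ S n) //; first last.
- by move=> t t0 tt tn; rewrite /S fam_sum; exact: wide.
- exact: pcoC pS.
- exact: pcoC pH.
rewrite {pS}/S; have -> : \sum_(k < n.+1) F k s = \sum_(k < n.+1) ce_diff true (h k) s.
  by apply: eq_bigr => k _; have [_ _ ->] := hP k.
elim: (index_enum _) => [|k r IH]; first by rewrite !big_nil ce_diff0.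
have cS : clos (\sum_(k <- r) h (nat_of_ord k)).
  elim: (r) => [|j r' IHr]; rewrite ?big_nil ?big_cons; first exact: (clos0 Lok).
  by rewrite -[h j]scale1r; apply: (closP Lok) => //; exact: pcoC (ph _).
rewrite !big_cons IH -[h k]scale1r ce_diffP //; last exact: pcoC (ph _).
by rewrite famE famE !scale1r.
Qed.

Lemma cochain_nr0 D h : cochain 0 D -> cochain (-1) h -> cochain (-1) (nr_br false true D h).
Proof. by move=> cD ch; have := cochain_nr Lok Ldeg cD ch; rewrite add0r. Qed.

(** The ideal argument for exact derivations. Bracketing with a derivation without unary part raises
    by one the arity up to which a primitive vanishes. *)
Lemma Jex_bch D D' h : good D -> cochain 0 D -> feq (ce_diff false D) 0 ->
  good D' -> cochain 0 D' -> feq (ce_diff false D') 0 ->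
  cochain (-1) h -> feq (D' - D) (ce_diff true h) -> Jex 0 (bch (- D) D').
Proof.
move=> gD cD eD gD' cD' eD' ch E; have gN := goodN gD; have ph := pcoh ch.
have vD b P : good P -> van 1 (D_ (- D) D' b).
  move=> _ s s0 ss s1; have [_ u0] := gD_ gN gD' b.
  case: s s0 ss s1 => [|u [|u' s]] //= _ ss _; by apply: u0; case/in_subc: ss.
have cN : cochain 0 (- D).
  by rewrite -scaleN1r -[_ *: _]addr0; apply: cochainP => //; exact: cochain0.
have eN : feq (ce_diff false (- D)) 0.
  move=> s s0 ss; have := ce_diffP false (-1) (pcoC gD.1) (clos0 Lok) s0 ss.
  by rewrite !scaleN1r addr0 => ->; rewrite !famE eD // ce_diff0 // oppr0 addr0.
have Jlin n (a : R) P Q : Jex n P -> Jex n Q -> Jex n (a *: P + Q).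
  move=> [k [ck vk ek]] [k' [ck' vk' ek']]; exists (a *: k + k'); split.
  - exact: cochainP.
  - by move=> s s0 ss sn; rewrite !famE vk // vk' // scaler0 addr0.
  - apply: feqT (feqP a ek ek') _; apply: feqS.
    by apply: ce_diffP; [exact: pcoC (pcoh ck)|exact: pcoC (pcoh ck')].
have J0 n : Jex n 0.
  exists 0; split => //; first exact: cochain0.
  exact: feqS (ce_diff0 _).
have Jnr n b P : Jex n P -> pco skew_chi false P -> Jex n.+1 (nr_br false false (D_ (- D) D' b) P).
  move=> [k [ck vk ek]] gP.
  have gb := gD_ gN gD' b.
  have cb : cochain 0 (D_ (- D) D' b) by case: (b).
  have eb : feq (ce_diff false (D_ (- D) D' b)) 0 by case: (b).
  exists (nr_br false true (D_ (- D) D' b) k); split; first exact: cochain_nr0.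
    move=> s s0 ss sn; rewrite /nr_br !famE.
    have vb := vD b D gD; have pk := pcoh ck.
    rewrite (van_insertion Lok _ _ (pcoM gb.1) (pcoC pk) vb vk) //.
    rewrite (van_insertion Lok _ _ (pcoM pk) (pcoC gb.1) vk vb) ?addn1 //.
    by rewrite scaler0 subrr.
  apply: feqT (nr_feq Lok false false (pcoC gb.1) (pcoC gP) (feqR _) ek) _.
  exact: nr_exact gb.1 (pcoh ck) eb.
apply: J_bch => //.
- by move=> n P Q e [k [ck vk ek]]; exists k; split=> //; apply: feqT ek; exact: feqS.
- by move=> n a P Q _ _; exact: Jlin.
- by move=> n b P gP jP; exact: Jnr.
- by move=> F _ vF jF; exact: Jex_sum.
- by exists h; split => //; [case|rewrite addrC].
(* The bracket of -D with D' equals that with D' - D, since -D commutes with itself. *)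
- have [k [ck vk ek]] : Jex 1 (nr_br false false (- D) (D' - D)).
    apply: (Jnr 0%N true); last by apply: pcoD gD'.1 gN.1.
    by exists h; split => //; case.
  exists k; split => //; apply: feqT ek => s s0 ss.
  have nn P : nr_br false false P P = 0 by rewrite /nr_br scale1r subrr.
  have := @nrPr _ _ Lok false false 1 (- D) D' (- D) (pcoM gN.1) (pcoC gN.1) (pcoC gD'.1) (pcoC gN.1) s s0 ss.
  by rewrite !scale1r nn addr0 => ->.
Qed.

Lemma ce_diff_unary h : cochain (-1) h -> unary0 (ce_diff true h).
Proof.
move=> /pcoh ph u su; rewrite /ce_diff /nr_br !famE.
have iu : in_sub [:: u] by apply/in_subc.
have vb : van 1 br by case=> [|v [|w s]] //= _ _ _.
have v0 P : van 0 P by case.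
rewrite (van_insertion Lok _ _ (pcoM pb) (pcoC ph) vb (v0 h)) //.
rewrite (van_insertion Lok _ _ (pcoM ph) (pcoC pb) (v0 h) vb) //.
by rewrite scaler0 subrr.
Qed.

Lemma good_exact h : cochain (-1) h -> good (ce_diff true h).
Proof.
move=> ch; split; last exact: ce_diff_unary.
exact: (pco_nr Lok pb (pcoh ch)).
Qed.

(** exp(D') = exp(D) exp(-D) exp(D'), and the last two factors are the exponential of the series of
    (-D, D'), which is exact by [Jex_bch]. *)
Lemma homotopic_exp D D' : good D -> ce_cocycle D -> good D' -> ce_cocycle D' ->
  ce_exact (D' - D) -> homotopic (linf_exp D') (linf_exp D).
Proof.
move=> gD [cD eD] gD' [cD' eD'] [h ch E].
have [k [ck _ ek]] := Jex_bch gD cD eD gD' cD' eD' ch E.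
have gN := goodN gD; have gb := good_bch Lok gN gD'; have gk := good_exact ck.
exists k => //; have pD := pco_linf_exp Lok gD; have pid := pco_id Lok.
apply: feqS.
have ce D0 : good D0 -> clos (linf_exp D0) by move=> g; exact: pcoC (pco_linf_exp Lok g).
apply: feqT (linf_comp_feq Lok (ce _ gk) (feqR _) (linf_exp_feq gk (feqS ek))) _.
apply: feqT (linf_comp_exp Lok gb pD) _.
apply: feqT (feqS (cexp_bch Lok gN gD' pD)) _.
apply: feqT (feqS (linf_expE Lok gD')); apply: (cexp_feq gD').
apply: feqT (feqS (linf_comp_exp Lok gN pD)) _; exact: linf_exp_inv.
Qed.

End Exact.
End Gauge.

(** * Tensors with named factors *)

Section NamedLists.
Context (R : realType) (L : glie R).
Local Notation X := (bool * L)%type.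
Local Notation Y := (nat * X)%type.
Implicit Types (l : seq Y) (x : X) (y : Y) (n u v : nat) (ns : seq nat) (Phi Psi : seq Y -> L).

(** Tensor factors carry names, so that an edge can refer to a vertex independently of the position
    of its factor; renaming and reordering become separate operations. *)
Definition names l : seq nat := [seq y.1 | y <- l].
Definition snds l : seq X := [seq y.2 | y <- l].
Definition dom ns l : bool := (names l == ns) && all (@okb R L) (snds l).
Definition xpar l : bool := foldr (fun y b => y.2.1 (+) b) false l.

Definition hat1 (p : bool) (D : L -> L) n y : Y :=
  if y.1 == n then (y.1, (y.2.1 (+) p, D y.2.2)) else y.
Definition hat p D n l := map (hat1 p D n) l.
Fixpoint sgp n l : bool :=
  if l is y :: l' then if y.1 == n then false else y.2.1 (+) sgp n l' else false.
(** Records whether [u] stands before [v]: an odd operator acting at the earlier factor changes the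
    sign seen by an operator at the later one. *)
Fixpoint bef u v l : bool :=
  if l is y :: l' then if y.1 == v then false else (y.1 == u) || bef u v l' else false.

(** A derivation of parity [p] acting on the factor named [n]; the sign is that of moving it past
    the factors in front. *)
Definition OP p D n Phi : seq Y -> L := fun l => (-1) ^+ (p && sgp n l) *: Phi (hat p D n l).

Record pder p D : Prop := Pder {
  pder_ok : forall q (f : L), @okb R L (q, f) -> @okb R L (q (+) p, D f);
  pder_lin : forall q (a : R) (f g : L), @okb R L (q, f) -> @okb R L (q, g) -> D (a *: f + g) = a *: D f + D g }.

Definition hml ns Phi := forall l1 l2 n q (a : R) (f g : L),
  dom ns (l1 ++ (n, (q, f)) :: l2) -> @okb R L (q, g) -> Phi (l1 ++ (n, (q, a *: f + g)) :: l2) =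
  a *: Phi (l1 ++ (n, (q, f)) :: l2) + Phi (l1 ++ (n, (q, g)) :: l2).

Lemma names_hat p D n l : names (hat p D n l) = names l.
Proof. by rewrite /names /hat -map_comp; apply: eq_map => y /=; rewrite /hat1; case: eqP. Qed.

Lemma names_cat l1 l2 : names (l1 ++ l2) = names l1 ++ names l2.
Proof. exact: map_cat. Qed.

Lemma dom_hat ns p D n l : pder p D -> dom ns l -> dom ns (hat p D n l).
Proof.
move=> dD /andP[/eqP nl ol]; rewrite /dom names_hat nl eqxx /=; move: ol {nl}.
elim: l => //= y l IH /andP[oy /IH->]; rewrite andbT /hat1.
by case: eqP => //= _; apply: pder_ok => //; case: (y.2) oy.
Qed.

Lemma hat_notin p D n l : n \notin names l -> hat p D n l = l.
Proof.
elim: l => //= y l IH; rewrite inE negb_or => /andP[ny /IH->].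
by rewrite /hat1 eq_sym (negbTE ny).
Qed.

Lemma hat_cat p D n l1 l2 : hat p D n (l1 ++ l2) = hat p D n l1 ++ hat p D n l2.
Proof. exact: map_cat. Qed.

Lemma sgp_cat n l1 l2 : sgp n (l1 ++ l2) =
  if n \in names l1 then sgp n l1 else xpar l1 (+) sgp n l2.
Proof.
elim: l1 => //= y l1 ->; rewrite inE eq_sym; case: eqP => //= _.
by case: ifP => // _; rewrite addbA.
Qed.

Lemma xpar_hat p D n l : uniq (names l) -> n \in names l -> xpar (hat p D n l) = xpar l (+) p.
Proof.
elim: l => //= y l IH /andP[yl ul]; rewrite inE /hat1 eq_sym.
case: eqP => /= [yn _|_ nl]; last by rewrite IH // addbA.
by rewrite hat_notin -?yn //; case: (p); case: (y.2.1); case: (xpar l).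
Qed.

Lemma sgp_hat p D n l : sgp n (hat p D n l) = sgp n l.
Proof. by elim: l => //= y l IH; rewrite /hat1; case: (eqVneq y.1 n) => /= [->|/negbTE->]; rewrite ?eqxx // IH. Qed.

Lemma sgp_hat2 p D u v l : uniq (names l) -> u != v ->
  sgp u (hat p D v l) = sgp u l (+) (p && bef v u l).
Proof.
elim: l => [_ _|y l IH] /=; first by rewrite andbF.
move=> /andP[yl ul] uv; rewrite /hat1; case: (y.1 =P v) => /= [yv|yv].
  have -> : (y.1 == u) = false by rewrite yv eq_sym; exact: negbTE.
  rewrite hat_notin -?yv //= andbT -!addbA; congr (_ (+) _); exact: addbC.
by case: ifP => // yu; rewrite ?andbF // IH // addbA.
Qed.

Lemma bef_total u v l : u != v -> u \in names l -> bef u v l (+) bef v u l.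
Proof.
elim: l => //= y l IH uv; rewrite inE [u == _]eq_sym; case: (y.1 =P u) => /= [yu _|yu ul].
  by have -> : (y.1 == v) = false by rewrite yu; exact: negbTE.
by case: (y.1 =P v) => //= yv; exact: IH.
Qed.

Lemma hat_comm p D p' D' u v l : u != v -> hat p D u (hat p' D' v l) = hat p' D' v (hat p D u l).
Proof.
move=> uv; rewrite /hat -!map_comp; apply: eq_map => y /=; rewrite /hat1.
case: (y.1 =P v) => /= [yv|yv].
  have E : (y.1 == u) = false by rewrite yv eq_sym; exact: negbTE.
  by rewrite E /= yv eqxx.
by case: (y.1 =P u) => //= yu; case: (y.1 =P v).
Qed.

Lemma split_name n l : n \in names l -> exists l1 x l2, l = l1 ++ (n, x) :: l2.
Proof.
elim: l => //= -[m x] l IH; rewrite inE => /orP[/eqP/= ->|/IH[l1 [x' [l2 ->]]]].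
  by exists [::], x, l.
by exists ((m, x) :: l1), x', l2.
Qed.

Lemma hat_mid p D n l1 x l2 : uniq (names (l1 ++ (n, x) :: l2)) ->
  hat p D n (l1 ++ (n, x) :: l2) = l1 ++ (n, (x.1 (+) p, D x.2)) :: l2.
Proof.
rewrite names_cat cat_uniq /= negb_or => /and3P[_ /andP[n1 _] /andP[n2 _]].
by rewrite hat_cat /= /hat1 eqxx !hat_notin.
Qed.

Lemma dom_mid ns l1 n q (f g : L) l2 : dom ns (l1 ++ (n, (q, f)) :: l2) -> @okb R L (q, g) ->
  dom ns (l1 ++ (n, (q, g)) :: l2).
Proof.
rewrite /dom /names /snds !map_cat !all_cat /= => /andP[-> /andP[-> /andP[_ ->]]] ->.
by [].
Qed.

Lemma dom_okb ns l1 n x l2 : dom ns (l1 ++ (n, x) :: l2) -> @okb R L x.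
Proof. by rewrite /dom /snds map_cat all_cat /= => /andP[_ /andP[_ /andP[]]]. Qed.

Section Fixed.
Variables (ns : seq nat) (Uns : uniq ns).

Lemma dom_uniq l : dom ns l -> uniq (names l).
Proof. by case/andP=> /eqP->. Qed.

Lemma hmlZ Phi l1 l2 n q (a : R) (f : L) : glieok L -> hml ns Phi -> dom ns (l1 ++ (n, (q, f)) :: l2) ->
  Phi (l1 ++ (n, (q, a *: f)) :: l2) = a *: Phi (l1 ++ (n, (q, f)) :: l2).
Proof.
move=> Lok mP dl; have z := okb0 Lok q.
have dz := dom_mid dl z.
have := mP l1 l2 n q (-1) 0 0 dz z; rewrite scaler0 addr0 scaleN1r addNr => E0.
by have := mP l1 l2 n q a f 0 dl z; rewrite addr0 E0 addr0.
Qed.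

Lemma OP_hml p D n Phi : pder p D -> hml ns Phi -> hml ns (OP p D n Phi).
Proof.
move=> dD mP l1 l2 m q a f g dl og; rewrite /OP.
have sE h : sgp n (l1 ++ (m, (q, h)) :: l2) = sgp n (l1 ++ (m, (q, f)) :: l2).
  by rewrite !sgp_cat.
have E h : hat p D n (l1 ++ (m, (q, h)) :: l2) =
    hat p D n l1 ++ (m, (if m == n then (q (+) p, D h) else (q, h))) :: hat p D n l2.
  by rewrite hat_cat /= /hat1 /=; case: eqP.
have dh := dom_hat n dD dl; have of_ := dom_okb dl.
rewrite !(sE (_ + _)) (sE g) !E; rewrite E in dh.
case: eqP dh => _ dh.
  rewrite (pder_lin dD a of_ og) mP //; last exact: pder_ok.
  by rewrite scalerDr !scalerA mulrC.
by rewrite mP // scalerDr !scalerA mulrC.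
Qed.

(** At different factors exactly one of the two operators changes the parity that the other has to
    cross, which gives the sign; at the same factor the sign comes from the hypothesis on [D] and
    [D']. *)
Lemma OP_comm p D p' D' u v Phi l : glieok L -> pder p D -> pder p' D' -> hml ns Phi ->
  (forall q (f : L), @okb R L (q, f) -> D' (D f) = (-1) ^+ (p && p') *: D (D' f)) ->
  u \in ns -> v \in ns -> dom ns l ->
  OP p D u (OP p' D' v Phi) l = (-1) ^+ (p && p') *: OP p' D' v (OP p D u Phi) l.
Proof.
move=> Lok dD dD' mP com ul vl dl; have Ul := dom_uniq dl.
have nl : names l = ns by case/andP: dl => /eqP.
rewrite /OP !scalerA -!signr_addb; have [uv|uv] := eqVneq u v.
  subst v; rewrite !sgp_hat; rewrite -nl in ul; have [l1 [[q f] [l2 el]]] := split_name ul.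
  rewrite {}el in dl Ul *.
  have fo := dom_okb dl.
  have h1 := dom_hat u dD dl; have h2 := dom_hat u dD' dl.
  have h21 := dom_hat u dD h2.
  rewrite [hat p D u _]hat_mid // [hat p' D' u (l1 ++ (u, (q, f)) :: l2)]hat_mid //.
  rewrite [hat p D u _]hat_mid // in h1; rewrite [hat p' D' u (l1 ++ (u, (q, f)) :: l2)]hat_mid // in h2 h21.
  have U1 := dom_uniq h1; have U2 := dom_uniq h2.
  rewrite [hat p D u _]hat_mid // in h21; rewrite /= in U1 U2 h21.
  rewrite !hat_mid //= (com q f fo) [q (+) p (+) p']addbAC hmlZ // scalerA -signr_addb; congr ((-1) ^+ _ *: _).
  by case: (p); case: (p'); case: (sgp _ _).
rewrite hat_comm; last by rewrite eq_sym.
rewrite !sgp_hat2 //; last by rewrite eq_sym.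
congr ((-1) ^+ _ *: _); rewrite -nl in ul; have := bef_total uv ul.
by case: (bef u v l); case: (bef v u l); case: (p); case: (p'); case: (sgp u l); case: (sgp v l).
Qed.

Definition eqf Phi Psi := forall l, dom ns l -> Phi l = Psi l.

Lemma OP_eqf p D n Phi Psi : pder p D -> eqf Phi Psi -> eqf (OP p D n Phi) (OP p D n Psi).
Proof. by move=> dD E l dl; rewrite /OP E //; exact: dom_hat. Qed.

Lemma OP_sum p D n (I : Type) (r : seq I) (F : I -> seq Y -> L) l :
  OP p D n (fun l => \sum_(i <- r) F i l) l = \sum_(i <- r) OP p D n (F i) l.
Proof. by rewrite /OP scaler_sumr. Qed.

Lemma OP_Z p D n (a : R) Phi l : OP p D n (fun l => a *: Phi l) l = a *: OP p D n Phi l.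
Proof. by rewrite /OP !scalerA mulrC. Qed.

Lemma hml_sum (I : Type) (r : seq I) (F : I -> seq Y -> L) :
  (forall i, hml ns (F i)) -> hml ns (fun l => \sum_(i <- r) F i l).
Proof.
move=> mF l1 l2 n q a f g dl og; rewrite scaler_sumr -big_split.
by apply: eq_bigr => i _; exact: mF.
Qed.

End Fixed.
End NamedLists.

(** * Action of graphs on a graded commutative algebra *)

(** What the action of graphs uses of the algebra of functions. For the edge type [b] the index runs
    over coordinates, [gD b true] acts at the tail and [gD b false] at the head of the black arrow,
    and [gpi b] is the parity of both. *)
Record galg (R : realType) (L : glie R) := Galg { gmu : L -> L -> L; gK : bool -> finType;
  gpi : bool -> bool; gD : forall b : bool, bool -> gK b -> L -> L;
  g_ok : forall p q f g, @okb R L (p, f) -> @okb R L (q, g) -> @okb R L (p (+) q, gmu f g);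
  g_Pl : forall (a : R) f f' g, gmu (a *: f + f') g = a *: gmu f g + gmu f' g;
  g_Pr : forall (a : R) f g g', gmu f (a *: g + g') = a *: gmu f g + gmu f g';
  g_A : forall f g h, gmu f (gmu g h) = gmu (gmu f g) h;
  g_C : forall p q f g, @okb R L (p, f) -> @okb R L (q, g) -> gmu f g = (-1) ^+ (p && q) *: gmu g f;
  g_der : forall b s k, pder (gpi b) (@gD b s k);
  g_leib : forall b s k p q f g, @okb R L (p, f) -> @okb R L (q, g) ->
    @gD b s k (gmu f g) = gmu (@gD b s k f) g + (-1) ^+ (gpi b && p) *: gmu f (@gD b s k g);
  g_com : forall b s k b' s' k' p f, @okb R L (p, f) ->
    @gD b s k (@gD b' s' k' f) = (-1) ^+ (gpi b && gpi b') *: @gD b' s' k' (@gD b s k f) }.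

Section NRep.
Context (R : realType) (L : glie R) (Lok : glieok L) (A : galg L).
Local Notation X := (bool * L)%type.
Local Notation Y := (nat * X)%type.
Implicit Types (l : seq Y) (x : X) (y : Y) (n u v : nat) (ns I J : seq nat) (Phi Psi : seq Y -> L).
Implicit Types (e : edge) (es G : seq edge).
Local Notation mul := (gmu A).
Local Notation xpar := (@xpar R L).

Fixpoint mu l : L := if l is y :: l' then if l' is [::] then y.2.2 else mul y.2.2 (mu l') else 0.

Definition OPE e (s : bool) (k : gK A e.2) Phi :=
  OP (gpi A e.2) (@gD _ _ A e.2 s k) (if s then e.1.1 else e.1.2) Phi.
(** The outer operator meets the tensor first, so the derivative at the head acts before the one at
    the tail, as in [rep_edges]. *)
Definition Delta e Phi : seq Y -> L := fun l => \sum_(k : gK A e.2) OPE (e := e) false k (OPE true k Phi) l.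
Definition nrep es := foldr Delta mu es.
Definition below ns e : bool := (e.1.1 \in ns) && (e.1.2 \in ns).

Lemma mul0 f : mul 0 f = 0.
Proof. by have := g_Pl A (-1) 0 0 f; rewrite scaler0 addr0 scaleN1r addNr. Qed.
Lemma mulZl (a : R) f g : mul (a *: f) g = a *: mul f g.
Proof. by have := g_Pl A a f 0 g; rewrite mul0 !addr0. Qed.
Lemma gmulr0 f : mul f 0 = 0.
Proof. by have := g_Pr A (-1) f 0 0; rewrite scaler0 addr0 scaleN1r addNr. Qed.
Lemma mulZr (a : R) f g : mul f (a *: g) = a *: mul f g.
Proof. by have := g_Pr A a f g 0; rewrite gmulr0 !addr0. Qed.
Lemma gmulDl f f' g : mul (f + f') g = mul f g + mul f' g.
Proof. by have := g_Pl A 1 f f' g; rewrite !scale1r. Qed.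
Lemma gmulDr f g g' : mul f (g + g') = mul f g + mul f g'.
Proof. by have := g_Pr A 1 f g g'; rewrite !scale1r. Qed.
Lemma mul_suml (T : Type) (r : seq T) (F : T -> L) g : mul (\sum_(i <- r) F i) g = \sum_(i <- r) mul (F i) g.
Proof. by elim: r => [|i r IH]; rewrite ?big_nil ?mul0 // !big_cons gmulDl IH. Qed.

Lemma mu_cons y l : l <> [::] -> mu (y :: l) = mul y.2.2 (mu l).
Proof. by case: l. Qed.

Lemma mu_cat l1 l2 : l1 <> [::] -> l2 <> [::] -> mu (l1 ++ l2) = mul (mu l1) (mu l2).
Proof.
move=> + l20; elim: l1 => // y [|y' l1] IH _; first exact: mu_cons.
by rewrite cat_cons mu_cons // IH // g_A -mu_cons.
Qed.

Lemma mu_hml ns : hml ns mu.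
Proof.
move=> l1 l2 n q a f g _ _; elim: l1 => [|y l1 IH].
  by case: l2 => [|y2 l2] //=; rewrite g_Pl.
have nn (t : Y) : l1 ++ t :: l2 <> [::] by case: (l1).
by rewrite !cat_cons !mu_cons // IH g_Pr.
Qed.

Lemma Delta_hml ns e Phi : hml ns Phi -> hml ns (Delta e Phi).
Proof.
move=> mP; apply: hml_sum => k.
by apply: OP_hml; [exact: g_der|apply: OP_hml => //; exact: g_der].
Qed.

Lemma nrep_hml ns es : hml ns (nrep es).
Proof. by elim: es => [|e es IH]; [exact: mu_hml|exact: Delta_hml]. Qed.

Lemma mu_ok ns l : dom ns l -> l <> [::] -> @okb R L (xpar l, mu l).
Proof.
move=> /andP[_]; elim: l => // -[n [q f]] l IH /= /andP[oy ol] _.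
case: l IH ol => [|y' l] IH ol; first by rewrite addbF.
by apply: g_ok => //; exact: IH.
Qed.

Lemma okb_sum q (T : Type) (r : seq T) (F : T -> L) : (forall i, @okb R L (q, F i)) -> @okb R L (q, \sum_(i <- r) F i).
Proof.
move=> oF; elim: r => [|i r IH]; rewrite ?big_nil ?big_cons; first exact: okb0.
by rewrite -[F i]scale1r; exact: okbP.
Qed.

Lemma okbZ q (a : R) (f : L) : @okb R L (q, f) -> @okb R L (q, a *: f).
Proof. by move=> o; rewrite -[_ *: _]addr0; apply: okbP => //; exact: okb0. Qed.

Lemma nrep_ok ns es l : uniq ns -> all (below ns) es -> dom ns l -> l <> [::] ->
  @okb R L (xpar l, nrep es l).
Proof.
move=> Uns; elim: es l => [|e es IH] l /=; first by move=> _; exact: mu_ok.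
move=> /andP[/andP[b1 b2] bes] dl l0; apply: okb_sum => k.
apply: okbZ; apply: okbZ.
have nl : names l = ns by case/andP: dl => /eqP.
have d1 := dom_hat e.1.2 (g_der false k) dl.
have d2 := dom_hat e.1.1 (g_der true k) d1.
have h0 : hat (gpi A e.2) (gD true k) e.1.1 (hat (gpi A e.2) (gD false k) e.1.2 l) <> [::].
  by case: (l) l0.
have := IH _ bes d2 h0.
by rewrite !xpar_hat ?names_hat ?nl // -addbA addbb addbF.
Qed.

Lemma Delta_eqf ns e Phi Psi : eqf ns Phi Psi -> eqf ns (Delta e Phi) (Delta e Psi).
Proof.
move=> E l dl; apply: eq_bigr => k _.
by apply: (OP_eqf (ns := ns)) => //; [exact: g_der|apply: OP_eqf => //; exact: g_der].
Qed.

(** An edge consists of two derivations of equal parity, hence is even and commutes with every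
    derivation. *)
Lemma OP_Delta ns b s k n e Phi l : uniq ns -> hml ns Phi -> n \in ns -> below ns e -> dom ns l ->
  OP (gpi A b) (@gD _ _ A b s k) n (Delta e Phi) l = Delta e (OP (gpi A b) (@gD _ _ A b s k) n Phi) l.
Proof.
move=> U mP nn /andP[b1 b2] dl; rewrite /Delta OP_sum; apply: eq_bigr => j _; rewrite /OPE.
have m1 : hml ns (OPE true j Phi) by apply: OP_hml => //; exact: g_der.
rewrite (OP_comm (ns := ns) U Lok) //; try exact: g_der; last first.
  by move=> q f; rewrite [gpi A b && _]andbC; exact: g_com.
rewrite -OP_Z; apply: (OP_eqf (ns := ns)) => //; first exact: g_der.
move=> l' dl'; rewrite (OP_comm (ns := ns) U Lok) //; try exact: g_der; last first.
  by move=> q f; rewrite [gpi A b && _]andbC; exact: g_com.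
by rewrite scalerA -signr_addb addbb scale1r.
Qed.

Lemma Delta_comm ns e e' Phi l : uniq ns -> hml ns Phi -> below ns e -> below ns e' -> dom ns l ->
  Delta e (Delta e' Phi) l = Delta e' (Delta e Phi) l.
Proof.
move=> U mP be be' dl; have [b1 b2] := andP be; rewrite {1}/Delta.
transitivity (\sum_(k : gK A e.2) Delta e' (OPE false k (OPE true k Phi)) l).
  apply: eq_bigr => k _; rewrite /OPE -(OP_Delta (ns := ns) _ k) //; last first.
    by apply: OP_hml => //; exact: g_der.
  apply: (OP_eqf (ns := ns)) => //; first exact: g_der.
  by move=> l' dl'; rewrite -(OP_Delta (ns := ns) _ k).
rewrite /Delta exchange_big /=; apply: eq_bigr => j _.
rewrite -OP_sum; apply: (OP_eqf (ns := ns)) => //; first exact: g_der.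
by move=> l' dl'; rewrite -OP_sum.
Qed.

(** Edge operators commute; this is why graphs may be multisets of edges. *)
Lemma nrep_perm ns es es' l : uniq ns -> all (below ns) es -> perm_eq es es' -> dom ns l ->
  nrep es l = nrep es' l.
Proof.
move=> U; elim: es es' l => [|e es IH] es' l bes.
  by rewrite perm_sym => /perm_nilP ->.
move=> pe dl; have ee : e \in es' by rewrite -(perm_mem pe) inE eqxx.
move: bes => /= /andP[be bes].
have [p [q E]] : exists p q, es' = p ++ e :: q by case/splitPr: ee => p q; exists p, q.
have pq : perm_eq es (p ++ q) by move: pe; rewrite E perm_sym perm_catC /= perm_cons perm_catC perm_sym.
rewrite (Delta_eqf (ns := ns) e (fun l' dl' => IH _ l' bes pq dl')) //.
have bp : all (below ns) p by move: bes; rewrite (perm_all _ pq) all_cat => /andP[].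
rewrite {}E {pe pq ee}; elim: p l dl bp => [|e' p IHp] l dl //= /andP[be' bp].
rewrite (Delta_comm (ns := ns)) //; last exact: nrep_hml.
by apply: (Delta_eqf (ns := ns)) => // l' dl'; exact: IHp.
Qed.

Section Swap.
Variables (n1 n2 : seq nat) (a b : nat).
Hypothesis Un : uniq (n1 ++ a :: b :: n2).
Let ns := n1 ++ a :: b :: n2.

Definition sw Phi := forall l1 y z l2, dom ns (l1 ++ y :: z :: l2) -> size l1 = size n1 ->
  Phi (l1 ++ y :: z :: l2) = (-1) ^+ (y.2.1 && z.2.1) *: Phi (l1 ++ z :: y :: l2).

Lemma sw_names l1 y z l2 : dom ns (l1 ++ y :: z :: l2) -> size l1 = size n1 ->
  [/\ names l1 = n1, y.1 = a, z.1 = b & names l2 = n2].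
Proof.
move=> /andP[/eqP + _] sl; rewrite names_cat /= /ns => /eqP.
by rewrite eqseq_cat ?size_map // => /andP[/eqP -> /eqP[-> -> ->]].
Qed.

Lemma sw_OP p D n Phi : pder p D -> sw Phi -> sw (OP p D n Phi).
Proof.
move=> dD sP l1 y z l2 dl sl; have [N1 Y1 Z1 N2] := sw_names dl sl.
have := dom_hat n dD dl; rewrite /OP hat_cat /= => dh.
rewrite sP ?size_map // [hat _ _ _ (l1 ++ _)]hat_cat /= !scalerA -!signr_addb.
congr ((-1) ^+ _ *: _); rewrite !sgp_cat N1.
move: Un; rewrite cat_uniq /= !inE !negb_or => /and3P[_ /and3P[an1 bn1 _] /and3P[/andP[ab _] _ _]].
rewrite /hat1 Y1 Z1; case: (n \in n1) /boolP => [n_in|_].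
  have na : (a == n) = false by apply: contraNF an1 => /eqP->.
  have nb : (b == n) = false by apply: contraNF bn1 => /eqP->.
  by rewrite na nb addbC.
have [na|na] := eqVneq a n.
  have -> : (b == n) = false by rewrite -na eq_sym; exact: negbTE.
  move=> /=; by case: (y.2.1); case: (z.2.1); case: (xpar l1); case: (p).
have [nb|nb] := eqVneq b n => /=.
  by case: (y.2.1); case: (z.2.1); case: (xpar l1); case: (p).
by case: (y.2.1); case: (z.2.1); case: (xpar l1); case: (p); case: (sgp n l2).
Qed.

Lemma sw_nrep es : sw (nrep es).
Proof.
elim: es => [|e es IH] /=.
  move=> l1 y z l2 dl _.
  have [oy oz] : okb y.2 /\ okb z.2.
    by move: dl; rewrite /dom /snds map_cat all_cat /= => /andP[_ /andP[_ /and3P[]]].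
  have Ez m : mu (y :: z :: m) = (-1) ^+ (y.2.1 && z.2.1) *: mu (z :: y :: m).
    rewrite (_ : mu (z :: y :: m) = if m is [::] then mul z.2.2 y.2.2 else mul (mul z.2.2 y.2.2) (mu m)); last first.
      by case: m => // y' m; rewrite -g_A.
    rewrite (_ : mu (y :: z :: m) = if m is [::] then mul y.2.2 z.2.2 else mul (mul y.2.2 z.2.2) (mu m)); last first.
      by case: m => // y' m; rewrite -g_A.
    have E : mul y.2.2 z.2.2 = (-1) ^+ (y.2.1 && z.2.1) *: mul z.2.2 y.2.2.
      by apply: g_C; rewrite -surjective_pairing.
    by case: m => // y' m; rewrite E mulZl.
  case: l1 {dl} => [|y1 l1]; first exact: Ez.
  by rewrite !(mu_cat (l1 := y1 :: l1)) // Ez mulZr.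
move=> l1 y z l2 dl sl; rewrite scaler_sumr; apply: eq_bigr => k _.
by apply: sw_OP dl sl; [exact: g_der|apply: sw_OP => //; exact: g_der].
Qed.
End Swap.

Lemma mu_der ns b s k l : uniq ns -> dom ns l -> l <> [::] ->
  gD s k (mu l) = \sum_(u <- ns) OP (gpi A b) (@gD _ _ A b s k) u mu l.
Proof.
move=> U dl l0; have nl : names l = ns by case/andP: dl => /eqP.
have Ul : uniq (names l) by rewrite nl.
have ol : all (@okb R L) (snds l) by case/andP: dl.
rewrite -{}nl {dl U}; elim: l l0 Ul ol => // -[n [q f]] l IH _ /= /andP[nl Ul] /andP[of_ ol].
rewrite big_cons [OP _ _ n _ _]/OP /= eqxx andbF scale1r /hat1 /= eqxx hat_notin //.
case: l IH nl Ul ol => [|y l] IH nl Ul ol; first by rewrite big_nil addr0.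
have [dm] : dom (names (y :: l)) (y :: l) by rewrite /dom eqxx.
have om : @okb R L (xpar (y :: l), mu (y :: l)) by exact: (@mu_ok (names (y :: l))).
rewrite [LHS](g_leib s k of_ om) big_seq.
transitivity (mul (gD s k f) (mu (y :: l)) + \sum_(u <- names (y :: l) | u \in names (y :: l))
   (-1) ^+ (gpi A b && q) *: mul f (OP (gpi A b) (@gD _ _ A b s k) u mu (y :: l))).
  congr (_ + _); rewrite IH // -big_seq -scaler_sumr; congr (_ *: _).
  elim: (names (y :: l)) => [|u r IHr]; rewrite ?big_nil ?gmulr0 // !big_cons gmulDr IHr //.
congr (_ + _); apply: eq_bigr => u ul; rewrite /OP /=.
have un : (n == u) = false by apply: contraNF nl => /eqP->.
rewrite /hat1 /= un -/(hat1 _ _ _ _) -/(hat _ _ _ _) mulZr scalerA -signr_addb.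
by rewrite andb_addr.
Qed.

End NRep.

(** * Insertion of graphs as composition of operators *)

Section Compose.
Context (R : realType) (L : glie R) (Lok : glieok L) (A : galg L).
Local Notation X := (bool * L)%type.
Local Notation Y := (nat * X)%type.
Implicit Types (l : seq Y) (x : X) (y : Y) (n u v : nat) (ns I J : seq nat) (Phi Psi : seq Y -> L).
Implicit Types (e : edge) (es G : seq edge) (lI lJ m K : seq Y) (c : seq nat).
Local Notation mul := (gmu A).
Local Notation xpar := (@xpar R L).
Local Notation nrep := (nrep A).
Local Notation pi b := (gpi A b).

Lemma der_sum p D q (T : eqType) (r : seq T) (a : T -> R) (F : T -> L) : pder p D ->
  (forall i, i \in r -> okb (q, F i)) -> D (\sum_(i <- r) a i *: F i) = \sum_(i <- r) a i *: D (F i).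
Proof.
move=> dD; have D0 : D 0 = 0.
  have z := okb0 Lok q; have := pder_lin dD (-1) z z.
  by rewrite scaler0 addr0 scaleN1r addNr.
elim: r => [|i r IH] oF; first by rewrite !big_nil.
rewrite !big_cons -IH => [|j jr]; last by apply: oF; rewrite inE jr orbT.
apply: (pder_lin dD (q := q)); first by apply: oF; rewrite inE eqxx.
rewrite big_seq; elim/big_ind: _ => [|f g of_ og|j jr]; first exact: okb0.
  by rewrite -[f]scale1r; exact: okbP.
by apply: okbZ => //; apply: oF; rewrite inE jr orbT.
Qed.

Lemma Delta_der ns b s k e Phi l : uniq ns -> below ns e -> dom ns l -> ns <> [::] ->
  (forall l, dom ns l -> okb (xpar l, Phi l)) ->
  @gD _ _ A b s k (Delta A e Phi l) = Delta A e (fun l => @gD _ _ A b s k (Phi l)) l.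
Proof.
move=> U /andP[b1 b2] dl n0 oP; rewrite /Delta.
pose c j := (-1) ^+ (pi e.2 && sgp e.1.2 l) * (-1) ^+ (pi e.2 && sgp e.1.1 (hat (pi e.2) (@gD _ _ A e.2 false j) e.1.2 l)) : R.
pose F j := Phi (hat (pi e.2) (gD true j) e.1.1 (hat (pi e.2) (@gD _ _ A e.2 false j) e.1.2 l)).
transitivity (gD s k (\sum_j c j *: F j)).
  by congr gD; apply: eq_bigr => j _; rewrite /OPE /OP scalerA.
rewrite (der_sum (q := xpar l) _ (g_der s k)) => [|j _].
  by apply: eq_bigr => j _; rewrite /OPE /OP scalerA.
have nl : names l = ns by case/andP: dl => /eqP.
have := oP _ (dom_hat e.1.1 (g_der true j) (dom_hat e.1.2 (g_der false j) dl)).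
by rewrite !xpar_hat ?names_hat ?nl // -addbA addbb addbF.
Qed.

(** Leibniz rule for the product, carried through the edges because they commute with derivations.
    It is the source of the sum over reattachments at the inserted vertex. *)
Lemma nrep_der ns b s k es l : uniq ns -> ns <> [::] -> all (below ns) es -> dom ns l ->
  gD s k (nrep es l) = \sum_(u <- ns) OP (pi b) (@gD _ _ A b s k) u (nrep es) l.
Proof.
move=> U n0; have ne l' : dom ns l' -> l' <> [::].
  by move=> /andP[/eqP + _] l'0; rewrite l'0 => /esym.
elim: es l => [|e es IH] l /=; first by move=> _ dl; apply: mu_der => //; exact: ne.
move=> /andP[be bes] dl; rewrite (Delta_der s k U be dl n0); last first.
  by move=> l' dl'; exact: (nrep_ok Lok A U bes dl' (ne l' dl')).
rewrite (Delta_eqf (ns := ns) A e (fun l' dl' => IH l' bes dl')) //.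
transitivity (\sum_(u <- ns | u \in ns) Delta A e (OP (pi b) (gD s k) u (nrep es)) l).
  rewrite -big_seq /Delta exchange_big; apply: eq_bigr => j _ /=.
  rewrite /OPE -OP_sum; rewrite /OP; congr (_ *: _); exact: scaler_sumr.
rewrite [RHS]big_seq; apply: eq_bigr => u un.
by rewrite (OP_Delta Lok (ns := ns)) //; exact: nrep_hml.
Qed.

Definition ren (phi : nat -> nat) l : seq Y := [seq (phi y.1, y.2) | y <- l].
Definition rene (phi : nat -> nat) es : seq edge := [seq (phi e.1.1, phi e.1.2, e.2) | e <- es].

Lemma hat_ren phi p D n l : {in n :: names l &, injective phi} ->
  hat p D (phi n) (ren phi l) = ren phi (hat p D n l).
Proof.
move=> inj; rewrite /hat /ren -!map_comp; apply/eq_in_map => y yl /=; rewrite /hat1 /=.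
have -> : (phi y.1 == phi n) = (y.1 == n).
  by rewrite (inj_in_eq inj) ?inE ?eqxx ?map_f ?orbT.
by case: eqP.
Qed.

Lemma sgp_ren phi n l : {in n :: names l &, injective phi} -> sgp (phi n) (ren phi l) = sgp n l.
Proof.
elim: l => //= y l IH inj; rewrite (inj_in_eq inj) ?inE ?eqxx ?orbT // IH // => i j.
by rewrite !inE => il jl; apply: inj; rewrite !inE; [case/orP: il|case/orP: jl] => ->; rewrite ?orbT.
Qed.

Lemma names_ren phi l : names (ren phi l) = map phi (names l).
Proof. by rewrite /names /ren -!map_comp. Qed.

Lemma snds_ren phi l : snds (ren phi l) = snds l.
Proof. by rewrite /snds /ren -map_comp. Qed.

Lemma mu_ren phi l : mu A (ren phi l) = mu A l.
Proof. by elim: l => // y [|y' l] //= ->. Qed.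

Lemma nrep_ren phi es l : {in names l &, injective phi} -> all (below (names l)) es ->
  nrep (rene phi es) (ren phi l) = nrep es l.
Proof.
elim: es l => [|e es IH] l inj /=; first by rewrite mu_ren.
move=> /andP[/andP[b1 b2] bes]; apply: eq_bigr => k _; rewrite /OPE /OP /=.
have i1 n : n \in names l -> {in n :: names l &, injective phi}.
  by move=> nl i j; rewrite !inE => /predU1P[->|il] /predU1P[->|jl] //; apply: inj.
rewrite sgp_ren; last exact: i1.
rewrite hat_ren; last exact: i1.
rewrite sgp_ren ?names_hat; last exact: i1.
rewrite hat_ren ?names_hat; last exact: i1.
by rewrite IH ?names_hat.
Qed.

Section Comp.
Variables (I J : seq nat) (G' : seq edge).
Hypotheses (UIJ : uniq (I ++ J)) (I0 : I <> [::]) (bG' : all (below I) G').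

Let UI : uniq I. Proof. by move: UIJ; rewrite cat_uniq => /andP[]. Qed.
Let UJ : uniq J. Proof. by move: UIJ; rewrite cat_uniq => /and3P[]. Qed.
(** In the outer graph the inserted block is vertex 0 and the vertices of [J] follow in order; [gl]
    is the tensor that the outer graph sees. *)
Definition jdx n := (index n J).+1.
Definition gl lI lJ : seq Y := (0%N, (xpar lI, nrep G' lI)) :: ren jdx lJ.
Let gns := 0%N :: map jdx J.

Lemma jdx_inj : {in J &, injective jdx}.
Proof. by move=> i j iJ jJ [] /(congr1 (nth 0%N J)); rewrite !nth_index. Qed.

Lemma dom_nil ns l : dom ns l -> ns <> [::] -> l <> [::].
Proof. by move=> /andP[/eqP + _] n0 l0; rewrite l0 => /esym. Qed.

Lemma slot_sum q (T : eqType) (r : seq T) (a : T -> R) (F : T -> L) m Psi : hml gns Psi ->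
  (forall f, okb (q, f) -> dom gns ((0%N, (q, f)) :: m)) -> (forall i, i \in r -> okb (q, F i)) ->
  Psi ((0%N, (q, \sum_(i <- r) a i *: F i)) :: m) = \sum_(i <- r) a i *: Psi ((0%N, (q, F i)) :: m).
Proof.
move=> mP dm; have z := okb0 Lok q.
elim: r => [|i r IH] oF; rewrite ?big_nil ?big_cons.
  have := mP [::] m 0%N q (-1) 0 0 (dm 0 z) z; rewrite scaler0 addr0 scaleN1r addNr.
  by move=> /= ->.
have oS : okb (q, \sum_(i <- r) a i *: F i).
  rewrite big_seq; elim/big_ind: _ => [|f g of_ og|j jr]; first exact: okb0.
    by rewrite -[f]scale1r; exact: okbP.
  by apply: okbZ => //; apply: oF; rewrite inE jr orbT.
have oi : okb (q, F i) by apply: oF; rewrite inE eqxx.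
rewrite -IH => [|j jr]; last by apply: oF; rewrite inE jr orbT.
exact: (mP [::] m 0%N q (a i) (F i) _ (dm _ oi) oS).
Qed.

(** A derivative at slot 0 hits the value of [G'] and spreads over the factors of [I] by the Leibniz
    rule, which is the list [attach I J 0]; at any other slot it hits a single factor. *)
Lemma star b s k Psi X0 i lI lJ : hml gns Psi ->
  (forall lI lJ, dom I lI -> dom J lJ -> Psi (gl lI lJ) = X0 (lI ++ lJ)) ->
  (i <= size J)%N -> dom I lI -> dom J lJ -> OP (pi b) (@gD _ _ A b s k) i Psi (gl lI lJ) =
  \sum_(u <- attach I J i) OP (pi b) (gD s k) u X0 (lI ++ lJ).
Proof.
move=> mP E iJ dI dJ; have nI : names lI = I by case/andP: dI => /eqP.
have nJ : names lJ = J by case/andP: dJ => /eqP.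
have jI n : n \in I -> n \notin J.
  by move=> nI'; move: UIJ; rewrite cat_uniq => /and3P[_ /hasPn H _]; apply: contraL nI' => /H.
case: i iJ => [_|i iJ] /=; last first.
  have iJ' : nth 0%N J i \in J by rewrite mem_nth.
  have ji : jdx (nth 0%N J i) = i.+1 by rewrite /jdx index_uniq.
  have inj : {in nth 0%N J i :: names lJ &, injective jdx}.
    by rewrite nJ => n n'; rewrite !inE => /predU1P[->|nl] /predU1P[->|nl'] //; apply: jdx_inj.
  rewrite big_seq1 /OP /= -ji sgp_ren // sgp_cat nI.
  have /negbTE-> : nth 0%N J i \notin I by apply: contraL iJ'; exact: jI.
  rewrite hat_ren // [hat _ _ _ (lI ++ lJ)]hat_cat.
  rewrite (hat_notin _ _ (l := lI)) ?nI; last by apply: contraL iJ'; exact: jI.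
  by rewrite -E //; exact: dom_hat (g_der s k) dJ.
rewrite /OP /= andbF scale1r /hat1 /= -/(hat _ _ _ (ren jdx lJ)) hat_notin; last first.
  by rewrite names_ren; apply/negP => /mapP[].
rewrite (nrep_der s k UI I0 bG' dI) /OP.
have xI u : u \in I -> xpar (hat (pi b) (gD s k) u lI) = xpar lI (+) pi b.
  by move=> uI; rewrite xpar_hat ?nI.
rewrite (@slot_sum (xpar lI (+) pi b)) //.
- rewrite [LHS]big_seq [RHS]big_seq; apply: eq_bigr => u uI.
  rewrite sgp_cat nI uI -(xI u uI) -[X in _ *: Psi X]/(gl (hat (pi b) (gD s k) u lI) lJ).
  rewrite E //; last exact: dom_hat (g_der s k) dI.
  by rewrite hat_cat (hat_notin _ _ (l := lJ)) // nJ jI.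
- move=> f of_; rewrite /dom /= names_ren snds_ren; case/andP: (dJ) => /eqP-> ->.
  by rewrite eqxx andbT.
- move=> u uI; rewrite -(xI u uI); have dh := dom_hat u (g_der s k) dI.
  by apply: (nrep_ok Lok A UI bG' dh); exact: dom_nil dh _.
Qed.

Lemma mu_gl lI lJ : dom I lI -> dom J lJ -> mu A (gl lI lJ) = nrep G' (lI ++ lJ).
Proof.
move=> dI dJ; case: lJ dJ => [|y lJ] dJ; first by rewrite cats0.
rewrite /gl mu_cons // mu_ren /=; set m := y :: lJ in dJ *.
have nJ : names m = J by case/andP: dJ => /eqP.
elim: G' bG' lI dI => [|e es IH] /=.
  by move=> _ lI dI; rewrite mu_cat //; exact: dom_nil dI _.
move=> /andP[/andP[b1 b2] bes] lI dI; rewrite /Delta mul_suml; apply: eq_bigr => k _.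
have nI : names lI = I by case/andP: dI => /eqP.
have jI n : n \in I -> n \notin names m.
  by rewrite nJ => nI'; move: UIJ; rewrite cat_uniq => /and3P[_ /hasPn H _]; apply: contraL nI' => /H.
rewrite /OPE /OP !mulZl sgp_cat nI b2 [hat _ _ e.1.2 (lI ++ m)]hat_cat.
rewrite (hat_notin _ _ (jI _ b2)) sgp_cat names_hat nI b1 hat_cat (hat_notin _ _ (jI _ b1)).
rewrite IH //; apply: dom_hat; first exact: g_der.
by apply: dom_hat; first exact: g_der.
Qed.

(** Induction on the edges of [G]: applying [star] at both ends of an edge produces the choices made
    by [reattach]. *)
Lemma nrep_comp G lI lJ : all (fun e => (e.1.1 <= size J)%N && (e.1.2 <= size J)%N) G ->
  dom I lI -> dom J lJ ->
  nrep G (gl lI lJ) = \sum_(es <- reattach I J G) nrep (es ++ G') (lI ++ lJ).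
Proof.
elim: G lI lJ => [|e G IH] lI lJ.
  by move=> _ dI dJ; rewrite big_seq1; exact: mu_gl.
move=> /andP[/andP[e1 e2] bG] dI dJ; rewrite /= big_allpairs_dep big_allpairs_dep.
pose X0 l := \sum_(es <- reattach I J G) nrep (es ++ G') l.
have E0 lI' lJ' : dom I lI' -> dom J lJ' -> nrep G (gl lI' lJ') = X0 (lI' ++ lJ').
  by move=> dI' dJ'; exact: IH.
rewrite /Delta.
transitivity (\sum_(k : gK A e.2) \sum_(v <- attach I J e.1.2) \sum_(u <- attach I J e.1.1)
   \sum_(es <- reattach I J G)
    OP (pi e.2) (gD false k) v (OP (pi e.2) (gD true k) u (nrep (es ++ G'))) (lI ++ lJ)).
  apply: eq_bigr => k _; rewrite /OPE /=.
  pose X1 l := \sum_(u <- attach I J e.1.1) OP (pi e.2) (gD true k) u X0 l.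
  rewrite (star false k (X0 := X1)) //.
  - apply: eq_bigr => v _; rewrite /X1 OP_sum; apply: eq_bigr => u _.
    by rewrite -OP_sum; rewrite /OP; congr (_ *: _); rewrite /X0 scaler_sumr.
  - by apply: OP_hml; [exact: g_der|exact: nrep_hml].
  - by move=> lI' lJ' dI' dJ'; apply: star => //; exact: nrep_hml.
rewrite exchange_big /= [RHS]exchange_big /=.
rewrite (eq_bigr (fun v => \sum_(u <- attach I J e.1.1) \sum_(es <- reattach I J G) \sum_(k : gK A e.2)
    OP (pi e.2) (gD false k) v (OP (pi e.2) (gD true k) u (nrep (es ++ G'))) (lI ++ lJ))) //.
move=> v _; rewrite exchange_big /=; apply: eq_bigr => u _; exact: exchange_big.
Qed.
End Comp.

Section Shuf.
Definition swall Phi := forall l1 y z l2, uniq (names (l1 ++ y :: z :: l2)) ->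
  all (@okb R L) (snds (l1 ++ y :: z :: l2)) ->
  Phi (l1 ++ y :: z :: l2) = (-1) ^+ (y.2.1 && z.2.1) *: Phi (l1 ++ z :: y :: l2).

Lemma swall_nrep es : swall (nrep es).
Proof.
move=> l1 y z l2 U o; rewrite names_cat /= in U.
by apply: (sw_nrep A U) => //; rewrite ?size_map // /dom names_cat eqxx.
Qed.

Lemma uo_perm l l' : perm_eq l l' -> uniq (names l) && all (@okb R L) (snds l) ->
  uniq (names l') && all (@okb R L) (snds l').
Proof. by move=> p; rewrite (perm_uniq (perm_map fst p)) (perm_all _ (perm_map snd p)). Qed.

Lemma swall_move Phi l1 y K m : swall Phi ->
  uniq (names (l1 ++ y :: K ++ m)) && all (@okb R L) (snds (l1 ++ y :: K ++ m)) ->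
  Phi (l1 ++ y :: K ++ m) = (-1) ^+ (y.2.1 && xpar K) *: Phi (l1 ++ K ++ y :: m).
Proof.
move=> sP; elim: K l1 => [|z K IH] l1 uo; first by rewrite andbF scale1r.
case/andP: (uo) => U o; rewrite cat_cons sP // -cat_rcons IH ?cat_rcons; last first.
  apply: uo_perm uo; rewrite perm_cat2l.
  by rewrite -[y :: (z :: K) ++ m]/([:: y] ++ [:: z] ++ (K ++ m)) perm_catCA.
by rewrite scalerA -signr_addb /= andb_addr.
Qed.

Lemma block_size_perm c l : size c = size l -> all (fun i => i < 2)%N c ->
  perm_eq l (block 0 c l ++ block 1 c l).
Proof.
elim: l c => [|y l IH] [|i c] //= [sc] /andP[i2 c2]; rewrite !blk_cons.
have := IH c sc c2; case: i i2 => [|[|i]] //= _ p; first by rewrite perm_cons.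
by rewrite perm_sym -cat1s perm_catCA /= perm_cons perm_sym.
Qed.

Lemma xpar_block c l : size c = size l ->
  xpar (block 0 c l) = odd (\sum_(j < size c) ((nth 0 c j < 1) && nth false [seq y.2.1 | y <- l] j)%N).
Proof.
elim: l c => [|y l IH] [|i c] //= => [_|[sc]]; first by rewrite big_ord0.
rewrite blk_cons big_ord_recl /= oddD -IH // ltnS leqn0 oddb.
by case: (i == 0%N).
Qed.

(** Moving the entries of the second block to the back costs one Koszul sign per inversion, whence
    the exponent with [andb]. *)
Lemma swall_shuffle Phi c l1 l : swall Phi -> size c = size l -> all (fun i => i < 2)%N c ->
  uniq (names (l1 ++ l)) && all (@okb R L) (snds (l1 ++ l)) ->
  Phi (l1 ++ l) = (-1) ^+ shuffle_exp andb c [seq y.2.1 | y <- l] *: Phi (l1 ++ block 0 c l ++ block 1 c l).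
Proof.
move=> sP; elim: l c l1 => [|y l IH] [|i c] l1 //.
  by rewrite /shuffle_exp big_ord0 scale1r.
move=> [sc] /= /andP[i2 c2] uo; rewrite !blk_cons shuffle_exp_cons.
rewrite -cat_rcons (IH c) ?cat_rcons //.
case: i i2 => [|[|i]] //= _.
  by rewrite big1 // => j _; rewrite ltn0.
rewrite swall_move //; last first.
  apply: uo_perm uo; rewrite perm_cat2l perm_cons; exact: block_size_perm.
rewrite scalerA -exprD -[in LHS]signr_odd -[in RHS]signr_odd; congr ((-1) ^+ _ *: _).
have E := xpar_block sc; rewrite !oddD addbC; congr nat_of_bool; congr addb; rewrite oddb.
case: (y.2.1); last by rewrite big1 // => j _; rewrite andbF.
by rewrite E.
Qed.
End Shuf.
End Compose.

(** * From graph chains to cochains *)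

Section ARep.
Context (R : realType) (L : glie R) (Lok : glieok L) (A : galg L).
Local Notation X := (bool * L)%type.
Local Notation Y := (nat * X)%type.
Implicit Types (h I J : seq X) (l lI lJ : seq Y) (x y : X) (ns : seq nat) (es : seq edge) (G H : graph).
Implicit Types (c : seq nat) (gamma : gchain R).
Local Notation okl := (all (@okb R L)).
Local Notation us := (@us R L).
Local Notation nrep := (nrep A).

Definition nm h : seq Y := zip (iota 0 (size h)) h.
Definition hp h : bool := foldr (fun x b => x.1 (+) b) false h.
Definition hrep gamma h : L := \sum_(G \in [set: graph]) gamma (size h) G *: nrep (edges G) (nm h).
Definition arep gamma : Defs.family L := ext (hrep gamma).

Definition swp i : nat -> nat := fun n => if n == i then i.+1 else if n == i.+1 then i else n.

(** The conditions on a chain that matter for signs and finiteness; the parity of the degree 3(N -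
    1) - 2k is that of N - 1. Acyclicity and connectedness are kept apart, in [gshape]. *)
Record gch (d : bool) gamma : Prop := Gch { gch_fin : forall N, finite_set [set G | gamma N G <> 0];
  gch_below : forall N G, gamma N G <> 0 -> vertices_below N G;
  gch_par : forall N G, gamma N G <> 0 -> odd N = ~~ d;
  gch_anti : forall N i G, (i.+1 < N)%N -> gamma N (seq_mset (relabel (swp i) G)) = - gamma N G }.

Definition gsp gamma N : seq graph := fset_set [set G | gamma N G <> 0].

Lemma gspP gamma N G : finite_set [set G | gamma N G <> 0] -> G \notin gsp gamma N -> gamma N G = 0.
Proof. by move=> f; rewrite /gsp in_fset_set // => /negP; rewrite inE /= => /contrapT. Qed.

Lemma mem_gsp gamma N G : finite_set [set G | gamma N G <> 0] -> G \in gsp gamma N -> gamma N G <> 0.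
Proof. by move=> f; rewrite /gsp in_fset_set // inE. Qed.

Lemma fs_seq (V : lmodType R) (F : graph -> V) (r : seq graph) : uniq r ->
  (forall G, G \notin r -> F G = 0) -> \sum_(G \in [set: graph]) F G = \sum_(G <- r) F G.
Proof.
move=> ur F0; rewrite [RHS]fsbig_seq //; symmetry; apply: fsbig_widen => // G [_ /= nG].
by apply: F0; exact/negP.
Qed.

Lemma gsp_uniq gamma N : uniq (gsp gamma N). Proof. exact: fset_uniq. Qed.

Lemma hrepE gamma h : finite_set [set G | gamma (size h) G <> 0] ->
  hrep gamma h = \sum_(G <- gsp gamma (size h)) gamma (size h) G *: nrep (edges G) (nm h).
Proof.
move=> f; apply: fs_seq; first exact: gsp_uniq.
by move=> G /(gspP f) ->; rewrite scale0r.
Qed.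

Lemma names_zip ns h : size ns = size h -> names (zip ns h) = ns.
Proof. by move=> e; rewrite -[LHS]/(unzip1 _) unzip1_zip // e. Qed.
Lemma snds_zip ns h : size ns = size h -> snds (zip ns h) = h.
Proof. by move=> e; rewrite -[LHS]/(unzip2 _) unzip2_zip // e. Qed.
Lemma names_nm h : names (nm h) = iota 0 (size h).
Proof. by rewrite names_zip // size_iota. Qed.
Lemma snds_nm h : snds (nm h) = h.
Proof. by rewrite snds_zip // size_iota. Qed.
Lemma xparE l : xpar l = hp (snds l).
Proof. by elim: l => //= y l ->. Qed.
Lemma dom_nm h : okl h -> dom (iota 0 (size h)) (nm h).
Proof. by move=> oh; rewrite /dom names_nm snds_nm eqxx. Qed.

Lemma nm_cat h1 h2 : nm (h1 ++ h2) = nm h1 ++ zip (iota (size h1) (size h2)) h2.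
Proof. by rewrite /nm size_cat iotaD zip_cat // size_iota. Qed.

Lemma vb_below N G : vertices_below N G -> all (below (iota 0 N)) (edges G).
Proof. by move=> /allP vb; apply/allP => e /vb; rewrite /below !mem_iota !add0n. Qed.

Lemma hrep_hmult gamma : (forall N, finite_set [set G | gamma N G <> 0]) -> hmult (hrep gamma).
Proof.
move=> f h1 h2 p a u v o1 o2 ou ov.
have oP := okbP Lok a ou ov.
have sz w : size (h1 ++ (p, w) :: h2) = (size h1 + (size h2).+1)%N by rewrite size_cat.
rewrite !hrepE // !sz scaler_sumr -big_split; apply: eq_bigr => G _ /=.
have dl : dom (iota 0 (size h1 + (size h2).+1)) (nm (h1 ++ (p, u) :: h2)).
  by have := dom_nm (h := h1 ++ (p, u) :: h2); rewrite sz all_cat /= o1 o2 ou; apply.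
rewrite !nm_cat /= in dl *; rewrite (@nrep_hml _ _ A _ (edges G) _ _ _ _ _ _ _ dl ov).
by rewrite scalerDr !scalerA mulrC.
Qed.

Lemma arep_us gamma h : (forall N, finite_set [set G | gamma N G <> 0]) -> okl h ->
  arep gamma (us h) = hrep gamma h.
Proof. by move=> f oh; apply: (ext_us Lok) => //; exact: hrep_hmult. Qed.

Lemma nrep_nm_ok G h : vertices_below (size h) G -> okl h -> h <> [::] ->
  okb (hp h, nrep (edges G) (nm h)).
Proof.
move=> vb oh h0; have := @nrep_ok _ _ Lok A (iota 0 (size h)) (edges G) (nm h) (iota_uniq _ _) (vb_below vb) (dom_nm oh).
by rewrite xparE snds_nm; apply; case: (h) h0.
Qed.

Lemma hrep_ok gamma h : (forall N, finite_set [set G | gamma N G <> 0]) ->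
  (forall N G, gamma N G <> 0 -> vertices_below N G) -> okl h -> h <> [::] ->
  okb (hp h, hrep gamma h).
Proof.
move=> f b oh h0; rewrite hrepE // big_seq.
elim/big_ind: _ => [|u v ou ov|G /(mem_gsp (f _)) Gs]; first exact: okb0.
  by rewrite -[u]scale1r; exact: okbP.
by apply: okbZ => //; apply: nrep_nm_ok => //; exact: b.
Qed.

Lemma nrep_mset es h : all (below (iota 0 (size h))) es -> okl h ->
  nrep (edges (seq_mset es)) (nm h) = nrep es (nm h).
Proof.
move=> be oh; have p : perm_eq (edges (seq_mset es)) es by exact: perm_eq_seq_mset.
apply: (nrep_perm Lok A (iota_uniq 0 (size h)) _ p (dom_nm oh)).
by rewrite (perm_all _ p).
Qed.

Lemma swp_i i : swp i i = i.+1. Proof. by rewrite /swp eqxx. Qed.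
Lemma swp_iS i : swp i i.+1 = i. Proof. by rewrite /swp eqxx; case: eqP => //; lia. Qed.
Lemma swp_lo i n : (n < i)%N -> swp i n = n.
Proof. by rewrite /swp; do ?case: eqP => //; lia. Qed.
Lemma swp_hi i n : (i.+1 < n)%N -> swp i n = n.
Proof. by rewrite /swp; do ?case: eqP => //; lia. Qed.
Lemma swpK i : involutive (swp i).
Proof. by move=> n; rewrite /swp; do ?case: eqP => //; lia. Qed.

Lemma edges_mset (s : seq edge) : perm_eq (edges (seq_mset s)) s.
Proof. exact: perm_eq_seq_mset. Qed.

Lemma relabel_mset (f : nat -> nat) (s : seq edge) : seq_mset (relabel f (seq_mset s)) = seq_mset (rene f s).
Proof. by apply/eq_seq_msetP/perm_map; exact: edges_mset. Qed.

Lemma relabelK i G : seq_mset (relabel (swp i) (seq_mset (relabel (swp i) G))) = G.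
Proof.
rewrite relabel_mset -[RHS]seq_mset_id; congr seq_mset.
rewrite /rene -map_comp -[RHS]map_id; apply: eq_map => -[[a b] c] /=.
by rewrite !swpK.
Qed.

Lemma swp_lt i N n : (i.+1 < N)%N -> (swp i n < N)%N = (n < N)%N.
Proof. by move=> iN; rewrite /swp; do ?case: eqP => //; lia. Qed.

(** Exchanging two arguments amounts to relabelling the graph by a transposition: antisymmetry of
    the chain supplies the signature, and the graded commutative product the Koszul sign. *)
Lemma hrep_swap d gamma h1 x y h2 : gch d gamma -> okl (h1 ++ x :: y :: h2) ->
  hrep gamma (h1 ++ x :: y :: h2) = (-1) ^+ skew_chi x.1 y.1 *: hrep gamma (h1 ++ y :: x :: h2).
Proof.
move=> [f b _ an] oh; set h := h1 ++ _; set h' := h1 ++ y :: x :: h2; set i := size h1.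
have sh : size h' = size h by rewrite !size_cat.
have iN : (i.+1 < size h)%N by rewrite /h size_cat /= /i; lia.
have oh' : okl h' by move: oh; rewrite !all_cat /= => /andP[-> /and3P[-> -> ->]].
have bG G : G \in gsp gamma (size h) -> vertices_below (size h) G.
  by move/(mem_gsp (f _)); exact: b.
pose rg G : graph := seq_mset (relabel (swp i) G).
have E G : G \in gsp gamma (size h) ->
    nrep (edges G) (nm h) = (-1) ^+ (x.1 && y.1) *: nrep (edges (rg G)) (nm h').
  move=> /bG vG; have bl := vb_below vG.
  have vG' : vertices_below (size h) (rg G).
    rewrite /vertices_below (perm_all _ (edges_mset _)) all_map.
    by apply/allP => e /(allP vG); rewrite /= !swp_lt.
  have := dom_nm oh; rewrite /h nm_cat /= -/i => dl.
  have U : uniq (names (nm h1 ++ (i, x) :: (i.+1, y) :: zip (iota i.+2 (size h2)) h2)).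
    by case/andP: dl => /eqP -> _; exact: iota_uniq.
  have o : okl (snds (nm h1 ++ (i, x) :: (i.+1, y) :: zip (iota i.+2 (size h2)) h2)).
    by case/andP: dl.
  rewrite (swall_nrep A _ U o) /=; congr (_ *: _).
  rewrite (nrep_mset (h := h')) //; last first.
    by rewrite sh -(perm_all _ (edges_mset _)); exact: vb_below.
  have -> : nm h' = ren (swp i) (nm h1 ++ (i.+1, y) :: (i, x) :: zip (iota i.+2 (size h2)) h2).
    rewrite /h' nm_cat /ren map_cat /= -/i swp_i swp_iS; congr (_ ++ _ :: _ :: _).
      rewrite -[LHS]map_id; apply/eq_in_map => z zl.
      have : z.1 \in names (nm h1) by exact: map_f.
      rewrite names_nm mem_iota add0n => /andP[_ zi].
      by rewrite swp_lo //; case: (z).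
    rewrite -[LHS]map_id; apply/eq_in_map => z zl.
    have : z.1 \in names (zip (iota i.+2 (size h2)) h2) by exact: map_f.
    rewrite names_zip ?size_iota // mem_iota => /andP[zi _].
    by rewrite swp_hi //; case: (z).
  rewrite -[relabel _ G]/(rene (swp i) (edges G)) nrep_ren //.
    by move=> n n' _ _; exact: (inv_inj (swpK i)).
  have -> // : all (below (names (nm h1 ++ (i.+1, y) :: (i, x) :: zip (iota i.+2 (size h2)) h2))) (edges G).
  move: bl; apply: sub_all => e; rewrite /below.
  have P : perm_eq (names (nm h1 ++ (i.+1, y) :: (i, x) :: zip (iota i.+2 (size h2)) h2)) (iota 0 (size h)).
    case/andP: dl => /eqP <- _; apply: perm_map; rewrite perm_cat2l.
    by apply/seq.permP => q /=; rewrite addnCA.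
  by rewrite !(perm_mem P).
rewrite !hrepE // sh big_seq.
transitivity (\sum_(G <- gsp gamma (size h)) (gamma (size h) G * (-1) ^+ (x.1 && y.1)) *: nrep (edges (rg G)) (nm h')).
  by rewrite [RHS]big_seq; apply: eq_bigr => G /E ->; rewrite scalerA.
(* Relabelling is an involution that changes the coefficient by a sign only, so it permutes the
   support. *)
have perm : perm_eq [seq rg G | G <- gsp gamma (size h)] (gsp gamma (size h)).
  apply: uniq_perm; [|exact: gsp_uniq|].
    rewrite map_inj_uniq ?gsp_uniq // => G1 G2 /(congr1 rg).
    by rewrite /rg !relabelK.
  move=> G; apply/mapP/idP => [[G' G's ->]|Gs].
    rewrite in_fset_set // inE /= an // => /eqP; rewrite oppr_eq0 => /eqP.
    exact: mem_gsp.
  exists (rg G); last by rewrite /rg relabelK.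
  rewrite in_fset_set // inE /= an // => /eqP; rewrite oppr_eq0 => /eqP.
  exact: mem_gsp.
rewrite -[in RHS](perm_big _ perm) big_map scaler_sumr; apply: eq_bigr => G _.
rewrite /rg an // scalerA; congr (_ *: _).
by case: (x.1); case: (y.1); rewrite /= ?expr0 ?expr1 ?mulr1 ?mulrN1 ?mul1r ?mulN1r ?opprK.
Qed.

Lemma lab_hp d h : odd (size h) = ~~ d -> lab d h = hp h.
Proof.
rewrite /lab; have -> : spar h = odd (size h) (+) hp h.
  by elim: h => //= x h ->; case: x.1; case: (odd _); case: (hp h).
by move=> ->; case: d; case: hp.
Qed.

Lemma pco_arep d gamma : gch d gamma -> pco skew_chi d (arep gamma).
Proof.
move=> g; have [f b pr _] := g; split.
- move=> s s0 ss; apply: gsub_ext => // h oh sh; apply: (@okb_sub _ _ (hp h, _)).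
  by apply: hrep_ok => // h0; move: sh s0; rewrite h0; case: (s).
- by apply: (ext_mult Lok); exact: hrep_hmult.
- move=> h1 h2 x y o1 o2 ox oy.
  have oh z w : okb z -> okb w -> okl (h1 ++ z :: w :: h2).
    by move=> oz ow; rewrite all_cat /= o1 oz ow o2.
  by rewrite !arep_us ?oh //; apply: hrep_swap g _; exact: oh.
- move=> h h0 oh; rewrite arep_us // hrepE // big_seq.
  elim/big_ind: _ => [|u v eu ev|G /(mem_gsp (f _)) Gs]; first exact: gpar0.
    by rewrite (gparD Lok) eu ev.
  rewrite (gparZ Lok); congr (_ *: _); rewrite lab_hp; last exact: pr Gs.
  by apply: (@okb_par _ _ (_, _)); apply: nrep_nm_ok => //; exact: b.
Qed.

Lemma sum_count (V : lmodType R) (T : Type) (r : seq T) (K : eqType) (f : T -> K) (cand : seq K) (F : K -> V) :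
  uniq cand -> all (fun t => f t \in cand) r ->
  \sum_(H <- cand) (count (fun t => f t == H) r)%:R *: F H = \sum_(t <- r) F (f t).
Proof.
move=> uc; elim: r => [|t r IH] /=.
  by rewrite big_nil big1 // => H _; rewrite scale0r.
move=> /andP[tc rc]; rewrite big_cons -IH //.
under eq_bigr do rewrite natrD scalerDl; rewrite big_split /=; congr (_ + _).
rewrite (bigD1_seq (f t)) //= eqxx scale1r big1 ?addr0 // => H.
by rewrite eq_sym => /negbTE ->; rewrite scale0r.
Qed.

(** A finite list containing every graph that can occur in the product in arity [M]; it turns sums
    over all graphs into finite ones. *)
Definition cand (gamma gamma' : gchain R) M : seq graph := undup
  [seq seq_mset (p.2.2 ++ relabel (nth 0%N (block 0 p.1 (iota 0 M))) p.2.1.2) |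
  p <- flatten [seq [seq (labels t, (GG, es)) | es <- reattach (block 0 (labels t) (iota 0 M)) (block 1 (labels t) (iota 0 M)) (edges GG.1)] |
  t <- enum {: M.-tuple 'I_2}, GG <- [seq ((G, G') : graph * graph) | G <- gsp gamma (size (block 1 (labels t) (iota 0 M))).+1,
  G' <- gsp gamma' (size (block 0 (labels t) (iota 0 M)))]]].

Lemma mem_cand (gamma gamma' : gchain R) M (c : M.-tuple 'I_2) G G' es :
  G \in gsp gamma (size (block 1 (labels c) (iota 0 M))).+1 ->
  G' \in gsp gamma' (size (block 0 (labels c) (iota 0 M))) ->
  es \in reattach (block 0 (labels c) (iota 0 M)) (block 1 (labels c) (iota 0 M)) (edges G) ->
  seq_mset (es ++ relabel (nth 0%N (block 0 (labels c) (iota 0 M))) G') \in cand gamma gamma' M.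
Proof.
move=> Gs Gs' ees; rewrite mem_undup; apply/mapP; exists (labels c, ((G, G'), es)) => //.
apply/flattenP; exists [seq (labels c, ((G, G'), es0)) | es0 <- reattach (block 0 (labels c) (iota 0 M)) (block 1 (labels c) (iota 0 M)) (edges G)].
  apply/allpairsPdep; exists c, (G, G'); split => //; first by rewrite mem_enum.
  by apply/allpairsP; exists (G, G').
by apply/mapP; exists es.
Qed.

Definition gci M (c : M.-tuple 'I_2) := block 0 (labels c) (iota 0 M).
Definition gcj M (c : M.-tuple 'I_2) := block 1 (labels c) (iota 0 M).

Lemma gc_preE d (gamma gamma' : gchain R) M H :
  (forall N, finite_set [set G | gamma N G <> 0]) -> (forall N, finite_set [set G | gamma' N G <> 0]) ->
  gc_pre d gamma gamma' M H = \sum_(c : M.-tuple 'I_2 | ord0 \in c)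
  (-1) ^+ (shuffle_exp skew_chi (labels c) [::] + d * size (gcj c)) *
  \sum_(G <- gsp gamma (size (gcj c)).+1) \sum_(G' <- gsp gamma' (size (gci c)))
  gamma (size (gcj c)).+1 G * gamma' (size (gci c)) G' * (insert_coef (gci c) (gcj c) G G' H)%:R.
Proof.
move=> f f'; apply: eq_bigr => c _; congr (_ * _).
rewrite (fs_seq (r := gsp gamma (size (gcj c)).+1)) ?gsp_uniq //.
  apply: eq_bigr => G _; rewrite (fs_seq (r := gsp gamma' (size (gci c)))) ?gsp_uniq // => G' G's.
  by rewrite (gspP (f' _) G's) mulr0 mul0r.
move=> G Gs; rewrite (fs_seq (r := [::])) ?big_nil // => G' _.
by rewrite (gspP (f _) Gs) !mul0r.
Qed.

Lemma gc_pre_cand d (gamma gamma' : gchain R) M H :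
  (forall N, finite_set [set G | gamma N G <> 0]) -> (forall N, finite_set [set G | gamma' N G <> 0]) ->
  H \notin cand gamma gamma' M -> gc_pre d gamma gamma' M H = 0.
Proof.
move=> f f' Hc; rewrite gc_preE //; apply: big1 => c _.
rewrite big_seq big1 ?mulr0 // => G Gs; rewrite big_seq big1 // => G' Gs'.
rewrite (_ : insert_coef _ _ _ _ _ = 0%N) ?mulr0 //; apply/eqP.
rewrite -leqn0 leqNgt -has_count; apply/hasPn => es ees.
by apply: contra Hc => /eqP <-; exact: (mem_cand Gs Gs' ees).
Qed.

Lemma gc_pre_fin d (gamma gamma' : gchain R) M :
  (forall N, finite_set [set G | gamma N G <> 0]) -> (forall N, finite_set [set G | gamma' N G <> 0]) ->
  finite_set [set H | gc_pre d gamma gamma' M H <> 0].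
Proof.
move=> f f'; apply: (@sub_finite_set _ _ [set` cand gamma gamma' M]); last exact: finite_seq.
by move=> H /= H0; apply: contrapT => /negP Hc; apply: H0; exact: gc_pre_cand.
Qed.

Lemma block_perm_nm (T : Type) k c (s : seq T) n : size c = size s ->
  block k c (zip (iota n (size s)) s) = zip (block k c (iota n (size s))) (block k c s).
Proof.
elim: s c n => [|y s IH] [|i c] n //= [sc]; rewrite !blk_cons IH //.
by case: (i == k).
Qed.

Lemma reattach_below (I J ns : seq nat) (es es' : seq edge) : {subset I <= ns} ->
  {subset J <= ns} -> all (fun e => (e.1.1 <= size J)%N && (e.1.2 <= size J)%N) es ->
  es' \in reattach I J es -> all (below ns) es'.
Proof.
move=> sI sJ; elim: es es' => [|e es IH] es' /=; first by rewrite inE => _ /eqP->.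
move=> /andP[/andP[e1 e2] be] /allpairsP[[x t] /= [/allpairsP[[u v] /= [ua va ->]] tr ->]] /=.
rewrite IH // andbT /below /=.
have att i w : (i <= size J)%N -> w \in attach I J i -> w \in ns.
  case: i => [_|i iJ] /=; first exact: sI.
  by rewrite inE => /eqP->; apply: sJ; rewrite mem_nth.
by rewrite (att _ _ e1 ua) (att _ _ e2 va).
Qed.

Lemma block_sub k c (s : seq nat) : {subset block k c s <= s}.
Proof.
elim: s c => [|y s IH] [|i c] // n; rewrite blk_cons; case: (i == k); rewrite ?inE.
  by case/predU1P => [->|/IH->]; rewrite ?eqxx ?orbT.
by move/IH => ->; rewrite orbT.
Qed.

(** [skew_chi] is the signature times the Koszul sign, and with an empty list of parities only the
    signature is left. *)
Lemma se_sign c (t : seq bool) : ((-1) ^+ shuffle_exp skew_chi c t * (-1) ^+ shuffle_exp andb c t : R)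
  = (-1) ^+ shuffle_exp skew_chi c [::].
Proof.
rewrite -exprD; congr (_ ^+ _); rewrite /shuffle_exp -big_split; apply: eq_bigr => j _ /=.
rewrite -big_split; apply: eq_bigr => i _ /=; rewrite !nth_nil /skew_chi.
by case: (_ < _)%N => //=; case: (nth _ _ _ && nth _ _ _).
Qed.

Lemma uniq_block_cat c (s : seq nat) : size c = size s -> all (fun i => i < 2)%N c -> uniq s ->
  uniq (block 0 c s ++ block 1 c s).
Proof.
move=> sc c2; rewrite (perm_uniq (s2 := s)) // perm_sym.
elim: s c sc c2 => [|y s IH] [|i c] //= [sc] /andP[i2 c2]; rewrite !blk_cons.
have := IH c sc c2; case: i i2 => [|[|i]] //= _ p; first by rewrite perm_cons.
by rewrite perm_sym -cat1s perm_catCA /= perm_cons perm_sym.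
Qed.

Lemma labels_lt M (c : M.-tuple 'I_2) : all (fun i => i < 2)%N (labels c).
Proof. by apply/allP => i /mapP[j _ ->]; exact: ltn_ord. Qed.

(* One block decomposition [c]: inserting [G'] on block 0 into vertex 0 of [G]. *)
Lemma nrep_insert h (c : (size h).-tuple 'I_2) G G' : okl h -> ord0 \in c ->
  vertices_below (size (gcj c)).+1 G -> vertices_below (size (gci c)) G' ->
  nrep (edges G) (nm ((hp (block 0 (labels c) h), nrep (edges G') (nm (block 0 (labels c) h)))
  :: block 1 (labels c) h)) =
  (-1) ^+ shuffle_exp andb (labels c) [seq x.1 | x <- h] *:
  \sum_(es <- reattach (gci c) (gcj c) (edges G)) nrep (es ++ relabel (nth 0%N (gci c)) G') (nm h).
Proof.
move=> oh c0 vG vG'; set lc := labels c; set I := gci c; set J := gcj c.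
have sc : size lc = size h by rewrite size_map size_tuple.
have c2 := labels_lt c.
pose lI := block 0 lc (nm h); pose lJ := block 1 lc (nm h).
have scn : size lc = size (nm h) by rewrite size_zip size_iota minnn.
have eI : lI = zip I (block 0 lc h) by exact: block_perm_nm.
have eJ : lJ = zip J (block 1 lc h) by exact: block_perm_nm.
have sI : size I = size (block 0 lc h) by apply: size_block; rewrite size_iota.
have sJ : size J = size (block 1 lc h) by apply: size_block; rewrite size_iota.
have nI : names lI = I by rewrite eI names_zip // sI.
have nJ : names lJ = J by rewrite eJ names_zip // sJ.
have dI' : snds lI = block 0 lc h by rewrite eI snds_zip // sI.
have dJ' : snds lJ = block 1 lc h by rewrite eJ snds_zip // sJ.
have oIJ : okl (block 0 lc h ++ block 1 lc h).
  have bs (T : eqType) k c' (s : seq T) : {subset block k c' s <= s}.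
    elim: s c' => [|z s IH] [|i c'] // n; rewrite blk_cons; case: (i == k); rewrite ?inE.
      by case/predU1P => [->|/IH->]; rewrite ?eqxx ?orbT.
    by move/IH => ->; rewrite orbT.
  by rewrite all_cat; apply/andP; split; apply/allP => z /bs; exact: (allP oh).
have [oI oJ] : okl (block 0 lc h) /\ okl (block 1 lc h) by move: oIJ; rewrite all_cat => /andP.
have dI : dom I lI by rewrite /dom nI dI' eqxx.
have dJ : dom J lJ by rewrite /dom nJ dJ' eqxx.
have UIJ : uniq (I ++ J) by apply: uniq_block_cat => //; rewrite ?size_iota ?iota_uniq.
have UI : uniq I by move: UIJ; rewrite cat_uniq => /andP[].
have UJ : uniq J by move: UIJ; rewrite cat_uniq => /and3P[].
have I0 : I <> [::].
  by have := mem_block c (h := h) erefl; rewrite c0 /nilp -/lc -sI => + I1; rewrite I1.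
pose phi := nth 0%N I.
have renI : lI = ren phi (nm (block 0 lc h)).
  rewrite eI /nm -sI; apply: (@eq_from_nth _ (0%N, (false, 0))).
    by rewrite size_map !size_zip size_iota.
  move=> i; rewrite size_zip -sI minnn => iI.
  rewrite (nth_map (0%N, (false, 0))) ?size_zip ?size_iota -?sI ?minnn //.
  by rewrite !nth_zip ?size_iota -?sI //= nth_iota.
have phi_inj : {in names (nm (block 0 lc h)) &, injective phi}.
  move=> i j; rewrite names_nm !mem_iota -sI !add0n => /andP[_ iI] /andP[_ jI].
  by move/eqP; rewrite nth_uniq // => /eqP.
have bG' : all (below (iota 0 (size I))) (edges G') by exact: vb_below.
have E1 : nrep (edges G') (nm (block 0 lc h)) = nrep (relabel phi G') lI.
  by rewrite renI -[relabel _ _]/(rene phi (edges G')) nrep_ren // names_nm -sI.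
have bR : all (below I) (relabel phi G').
  rewrite all_map; apply/allP => e /(allP bG'); rewrite /below !mem_iota !add0n /= => /andP[e1 e2].
  by rewrite !mem_nth.
have E2 : nm ((hp (block 0 lc h), nrep (edges G') (nm (block 0 lc h))) :: block 1 lc h)
          = gl A J (relabel phi G') lI lJ.
  rewrite /gl /nm /= E1 xparE dI'; congr (_ :: _).
  rewrite /ren eJ -sJ; apply: (@eq_from_nth _ (0%N, (false, 0))).
    by rewrite [RHS]size_map !size_zip size_iota.
  move=> i; rewrite size_zip size_iota -sJ minnn => iJ.
  rewrite (nth_map (0%N, (false, 0))) ?size_zip -?sJ ?minnn //.
  by rewrite !nth_zip ?size_iota -?sJ //= nth_iota // /jdx index_uniq.
have bG : all (fun e => (e.1.1 <= size J)%N && (e.1.2 <= size J)%N) (edges G).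
  by move: vG; apply: sub_all => e.
rewrite E2 (nrep_comp Lok A UIJ I0 bR bG dI dJ) scaler_sumr big_seq [RHS]big_seq.
apply: eq_bigr => es ees.
have := @swall_shuffle _ _ (nrep (es ++ relabel phi G')) lc [::] (nm h) (@swall_nrep _ _ _ _) scn c2.
have t1 : [seq z.2.1 | z <- nm h] = [seq x.1 | x <- h].
  by rewrite -[in RHS](snds_nm h) /snds -map_comp.
rewrite /= names_nm snds_nm iota_uniq oh t1 => -> //.
by rewrite scalerA -signr_odd -expr2 sqrr_sign scale1r.
Qed.

(** Both sides are sums over the set of vertices that come from [gamma']. The Koszul sign of the
    shuffle is produced by [nrep_insert], the signature is the sign in [gc_pre], and together they
    form the skew sign. *)
Lemma arep_insertion d d' gamma gamma' : gch d gamma -> gch d' gamma' ->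
  feq (insertion skew_chi d' (arep gamma) (arep gamma')) (arep (gc_pre d' gamma gamma')).
Proof.
move=> g g'; have [f b pr _] := g; have [f' b' pr' _] := g'.
have pg := pco_arep g; have pg' := pco_arep g'.
have fp N := gc_pre_fin d' N f f'.
have mP := pcoM pg; have mP' := pcoM pg'; have cP' := pcoC pg'.
apply: (feq_ok Lok).
- exact: insertion_mult.
- by apply: (ext_mult Lok); exact: hrep_hmult.
move=> h h0 oh; rewrite ins_us // arep_us //; set M := size h.
rewrite /insh -Sh_tuple.
transitivity (\sum_(c : M.-tuple 'I_2 | ord0 \in c)
    (-1) ^+ (shuffle_exp skew_chi (labels c) [::] + d' * size (gcj c)) *:
    \sum_(G <- gsp gamma (size (gcj c)).+1) \sum_(G' <- gsp gamma' (size (gci c)))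
      (gamma (size (gcj c)).+1 G * gamma' (size (gci c)) G') *:
       \sum_(es <- reattach (gci c) (gcj c) (edges G)) nrep (es ++ relabel (nth 0%N (gci c)) G') (nm h)).
  rewrite [RHS]big_mkcond; apply: eq_bigr => c _.
  case: ifP => [n1|/negbT n0]; first by rewrite (mem_block c (h := h)) // n1 scaler0.
  have c0 : ord0 \in c by rewrite (mem_block c (h := h)).
  rewrite c0.
  set I := block 0 (labels c) h; set J := block 1 (labels c) h.
  have oIJ k : okl (block k (labels c) h).
    have bs (T : eqType) c' (s : seq T) : {subset block k c' s <= s}.
      elim: s c' => [|z s IH] [|i c'] // n; rewrite blk_cons; case: (i == k); rewrite ?inE.
        by case/predU1P => [->|/IH->]; rewrite ?eqxx ?orbT.
      by move/IH => ->; rewrite orbT.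
    by apply/allP => z /bs; exact: (allP oh).
  have I0 : I <> [::] by move/nilP: n0.
  have sI : size I = size (gci c) by apply: size_block; rewrite size_iota.
  have sJ : size J = size (gcj c) by apply: size_block; rewrite size_iota.
  have oI := oIJ 0%N; have oJ := oIJ 1%N.
  have oF : okb (hp I, hrep gamma' I) by exact: (hrep_ok f' b' oI I0).
  rewrite (arep_us f' oI) -[hrep gamma' I :: us J]/(us ((hp I, hrep gamma' I) :: J)).
  rewrite arep_us //=; last by rewrite oF.
  rewrite hrepE // /= sJ exprD !scalerA scaler_sumr [RHS]scaler_sumr.
  rewrite big_seq [RHS]big_seq; apply: eq_bigr => G Gs.
  have vG := b _ _ (mem_gsp (f _) Gs).
  have lin : nrep (edges G) (nm ((hp I, hrep gamma' I) :: J)) =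
     \sum_(G' <- gsp gamma' (size (gci c))) gamma' (size (gci c)) G' *:
        nrep (edges G) (nm ((hp I, nrep (edges G') (nm I)) :: J)).
    rewrite hrepE // sI.
    have dm u : okb (hp I, u) -> dom (iota 0 (size J).+1) (nm ((hp I, u) :: J)).
      by move=> ou; have := dom_nm (h := (hp I, u) :: J); apply; rewrite /= ou oIJ.
    have ok' G' : G' \in gsp gamma' (size (gci c)) -> okb (hp I, nrep (edges G') (nm I)).
      by move=> /(mem_gsp (f' _)) Gs'; apply: nrep_nm_ok => //; rewrite sI; exact: b'.
    have hm := @nrep_hml _ _ A (iota 0 (size J).+1) (edges G).
    elim: (gsp gamma' _) ok' => [|G' r IH] ok'.
      rewrite !big_nil; have z := okb0 Lok (hp I).
      have := hm [::] (zip (iota 1 (size J)) J) 0%N (hp I) (-1) 0 0 (dm _ z) z.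
      by rewrite scaler0 addr0 scaleN1r addNr.
    have okr : okb (hp I, \sum_(G' <- r) gamma' (size (gci c)) G' *: nrep (edges G') (nm I)).
      rewrite big_seq; elim/big_ind: _ => [|u v ou ov|G0 Gr]; first exact: okb0.
        by rewrite -[u]scale1r; exact: okbP.
      by apply: okbZ => //; apply: ok'; rewrite inE Gr orbT.
    have okG : okb (hp I, nrep (edges G') (nm I)) by apply: ok'; rewrite inE eqxx.
    rewrite !big_cons -IH => [|G0 Gr]; last by apply: ok'; rewrite inE Gr orbT.
    exact: (hm [::] (zip (iota 1 (size J)) J) 0%N (hp I) _ _ _ (dm _ okG) okr).
  rewrite lin scalerA !scaler_sumr big_seq [RHS]big_seq; apply: eq_bigr => G' Gs'.
  have vG' := b' _ _ (mem_gsp (f' _) Gs').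
  rewrite nrep_insert // !scalerA; congr (_ *: _).
  rewrite -(se_sign (labels c) [seq x.1 | x <- h]) -[in RHS](signr_odd _ (d' * _)) oddM oddb.
  by ring.
rewrite hrepE // -/M.
transitivity (\sum_(H <- cand gamma gamma' M) gc_pre d' gamma gamma' M H *: nrep (edges H) (nm h)); last first.
  rewrite -[LHS](fs_seq (r := cand gamma gamma' M)); first apply: fs_seq; rewrite ?gsp_uniq ?undup_uniq //.
    by move=> G /(gspP (fp _)) ->; rewrite scale0r.
  by move=> G Gc; rewrite gc_pre_cand // scale0r.
under [RHS]eq_bigr do rewrite gc_preE // scaler_suml.
rewrite [RHS]exchange_big /=; apply: eq_bigr => c c0.
under [RHS]eq_bigr do rewrite -scalerA; rewrite -scaler_sumr; congr (_ *: _).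
under [RHS]eq_bigr do rewrite scaler_suml; rewrite [RHS]exchange_big /= big_seq [RHS]big_seq.
apply: eq_bigr => G Gs.
under [RHS]eq_bigr do rewrite scaler_suml; rewrite [RHS]exchange_big /= big_seq [RHS]big_seq.
apply: eq_bigr => G' Gs'.
under [RHS]eq_bigr do rewrite -scalerA; rewrite -scaler_sumr; congr (_ *: _).
have vG := b _ _ (mem_gsp (f _) Gs); have vG' := b' _ _ (mem_gsp (f' _) Gs').
(* The coefficient of a graph counts the reattachments that produce it, so summing over graphs gives
   back the sum over reattachments. *)
rewrite /insert_coef (sum_count (K := graph) (f := fun es => seq_mset (es ++ relabel (nth 0%N (gci c)) G')) (fun H => nrep (edges H) (nm h))) ?undup_uniq //; last first.
  by apply/allP => es ees; exact: (mem_cand Gs Gs' ees).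
rewrite big_seq [RHS]big_seq; apply: eq_bigr => es ees; rewrite nrep_mset // all_cat.
apply/andP; split.
  apply: (reattach_below (I := gci c) (J := gcj c) _ _ _ ees); try exact: block_sub.
  by move: vG; apply: sub_all => e.
rewrite all_map; apply/allP => e /(allP vG') /andP[e1 e2]; rewrite /= /below.
by apply/andP; split; apply: (block_sub (c := labels c) (k := 0)); exact: mem_nth.
Qed.

End ARep.

(** * The product of functions as a convolution over monomials *)

Section Inversions.
Context (n : nat).
Implicit Types (S T : {set 'I_n}) (i j : 'I_n).
(** Exponent of the sign that sorts the product of the odd monomials theta_S and theta_T. *)
Definition inv S T : nat := \sum_(i in S) \sum_(j in T) (j < i)%N.
Definition lo S i : nat := \sum_(j in S) (j < i)%N.
Definition hi S i : nat := \sum_(j in S) (i < j)%N.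

Lemma invE S T : #|[set ij : 'I_n * 'I_n | [&& ij.1 \in S, ij.2 \in T & (ij.2 < ij.1)%N]]| = inv S T.
Proof.
rewrite /inv (eq_bigr _ (fun i _ => big_mkcond _ _)) pair_big_dep /= -sum1_card big_mkcond [RHS]big_mkcond.
apply: eq_bigr => -[i j] _ /=; rewrite andbT.
rewrite (_ : (_ \in _) = [&& i \in S, j \in T & (j < i)%N]); last first.
  by apply/idP/idP => [/set_mem//|?]; exact/mem_set.
by case: (i \in S); case: (j \in T); case: (j < i)%N.
Qed.

Lemma loE S i : #|[set j in S | (j < i)%N]| = lo S i.
Proof.
rewrite /lo -sum1_card big_mkcond [RHS]big_mkcond; apply: eq_bigr => j _ /=.
rewrite (_ : (_ \in _) = (j \in S) && (j < i)%N); last first.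
  by rewrite inE.
by case: (j \in S); case: (j < i)%N.
Qed.
End Inversions.

Section Conv.
Context (R : realType) (m n : nat).
Local Notation dis S T := (fintype.disjoint (mem S) (mem T)).
Local Notation mon := ({ffun 'I_m -> nat} * {set 'I_n})%type.
Implicit Types (u v w q : mon) (p : mon * mon) (phi psi : mon -> R) (S T : {set 'I_n}) (i j : 'I_n) (mu : 'I_m).

Definition join u v : mon := ([ffun k => u.1 k + v.1 k]%N, u.2 :|: v.2).
Definition dj u v := (dis (u.2) (v.2)).

Lemma invUl S S' T : (dis (S) (S')) -> inv (S :|: S') T = (inv S T + inv S' T)%N.
Proof. by move=> d; rewrite /inv (eq_bigl [in [predU S & S']]) ?bigU // => i; rewrite !inE. Qed.
Lemma invUr S T T' : (dis (T) (T')) -> inv S (T :|: T') = (inv S T + inv S T')%N.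
Proof. by move=> d; rewrite /inv -big_split; apply: eq_bigr => i _; rewrite (eq_bigl [in [predU T & T']]) ?bigU // => j; rewrite !inE. Qed.
Lemma inv1l T i : inv [set i] T = lo T i. Proof. by rewrite /inv big_set1. Qed.
Lemma inv1r S i : inv S [set i] = hi S i.
Proof. by apply: eq_bigr => j _; rewrite big_set1. Qed.

Lemma lo_hi S i : i \notin S -> (lo S i + hi S i)%N = #|S|.
Proof.
move=> iS; rewrite /lo /hi -big_split -sum1_card; apply: eq_bigr => j jS /=.
by case: ltngtP => // /val_inj ij; rewrite -ij jS in iS.
Qed.

Lemma inv_swap S T : (dis (S) (T)) -> (inv S T + inv T S)%N = (#|S| * #|T|)%N.
Proof.
move=> d; rewrite /inv [X in (_ + X)%N]exchange_big -big_split -sum_nat_const.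
apply: eq_bigr => i iS; rewrite -big_split -sum1_card; apply: eq_bigr => j jT /=.
case: ltngtP => // /val_inj ij; move: (finset.disjoint_setI0 d) => /finset.setP/(_ i).
by rewrite !inE iS -ij jT.
Qed.

Lemma loU S T i : (dis (S) (T)) -> lo (S :|: T) i = (lo S i + lo T i)%N.
Proof. by move=> d; rewrite /lo (eq_bigl [in [predU S & T]]) ?bigU // => j; rewrite !inE. Qed.

Definition box N : seq mon :=
  [seq ([ffun k => b k : nat], T) | b : {ffun 'I_m -> 'I_N} <- enum {: {ffun 'I_m -> 'I_N}}, T : {set 'I_n} <- enum {: {set 'I_n}}].

Lemma mem_box N u : (u \in box N) = [forall k, u.1 k < N]%N.
Proof.
apply/allpairsP/forallP => [[[b T] /= [_ _ ->]] k|uN]; first by rewrite ffunE.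
exists ([ffun k => Ordinal (uN k)], u.2); rewrite !mem_enum; split => //=.
by case: u uN => a T uN; congr pair; apply/ffunP => k; rewrite !ffunE.
Qed.

Definition dsum q : nat := (\sum_k q.1 k).+1.
Lemma dsumP q k : (q.1 k < dsum q)%N.
Proof. by rewrite ltnS (bigD1 k) //= leq_addr. Qed.

(** All factorisations of the monomial [q] into two; the box bounds the exponents and makes the list
    finite. *)
Definition spl q : seq (mon * mon) :=
  [seq p <- [seq (u, v) | u <- undup (box (dsum q)), v <- undup (box (dsum q))] | dj p.1 p.2 && (join p.1 p.2 == q)].

Lemma mspl q p : (p \in spl q) = dj p.1 p.2 && (join p.1 p.2 == q).
Proof.
rewrite mem_filter; apply: andb_idr => /andP[d /eqP jq].
apply/allpairsP; exists p; rewrite !mem_undup !mem_box; split; last by case: p d jq.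
  apply/forallP => k; apply: leq_ltn_trans (dsumP q k); rewrite -jq ffunE; exact: leq_addr.
apply/forallP => k; apply: leq_ltn_trans (dsumP q k); rewrite -jq ffunE; exact: leq_addl.
Qed.

Lemma spl_uniq q : uniq (spl q).
Proof. by apply: filter_uniq; apply: allpairs_uniq => //; rewrite ?undup_uniq // => -[a b] [c d]. Qed.

(** The product of functions at a fixed base point, seen on coefficients. *)
Definition conv phi psi : mon -> R := fun q =>
  \sum_(p <- spl q) (-1) ^+ inv p.1.2 p.2.2 * phi p.1 * psi p.2.

Lemma perm_map_sum (I K : eqType) (r1 : seq I) (r2 : seq K) (h : I -> K) (F : K -> R) :
  uniq r1 -> uniq r2 -> {in r1 &, injective h} -> (forall k, (k \in r2) = (k \in map h r1)) ->
  \sum_(k <- r2) F k = \sum_(i <- r1) F (h i).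
Proof.
move=> u1 u2 hi_ E; rewrite -(big_map h xpredT F); apply: perm_big; apply: uniq_perm => //.
by rewrite map_inj_in_uniq.
Qed.

Lemma joinA u v w : join u (join v w) = join (join u v) w.
Proof. by congr pair; [apply/ffunP => k; rewrite !ffunE addnA|rewrite finset.setUA]. Qed.
Lemma joinC u v : join u v = join v u.
Proof. by congr pair; [apply/ffunP => k; rewrite !ffunE addnC|rewrite finset.setUC]. Qed.

Lemma disjUl S S' T : (dis (S :|: S') (T)) = (dis (S) (T)) && (dis (S') (T)).
Proof. by rewrite -!finset.setI_eq0 finset.setIUl finset.setU_eq0. Qed.
Lemma disjUr S T T' : (dis (S) (T :|: T')) = (dis (S) (T)) && (dis (S) (T')).
Proof. by rewrite -!finset.setI_eq0 finset.setIUr finset.setU_eq0. Qed.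

(** Both sides enumerate the factorisations into three monomials, with the inversions of all three
    pairs. *)
Lemma convA phi psi chi : conv phi (conv psi chi) = conv (conv phi psi) chi.
Proof.
apply/funext => q.
pose F (t : mon * mon * mon) := (-1) ^+ (inv t.1.1.2 t.1.2.2 + inv t.1.1.2 t.2.2 + inv t.1.2.2 t.2.2) * phi t.1.1 * psi t.1.2 * chi t.2.
transitivity (\sum_(t <- [seq (p.1, p'.1, p'.2) | p <- spl q, p' <- spl p.2]) F t).
  rewrite big_allpairs_dep [LHS]big_seq [RHS]big_seq; apply: eq_bigr => p.
  rewrite mspl => /andP[d _]; rewrite mulr_sumr big_seq [RHS]big_seq; apply: eq_bigr => p'.
  rewrite mspl => /andP[d' /eqP j']; rewrite /F /= -j' /=.
  by rewrite invUr // !exprD; ring.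
transitivity (\sum_(t <- [seq (p'.1, p'.2, p.2) | p <- spl q, p' <- spl p.1]) F t); last first.
  rewrite big_allpairs_dep [LHS]big_seq [RHS]big_seq; apply: eq_bigr => p.
  rewrite mspl => /andP[d _]; rewrite mulr_sumr mulr_suml big_seq [RHS]big_seq; apply: eq_bigr => p'.
  rewrite mspl => /andP[d' /eqP j']; rewrite /F /= -j' /=.
  by rewrite invUl // !exprD; ring.
apply: perm_big; apply: uniq_perm.
- apply: allpairs_uniq_dep; [exact: spl_uniq|by move=> p _; exact: spl_uniq|].
  move=> [[u1 v1] [u2 v2]] [[u3 v3] [u4 v4]] /allpairsPdep[p [p' [ps ps' [E1 E2]]]] /allpairsPdep[t [t' [ts ts' [E3 E4]]]].
  move: ps' ts'; rewrite !mspl => /andP[_ /eqP j1] /andP[_ /eqP j2].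
  case: p ps E1 j1 => a b _ [-> ->] /= j1; case: t ts E3 j2 => c d _ [-> ->] /= j2.
  by move: j1 j2; rewrite -E2 -E4 /= => <- <- [-> -> ->].
- apply: allpairs_uniq_dep; [exact: spl_uniq|by move=> p _; exact: spl_uniq|].
  move=> [[u1 v1] [u2 v2]] [[u3 v3] [u4 v4]] /allpairsPdep[p [p' [ps ps' [E1 E2]]]] /allpairsPdep[t [t' [ts ts' [E3 E4]]]].
  move: ps' ts'; rewrite !mspl => /andP[_ /eqP j1] /andP[_ /eqP j2].
  case: p ps E1 j1 => a b _ [-> ->] /= j1; case: t ts E3 j2 => c d _ [-> ->] /= j2.
  by move: j1 j2; rewrite -E2 -E4 /= => <- <- [-> -> ->].
move=> [[u v] w]; apply/allpairsPdep/allpairsPdep => -[p [p' [ps ps' [-> -> ->]]]].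
  move: ps ps'; rewrite !mspl => /andP[d /eqP jq] /andP[d' /eqP j'].
  move: d; rewrite /dj -j' /= disjUr => /andP[d1 d2].
  exists (join p.1 p'.1, p'.2), (p.1, p'.1); rewrite !mspl /= eqxx andbT; split => //.
  move: d'; rewrite /dj => d'; by rewrite /= disjUl d2 d' -joinA j' jq eqxx.
move: ps ps'; rewrite !mspl => /andP[d /eqP jq] /andP[d' /eqP j'].
move: d; rewrite /dj -j' /= disjUl => /andP[d1 d2].
exists (p'.1, join p'.2 p.2), (p'.2, p.2); rewrite !mspl /= eqxx andbT; split => //.
move: d'; rewrite /dj => d'; by rewrite /= disjUr d1 d' joinA j' jq eqxx.
Qed.

Definition par (b : bool) phi := forall q, phi q <> 0 -> odd #|q.2| = b.

Lemma spl_card q p : p \in spl q -> #|q.2| = (#|p.1.2| + #|p.2.2|)%N.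
Proof.
rewrite mspl => /andP[d /eqP <-] /=.
by rewrite cardsU finset.disjoint_setI0 // cards0 subn0.
Qed.

Lemma convC a b phi psi : par a phi -> par b psi -> conv phi psi = (-1) ^+ (a && b) *: (conv psi phi : mon -> R^o).
Proof.
move=> pa pb; apply/funext => q.
rewrite -[RHS]/((-1) ^+ (a && b) * conv psi phi q) /conv mulr_sumr.
rewrite (perm_map_sum (r1 := spl q) (h := fun p => (p.2, p.1))); rewrite ?spl_uniq //.
- rewrite big_seq [RHS]big_seq; apply: eq_bigr => p pq /=.
  have d : dj p.1 p.2 by move: pq; rewrite mspl => /andP[].
  case: (phi p.2 =P 0) => [->|/pa pha]; first by rewrite !(mulr0, mul0r).
  case: (psi p.1 =P 0) => [->|/pb psb]; first by rewrite !(mulr0, mul0r).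
  have := inv_swap d; move/(congr1 odd); rewrite oddD oddM pha psb => E.
  have S : (-1) ^+ inv p.2.2 p.1.2 = (-1) ^+ (a && b) * (-1) ^+ inv p.1.2 p.2.2 :> R.
    rewrite -[LHS]signr_odd -[X in _ = _ * X]signr_odd -signr_addb andbC -E.
    by rewrite addbAC addbb addFb.
  by rewrite S; ring.
- by move=> [a1 b1] [a2 b2] _ _ [-> ->].
- move=> p; apply/idP/mapP => [pq|[p' pq ->]].
    exists (p.2, p.1); last by case: p pq.
    by move: pq; rewrite !mspl /dj /= disjoint_sym joinC.
  by move: pq; rewrite !mspl /dj /= disjoint_sym joinC.
Qed.

Lemma par_conv a b phi psi : par a phi -> par b psi -> par (a (+) b) (conv phi psi).
Proof.
move=> pa pb q; rewrite /conv big_seq => H.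
apply: contrapT => od; apply: H; apply: big1 => p pq.
case: (phi p.1 =P 0) => [->|/pa pha]; first by rewrite !(mulr0, mul0r).
case: (psi p.2 =P 0) => [->|/pb psb]; first by rewrite !(mulr0, mul0r).
by case: od; rewrite (spl_card pq) oddD pha psb.
Qed.

Lemma convPl (a : R) phi phi' psi q : conv (fun u => a * phi u + phi' u) psi q = a * conv phi psi q + conv phi' psi q.
Proof. by rewrite /conv mulr_sumr -big_split; apply: eq_bigr => p _ /=; ring. Qed.
Lemma convPr (a : R) phi psi psi' q : conv phi (fun u => a * psi u + psi' u) q = a * conv phi psi q + conv phi psi' q.
Proof. by rewrite /conv mulr_sumr -big_split; apply: eq_bigr => p _ /=; ring. Qed.

(** The Euler operator of one even variable: a derivation that the polynomial model uses to
    recognise a factor. *)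
Definition eul (l : 'I_m) phi : mon -> R := fun q => (q.1 l)%:R * phi q.
Lemma eul_leib l phi psi q : eul l (conv phi psi) q = conv (eul l phi) psi q + conv phi (eul l psi) q.
Proof.
rewrite /eul /conv mulr_sumr -big_split big_seq [RHS]big_seq; apply: eq_bigr => p.
by rewrite mspl => /andP[_ /eqP <-] /=; rewrite ffunE natrD; ring.
Qed.

Definition up u mu : mon := ([ffun k => u.1 k + (k == mu)]%N, u.2).
Definition dp mu phi : mon -> R := fun q => (q.1 mu).+1%:R * phi (up q mu).

Lemma up_inj mu : injective (up^~ mu).
Proof.
move=> [a S] [b T] [/ffunP E ->]; congr pair; apply/ffunP => k.
by have := E k; rewrite !ffunE => /addIn.
Qed.

Lemma join_up u v mu : join (up u mu) v = up (join u v) mu.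
Proof. by congr pair; apply/ffunP => k; rewrite !ffunE addnAC. Qed.

(** The exponent of the variable [mu] in [up q mu] is the sum of those in the two factors; the share
    of a factor is the coefficient that differentiating this factor produces. *)
Lemma dp_leib mu phi psi q : dp mu (conv phi psi) q = conv (dp mu phi) psi q + conv phi (dp mu psi) q.
Proof.
pose X p := (-1) ^+ inv p.1.2 p.2.2 * phi p.1 * psi p.2.
(* Lowering the exponent in one factor is a bijection from the factorisations of [up q mu] where it
   is positive to those of [q]; where it is zero the term vanishes. *)
have key (fst_ : bool) : \sum_(p <- spl (up q mu)) ((if fst_ then p.1 else p.2).1 mu)%:R * X p =
   \sum_(p <- spl q) ((if fst_ then p.1 else p.2).1 mu).+1%:R * X (if fst_ then (up p.1 mu, p.2) else (p.1, up p.2 mu)).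
  rewrite (bigID (fun p => 0 < (if fst_ then p.1 else p.2).1 mu)%N) /= [X in _ + X]big1 ?addr0; last first.
    by move=> p; rewrite lt0n negbK => /eqP->; rewrite mul0r.
  rewrite -big_filter.
  rewrite (perm_map_sum (r1 := spl q) (h := fun p => if fst_ then (up p.1 mu, p.2) else (p.1, up p.2 mu))).
  - apply: eq_bigr => p _; congr (_%:R * _).
    by case: fst_; rewrite /= ffunE eqxx addn1.
  - exact: spl_uniq.
  - by apply: filter_uniq; exact: spl_uniq.
  - move=> [a1 b1] [a2 b2] _ _; case: fst_ => -[].
      by move=> E1 E2 ->; congr pair; apply: (@up_inj mu); rewrite /up E1 E2.
    by move=> -> E1 E2; congr pair; apply: (@up_inj mu); rewrite /up E1 E2.
  - move=> p; rewrite mem_filter mspl; apply/idP/mapP.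
      move=> /andP[p0 /andP[d /eqP jq]].
      pose dn (u : mon) : mon := ([ffun k => u.1 k - (k == mu)]%N, u.2).
      have dnK u : (0 < u.1 mu)%N -> up (dn u) mu = u.
        move=> u0; case: u u0 => a S /= u0; congr pair; apply/ffunP => k; rewrite !ffunE /=.
        by case: eqP => [->|_]; [rewrite subnK|rewrite subn0 addn0].
      exists (if fst_ then (dn p.1, p.2) else (p.1, dn p.2)).
        rewrite mspl; apply/andP; split; first by case: fst_ p0.
        apply/eqP/(@up_inj mu); rewrite -jq; case: fst_ p0 => /= p0; first by rewrite -join_up dnK.
        by rewrite joinC -join_up dnK // joinC.
      by case: p p0 {d jq} => a b; case: fst_ => /= p0; rewrite dnK.
    move=> [p' + ->]; rewrite mspl => /andP[d /eqP jq].
    case: fst_ => /=; rewrite ?join_up ?[join _ (up _ _)]joinC ?join_up ?[join p'.2 _]joinC jq eqxx andbT.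
      by rewrite ffunE eqxx addn1.
    by rewrite ffunE eqxx addn1.
rewrite /dp /conv mulr_sumr.
transitivity (\sum_(p <- spl (up q mu)) ((p.1.1 mu)%:R * X p + (p.2.1 mu)%:R * X p)).
  rewrite big_seq [RHS]big_seq; apply: eq_bigr => p; rewrite mspl => /andP[_ /eqP/(congr1 (fun u => u.1 mu))].
  by rewrite /= !ffunE eqxx addn1 => <-; rewrite natrD -mulrDl /X.
rewrite big_split (key true) (key false) /=; congr (_ + _).
  by apply: eq_bigr => p _; rewrite /X /=; ring.
by apply: eq_bigr => p _; rewrite /X /=; ring.
Qed.

Definition ins i u : mon := (u.1, i |: u.2).
Definition dth i phi : mon -> R := fun q =>
  if i \in q.2 then 0 else (-1) ^+ lo q.2 i * phi (ins i q).
Definition pinv phi : mon -> R := fun q => (-1) ^+ #|q.2| * phi q.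

Lemma dj1 i S : (dis ([set i]%SET) (S)) = (i \notin S).
Proof. by rewrite disjoints1. Qed.

(** If i is not in q, the factorisations of theta_i q put i into exactly one factor. If i is in q,
    the left side is 0 and the two sums on the right cancel by moving i from one factor to the
    other. *)
Lemma dth_leib i phi psi q :
  dth i (conv phi psi) q = conv (dth i phi) psi q + conv (pinv phi) (dth i psi) q.
Proof.
pose X p := (-1) ^+ inv p.1.2 p.2.2 * phi p.1 * psi p.2.
have A1 p : dj p.1 p.2 -> i \notin p.1.2 -> i \notin p.2.2 ->
   (-1) ^+ inv p.1.2 p.2.2 * dth i phi p.1 * psi p.2 = (-1) ^+ (lo p.1.2 i + lo p.2.2 i) * X (ins i p.1, p.2).
  move=> d i1 i2; rewrite /dth (negbTE i1) /X /= invUl ?dj1 // inv1l !exprD.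
  have := sqrr_sign R (lo p.2.2 i); rewrite expr2 => E; rewrite -[LHS]mul1r -{1}E; ring.
have A2 p : dj p.1 p.2 -> i \notin p.1.2 -> i \notin p.2.2 ->
   (-1) ^+ inv p.1.2 p.2.2 * pinv phi p.1 * dth i psi p.2 = (-1) ^+ (lo p.1.2 i + lo p.2.2 i) * X (p.1, ins i p.2).
  move=> d i1 i2; rewrite /pinv /dth (negbTE i2) /X /= invUr ?dj1 // inv1r -(lo_hi i1) !exprD.
  ring.
have B p : dj p.1 p.2 -> i \notin p.1.2 -> i \notin p.2.2 ->
   (-1) ^+ inv p.1.2 (i |: p.2.2) * dth i phi p.1 * psi (ins i p.2) =
   - ((-1) ^+ inv (i |: p.1.2) p.2.2 * pinv phi (ins i p.1) * dth i psi p.2).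
  move=> d i1 i2; rewrite /pinv /dth (negbTE i1) (negbTE i2) /= invUr ?dj1 // invUl ?dj1 // inv1l inv1r.
  rewrite finset.cardsU1 i1 -(lo_hi i1) !exprD expr1.
  have := sqrr_sign R (lo p.2.2 i); rewrite expr2 => E; rewrite -[LHS]mul1r -{1}E; ring.
case iq : (i \in q.2); last first.
  rewrite {1}/dth iq.
  have iN p : p \in spl q -> [/\ dj p.1 p.2, i \notin p.1.2 & i \notin p.2.2].
    rewrite mspl => /andP[d /eqP jq]; move: iq; rewrite -jq inE => /negbT; rewrite negb_or => /andP[].
    by split.
  have E : perm_eq (spl (ins i q)) ([seq (ins i p.1, p.2) | p <- spl q] ++ [seq (p.1, ins i p.2) | p <- spl q]).
    apply: uniq_perm; first exact: spl_uniq.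
      rewrite cat_uniq !map_inj_in_uniq ?spl_uniq /= ?andbT.
      - apply/hasPn => _ /mapP[p /iN[d i1 i2] ->]; apply/negP => /mapP[p' _ [E _]].
        by move: i1; rewrite E finset.setU11.
      - move=> [a1 b1] [a2 b2] /iN[/= _ _ i1] /iN[/= _ _ i2] [-> E1 E2].
        by congr pair; case: b1 b2 i1 i2 E1 E2 => [b1 S1] [b2 S2] /= i1 i2 -> E2; congr pair; rewrite -(finset.setU1K i1) E2 finset.setU1K.
      - move=> [a1 b1] [a2 b2] /iN[/= _ i1 _] /iN[/= _ i2 _] [E1 E2 ->].
        by congr pair; case: a1 a2 i1 i2 E1 E2 => [b1' S1] [b2' S2] /= i1 i2 -> E2; congr pair; rewrite -(finset.setU1K i1) E2 finset.setU1K.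
    move=> p; rewrite mem_cat mspl; apply/idP/orP.
      move=> /andP[d /eqP jq].
      have : i \in p.1.2 :|: p.2.2 by rewrite -[_ :|: _]/((join p.1 p.2).2) jq finset.setU11.
      have ne : i \in p.1.2 -> i \in p.2.2 -> False.
        by move=> i1 i2; move: (finset.disjoint_setI0 d) => /finset.setP/(_ i); rewrite !inE i1 i2.
      case/finset.setUP => ip; [left|right]; apply/mapP.
        have i2 : i \notin p.2.2 by apply/negP; exact: ne.
        exists ((p.1.1, p.1.2 :\ i), p.2); last by case: p ip {d jq ne i2} => [[a S] v] /= ip; rewrite /ins /= finset.setD1K.
        rewrite mspl /dj /=; apply/andP; split.
          by apply: disjointWl d; exact: finset.subsetDl.
        move: jq; rewrite /join /ins /= => -[E1 E2]; apply/eqP; case: (q) E1 E2 iq => a S /= -> E2 iS.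
        congr pair; apply/finset.setP => k; move/finset.setP/(_ k): E2; rewrite !inE.
        by case: eqP => //= ->; rewrite (negbTE i2) iS.
      have i2 : i \notin p.1.2 by apply/negP => i1; exact: ne.
      exists (p.1, (p.2.1, p.2.2 :\ i)); last by case: p ip {d jq ne i2} => [v [a S]] /= ip; rewrite /ins /= finset.setD1K.
      rewrite mspl /dj /=; apply/andP; split.
        by apply: disjointWr d; exact: finset.subsetDl.
      move: jq; rewrite /join /ins /= => -[E1 E2]; apply/eqP; case: (q) E1 E2 iq => a S /= -> E2 iS.
      congr pair; apply/finset.setP => k; move/finset.setP/(_ k): E2; rewrite !inE.
      by case: eqP => //= ->; rewrite (negbTE i2) iS.
    case=> /mapP[p' p's ->]; have [d i1 i2] := iN _ p's; move: p's; rewrite mspl => /andP[_ /eqP jq].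
      by rewrite /dj /= disjUl dj1 i2 [X in X && _]d -jq /ins /join /= finset.setUA eqxx.
    by rewrite /dj /= disjUr disjoint_sym dj1 i1 [X in X && _]d -jq /ins /join /= finset.setUCA eqxx.
  rewrite /conv (perm_big _ E) big_cat !big_map /= mulrDr !mulr_sumr; congr (_ + _); rewrite big_seq [RHS]big_seq.
    apply: eq_bigr => p ps; have [d i1 i2] := iN _ ps; rewrite (A1 p) // /X /=.
    by move: ps; rewrite mspl => /andP[_ /eqP <-]; rewrite /= loU.
  apply: eq_bigr => p ps; have [d i1 i2] := iN _ ps; rewrite (A2 p) // /X /=.
  by move: ps; rewrite mspl => /andP[_ /eqP <-]; rewrite /= loU.
rewrite {1}/dth iq /conv; apply/esym/eqP; rewrite addr_eq0; apply/eqP.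
rewrite (bigID (fun p => i \in p.1.2)) /= big1 ?add0r; last by move=> p ip; rewrite /dth ip mulr0 mul0r.
rewrite [X in _ = - X](bigID (fun p => i \in p.2.2)) /= [X in _ = - (X + _)]big1 ?add0r; last by move=> p ip; rewrite /dth ip mulr0.
have nb p : p \in spl q -> (i \in p.1.2) = ~~ (i \in p.2.2).
  rewrite mspl => /andP[d /eqP jq]; move: iq; rewrite -jq inE.
  by move: (finset.disjoint_setI0 d) => /finset.setP/(_ i); rewrite !inE; case: (i \in p.1.2); case: (i \in p.2.2).
rewrite -[LHS]big_filter -[X in _ = - X]big_filter -sumrN.
rewrite [RHS](perm_map_sum (r1 := seq.filter (fun p : mon * mon => i \notin p.1.2) (spl q))
  (h := fun p : mon * mon => (ins i p.1, (p.2.1, p.2.2 :\ i)%SET))).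
- rewrite big_seq [RHS]big_seq; apply: eq_bigr => -[u [a S]]; rewrite mem_filter => /andP[/= i1 ps].
  have i2 : i \in S by have := nb _ ps; rewrite /= (negbTE i1) => /esym/negbFE.
  have d : dj u (a, S) by move: ps; rewrite mspl => /andP[].
  have := B (u, (a, S :\ i)%SET); rewrite /= finset.setD11 => H.
  rewrite -H //; first by rewrite /ins /= finset.setD1K.
  by rewrite /dj /=; apply: disjointWr d; exact: finset.subsetDl.
- by apply: filter_uniq; exact: spl_uniq.
- by apply: filter_uniq; exact: spl_uniq.
- move=> [[a1 S1] [b1 T1]] [[a2 S2] [b2 T2]]; rewrite !(mem_filter _ _ (spl q)) => /andP[/= i1 ps1] /andP[/= i2 ps2] [-> E1 -> E2].
  have /= := nb _ ps1; rewrite (negbTE i1) => /esym/negbFE j1.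
  have /= := nb _ ps2; rewrite (negbTE i2) => /esym/negbFE j2.
  by rewrite -(finset.setU1K i1) E1 finset.setU1K // -(finset.setD1K j1) E2 finset.setD1K.
- move=> p; apply/idP/mapP; rewrite mem_filter.
    move=> /andP[i2 ps]; have i1 : i \in p.1.2 by rewrite nb.
    exists ((p.1.1, p.1.2 :\ i), (p.2.1, i |: p.2.2)); last first.
      by case: p i1 i2 {ps} => [[a S] [b T]] /= i1 i2; rewrite /ins /= finset.setD1K // finset.setU1K.
    rewrite mem_filter /= finset.setD11 /=; move: ps; rewrite !mspl /dj /= => /andP[d /eqP <-].
    rewrite disjUr disjoint_sym dj1 finset.setD11 (disjointWl (finset.subsetDl _ _) d) /=.
    by rewrite /join /= finset.setUCA finset.setUA finset.setD1K.
  move=> [[[a S] [b T]]]; rewrite mem_filter => /andP[/= i1 ps] ->.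
  have /= := nb _ ps; rewrite (negbTE i1) => /esym/negbFE i2.
  move: ps; rewrite !mspl /dj /= finset.setD11 /= => /andP[d /eqP <-].
  rewrite disjUl dj1 finset.setD11 (disjointWr (finset.subsetDl _ _) d) /=.
  by rewrite /join /= -finset.setUA finset.setUCA finset.setD1K.
Qed.

Lemma dp_dp mu nu phi : dp mu (dp nu phi) = dp nu (dp mu phi).
Proof.
apply/funext => q; rewrite /dp; have -> : up (up q mu) nu = up (up q nu) mu.
  by congr pair; apply/ffunP => k; rewrite !ffunE addnAC.
rewrite !mulrA; congr (_ * _); rewrite /= !ffunE.
have [->|mn] := eqVneq mu nu; first by [].
by rewrite !addn0 mulrC.
Qed.

Lemma dp_dth mu i phi : dp mu (dth i phi) = dth i (dp mu phi).
Proof. by apply/funext => q; rewrite /dp /dth /=; case: ifP => _; rewrite ?mulr0 // mulrCA. Qed.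

Lemma dth_dth i j phi q : dth i (dth j phi) q = - dth j (dth i phi) q.
Proof.
rewrite /dth /= !inE; case: (eqVneq i j) => [->|ij].
  by case: ifP => _ /=; rewrite ?mulr0 ?oppr0.
move=> /=; case iq : (i \in q.2); case jq : (j \in q.2); rewrite ?mulr0 ?oppr0 //.
have -> : ins j (ins i q) = ins i (ins j q) by rewrite /ins /= finset.setUCA.
rewrite !mulrA; rewrite -mulNr; congr (_ * _); rewrite -!exprD.
rewrite !loU ?dj1 ?iq ?jq // /lo !big_set1.
by case: ltngtP ij => [ij|ij|/val_inj->]; rewrite ?eqxx // => _; rewrite ?add0n ?add1n ?addnS ?exprS ?mulN1r ?opprK // addnC.
Qed.

End Conv.

(** * Smooth functions and symmetry of second derivatives *)

Section Clairaut.
Context (R : realType) (m : nat) (U : set 'rV[R]_m) (Uo : open U).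
Local Notation V := 'rV[R]_m.
Implicit Types (f g : V -> R^o) (x y e : V) (mu nu : 'I_m).
Local Notation dl mu := (delta_mx 0 mu : V).
Local Notation partial := (partial U).

Lemma derivable_line f y e (a : R) :
  derivable f (y + a *: e) e -> is_derive a 1 (fun t : R => f (y + t *: e) : R) ('D_e f (y + a *: e)).
Proof.
have E : (fun h : R => h^-1 *: (((fun t : R => f (y + t *: e) : R^o) \o shift a) (h *: (1 : R^o)) - f (y + a *: e))) =
   (fun h : R => h^-1 *: ((f \o shift (y + a *: e)) (h *: e) - f (y + a *: e))).
  apply/funext => h /=; congr (_ *: (f _ - _)).
  have -> : h%:A = h :> R^o by exact: mulr1.
  by rewrite scalerDl addrCA.
move=> df; apply: DeriveDef; first by rewrite /derivable E.
by rewrite /derive E.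
Qed.

Lemma partialE mu f x : U x -> partial mu f x = 'D_(dl mu) f x.
Proof. by move=> Ux; rewrite /Defs.partial mem_set. Qed.

Lemma partial_off mu f x : ~ U x -> partial mu f x = 0.
Proof. by move=> Ux; rewrite /Defs.partial memNset. Qed.

Lemma mvt_line f y e (h : R) : 0 < h -> (forall t, 0 <= t <= h -> derivable f (y + t *: e) e) ->
  exists2 t, 0 <= t <= h & f (y + h *: e) - f y = 'D_e f (y + t *: e) * h.
Proof.
move=> h0 df.
pose F (t : R) : R := f (y + t *: e); pose dF (t : R) : R := 'D_e f (y + t *: e).
have dd t : 0 <= t <= h -> is_derive t 1 F (dF t) by move=> /df; exact: derivable_line.
have H1 (t : R) : t \in `]0, h[%R -> is_derive t 1 F (dF t).
  by rewrite in_itv /= => /andP[t0 th]; apply: dd; rewrite !ltW.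
have H2 : {within `[0, h], continuous F}.
  apply: derivable_within_continuous => t; rewrite in_itv /= => /dd [dx _]; exact: dx.
have [t th E] := MVT_segment (ltW h0) H1 H2.
exists t; first by move: th; rewrite in_itv.
by move: E; rewrite /F /dF scale0r addr0 subr0.
Qed.

(** The mean value theorem twice: along mu for the increment in direction nu, then along nu for the
    partial derivative. *)
Lemma second_difference f mu nu y (h : R) : smooth U f -> 0 < h ->
  (forall s t, 0 <= s <= h -> 0 <= t <= h -> U (y + s *: dl mu + t *: dl nu)) ->
  exists s t, [/\ 0 <= s <= h, 0 <= t <= h &
  f (y + h *: dl mu + h *: dl nu) - f (y + h *: dl mu) - f (y + h *: dl nu) + f y =
  partial nu (partial mu f) (y + s *: dl mu + t *: dl nu) * h * h].
Proof.
move=> [_ sf] h0 Uy; have hh : 0 <= h <= h by rewrite ltW //=.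
have h00 : (0 : R) <= 0 <= h by rewrite lexx ltW.
pose g z := f (z + h *: dl nu) - f z : R^o.
have shiftd z : derivable f (z + h *: dl nu) (dl mu) ->
    is_derive z (dl mu) (fun z => f (z + h *: dl nu) : R^o) ('D_(dl mu) f (z + h *: dl nu)).
  have E : (fun k : R => k^-1 *: (((fun z => f (z + h *: dl nu) : R^o) \o shift z) (k *: dl mu) - f (z + h *: dl nu))) =
     (fun k : R => k^-1 *: ((f \o shift (z + h *: dl nu)) (k *: dl mu) - f (z + h *: dl nu))).
    by apply/funext => k /=; rewrite addrA.
  by move=> df; apply: DeriveDef; rewrite ?/derivable ?/derive E.
have dg t : 0 <= t <= h -> is_derive (y + t *: dl mu) (dl mu) g
    ('D_(dl mu) f (y + t *: dl mu + h *: dl nu) - 'D_(dl mu) f (y + t *: dl mu)).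
  move=> th; have U1 := Uy _ _ th hh; have U2 := Uy _ _ th h00; rewrite scale0r addr0 in U2.
  have [_ d1] := sf [::] _ U1; have [_ d2] := sf [::] _ U2.
  by apply: is_deriveB; [exact: shiftd|exact: derivableP].
have [s sh Es] : exists2 s, 0 <= s <= h & g (y + h *: dl mu) - g y = 'D_(dl mu) g (y + s *: dl mu) * h.
  by apply: mvt_line => // t /dg [].
have [_ Dg] := dg s sh; rewrite Dg in Es.
have [t th Et] : exists2 t, 0 <= t <= h & partial mu f (y + s *: dl mu + h *: dl nu) - partial mu f (y + s *: dl mu) =
    'D_(dl nu) (partial mu f) (y + s *: dl mu + t *: dl nu) * h.
  apply: mvt_line => // t th; have [_] := sf [:: mu] _ (Uy _ _ sh th); exact.
exists s, t; split => //.
have U2 := Uy _ _ sh h00; rewrite scale0r addr0 in U2.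
rewrite !partialE ?(Uy _ _ sh th) ?(Uy _ _ sh hh) // in Et *; last exact: Uy.
  by rewrite -Et -Es /g; ring.
exact: Uy.
Qed.

(** The second difference is symmetric in the two directions, so the two mixed partials agree at a
    pair of points near x, and continuity compares both with their values at x. This is what makes
    edge operators commute. *)
Lemma clairaut f mu nu : smooth U f -> partial mu (partial nu f) = partial nu (partial mu f).
Proof.
move=> sf; apply/funext => x; have [Ux|nU] := pselect (U x); last by rewrite !partial_off.
have [_ sf'] := sf; have [c1 _] := sf' [:: mu; nu] x Ux; have [c2 _] := sf' [:: nu; mu] x Ux.
rewrite /= in c1 c2.
apply/eqP; rewrite -subr_eq0 -normr_le0; apply/ler_addgt0Pl => eps e0; rewrite addr0.
have e2 : 0 < eps / 2 by rewrite divr_gt0.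
pose M1 : set V := [set y | `|partial mu (partial nu f) x - partial mu (partial nu f) y| < eps / 2].
pose M2 : set V := [set y | `|partial nu (partial mu f) x - partial nu (partial mu f) y| < eps / 2].
have n1 : nbhs x M1 by move/cvgrPdist_lt: c1 => /(_ _ e2).
have n2 : nbhs x M2 by move/cvgrPdist_lt: c2 => /(_ _ e2).
have nU : nbhs x U by exact: open_nbhs_nbhs.
have nn : nbhs x (U `&` (M1 `&` M2)) by apply: filterI => //; exact: filterI.
have [r /= r0 rP'] := (nbhs_ballP x _).1 nn.
have rP y : ball x r y -> [/\ U y, M1 y & M2 y] by move=> /rP'[? []].
(* Chosen so that h (|e_mu| + |e_nu|) < r: the rectangle of side h at x stays in the ball. *)
pose h := r / (2 * (`|dl mu| + `|dl nu| + 1)).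
have den : 0 < 2 * (`|dl mu| + `|dl nu| + 1) by rewrite mulr_gt0 // ltr_wpDl // addr_ge0.
have h0 : 0 < h by rewrite divr_gt0.
have inb a b : forall s t, 0 <= s <= h -> 0 <= t <= h ->
   `|dl a| + `|dl b| = `|dl mu| + `|dl nu| -> ball x r (x + s *: dl a + t *: dl b).
  move=> s t /andP[s0 sh] /andP[t0 th] E; rewrite -ball_normE /= -addrA opprD addrA subrr add0r normrN.
  apply: le_lt_trans (ler_normD _ _) _; rewrite !normrZ !ger0_norm //.
  apply: (@le_lt_trans _ _ (h * (`|dl a| + `|dl b|))).
    by rewrite mulrDr lerD // ler_wpM2r.
  rewrite E /h -mulrA gtr_pMr // mulrC ltr_pdivrMr // mul1r.
  have := normr_ge0 (dl mu); have := normr_ge0 (dl nu); lra.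
have E2 : `|dl nu| + `|dl mu| = `|dl mu| + `|dl nu| by rewrite addrC.
have [|s [t [sh th Est]]] := @second_difference f mu nu x h sf h0.
  by move=> s t sh th; have [] := rP _ (inb mu nu s t sh th erefl).
have [|s' [t' [sh' th' Est']]] := @second_difference f nu mu x h sf h0.
  by move=> s0 t0 sh0 th0; have [] := rP _ (inb nu mu s0 t0 sh0 th0 E2).
have [_ _ B2] := rP _ (inb mu nu s t sh th erefl).
have [_ B1 _] := rP _ (inb nu mu s' t' sh' th' E2).
have Eq : partial nu (partial mu f) (x + s *: dl mu + t *: dl nu) = partial mu (partial nu f) (x + s' *: dl nu + t' *: dl mu).
  have hn : h != 0 by rewrite gt_eqF.
  have Q : f (x + h *: dl mu + h *: dl nu) - f (x + h *: dl mu) - f (x + h *: dl nu) + f x =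
    f (x + h *: dl nu + h *: dl mu) - f (x + h *: dl nu) - f (x + h *: dl mu) + f x :> R.
    have -> : x + h *: dl mu + h *: dl nu = x + h *: dl nu + h *: dl mu by exact: addrAC.
    move: (f (x + h *: dl nu + h *: dl mu)) (f (x + h *: dl nu)) (f (x + h *: dl mu)) => k1 k2 k3.
    by congr (_ + _); exact: addrAC.
  have E3 := etrans (esym Est) (etrans Q Est').
  by move: E3 => /(mulIf hn)/(mulIf hn).
move: B2 B1 Eq; rewrite /M1 /M2 /=.
move: (partial nu (partial mu f) (x + s *: dl mu + t *: dl nu)) (partial mu (partial nu f) (x + s' *: dl nu + t' *: dl mu)).
move: (partial mu (partial nu f) x) (partial nu (partial mu f) x) => p1 p2 q2 q1 B2 B1 Eq; subst q2.
apply: le_trans (ler_distD q1 p1 p2) _.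
by rewrite [leRHS](splitr eps) lerD // ltW // distrC.
Qed.

(** [smooth] quantifies over all iterated partial derivatives at once; a class of functions closed
    under partial derivatives provides them by induction on the list of directions. *)
Lemma smooth_coind (P : (V -> R^o) -> Prop) g : (forall g, P g -> [/\ forall x, ~ U x -> g x = 0,
  forall x, U x -> {for x, continuous g} /\ forall mu, derivable g x (dl mu) &
  forall mu, P (partial mu g)]) -> P g -> smooth U g.
Proof.
move=> H Pg; split; first by have [] := H g Pg.
move=> l x Ux; have Pl : P (foldr partial g l) by elim: l => //= mu l IH; have [_ _] := H _ IH.
by have [_ c _] := H _ Pl; exact: c.
Qed.

(** Derivatives of a product are sums of products, so closure under differentiation holds for the
    algebra generated by smooth functions, not for single products. *)
Inductive salg : (V -> R^o) -> Prop :=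
| salg_sm f : smooth U f -> salg f
| salg_lin (a : R) f g : salg f -> salg g -> salg (fun x => a * f x + g x)
| salg_mul f g : salg f -> salg g -> salg (fun x => f x * g x).

Lemma smooth_partial mu f : smooth U f -> smooth U (partial mu f).
Proof.
move=> [f0 sf]; split; first by move=> x; exact: partial_off.
by move=> l x Ux; have := sf (rcons l mu) x Ux; rewrite foldr_rcons.
Qed.

Lemma partial_lin mu (a : R) f g : (forall x, U x -> derivable f x (dl mu)) ->
  (forall x, U x -> derivable g x (dl mu)) ->
  partial mu (fun x => a * f x + g x) = fun x => a * partial mu f x + partial mu g x.
Proof.
move=> df dg; apply/funext => x; have [Ux|nU] := pselect (U x); last by rewrite !partial_off // mulr0 addr0.
rewrite !partialE //.
have := @deriveD _ _ _ (a \*: f) g x (dl mu) (derivableZ (df x Ux)) (dg x Ux).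
by rewrite deriveZ; [exact|exact: df].
Qed.

Lemma partial_mul mu f g : (forall x, U x -> derivable f x (dl mu)) ->
  (forall x, U x -> derivable g x (dl mu)) ->
  partial mu (fun x => f x * g x) = fun x => 1 * (partial mu f x * g x) + f x * partial mu g x.
Proof.
move=> df dg; apply/funext => x; have [Ux|nU] := pselect (U x); last by rewrite !partial_off // mulr0 mul0r mulr0 addr0.
rewrite !partialE //; have := deriveM (df x Ux) (dg x Ux).
rewrite /GRing.scale /= => E; rewrite [LHS]E; ring.
Qed.

Lemma salg_smooth g : salg g -> smooth U g.
Proof.
apply: smooth_coind => {}g; elim => {g} [f sf|a f g _ [f0 fc fp] _ [g0 gc gp]|f g af [f0 fc fp] ag [g0 gc gp]].
- split; [by case: sf|by move=> x Ux; case: sf => _ /(_ [::] x Ux)|].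
  by move=> mu; apply: salg_sm; exact: smooth_partial.
- split.
  + by move=> x nU; rewrite f0 // g0 // mulr0 addr0.
  + move=> x Ux; have [c1 d1] := fc x Ux; have [c2 d2] := gc x Ux; split.
      by apply: (@continuousD _ _ _ (fun x => a *: f x) g) => //; apply: continuousZr.
    by move=> mu; exact: (derivableD (derivableZ (d1 mu)) (d2 mu)).
  + move=> mu; rewrite partial_lin; first exact: salg_lin.
      by move=> x Ux; have [_] := fc x Ux.
    by move=> x Ux; have [_] := gc x Ux.
- split.
  + by move=> x nU; rewrite f0 // mul0r.
  + move=> x Ux; have [c1 d1] := fc x Ux; have [c2 d2] := gc x Ux; split.
      exact: (@continuousM _ _ f g).
    by move=> mu; exact: (derivableM (d1 mu) (d2 mu)).
  + move=> mu; rewrite partial_mul.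
      by apply: salg_lin; apply: salg_mul.
      by move=> x Ux; have [_] := fc x Ux.
    by move=> x Ux; have [_] := gc x Ux.
Qed.

Lemma smooth_lin (a : R) f g : smooth U f -> smooth U g -> smooth U (fun x => a * f x + g x).
Proof. by move=> sf sg; apply: salg_smooth; apply: salg_lin; apply: salg_sm. Qed.
Lemma smooth_mul f g : smooth U f -> smooth U g -> smooth U (fun x => f x * g x).
Proof. by move=> sf sg; apply: salg_smooth; apply: salg_mul; apply: salg_sm. Qed.
Lemma partial0 mu : partial mu (fun=> 0) = fun=> 0.
Proof.
apply/funext => x; have [Ux|nU] := pselect (U x); last by rewrite partial_off.
by rewrite partialE //; exact: derive_cst.
Qed.
Lemma smooth0 : smooth U (fun=> 0).
Proof.
apply: (@smooth_coind (fun g => g = fun=> 0)) => // g ->; split => //.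
  by move=> x Ux; split; [exact: (@cst_continuous _ _ 0)|move=> mu; exact: derivable_cst].
by move=> mu; exact: partial0.
Qed.
Lemma smooth_derivable f mu x : smooth U f -> U x -> derivable f x (dl mu).
Proof. by move=> [_ sf] Ux; have [_] := sf [::] x Ux. Qed.

Lemma smooth_sum (I : Type) (r : seq I) (F : I -> V -> R^o) : (forall i, smooth U (F i)) ->
  smooth U (fun x => \sum_(i <- r) F i x) /\
  forall mu, partial mu (fun x => \sum_(i <- r) F i x) = fun x => \sum_(i <- r) partial mu (F i) x.
Proof.
move=> sF; elim: r => [|i r [IH1 IH2]].
  have -> : (fun x => \sum_(i <- [::]) F i x) = (fun=> 0) by apply/funext => x; rewrite big_nil.
  split; first exact: smooth0.
  by move=> mu; rewrite partial0; apply/funext => x; rewrite big_nil.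
have -> : (fun x => \sum_(j <- i :: r) F j x) = (fun x => 1 * F i x + \sum_(j <- r) F j x).
  by apply/funext => x; rewrite big_cons mul1r.
split; first exact: smooth_lin.
move=> mu; rewrite partial_lin ?IH2 => [|x Ux|x Ux]; try exact: smooth_derivable.
by apply/funext => x; rewrite big_cons mul1r.
Qed.

End Clairaut.

(** * The algebra of functions on the graded manifold *)

Section GfunAlgebra.
Context (R : realType) (m r : nat).
Local Notation V := 'rV[R]_m.
Local Notation gf := (gfun R m r).
Local Notation mon := ({ffun 'I_m -> nat} * {set 'I_(r + r)})%type.
Implicit Types (f g h : gf) (q : mon) (x : V) (mu nu : 'I_m) (i j : 'I_(r + r)).

(** The divisors of [q] summed over in [gmul] correspond to the factorisations of [q], a divisor
    being paired with its quotient; all algebraic laws then follow pointwise on the base. *)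
Lemma gmulE f g q x : gmul f g q x = conv (f^~ x) (g^~ x) q.
Proof.
rewrite /gmul pair_big_dep /= -big_filter.
set r1 := (X in \sum_(i <- X) _); rewrite /conv (perm_map_sum (r2 := spl q) (r1 := r1)
  (h := fun t : {ffun 'I_m -> 'I_(\sum_k q.1 k).+1} * {set 'I_(r + r)} =>
    (([ffun k => t.1 k : nat], t.2), ([ffun k => q.1 k - t.1 k]%N, q.2 :\: t.2)%SET))).
- apply: eq_bigr => t _ /=; rewrite -(invE t.2 (q.2 :\: t.2)%SET).
  by congr (_ * f (_, _) x * g (_, _) x); apply/ffunP => k; rewrite !ffunE.
- by apply: filter_uniq; exact: index_enum_uniq.
- exact: spl_uniq.
- move=> [b S] [b' S'] _ _ [E -> _ _]; congr pair; apply/ffunP => k; apply/val_inj.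
  by move/ffunP: E => /(_ k); rewrite !ffunE.
- move=> [[a S] [b T]]; rewrite mspl; apply/idP/mapP.
    move=> /andP[d /eqP jq].
    have aq k : (a k < (\sum_k q.1 k).+1)%N.
      by rewrite ltnS (bigD1 k) //= -jq ffunE /= -addnA leq_addr.
    exists ([ffun k => Ordinal (aq k)], S).
      have [le Sq] : (forall k, a k <= q.1 k)%N /\ S \subset q.2.
        by rewrite -jq; split; [move=> k; rewrite ffunE /= leq_addr|exact: finset.subsetUl].
      rewrite mem_filter mem_index_enum andbT; apply/andP; split; last exact: Sq.
      by apply/forallP => k; rewrite ffunE /=.
    have q1 k : q.1 k = (a k + b k)%N by rewrite -jq ffunE.
    have q2 : q.2 = (S :|: T)%SET by rewrite -jq.
    rewrite /= q2; congr pair; congr pair.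
    + by apply/ffunP => k; rewrite !ffunE.
    + by apply/ffunP => k; rewrite !ffunE /= q1 addKn.
    + rewrite finset.setDUl finset.setDv finset.set0U; apply/esym/finset.setDidPl.
      by rewrite disjoint_sym.
  move=> [[b' S']]; rewrite mem_filter mem_index_enum andbT => /andP[/forallP/= le sub] [-> -> -> ->].
  apply/andP; split; first by rewrite /dj /= disjoint_sym; apply/finset.setDidPl; rewrite finset.setDDl finset.setUid.
  have E (u v : mon) : u.1 = v.1 -> u.2 = v.2 -> u = v by case: u v => [? ?] [? ?] /= -> ->.
  apply/eqP/E; first by apply/ffunP => k; rewrite /join /= !ffunE subnKC.
  by rewrite /join /= -{1}(finset.setIidPr sub) finset.setID.
Qed.

Lemma gmulPl (a : R) f f' g : gmul (a *: f + f') g = a *: gmul f g + gmul f' g.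
Proof.
apply/funext => q; apply/funext => x.
by rewrite -[RHS]/(a * gmul f g q x + gmul f' g q x) !gmulE -convPl.
Qed.
Lemma gmulPr (a : R) f g g' : gmul f (a *: g + g') = a *: gmul f g + gmul f g'.
Proof.
apply/funext => q; apply/funext => x.
by rewrite -[RHS]/(a * gmul f g q x + gmul f g' q x) !gmulE -convPr.
Qed.
Lemma gmul_at f g x : (gmul f g)^~ x = conv (f^~ x) (g^~ x).
Proof. by apply/funext => q; rewrite gmulE. Qed.
Lemma gmulA f g h : gmul f (gmul g h) = gmul (gmul f g) h.
Proof. by apply/funext => q; apply/funext => x; rewrite !gmulE !gmul_at convA. Qed.

Lemma partyP b f : parity_part b f = f <-> forall x, par b (f^~ x).
Proof.
split=> [E x q H|H].
  by apply: contrapT => nb; apply: H; rewrite -E /parity_part; case: eqP.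
apply/funext => q; rewrite /parity_part; case: eqP => // nb.
by apply/funext => x; apply: contrapT => fx; apply: nb; apply: (H x); exact: nesym.
Qed.

Lemma gmulC a b f g : parity_part a f = f -> parity_part b g = g ->
  gmul f g = (-1) ^+ (a && b) *: gmul g f.
Proof.
move=> /partyP pf /partyP pg; apply/funext => q; apply/funext => x.
by rewrite -[RHS]/((-1) ^+ (a && b) * gmul g f q x) !gmulE (convC (pf x) (pg x)).
Qed.

Lemma parity_gmul a b f g : parity_part a f = f -> parity_part b g = g ->
  parity_part (a (+) b) (gmul f g) = gmul f g.
Proof.
move=> /partyP pf /partyP pg; apply/partyP => x.
by rewrite gmul_at; exact: par_conv.
Qed.

Lemma d_thetaE i f x : (d_theta i f)^~ x = dth i (f^~ x).
Proof.
apply/funext => q; rewrite /d_theta /dth; case: ifP => // _.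
by rewrite loE.
Qed.
Lemma par_invE f x : (par_inv f)^~ x = pinv (f^~ x). Proof. by []. Qed.

Lemma par_inv_hom a f : parity_part a f = f -> par_inv f = (-1) ^+ a *: f.
Proof.
move=> /partyP pf; apply/funext => q; apply/funext => x.
rewrite -[LHS]/((-1) ^+ #|q.2| * f q x) -[RHS]/((-1) ^+ a * f q x).
have [->|/eqP/pf <-] := eqVneq (f q x) 0; first by rewrite !mulr0.
by rewrite signr_odd.
Qed.

Lemma d_p_leib mu f g : d_p mu (gmul f g) = gmul (d_p mu f) g + gmul f (d_p mu g).
Proof.
apply/funext => q; apply/funext => x; rewrite -[RHS]/(gmul (d_p mu f) g q x + gmul f (d_p mu g) q x).
by rewrite !gmulE -[LHS]/(dp mu ((gmul f g)^~ x) q) gmul_at dp_leib.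
Qed.

Lemma d_theta_leib a i f g : parity_part a f = f ->
  d_theta i (gmul f g) = gmul (d_theta i f) g + (-1) ^+ a *: gmul f (d_theta i g).
Proof.
move=> pf; apply/funext => q; apply/funext => x.
rewrite -[RHS]/(gmul (d_theta i f) g q x + (-1) ^+ a * gmul f (d_theta i g) q x).
rewrite -[LHS]/((d_theta i (gmul f g))^~ x q) d_thetaE gmul_at dth_leib !gmulE !d_thetaE.
congr (_ + _); rewrite -par_invE (par_inv_hom pf) -[RHS]addr0.
have -> : ((-1) ^+ a *: f)^~ x = (fun q => (-1) ^+ a * f q x + 0 * f q x).
  by apply/funext => u; rewrite mul0r addr0.
rewrite (convPl ((-1) ^+ a) (f^~ x) (fun q => 0 * f q x)); congr (_ + _).
by rewrite /conv big1 // => p _; rewrite mul0r mulr0 mul0r.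
Qed.

Definition e_l (l : 'I_m) f : gf := fun q => (q.1 l)%:R *: f q.
Lemma e_l_leib l f g : e_l l (gmul f g) = gmul (e_l l f) g + gmul f (e_l l g).
Proof.
apply/funext => q; apply/funext => x; rewrite -[RHS]/(gmul (e_l l f) g q x + gmul f (e_l l g) q x).
by rewrite !gmulE -[LHS]/(eul l ((gmul f g)^~ x) q) gmul_at eul_leib.
Qed.

Lemma d_pp mu nu f : d_p mu (d_p nu f) = d_p nu (d_p mu f).
Proof.
apply/funext => q; apply/funext => x.
by rewrite -[LHS]/(dp mu (dp nu (f^~ x)) q) dp_dp.
Qed.

Lemma d_tt i j f : d_theta i (d_theta j f) = - d_theta j (d_theta i f).
Proof.
apply/funext => q; apply/funext => x; have E u v : (d_theta u (d_theta v f))^~ x = dth u (dth v (f^~ x)) by rewrite !d_thetaE.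
exact: etrans (congr1 (@^~ q) (E i j)) (etrans (dth_dth _ _ _ _) (congr1 -%R (esym (congr1 (@^~ q) (E j i))))).
Qed.

Lemma d_pt mu i f : d_p mu (d_theta i f) = d_theta i (d_p mu f).
Proof.
apply/funext => q; apply/funext => x.
by rewrite -[LHS]/(dp mu ((d_theta i f)^~ x) q) -[RHS]/((d_theta i (d_p mu f))^~ x q) !d_thetaE dp_dth.
Qed.

Lemma d_pP mu (a : R) f g : d_p mu (a *: f + g) = a *: d_p mu f + d_p mu g.
Proof. by apply/funext => q; rewrite /d_p scalerDr !scalerA mulrC -scalerA. Qed.
Lemma d_thetaP i (a : R) f g : d_theta i (a *: f + g) = a *: d_theta i f + d_theta i g.
Proof.
apply/funext => q; rewrite -[RHS]/(a *: d_theta i f q + d_theta i g q) /d_theta.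
case: ifP => _; first by rewrite scaler0 addr0.
by rewrite scalerDr !scalerA mulrC.
Qed.

Lemma parity_d_p b mu f : parity_part b f = f -> parity_part b (d_p mu f) = d_p mu f.
Proof.
move=> /partyP pf; apply/partyP => x q; rewrite /d_p => H.
by apply: (pf x (up q mu)) => E; apply: H; rewrite -[LHS]/((q.1 mu).+1%:R * f (up q mu) x) E mulr0.
Qed.

Lemma parity_d_theta b i f : parity_part b f = f -> parity_part (~~ b) (d_theta i f) = d_theta i f.
Proof.
move=> /partyP pf; apply/partyP => x q; rewrite -[d_theta i f q x]/((d_theta i f)^~ x q) d_thetaE /dth.
case: ifP => // /negbT iq H.
have := pf x (ins i q); rewrite /= cardsU1 iq add1n /= => P.
by rewrite -P ?negbK // => E; apply: H; rewrite E mulr0.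
Qed.

Section Smooth.
Variables (U : set V) (Uo : open U).
Local Notation smg := (smooth_gfun (r := r) U).

Lemma smg0 : smg 0.
Proof. by split; [move=> q; exact: smooth0|exists 0%N]. Qed.
Lemma smgP (a : R) f g : smg f -> smg g -> smg (a *: f + g).
Proof.
move=> [sf [k kf]] [sg [l lg]]; split; first by move=> q; exact: smooth_lin.
exists (maxn k l) => q; rewrite gtn_max => /andP[kq lq].
by rewrite -[LHS]/(a *: f q + g q) kf // lg // scaler0 addr0.
Qed.
Lemma smg_parity b f : smg f -> smg (parity_part b f).
Proof.
move=> [sf [k kf]]; split; first by move=> q; rewrite /parity_part; case: ifP => // _; exact: smooth0.
by exists k => q kq; rewrite /parity_part kf //; case: ifP.
Qed.

Lemma gmul_fun f g q : gmul f g q = fun x => \sum_(p <- spl q) ((-1) ^+ inv p.1.2 p.2.2 * f p.1 x * g p.2 x : R^o).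
Proof. by apply/funext => x; rewrite gmulE. Qed.

Lemma mdegree_join p q : p \in spl q -> mdegree q = (mdegree p.1 + mdegree p.2)%N.
Proof.
move=> ps; have := spl_card ps; move: ps; rewrite mspl => /andP[_ /eqP <-].
rewrite /mdegree => ->; have -> : (\sum_k (join p.1 p.2).1 k = \sum_k p.1.1 k + \sum_k p.2.1 k)%N.
  by rewrite -big_split; apply: eq_bigr => k _; rewrite ffunE.
by rewrite mulnDr addnACA.
Qed.

Lemma sder mu (f : V -> R^o) : smooth U f -> forall x, U x -> derivable f x ('e_mu : V).
Proof. by move=> sf x Ux; exact: smooth_derivable sf Ux. Qed.

Lemma smooth_scale (a : R) (f : V -> R^o) : smooth U f -> smooth U (fun x => a * f x).
Proof.
move=> sf; have := smooth_lin a sf (smooth0 U).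
by under eq_fun do rewrite addr0.
Qed.

Lemma smg_gmul f g : smg f -> smg g -> smg (gmul f g).
Proof.
move=> [sf [k kf]] [sg [l lg]]; split.
  move=> q; rewrite gmul_fun; have [] // := @smooth_sum _ _ U _ (spl q) (fun p x => (-1) ^+ inv p.1.2 p.2.2 * f p.1 x * g p.2 x).
  by move=> p; apply: smooth_mul => //; exact: smooth_scale.
exists (k + l)%N => q kq; apply/funext => x; rewrite gmulE /conv big_seq big1 // => p ps.
have [kp|kp] := ltnP k (mdegree p.1); first by rewrite kf // mulr0 mul0r.
rewrite lg ?mulr0 // ltnNge; apply/negP => lp; have := leq_add kp lp; by rewrite -(mdegree_join ps) leqNgt kq.
Qed.

Lemma d_x_leib mu f g : smg f -> smg g -> d_x U mu (gmul f g) = gmul (d_x U mu f) g + gmul f (d_x U mu g).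
Proof.
move=> [sf _] [sg _]; apply/funext => q.
have s2 p : smooth U (fun x => f p.1 x * g p.2 x : R^o) by apply: smooth_mul.
rewrite {1}/d_x gmul_fun.
have [_ ->] := @smooth_sum _ _ U _ (spl q) (fun p x => (-1) ^+ inv p.1.2 p.2.2 * f p.1 x * g p.2 x) (fun p => smooth_mul (smooth_scale _ (sf _)) (sg _)).
apply/funext => x; rewrite -[RHS]/(gmul (d_x U mu f) g q x + gmul f (d_x U mu g) q x) !gmulE /conv -big_split.
apply: eq_bigr => p _; rewrite partial_mul => [|y Uy|y Uy]; [|exact: sder (smooth_scale _ (sf _)) _ Uy|exact: sder (sg _) _ Uy].
have -> : partial U mu (fun x => (-1) ^+ inv p.1.2 p.2.2 * f p.1 x) = fun x => (-1) ^+ inv p.1.2 p.2.2 * partial U mu (f p.1) x.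
  have := @partial_lin _ _ U mu ((-1) ^+ inv p.1.2 p.2.2) (f p.1) (fun=> 0)
    (@sder mu _ (sf _)) (@sder mu _ (smooth0 U)).
  rewrite partial0; under eq_fun do rewrite addr0.
  by under [RHS]eq_fun do rewrite addr0.
rewrite /d_x mul1r; congr (_ + _); ring.
Qed.

Lemma smg_d_x mu f : smg f -> smg (d_x U mu f).
Proof.
move=> [sf [k kf]]; split; first by move=> q; exact: smooth_partial.
by exists k => q kq; rewrite /d_x kf //; exact: partial0.
Qed.
Lemma d_x_lin mu (a : R) f g : smg f -> smg g -> d_x U mu (a *: f + g) = a *: d_x U mu f + d_x U mu g.
Proof.
move=> [sf _] [sg _]; apply/funext => q.
exact: (@partial_lin _ _ U mu a (f q) (g q) (@sder mu (f q) (sf _)) (@sder mu (g q) (sg _))).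
Qed.
Lemma parity_d_x b mu f : parity_part b f = f -> parity_part b (d_x U mu f) = d_x U mu f.
Proof.
move=> E; apply/funext => q; rewrite /parity_part; case: ifP => // ob.
rewrite /d_x -E /parity_part ob; apply/esym; exact: partial0.
Qed.
Lemma smg_scale (F : mon -> mon) (c : mon -> R) (d : nat) f :
  (forall q, (mdegree q <= mdegree (F q) + d)%N) -> smg f -> smg (fun q => c q *: f (F q)).
Proof.
move=> Fd [sf [k kf]]; split.
  by move=> q; exact: smooth_scale.
by exists (k + d)%N => q kq; rewrite kf ?scaler0 //; have := Fd q; lia.
Qed.
Lemma smg_d_p mu f : smg f -> smg (d_p mu f).
Proof.
apply: (@smg_scale (fun q => up q mu) (fun q => (q.1 mu).+1%:R) 0) => q.
rewrite addn0 /mdegree leq_add2r leq_mul2l /=; apply: leq_sum => k _; rewrite ffunE; exact: leq_addr.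
Qed.
Lemma smg_d_theta i f : smg f -> smg (d_theta i f).
Proof.
move=> sf; have -> : d_theta i f = fun q => (if i \in q.2 then 0 else (-1) ^+ #|[set j in q.2 | (j < i)%N]|) *: f (q.1, i |: q.2).
  by apply/funext => q; rewrite /d_theta; case: ifP; rewrite ?scale0r.
apply: (@smg_scale (fun q => ins i q) _ 0) sf => q.
by rewrite addn0 /mdegree leq_add2l; apply: subset_leq_card; exact: finset.subsetUr.
Qed.
Lemma d_xx mu nu f : smg f -> d_x U mu (d_x U nu f) = d_x U nu (d_x U mu f).
Proof. by move=> [sf _]; apply/funext => q; exact: clairaut. Qed.
Lemma d_xs mu (F : mon -> mon) (c : mon -> R) f : smg f ->
  d_x U mu (fun q => c q *: f (F q)) = fun q => c q *: d_x U mu f (F q).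
Proof.
move=> [sf _]; apply/funext => q; rewrite /d_x.
have := @partial_lin _ _ U mu (c q) (f (F q)) (fun=> 0)
    (@sder mu _ (sf _)) (@sder mu _ (smooth0 U)).
rewrite partial0; under eq_fun do rewrite addr0.
by under [RHS]eq_fun do rewrite addr0.
Qed.
Lemma d_xp mu nu f : smg f -> d_x U mu (d_p nu f) = d_p nu (d_x U mu f).
Proof. exact: (@d_xs mu (fun q => up q nu) (fun q => (q.1 nu).+1%:R)). Qed.
Lemma d_xt mu i f : smg f -> d_x U mu (d_theta i f) = d_theta i (d_x U mu f).
Proof.
move=> sf; have E g : d_theta i g = fun q => (if i \in q.2 then 0 else (-1) ^+ #|[set j in q.2 | (j < i)%N]|) *: g (q.1, i |: q.2).
  by apply/funext => q; rewrite /d_theta; case: ifP; rewrite ?scale0r.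
by rewrite !E; exact: (@d_xs mu (fun q => ins i q)).
Qed.

(** All smooth functions. The two subalgebras are handled inside it, since the operators of graphs
    are the same. *)
Definition Lsm : glie R := shifted_algebra U smg.

Lemma parity_lin b (a : R) f g : parity_part b (a *: f + g) = a *: parity_part b f + parity_part b g.
Proof.
apply/funext => q; rewrite -[RHS]/(a *: parity_part b f q + parity_part b g q) /parity_part.
by case: ifP => // _; rewrite scaler0 addr0.
Qed.

Lemma glie_ok_shifted (A : set gf) : A 0 -> (forall (a : R) f g, A f -> A g -> A (a *: f + g)) ->
  (forall b f, A f -> A (parity_part b f)) -> glieok (shifted_algebra U A).
Proof.
move=> A0 AP Ap; split => //.
- by move=> b a u v; exact: parity_lin.
- move=> b b' u; apply/funext => q; rewrite /= /parity_part.
  by case: eqVneq => [<-|nb]; case: eqP => // e; case: eqP => // e'; case: eqP nb => // ; rewrite -e -e'.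
- move=> u; apply/funext => q; rewrite -[LHS]/(parity_part false u q + parity_part true u q) /parity_part.
  by case: (odd _); rewrite ?addr0 ?add0r.
Qed.

Lemma glie_ok_sm : glieok Lsm.
Proof. by apply: glie_ok_shifted; [exact: smg0|exact: smgP|exact: smg_parity]. Qed.

Lemma okb_sm b f : @okb R Lsm (b, f) <-> smg f /\ parity_part b f = f.
Proof. by split=> [/asboolP|?]; [|apply/asboolP]. Qed.

Definition smK (b : bool) : finType := if b then 'I_m : finType else 'I_r.
(** Aligned edges ([b = true]) pair d_x at the tail with d_p at the head; opposite edges pair d_xi
    with d_zeta. *)
Definition smD (b s : bool) : smK b -> Lsm -> Lsm :=
  if b return smK b -> Lsm -> Lsm then fun mu => if s then d_x U mu else d_p mu
  else fun a => if s then d_xi a else d_zeta a.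
Definition smth (s : bool) (a : 'I_r) : 'I_(r + r) := if s then lshift r a else rshift r a.
Lemma smDf s (a : smK false) : smD s a = d_theta (smth s a). Proof. by case: s. Qed.

Lemma sm_der b s k : pder (~~ b) (@smD b s k).
Proof.
case: b k => k; split.
- move=> p f /okb_sm[sf pf]; apply/okb_sm; rewrite addbF; case: s => /=.
    by split; [exact: smg_d_x|exact: parity_d_x].
  by split; [exact: smg_d_p|exact: parity_d_p].
- move=> p a f g /okb_sm[sf _] /okb_sm[sg _]; case: s => /=; [exact: d_x_lin|exact: d_pP].
- move=> p f /okb_sm[sf pf]; apply/okb_sm; rewrite smDf addbT.
  by split; [exact: smg_d_theta|exact: parity_d_theta].
- by move=> p a f g _ _; rewrite smDf; exact: d_thetaP.
Qed.

Lemma sm_leib b s k p (q : bool) (f g : Lsm) : okb (p, f) -> okb (q, g) ->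
  @smD b s k (gmul f g) = gmul (@smD b s k f) g + (-1) ^+ (~~ b && p) *: gmul f (@smD b s k g).
Proof.
case: b k => k /okb_sm[sf pf] /okb_sm[sg pg]; last by rewrite smDf /=; exact: d_theta_leib.
by rewrite scale1r; case: s => /=; [exact: d_x_leib|exact: d_p_leib].
Qed.

Lemma sm_com b s k b' s' k' p (f : Lsm) : okb (p, f) ->
  @smD b s k (@smD b' s' k' f) = (-1) ^+ (~~ b && ~~ b') *: @smD b' s' k' (@smD b s k f).
Proof.
move=> /okb_sm[sf _]; case: b k => k; case: b' k' => k'; rewrite /= ?scale1r.
- by case: s; case: s'; [exact: d_xx|exact: d_xp|apply/esym; exact: d_xp|exact: d_pp].
- by rewrite -!/(@smD false s' k') !smDf; case: s; [exact: d_xt|exact: d_pt].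
- by rewrite -!/(@smD false s k) !smDf; case: s'; apply/esym; [exact: d_xt|exact: d_pt].
- by rewrite -!/(@smD false s _) -!/(@smD false s' _) !smDf scaleN1r; exact: d_tt.
Qed.

Definition sm_galg : galg Lsm.
Proof.
apply: (@Galg R Lsm (fun f g => gmul f g) smK negb smD).
- move=> p q f g /okb_sm[sf pf] /okb_sm[sg pg]; apply/okb_sm.
  by split; [exact: smg_gmul|exact: parity_gmul].
- exact: gmulPl.
- exact: gmulPr.
- exact: gmulA.
- by move=> p q f g /okb_sm[_ pf] /okb_sm[_ pg]; exact: gmulC.
- exact: sm_der.
- exact: sm_leib.
- exact: sm_com.
Defined.

End Smooth.
End GfunAlgebra.

(** * Comparison with the action by positions *)

Section OddAt.
Context (R : realType) (L : glie R) (Lok : glieok L).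
Local Notation X := (bool * L)%type.
Local Notation okl := (all (@okb R L)).
Implicit Types (h : seq X).

(** Tagged version of [odd_at]: each previous factor receives the sign of letting an operator of
    parity [p] pass. *)
Definition odd_h p (D : L -> L) i h : seq X :=
  [seq (x.1, (-1) ^+ (p && x.1) *: x.2) | x <- take i h] ++
  ((nth (false, 0) h i).1 (+) p, D (nth (false, 0) h i).2) :: drop i.+1 h.

Lemma hml_signs p ns Phi l0 ns1 h1 l2 : hml ns Phi -> size ns1 = size h1 ->
  dom ns (l0 ++ zip ns1 h1 ++ l2) ->
  Phi (l0 ++ zip ns1 [seq (x.1, (-1) ^+ (p && x.1) *: x.2) | x <- h1] ++ l2) =
  (-1) ^+ (p && hp h1) *: Phi (l0 ++ zip ns1 h1 ++ l2).
Proof.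
move=> mPhi; elim: h1 ns1 l0 => [|[b f] h1 IH] [|n ns1] l0 //=; first by rewrite andbF scale1r.
move=> [es] d; rewrite (hmlZ _ Lok mPhi).
  rewrite -cat_rcons IH //; last by rewrite cat_rcons.
  by rewrite cat_rcons scalerA -signr_addb; congr ((-1) ^+ _ *: _); case: (p); case: (b).
move: d; rewrite /dom /names /snds !map_cat /= !map_cat !all_cat /= !all_cat => /andP[/eqP <- /and3P[-> -> /andP[w1 ->]]].
rewrite andbT; apply/andP; split.
  apply/eqP; congr (_ ++ _ :: _ ++ _); elim: h1 ns1 es {IH w1} => [|x h1 IH] [|k ns1] //= [es]; by rewrite (IH _ es).
elim: h1 ns1 es w1 {IH} => [|x h1 IH] [|k ns1] //= [es] /andP[ox w1].
by have /= -> := IH _ es w1; rewrite andbT; apply: okbZ => //; case: (x) ox.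
Qed.

Lemma nm_split h1 x h2 : nm (h1 ++ x :: h2) =
  nm h1 ++ (size h1, x) :: zip (iota (size h1).+1 (size h2)) h2.
Proof. by rewrite nm_cat. Qed.

Lemma sgp_end n l x l2 : n \notin names l -> sgp n (l ++ (n, x) :: l2) = @xpar R L l.
Proof.
elim: l => [|y l IH] /=; first by rewrite eqxx.
by rewrite inE negb_or eq_sym => /andP[/negbTE -> /IH ->].
Qed.

Lemma okl_odd p D i h : pder p D -> okl h -> (i < size h)%N ->
  okl (odd_h p D i h) /\ size (odd_h p D i h) = size h.
Proof.
move=> pD oh ih; split.
  rewrite /odd_h all_cat /= all_map; apply/and3P; split.
  - apply/allP => x /mem_take xh; have := allP oh _ xh; case: x {xh} => b f /=.
    exact: okbZ.
  - apply: (pder_ok pD); have := allP oh _ (mem_nth (false, 0) ih); by case: nth.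
  - by apply/allP => x /mem_drop; exact: (allP oh).
by rewrite /odd_h size_cat size_map /= size_takel ?size_drop // 1?ltnW //; lia.
Qed.

(** By multilinearity the signs distributed over the preceding factors can be pulled out in
    front. *)
Lemma odd_h_OP p D i h Phi : pder p D -> hml (iota 0 (size h)) Phi -> okl h -> (i < size h)%N ->
  Phi (nm (odd_h p D i h)) = OP p D i Phi (nm h).
Proof.
move=> pD mPhi oh ih; set x := nth (false, 0) h i.
have hE : h = take i h ++ x :: drop i.+1 h by rewrite -drop_nth // cat_take_drop.
rewrite /odd_h -/x; move: hE; set h1 := take i h; set h2 := drop i.+1 h => hE.
have si : size h1 = i by rewrite size_takel // ltnW.
have E0 : nm h = nm h1 ++ (i, x) :: zip (iota i.+1 (size h2)) h2 by rewrite {1}hE nm_split si.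
have := dom_nm oh; rewrite /OP E0 nm_split size_map si => d.
rewrite hat_mid; last by move: (dom_uniq (iota_uniq _ _) d).
rewrite sgp_end; last by rewrite names_nm mem_iota si ltnn andbF.
rewrite xparE snds_nm -[nm (map _ _)]/(zip _ _) size_map si.
have d2 : dom (iota 0 (size h)) ([::] ++ zip (iota 0 i) h1 ++ (i, (x.1 (+) p, D x.2)) :: zip (iota i.+1 (size h2)) h2).
  move: d; rewrite /nm si /dom /names /snds !map_cat !all_cat /= => /andP[-> /and3P[-> ox ->]].
  by rewrite (pder_ok pD) //; case: (x) ox.
by rewrite /= -(cat0s (zip (iota 0 i) (map _ _) ++ _)) (hml_signs p mPhi) ?size_iota //= /nm si.
Qed.
End OddAt.

Section RepEdges.
Context (R : realType) (m r : nat) (U : set 'rV[R]_m) (Uo : open U).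
Local Notation gf := (gfun R m r).
Local Notation smg := (@smooth_gfun R m r U).
Local Notation L := (@Lsm R m r U).
Local Notation okL := (@glie_ok_sm R m r U).
Local Notation SA := (@sm_galg R m r U Uo).
Implicit Types (D F : gf -> gf) (i j : nat).

(** Common form of [even_at] and [odd_at]: [F] is the identity or the parity involution on the
    factors passed over. *)
Definition at_ i F D s : seq gf := [seq F f | f <- take i s] ++ D (nth 0 s i) :: drop i.+1 s.
Definition smF (b : bool) : gf -> gf := if b then id else @par_inv R m r.

Lemma size_at i F D s : (i < size s)%N -> size (at_ i F D s) = size s.
Proof. by move=> h; rewrite size_cat size_map /= size_takel ?size_drop // 1?ltnW //; lia. Qed.

Lemma nth_at i F D s k : (i < size s)%N -> (k < size s)%N -> nth 0 (at_ i F D s) k =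
  (if k == i then D (nth 0 s i) else if (k < i)%N then F (nth 0 s k) else nth 0 s k).
Proof.
move=> hi hk; rewrite nth_cat size_map (size_takel (ltnW hi)).
have [->|ne] := eqVneq k i; first by rewrite ltnn subnn.
case: ltnP => ik; first by rewrite (nth_map 0) ?(size_takel (ltnW hi)) // nth_take.
by case E: (k - i)%N => [|n] /=; [lia|rewrite nth_drop; congr nth; lia].
Qed.

Lemma even_atE i D s : (i < size s)%N -> even_at i D s = at_ i id D s.
Proof.
move=> h; apply: (@eq_from_nth _ 0).
  by rewrite size_at // size_set_nth; apply/maxn_idPr.
move=> k; rewrite size_set_nth (maxn_idPr h) => hk.
by rewrite nth_set_nth /= nth_at //; case: eqP => // _; case: ifP.
Qed.

Lemma rep_edges_cons i j b es s : (i < size s)%N -> (j < size s)%N ->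
  rep_edges U ((i, j, b) :: es) s = \sum_(k : smK m r b) rep_edges U es
  (at_ i (smF b) (@smD R m r U b true k) (at_ j (smF b) (@smD R m r U b false k) s)).
Proof.
move=> hi hj; case: b; last by [].
by apply: eq_bigr => k _; rewrite !even_atE // size_at.
Qed.

Lemma smF_par b (x : bool * gf) : parity_part x.1 x.2 = x.2 ->
  smF b x.2 = (-1) ^+ (~~ b && x.1) *: x.2.
Proof. by case: b => px; [rewrite scale1r|exact: par_inv_hom]. Qed.

Lemma at_us b D i (h : seq (bool * L)) : all (@okb R L) h -> (i < size h)%N ->
  at_ i (smF b) D (us h) = us (odd_h (L := L) (~~ b) D i h).
Proof.
move=> oh ih; rewrite /at_ /odd_h us_cat /= /us (nth_map (false, 0)) // map_drop; congr (_ ++ _).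
rewrite -map_take -!map_comp; apply/seq.eq_in_map => x /mem_take xh /=.
by apply: smF_par; have /okb_sm[] : okb (x.1, x.2) by have := allP oh _ xh; case: (x).
Qed.

Lemma mu_prod_us (h : seq (bool * L)) : mu_prod (us h) = mu SA (nm h).
Proof.
rewrite -[RHS](_ : mu SA (zip (iota 0 (size h)) h) = _) //; move: 0%N => n.
case: h => // x h; rewrite /mu_prod /=.
elim/last_ind: h n => [|h y IH] n //=.
rewrite size_rcons -[(size h).+1]addn1 iotaD -cats1 zip_cat ?size_iota //.
have nz : ((n, x) :: zip (iota n.+1 (size h)) h) <> [::] by [].
have e : (n, x) :: zip (iota n.+1 (size h)) h ++ zip (iota (n.+1 + size h) 1) [:: y] =
  ((n, x) :: zip (iota n.+1 (size h)) h) ++ zip (iota (n.+1 + size h) 1) [:: y] by [].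
rewrite -[RHS]/(mu SA ((n, x) :: (zip (iota n.+1 (size h)) h ++ zip (iota (n.+1 + size h) 1) [:: y]))) e (mu_cat SA) //.
have IH' : foldl (@gmul R m r) x.2 (us h) = mu SA ((n, x) :: zip (iota n.+1 (size h)) h) by exact: IH.
by rewrite -IH' /us map_cat foldl_cat.
Qed.

Lemma rep_edges_nrep es (h : seq (bool * L)) : h <> [::] -> all (@okb R L) h ->
  all (below (iota 0 (size h))) es -> rep_edges U es (us h) = nrep SA es (nm h).
Proof.
move=> h0; elim: es h h0 => [|[[i j] b] es IH] h h0 oh /=; first by move=> _; exact: mu_prod_us.
rewrite {1}/below /= !mem_iota !add0n /= => /andP[/andP[hi hj] bes].
rewrite -[LHS]/(rep_edges U ((i, j, b) :: es) (us h)) rep_edges_cons ?size_map //.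
apply: eq_bigr => k _.
have pF := @sm_der R m r U b false k; have pT := @sm_der R m r U b true k.
have [w1 s1] := okl_odd okL pF oh hj.
have hi1 : (i < size (odd_h (~~ b) (@smD R m r U b false k) j h))%N by rewrite s1.
have [w2 s2] := okl_odd okL pT w1 hi1.
rewrite at_us // at_us // IH //.
- have hm1 : hml (iota 0 (size (odd_h (L := L) (~~ b) (@smD R m r U b false k) j h))) (nrep SA es) by exact: nrep_hml.
  have hm2 : hml (iota 0 (size h)) (OP (~~ b) (@smD R m r U b true k) i (nrep SA es)).
    by apply: (OP_hml _ pT); exact: nrep_hml.
  rewrite (odd_h_OP okL pT hm1 w1 hi1); exact: (odd_h_OP okL pF hm2 oh hj).
- by move=> e; move: s2; rewrite e s1; case: (h) h0.
- by rewrite s2 s1.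
Qed.

(** Multilinearity at a fixed length. It is what extends the comparison with [nrep] from homogeneous
    arguments to all arguments. *)
Definition multN N (P : seq gf -> gf) := forall s1 s2 (a : R) u v, (size s1 + size s2).+1 = N ->
  (forall f, f \in s1 -> smg f) -> (forall f, f \in s2 -> smg f) -> smg u -> smg v ->
  P (s1 ++ (a *: u + v) :: s2) = a *: P (s1 ++ u :: s2) + P (s1 ++ v :: s2).

Lemma smF_lin b (a : R) f g : smF b (a *: f + g) = a *: smF b f + smF b g.
Proof.
case: b => //; apply/funext => q; rewrite -[RHS]/(a *: ((-1) ^+ #|q.2| *: f q) + (-1) ^+ #|q.2| *: g q).
rewrite -[LHS]/((-1) ^+ #|q.2| *: (a *: f q + g q)); by rewrite scalerDr !scalerA mulrC.
Qed.
Lemma smg_smF b f : smg f -> smg (smF b f).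
Proof.
case: b => // -[sf [k kf]]; split; first by move=> q; exact: smooth_scale.
by exists k => q kq; rewrite /smF /par_inv kf // scaler0.
Qed.
Lemma smg_smD b s k f : smg f -> smg (@smD R m r U b s k f).
Proof.
case: b k => k sf; first by case: s; [exact: smg_d_x|exact: smg_d_p].
by rewrite smDf; exact: smg_d_theta.
Qed.
Lemma smD_lin b s k (a : R) f g : smg f -> smg g ->
  @smD R m r U b s k (a *: f + g) = a *: @smD R m r U b s k f + @smD R m r U b s k g.
Proof.
case: b k => k sf sg; first by case: s; [exact: d_x_lin|exact: d_pP].
by rewrite !smDf; exact: d_thetaP.
Qed.

Lemma in_smg_at b s k i t : (i < size t)%N -> (forall f, f \in t -> smg f) ->
  forall f, f \in at_ i (smF b) (@smD R m r U b s k) t -> smg f.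
Proof.
move=> it st f; rewrite mem_cat inE => /or3P[/mapP[g /mem_take/st sg ->]|/eqP ->|/mem_drop/st //].
  exact: smg_smF.
by apply: smg_smD; apply: st; exact: mem_nth.
Qed.

Lemma at_lo i F D s1 u s2 : (i < size s1)%N -> at_ i F D (s1 ++ u :: s2) = at_ i F D s1 ++ u :: s2.
Proof.
move=> h; rewrite /at_ takel_cat 1?ltnW // nth_cat h -catA /=; congr (_ ++ _ :: _).
rewrite drop_cat; case: ltnP => // h'; have -> : i.+1 = size s1 by lia.
by rewrite subnn drop0 drop_size.
Qed.
Lemma at_eq F D s1 u s2 : at_ (size s1) F D (s1 ++ u :: s2) = [seq F f | f <- s1] ++ D u :: s2.
Proof. rewrite /at_ take_size_cat // nth_cat ltnn subnn /=; congr (_ ++ _ :: _).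
by rewrite drop_cat ltnNge leqnSn /= subSnn /= drop0. Qed.
Lemma at_hi i F D s1 u s2 : (size s1 < i)%N ->
  at_ i F D (s1 ++ u :: s2) = [seq F f | f <- s1] ++ F u :: at_ (i - (size s1).+1) F D s2.
Proof.
move=> h; have e : i = (size s1 + (i - (size s1).+1).+1)%N by lia.
rewrite {1}e /at_ !take_cat nth_cat drop_cat.
move: {e h} (i - (size s1).+1)%N => n.
have c1 : (size s1 + n.+1 < size s1)%N = false by lia.
have c2 : ((size s1 + n.+1).+1 < size s1)%N = false by lia.
have c3 : ((size s1 + n.+1).+1 - size s1 = n.+2)%N by lia.
by rewrite c1 c2 c3 !addKn map_cat /= -catA.
Qed.

Lemma multN_at N P b s k i : (i < N)%N -> multN N P ->
  multN N (fun t => P (at_ i (smF b) (@smD R m r U b s k) t)).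
Proof.
move=> iN mP s1 s2 a u v sz i1 i2 su sv; case: (ltngtP i (size s1)) => h.
- rewrite !at_lo // mP ?size_at //; exact: in_smg_at.
- rewrite !at_hi // smF_lin; have h2 : (i - (size s1).+1 < size s2)%N by lia.
  rewrite mP ?size_map ?size_at //; try exact: smg_smF; first last.
    exact: in_smg_at.
  by move=> f /mapP[g /i1 sg ->]; exact: smg_smF.
- rewrite h !at_eq smD_lin // mP ?size_map //; try exact: smg_smD.
  by move=> f /mapP[g /i1 sg ->]; exact: smg_smF.
Qed.

Lemma foldl_gmulP t (a : R) f g : foldl (@gmul R m r) (a *: f + g) t = a *: foldl (@gmul R m r) f t + foldl (@gmul R m r) g t.
Proof. by elim: t f g => //= x t IH f g; rewrite gmulPl IH. Qed.

Lemma multN_mu N : multN N (@mu_prod R m r).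
Proof.
move=> [|f s1] s2 a u v _ _ _ _ _ /=; first exact: foldl_gmulP.
by rewrite !foldl_cat /= gmulPr foldl_gmulP.
Qed.

Lemma multN_rep_edges N es : all (below (iota 0 N)) es -> multN N (rep_edges U es).
Proof.
elim: es => [|[[i j] b] es IH] /=; first by move=> _; exact: multN_mu.
rewrite {1}/below /= !mem_iota !add0n /= => /andP[/andP[hi hj] bes].
move=> s1 s2 a u v sz i1 i2 su sv; rewrite -!/(rep_edges U ((i, j, b) :: es) _).
have szc w : size (s1 ++ w :: s2) = N by rewrite size_cat /= addnS.
rewrite !rep_edges_cons ?szc // scaler_sumr -big_split; apply: eq_bigr => k _.
exact: (multN_at false k hj (multN_at true k hi (IH bes))).
Qed.

Lemma repE gamma (s : seq gf) : finite_set [set G | gamma (size s) G <> 0] ->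
  rep U gamma s = \sum_(G <- gsp gamma (size s)) gamma (size s) G *: rep_edges U (edges G) s.
Proof.
move=> f; rewrite /rep (@fs_seq R _ _ (gsp gamma (size s))) ?gsp_uniq // => G /(gspP f) ->.
by rewrite scale0r.
Qed.

Lemma mult_rep gamma : (forall N, finite_set [set G | gamma N G <> 0]) ->
  (forall N G, gamma N G <> 0 -> vertices_below N G) -> mult (rep U gamma : Defs.family L).
Proof.
move=> fin bel s1 s2 a u v i1 i2 su sv.
have sz (w : L) : size (s1 ++ w :: s2) = (size s1 + size s2).+1 by rewrite size_cat /= addnS.
rewrite !repE ?sz // scaler_sumr -big_split big_seq [RHS]big_seq; apply: eq_bigr => G /(mem_gsp (fin _))/bel vb.
have -> := @multN_rep_edges _ _ (vb_below vb) s1 s2 a u v erefl i1 i2 su sv.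
by rewrite scalerDr !scalerA mulrC.
Qed.

Lemma rep_arep d gamma : gch d gamma -> feq (rep U gamma : Defs.family L) (arep SA gamma).
Proof.
move=> g; have [fin bel _ _] := g.
apply: (feq_ok okL); first exact: mult_rep.
  exact: pcoM (pco_arep okL SA g).
move=> h h0 oh; rewrite (arep_us okL) // repE ?size_map // hrepE // big_seq [RHS]big_seq.
apply: eq_bigr => G /(mem_gsp (fin _))/bel vb; rewrite rep_edges_nrep //; exact: vb_below.
Qed.

Lemma pco_rep d gamma : gch d gamma -> pco skew_chi d (rep U gamma : Defs.family L).
Proof. by move=> g; first [exact: (pco_feq okL (feqS (rep_arep g)) (pco_arep okL SA g)) | apply: (pco_feq (feqS (rep_arep g))); [exact: okL|exact: pco_arep] | apply: pco_feq; [exact: okL|exact: feqS (rep_arep g)|exact: pco_arep]|apply: (pco_feq (feqS (rep_arep g))); exact: pco_arep]. Qed.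

Definition hom (d : int) (f : gf) := forall q, f q <> 0 -> (mdegree q)%:Z = d.
Definition homs (ds : seq int) s := size ds = size s /\ forall k, (k < size s)%N -> hom (nth 0 ds k) (nth 0 s k).

Lemma homP (a : R) d f g : hom d f -> hom d g -> hom d (a *: f + g).
Proof.
move=> hf hg q; rewrite -[(_ + _) q]/(a *: f q + g q).
have [->|/eqP fq] := eqVneq (f q) 0; last by move=> _; exact: hf.
by rewrite scaler0 add0r; exact: hg.
Qed.
Lemma hom0 d : hom d 0. Proof. by move=> q []. Qed.
Lemma hom_sum d (I : Type) (t : seq I) (F : I -> gf) : (forall i : I, hom d (F i)) -> hom d (\sum_(i <- t) F i).
Proof.
move=> hF; elim: t => [|i t IH]; rewrite ?big_nil ?big_cons; first exact: hom0.
by rewrite -[F i]scale1r; exact: homP.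
Qed.
Lemma hom_smF b d f : hom d f -> hom d (smF b f).
Proof.
case: b => // hf q h; apply: hf => e; apply: h; by rewrite /smF /par_inv e scaler0.
Qed.
(** Degree lost at the two ends of an edge: 0 and 2 for an aligned one, 1 and 1 for an opposite one,
    so 2 in either case. *)
Definition wt (b s : bool) : int := if b then (if s then 0 else 2) else 1.
Lemma hom_smD b s k d f : hom d f -> hom (d - wt b s) (@smD R m r U b s k f).
Proof.
case: b k => k hf q; rewrite /wt; last first.
  rewrite smDf /d_theta; case: ifP => // /negbT iq h.
  have /hf <- : f (q.1, smth s k |: q.2)%SET <> 0 by move=> e; apply: h; rewrite e scaler0.
  by rewrite /mdegree /= cardsU1 iq /=; move: (2 * _)%N #|_| => x y; lia.
case: s => /= h.
  rewrite subr0; apply: hf => e; apply: h; rewrite /d_x e; exact: partial0.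
have /hf <- : f ([ffun nu => q.1 nu + (nu == k)]%N, q.2) <> 0 by move=> e; apply: h; rewrite /d_p e scaler0.
rewrite /mdegree /=; have -> : (\sum_i [ffun nu => (q.1 nu + (nu == k))%N] i = \sum_i q.1 i + 1)%N.
  under eq_bigr do rewrite ffunE; rewrite big_split /=; congr (_ + _)%N.
  by rewrite (bigD1 k) //= eqxx big1 // => i /negbTE ->.
move: (\sum_i _)%N #|_| => x y; lia.
Qed.
Lemma hom_gmul d d' f g : hom d f -> hom d' g -> hom (d + d') (gmul f g).
Proof.
move=> hf hg q h; apply: contrapT => nd; apply: h; apply/funext => x.
rewrite gmulE /conv big_seq big1 // => p ps.
have [E|/eqP fp] := eqVneq (f p.1) 0; first by rewrite E mulr0 mul0r.
have [E|/eqP gp] := eqVneq (g p.2) 0; first by rewrite E mulr0.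
by case: nd; rewrite (mdegree_join ps) PoszD (hf _ fp) (hg _ gp).
Qed.

Lemma homs_at b s k i ds t : (i < size t)%N -> homs ds t ->
  exists2 ds', \sum_(e <- ds') e = \sum_(e <- ds) e - wt b s & homs ds' (at_ i (smF b) (@smD R m r U b s k) t).
Proof.
move=> it [sd hd]; have id : (i < size ds)%N by rewrite sd.
exists (take i ds ++ (nth 0 ds i - wt b s) :: drop i.+1 ds).
  rewrite big_cat big_cons /= addrCA -addrA -[in RHS](cat_take_drop i ds) big_cat /= (drop_nth 0 id) big_cons /=; ring.
have sd' : size (take i ds ++ (nth 0 ds i - wt b s) :: drop i.+1 ds) = size ds.
  by rewrite size_cat /= size_takel ?size_drop // 1?ltnW //; lia.
split; first by rewrite sd' size_at.
move=> j; rewrite size_at // => jt; rewrite nth_at // nth_cat (size_takel (ltnW id)).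
have [->|ne] := eqVneq j i; first by rewrite ltnn subnn; apply: hom_smD; exact: hd.
case: ltnP => ij; first by rewrite nth_take //; apply: hom_smF; exact: hd.
case E: (j - i)%N => [|n] /=; first by lia.
by rewrite nth_drop (_ : (i.+1 + n = j)%N); [exact: hd|lia].
Qed.

Lemma homs_mu ds t : t <> [::] -> homs ds t -> hom (\sum_(e <- ds) e) (mu_prod t).
Proof.
case: t => // f t _ [/=]; case: ds => // d ds [sd] hd; rewrite big_cons /mu_prod.
have hf := hd 0%N isT; have ht k := hd k.+1; move: hf ht => /= {hd}.
elim: t ds sd d f => [|g t IH] [|e ds] //=; first by move=> _ d f hf _; rewrite big_nil addr0.
move=> [sd] d f hf ht.
rewrite big_cons addrA; apply: IH => //; first by apply: hom_gmul => //; exact: (ht 0%N).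
by move=> k; exact: (ht k.+1).
Qed.

Lemma hom_rep_edges es ds t : t <> [::] -> all (below (iota 0 (size t))) es -> homs ds t ->
  hom (\sum_(e <- ds) e - 2 * (size es)%:Z) (rep_edges U es t).
Proof.
elim: es ds t => [|[[i j] b] es IH] ds t t0; first by move=> _; rewrite subr0; exact: homs_mu.
rewrite [all _ _]/= {1}/below /= !mem_iota !add0n /= => /andP[/andP[hi hj] bes] hd.
rewrite -/(rep_edges U ((i, j, b) :: es) _) rep_edges_cons //; apply: hom_sum => k.
have [ds1 E1 hd1] := @homs_at b false k _ _ _ hj hd.
have hi1 : (i < size (at_ j (smF b) (@smD R m r U b false k) t))%N by rewrite size_at.
have [ds2 E2 hd2] := @homs_at b true k _ _ _ hi1 hd1.
have -> : \sum_(e <- ds) e - 2 * (size es).+1%:Z = \sum_(e <- ds2) e - 2 * (size es)%:Z.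
  by rewrite E2 E1 /wt; case: b {k hd1 hi1 hd2 E1 E2}; lia.
apply: IH hd2; last by rewrite !size_at // size_at.
by move=> e; move: (size_at (smF b) (@smD R m r U b true k) hi1); rewrite e size_at //; case: (t) t0.
Qed.
End RepEdges.

(** * Supports of products of chains *)

Section Support.
Context (R : realType).
Implicit Types (gamma : gchain R) (G H : graph).

Lemma gc_pre_supp d gamma gamma' M H :
  (forall N, finite_set [set G | gamma N G <> 0]) -> (forall N, finite_set [set G | gamma' N G <> 0]) ->
  gc_pre d gamma gamma' M H <> 0 -> exists (c : M.-tuple 'I_2) G G' es,
  [/\ ord0 \in c, gamma (size (gcj c)).+1 G <> 0, gamma' (size (gci c)) G' <> 0,
  es \in reattach (gci c) (gcj c) (edges G) & H = seq_mset (es ++ relabel (nth 0%N (gci c)) G')].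
Proof.
move=> f f' H0; apply: contrapT => nex; apply: H0; rewrite gc_preE //; apply: big1 => c oc.
rewrite big_seq big1 ?mulr0 // => G /(mem_gsp (f _)) Gs.
rewrite big_seq big1 // => G' /(mem_gsp (f' _)) Gs'.
rewrite (_ : insert_coef _ _ _ _ _ = 0%N) ?mulr0 //; apply/eqP.
rewrite -leqn0 leqNgt -has_count; apply/negP => /hasP[es ees /eqP E]; apply: nex.
by exists c, G, G', es; split.
Qed.

Lemma gcij_perm M (c : M.-tuple 'I_2) : perm_eq (gci c ++ gcj c) (iota 0 M).
Proof.
apply: uniq_perm; [|exact: iota_uniq|].
  by apply: uniq_block_cat; [rewrite size_map size_tuple size_iota|exact: labels_lt|exact: iota_uniq].
have : size (labels c) = size (iota 0 M) by rewrite size_map size_tuple size_iota.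
rewrite /gci /gcj; have := labels_lt c; elim: (labels c) (iota 0 M) => [|i l IH] [|y s] //= /andP[i2 l2] [es] z.
rewrite !blk_cons !inE mem_cat -(IH _ l2 es) mem_cat.
by case: i i2 => [|[|i]] //= _; rewrite !inE; case: (z == y); rewrite /= ?orbT.
Qed.

Lemma gcij_size M (c : M.-tuple 'I_2) : (size (gci c) + size (gcj c) = M)%N.
Proof. by have := perm_size (gcij_perm c); rewrite size_cat size_iota. Qed.
Lemma gci_sub M (c : M.-tuple 'I_2) : {subset gci c <= iota 0 M}.
Proof. exact: block_sub. Qed.
Lemma gcj_sub M (c : M.-tuple 'I_2) : {subset gcj c <= iota 0 M}.
Proof. exact: block_sub. Qed.

Lemma below_mset M (s : seq edge) : vertices_below M (seq_mset s) = all (below (iota 0 M)) s.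
Proof.
rewrite /vertices_below (perm_all _ (edges_mset s)); apply: eq_all => e.
by rewrite /below !mem_iota.
Qed.

Lemma insert_below M (c : M.-tuple 'I_2) G G' es : vertices_below (size (gcj c)).+1 G ->
  vertices_below (size (gci c)) G' -> es \in reattach (gci c) (gcj c) (edges G) ->
  vertices_below M (seq_mset (es ++ relabel (nth 0%N (gci c)) G')).
Proof.
move=> vG vG' ees; rewrite below_mset all_cat; apply/andP; split.
  by apply: (reattach_below (@gci_sub _ c) (@gcj_sub _ c) _ ees).
rewrite all_map; apply/allP => e /(allP vG')/andP[e1 e2].
by apply/andP; split; apply: (@gci_sub _ c); exact: mem_nth.
Qed.

Lemma size_gci M (c : M.-tuple 'I_2) : ord0 \in c -> (0 < size (gci c))%N.
Proof.
move=> oc; have : (0 : nat) \in labels c by apply/mapP; exists ord0.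
have : size (labels c) = size (iota 0 M) by rewrite size_map size_tuple size_iota.
rewrite /gci; elim: (labels c) (iota 0 M) => [|i l IH] [|y s] //= [es]; rewrite blk_cons inE eq_sym.
by case: eqP => //= _; exact: IH.
Qed.
End Support.

(** * A faithful polynomial model of graphs *)

Section Model.
Context (R : realType) (N' : nat).
Local Notation M := N'.+1.
Local Notation T := ('I_M + 'I_M * 'I_M * bool)%type.
Local Notation m := #|{: T}|.
Local Notation gf := (gfun R m 0).
Local Notation mon := ({ffun 'I_m -> nat} * {set 'I_(0 + 0)})%type.
Implicit Types (f g : gf) (phi psi : 'I_m -> nat).

Lemma belE (e : edge) : below (iota 0 M) e = (e.1.1 < M)%N && (e.1.2 < M)%N.
Proof. by rewrite /below !mem_iota. Qed.

Definition ix (x : T) : 'I_m := enum_rank x.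
Lemma ix_eq (x y : T) : (ix x == ix y) = (x == y).
Proof. by apply/eqP/eqP => [/enum_rank_inj|->]. Qed.

(** Monomials in the fibre coordinates, constant along the base. There is one coordinate for each
    vertex and one for each possible edge, and no odd coordinate. *)
Definition mono phi : gf := fun q _ => (q.1 == [ffun k => phi k])%:R.
Definition dlt (t : 'I_m) : 'I_m -> nat := fun k => (k == t : nat).
Definition Lm : glie R := shifted_algebra [set: 'rV[R]_m] [set: gf].

Lemma set_ord0 (S : {set 'I_(0 + 0)}) : S = finset.set0.
Proof. by apply/setP => -[]. Qed.
Lemma mono_eq phi psi : phi =1 psi -> mono phi = mono psi.
Proof. by move=> E; congr mono; apply/funext. Qed.
Lemma par_f f : parity_part false f = f.
Proof. by apply/funext => q; rewrite /parity_part (set_ord0 q.2) finset.cards0. Qed.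
Lemma okm b f : @okb R Lm (b, f) <-> parity_part b f = f.
Proof. by split=> [/asboolP[]|?]; [|apply/asboolP]. Qed.
Lemma okm_f f : @okb R Lm (false, f). Proof. by apply/okm; exact: par_f. Qed.
Lemma Lm_ok : glieok Lm. Proof. exact: glie_ok_shifted. Qed.

Lemma gmul0l f : gmul 0 f = 0.
Proof. by apply/funext => q; apply/funext => x; rewrite gmulE /conv big1 // => p _; rewrite mulr0 mul0r. Qed.
Lemma gmulCf f g : gmul f g = gmul g f.
Proof. by rewrite (gmulC (par_f f) (par_f g)) scale1r. Qed.
Lemma gmulCA f g h : gmul f (gmul g h) = gmul g (gmul f h :> gf).
Proof. by rewrite !gmulA (gmulCf f). Qed.

Lemma mono_mul phi psi : gmul (mono phi) (mono psi) = mono (fun k => phi k + psi k)%N.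
Proof.
apply/funext => q; apply/funext => x; rewrite gmulE /conv.
pose p0 : mon * mon := (([ffun k => phi k], finset.set0), ([ffun k => psi k], finset.set0)).
have jE : (join p0.1 p0.2).1 = [ffun k => phi k + psi k]%N by apply/ffunP => k; rewrite !ffunE.
have z p : p \in spl q -> p != p0 -> (-1) ^+ inv p.1.2 p.2.2 * mono phi p.1 x * mono psi p.2 x = 0 :> R.
  case: p => [[a S] [b S']] _ ne; rewrite /mono /=.
  have [Ea|] := eqVneq a; last by rewrite mulr0 mul0r.
  have [Eb|] := eqVneq b; last by rewrite mulr0.
  by move: ne; rewrite /p0 Ea Eb (set_ord0 S) (set_ord0 S') eqxx.
rewrite -[RHS]/((q.1 == [ffun k => phi k + psi k]%N)%:R : R).
have [qE|qE] := eqVneq q.1 [ffun k => phi k + psi k]%N.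
  have p0s : p0 \in spl q.
    rewrite mspl /dj /= /join /=; apply/andP; split; first by apply/pred0P => -[].
    by apply/eqP; case: (q) qE => a S /= ->; rewrite (set_ord0 S) (set_ord0 (_ :|: _)%SET); congr pair; apply/ffunP => k; rewrite !ffunE.
  rewrite (bigD1_seq p0) ?spl_uniq //= big_seq_cond big1 => [|p /andP[ps ne]]; last exact: z.
  rewrite /mono /= !eqxx addr0 !mulr1 /inv big1 // => i; first by rewrite inE.
rewrite big_seq big1 // => p ps; apply: z => //; apply/eqP => E.
by case/eqP: qE; move: ps; rewrite mspl E => /andP[_ /eqP <-].
Qed.

Lemma e_l_mono l (c : R) phi : e_l l (c *: mono phi) = (c * (phi l)%:R) *: mono phi.
Proof.
apply/funext => q; apply/funext => x.
rewrite -[LHS]/((q.1 l)%:R * (c * (q.1 == [ffun k => phi k])%:R)) -[RHS]/(c * (phi l)%:R * (q.1 == [ffun k => phi k])%:R).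
by case: eqP => [->|_]; rewrite ?mulr0 // ffunE !mulr1 mulrC.
Qed.
Lemma e_l_w x y : e_l (ix (inl x)) (mono (dlt (ix (inr y)))) = 0.
Proof. by rewrite -[mono _]scale1r e_l_mono /dlt ix_eq mulr0 scale0r. Qed.
Lemma e_lC k t f : e_l k (e_l t f) = e_l t (e_l k f).
Proof. by apply/funext => q; rewrite /e_l !scalerA mulrC. Qed.
Lemma e_lP k (a : R) f g : e_l k (a *: f + g) = a *: e_l k f + e_l k g.
Proof. by apply/funext => q; rewrite /e_l scalerDr !scalerA mulrC -scalerA. Qed.

(** The Euler operators of two vertex variables select the tail and the head factor, and
    multiplication by an edge variable records the edge. On a tensor with one vertex variable per
    factor, a graph thus produces the product of its edge variables. *)
Definition mD (b s : bool) (k : 'I_M * 'I_M) (f : Lm) : Lm :=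
  if s then gmul (mono (dlt (ix (inr (k.1, k.2, b))))) (e_l (ix (inl k.1)) f) else e_l (ix (inl k.2)) f.

Lemma e_l_wm x y f : e_l (ix (inl x)) (gmul (mono (dlt (ix (inr y)))) f) =
  gmul (mono (dlt (ix (inr y)))) (e_l (ix (inl x)) f).
Proof. by rewrite e_l_leib e_l_w gmul0l add0r. Qed.

Lemma mD_der b s k : pder false (@mD b s k).
Proof.
split=> [q f /okm pf|q a f g _ _]; last by case: s; rewrite /mD ?e_lP ?gmulPr.
apply/okm; rewrite addbF; case: q pf => pf; last exact: par_f.
have -> : f = 0 by rewrite -pf -[in LHS](par_f f); apply/funext => q; rewrite /parity_part; case: (odd _).
have e0 l : e_l l (0 : gf) = 0 by apply/funext => q; rewrite /e_l scaler0.
have p0 : parity_part true (0 : gf) = 0 by apply/funext => q; rewrite /parity_part; case: ifP.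
by rewrite /mD !e0; case: s; rewrite ?p0 // gmulCf gmul0l p0.
Qed.

Definition model : galg Lm.
Proof.
apply: (@Galg R Lm (fun f g => gmul f g) (fun=> ('I_M * 'I_M)%type) (fun=> false) mD).
- by move=> p q f g /okm pf /okm pg; apply/okm; exact: parity_gmul.
- exact: gmulPl.
- exact: gmulPr.
- exact: gmulA.
- by move=> p q f g /okm pf /okm pg; exact: gmulC.
- exact: mD_der.
- move=> b s k p q f g _ _; rewrite scale1r; case: s; rewrite /mD e_l_leib //.
  by rewrite -[in LHS](scale1r (gmul (e_l _ f) g)) gmulPr scale1r gmulA gmulCA.
- move=> b s k b' s' k' p f _; rewrite scale1r; case: s; case: s'; rewrite /mD ?e_l_wm.
  + by rewrite gmulCA e_lC.
  + by rewrite e_lC.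
  + by rewrite e_lC.
  + exact: e_lC.
Defined.

Local Notation Y := (nat * (bool * Lm))%type.
Definition lms (c : nat -> R) (a : nat -> 'I_m -> nat) (s : seq nat) : seq Y :=
  [seq (v, (false, c v *: mono (a v) : Lm)) | v <- s].
Definition updc (c : nat -> R) (n : nat) (d : bool) (v : nat) : R := if v == n then c v * d%:R else c v.
Definition upda (a : nat -> 'I_m -> nat) (n : nat) (t : 'I_m) (v : nat) (k : 'I_m) : nat := if v == n then (a v k + (k == t))%N else a v k.

Lemma hatF b (k : 'I_M * 'I_M) (n : nat) (c : nat -> R) (a : nat -> 'I_m -> nat) (s : seq nat) (d : bool) : (forall v, v \in s -> v = n -> a v (ix (inl k.2)) = d :> nat) ->
  hat false (@mD b false k) n (lms c a s) = lms (updc c n d) a s.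
Proof.
move=> H; rewrite /hat /lms -map_comp; apply/seq.eq_in_map => v vs.
rewrite /= /hat1 /updc /=; case: eqP => // e; congr (_, (_, _)).
by rewrite /mD e_l_mono (H v vs e).
Qed.
Lemma hatT b (k : 'I_M * 'I_M) (n : nat) (c : nat -> R) (a : nat -> 'I_m -> nat) (s : seq nat) (d : bool) : (forall v, v \in s -> v = n -> a v (ix (inl k.1)) = d :> nat) ->
  hat false (@mD b true k) n (lms c a s) = lms (updc c n d) (upda a n (ix (inr (k.1, k.2, b)))) s.
Proof.
move=> H; rewrite /hat /lms -map_comp; apply/seq.eq_in_map => v vs.
rewrite /= /hat1 /updc /upda /=; case: eqP => // e; congr (_, (_, _)).
rewrite /mD e_l_mono (H v vs e) gmulCf -[_ *: mono _]addr0 gmulPl gmul0l addr0 mono_mul.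
by congr (_ *: _); apply: mono_eq.
Qed.

Lemma prod_updc c n d s : uniq s -> n \in s -> \prod_(v <- s) updc c n d v = d%:R * \prod_(v <- s) c v.
Proof.
move=> us ns; rewrite !(bigD1_seq n) //= /updc eqxx mulrCA mulrA; congr (_ * _).
by apply: eq_bigr => v /negbTE ->.
Qed.
Lemma sum_upda a n t s k : uniq s -> n \in s ->
  (\sum_(v <- s) upda a n t v k = \sum_(v <- s) a v k + (k == t))%N.
Proof.
move=> us ns; rewrite !(bigD1_seq n) //= /upda eqxx addnAC; congr (_ + _ + _)%N.
by apply: eq_bigr => v /negbTE ->.
Qed.

Lemma mu_lms c a s : s <> [::] ->
  mu model (lms c a s) = (\prod_(v <- s) c v) *: mono (fun k => \sum_(v <- s) a v k)%N.
Proof.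
elim: s => // v [_ _|w s IH _].
  by rewrite /= big_seq1; congr (_ *: _); apply: mono_eq => k; rewrite big_seq1.
rewrite -[mu _ _]/(gmul (c v *: mono (a v)) (mu model (lms c a (w :: s)))) IH // [in RHS]big_cons.
rewrite -[c v *: _]addr0 gmulPl gmul0l addr0 -[_ *: mono (fun k => _)]addr0 gmulPr (gmulCf _ 0) gmul0l addr0 mono_mul scalerA.
by congr (_ *: _); apply: mono_eq => k; rewrite [in RHS]big_cons.
Qed.

Definition ixe (tau : nat -> nat) (e : edge) : 'I_m := ix (inr (inord (tau e.1.1), inord (tau e.1.2), e.2)).

(** The factor v contains, among the vertex variables, exactly that of tau(v). So a single pair of
    indices survives in the sum for an edge, and it contributes the variable of that edge. *)
Lemma nrep_model tau es c (a : nat -> 'I_m -> nat) s : uniq s -> s <> [::] -> all (below s) es ->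
  (forall v, v \in s -> tau v < M)%N ->
  (forall v (k : 'I_M), v \in s -> a v (ix (inl k)) = (val k == tau v) :> nat) ->
  nrep model es (lms c a s) = (\prod_(v <- s) c v) *:
  mono (fun k => \sum_(v <- s) a v k + count (fun e => ixe tau e == k) es)%N.
Proof.
move=> Us s0 + tM; elim: es c a => [|e es IH] c a.
  by move=> _ _; rewrite -[LHS]/(mu model (lms c a s)) mu_lms //; congr (_ *: _); apply: mono_eq => k; rewrite addn0.
move=> /andP[/andP[e1 e2] bes] ia.
have E (k : 'I_M * 'I_M) : OPE (A := model) (e := e) false k (OPE (A := model) (e := e) true k (nrep model es)) (lms c a s) =
  ((val k.1 == tau e.1.1)%:R * ((val k.2 == tau e.1.2)%:R * \prod_(v <- s) c v)) *:
  mono (fun t => \sum_(v <- s) a v t + (t == ix (inr (k.1, k.2, e.2))) + count (fun e => ixe tau e == t) es)%N.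
  rewrite /OPE /OP /= !scale1r (hatF e.2 c (d := val k.2 == tau e.1.2)); last by move=> v vs ve; rewrite ia // ve.
  rewrite (hatT e.2 _ (d := val k.1 == tau e.1.1)); last by move=> v vs ve; rewrite ia // ve.
  rewrite IH //; last first.
    by move=> v x vs; rewrite /upda ix_eq addn0; case: eqP => _; exact: ia.
  rewrite !prod_updc //; congr (_ *: _); apply: mono_eq => t; by rewrite sum_upda.
transitivity (\sum_(k : 'I_M * 'I_M) OPE (A := model) (e := e) false k (OPE (A := model) (e := e) true k (nrep model es)) (lms c a s)); first by [].
rewrite (eq_bigr _ (fun k _ => E k)).
pose k0 : 'I_M * 'I_M := (inord (tau e.1.1), inord (tau e.1.2)).
rewrite (bigD1 k0) //= [X in _ + X]big1 ?addr0.
  rewrite !inordK ?tM // !eqxx !mul1r; congr (_ *: _); apply: mono_eq => t.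
  by rewrite -addnA; congr (_ + (_ + _))%N; rewrite /ixe eq_sym.
move=> [k1 k2] ne /=; case: eqP => E1; last by rewrite mul0r scale0r.
case: eqP => E2; last by rewrite mul0r mulr0 scale0r.
by case/eqP: ne; rewrite /k0 -E1 -E2 !inord_val.
Qed.

Definition htau (tau : nat -> nat) : seq (bool * Lm) :=
  [seq (false, mono (dlt (ix (inl (inord (tau v)))))) | v <- iota 0 M].
(** The monomial that encodes [G]: every vertex variable once and the edge variables with their
    multiplicities. *)
Definition q0 (G : graph) : mon :=
  ([ffun k => \sum_(v <- iota 0 M) dlt (ix (inl (inord v))) k + count (fun e => ixe id e == k) (edges G)]%N, finset.set0).

Lemma nm_htau tau : nm (htau tau) = lms (fun=> 1) (fun v => dlt (ix (inl (inord (tau v))))) (iota 0 M).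
Proof.
rewrite /nm /htau size_map size_iota /lms; elim: (iota 0 M) => //= v s ->.
by rewrite scale1r.
Qed.
Lemma ok_htau tau : all (@okb R Lm) (htau tau).
Proof. by apply/allP => x /mapP[v _ ->]; exact: okm_f. Qed.

Lemma ixe_inj (e e' : edge) : below (iota 0 M) e -> below (iota 0 M) e' -> (ixe id e == ixe id e') = (e == e').
Proof.
case: e e' => [[i j] b] [[i' j'] b']; rewrite !belE => /andP[/= i1 i2] /andP[/= i3 i4].
rewrite /ixe ix_eq /=; apply/eqP/eqP => [[E1 E2 ->]|[-> -> ->]] //.
by move: (congr1 val E1) (congr1 val E2); rewrite /= !inordK // => -> ->.
Qed.

Lemma count_ixe (s s' : seq edge) : all (below (iota 0 M)) s -> all (below (iota 0 M)) s' ->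
  (forall k, count (fun e => ixe id e == k) s = count (fun e => ixe id e == k) s') -> perm_eq s s'.
Proof.
move=> bs bs' E; apply/seq.allP => x; rewrite mem_cat => xs /=.
have bx : below (iota 0 M) x by case/orP: xs; [exact: (seq.allP bs)|exact: (seq.allP bs')].
have C (t : seq edge) : all (below (iota 0 M)) t -> count (pred1 x) t = count (fun e => ixe id e == ixe id x) t.
  by move=> bt; apply: eq_in_count => e et; rewrite /= ixe_inj //; exact: (seq.allP bt).
by rewrite (C s) // (C s') // E.
Qed.

(** Distinct multisets of edges give distinct monomials, so the coefficient at [q0 G0] picks out a
    single graph. *)
Lemma coef_model tau (gamma : gchain R) G0 : involutive tau -> (forall v, (tau v < M) = (v < M))%N ->
  (forall N, finite_set [set G | gamma N G <> 0]) -> (forall N G, gamma N G <> 0 -> vertices_below N G) ->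
  vertices_below M G0 -> arep model gamma (us (htau tau)) (q0 G0) 0 = gamma M (seq_mset (relabel tau G0)).
Proof.
move=> tK tM fin bel v0; rewrite (arep_us Lm_ok) ?ok_htau //.
have sz : size (htau tau) = M by rewrite size_map size_iota.
rewrite hrepE ?sz // nm_htau.
have evS (I : Type) (s : seq I) (F : I -> gf) q x : (\sum_(i <- s) F i) q x = \sum_(i <- s) F i q x.
  by elim: s => [|i s IH]; rewrite ?big_nil // !big_cons -IH.
rewrite evS; set G1 := seq_mset _.
have bt s : all (below (iota 0 M)) (rene tau s) = all (below (iota 0 M)) s.
  rewrite all_map; apply: eq_all => e.
  by rewrite -[LHS]/(below (iota 0 M) (tau e.1.1, tau e.1.2, e.2)) !belE /= !tM.
have E G : G \in gsp gamma M -> (gamma M G *: nrep model (edges G) (lms (fun=> 1) (fun v => dlt (ix (inl (inord (tau v))))) (iota 0 M))) (q0 G0) 0 = gamma M G * (G == G1)%:R.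
  move=> /(mem_gsp (fin _)) Gs; have vG := bel _ _ Gs.
  rewrite (@nrep_model tau (edges G) _ _ (iota 0 M) (iota_uniq 0 M) _ (vb_below vG)) //.
  - rewrite big1 // scale1r -[LHS]/(gamma M G * ((q0 G0).1 == [ffun k => _])%:R); congr (_ * _%:R); congr nat_of_bool.
    have S k : (\sum_(v <- iota 0 M) dlt (ix (inl (inord (tau v)))) k = \sum_(v <- iota 0 M) dlt (ix (inl (inord v))) k)%N.
      rewrite -(big_map tau xpredT (fun v => dlt (ix (inl (inord v))) k)); apply: perm_big.
      apply: uniq_perm; rewrite ?iota_uniq ?map_inj_uniq ?iota_uniq //; first exact: inv_inj.
      have Z w : (w \in iota 0 M) = (w < M)%N by rewrite mem_iota.
      move=> z; apply/mapP/idP => [[y yM ->]|zM]; first by rewrite Z tM -Z.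
      by exists (tau z); rewrite ?tK // Z tM -Z.
    have C (G2 : graph) k : count (fun e => ixe tau e == k) (edges G2) = count (fun e => ixe id e == k) (rene tau (edges G2)) by rewrite count_map.
    apply/eqP/eqP => [/ffunP H|->].
      have P : perm_eq (edges G0) (rene tau (edges G)).
        apply: count_ixe; rewrite ?bt ?(vb_below vG) ?(vb_below v0) // => k.
        by have := H k; rewrite !ffunE S => /addnI ->; exact: C.
      rewrite /G1 -[LHS]seq_mset_id; apply/eq_seq_msetP.
      have := perm_map (fun e : edge => (tau e.1.1, tau e.1.2, e.2)) P; rewrite /relabel perm_sym => /(fun h => perm_trans h _) P'.
      apply: perm_trans (P' _ (perm_refl _)); rewrite /rene -map_comp -[X in perm_eq X]map_id.
      by rewrite (eq_map (g := id)) // => -[[x y] z] /=; rewrite !tK.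
    apply/ffunP => k; rewrite !ffunE S; congr (_ + _)%N; rewrite (C G1).
    have -> : count (fun e => ixe id e == k) (rene tau (edges G1)) = count (fun e => ixe id e == k) (rene tau (relabel tau G0)).
      by apply/seq.permP/perm_map/edges_mset.
    congr count; rewrite /rene /relabel -map_comp -[LHS]map_id; apply: eq_map => -[[x y] z] /=; by rewrite !tK.
  - by move=> v; rewrite mem_iota add0n tM.
  - move=> v k; rewrite mem_iota add0n => vM; by rewrite /dlt ix_eq -[inl _ == _]/(k == inord (tau v)) -val_eqE /= inordK ?tM.
transitivity (\sum_(G <- gsp gamma M) gamma M G * (G == G1)%:R).
  by rewrite big_seq [RHS]big_seq; apply: eq_bigr => G; exact: E.
have [G1s|G1s] := boolP (G1 \in gsp gamma M).
  by rewrite (bigD1_seq G1) ?gsp_uniq //= eqxx mulr1 big1 ?addr0 // => G /negbTE ->; rewrite mulr0.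
rewrite (gspP (fin _) G1s) big_seq big1 // => G Gs; case: eqP => [e|_]; rewrite ?mulr0 //.
by move: G1s; rewrite -e Gs.
Qed.

Lemma relabel_id G : seq_mset (relabel id G) = G.
Proof. by rewrite -[RHS]seq_mset_id; congr seq_mset; rewrite /relabel -[RHS]map_id; apply: eq_map => -[[]]. Qed.

Lemma arep_inj (gamma gamma' : gchain R) :
  (forall N, finite_set [set G | gamma N G <> 0]) -> (forall N G, gamma N G <> 0 -> vertices_below N G) ->
  (forall N, finite_set [set G | gamma' N G <> 0]) -> (forall N G, gamma' N G <> 0 -> vertices_below N G) ->
  feq (arep model gamma) (arep model gamma') -> gamma M = gamma' M.
Proof.
move=> f b f' b' E; apply/funext => G.
have [vG|nG] := boolP (vertices_below M G).
  rewrite -(relabel_id G) -!(@coef_model id) // E //.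
have z (g : gchain R) : (forall N G, g N G <> 0 -> vertices_below N G) -> g M G = 0.
  by move=> bg; apply: contrapT => /bg; exact/negP.
by rewrite !z.
Qed.

(** Evaluating on the vertex variables in exchanged order reads off the coefficient of the
    relabelled graph; these arguments are even, so skew-symmetry of the operator gives a minus
    sign. *)
Lemma arep_swap d (gamma : gchain R) i G :
  (forall N, finite_set [set G | gamma N G <> 0]) -> (forall N G, gamma N G <> 0 -> vertices_below N G) ->
  pco skew_chi d (arep model gamma) -> (i.+1 < M)%N -> gamma M (seq_mset (relabel (swp i) G)) = - gamma M G.
Proof.
move=> f b P iM.
have bt s : all (below (iota 0 M)) (rene (swp i) s) = all (below (iota 0 M)) s.
  rewrite all_map; apply: eq_all => e.
  by rewrite -[LHS]/(below (iota 0 M) (swp i e.1.1, swp i e.1.2, e.2)) !belE /= !swp_lt.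
have vE : vertices_below M (seq_mset (relabel (swp i) G)) = vertices_below M G.
  rewrite below_mset -[relabel _ _]/(rene (swp i) (edges G)) bt; apply: eq_all => e.
  by rewrite belE.
have [vG|nG] := boolP (vertices_below M G); last first.
  have z H : ~~ vertices_below M H -> gamma M H = 0 by move=> nH; apply: contrapT => /b; exact/negP.
  by rewrite !z ?oppr0 // vE.
rewrite -{2}(relabel_id G) -(@coef_model (swp i) gamma G (@swpK i) (fun v => swp_lt v iM) f b vG).
rewrite -(@coef_model id gamma G (fun=> erefl) (fun=> erefl) f b vG).
have hE tau : htau tau = [seq (false, mono (dlt (ix (inl (inord (tau v)))))) | v <- iota 0 i] ++
  (false, mono (dlt (ix (inl (inord (tau i)))))) :: (false, mono (dlt (ix (inl (inord (tau i.+1)))))) ::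
  [seq (false, mono (dlt (ix (inl (inord (tau v)))))) | v <- iota i.+2 (M - i.+2)].
  rewrite /htau; have -> : iota 0 M = iota 0 i ++ i :: i.+1 :: iota i.+2 (M - i.+2).
    have e : M = (i + (M - i.+2).+2)%N by lia.
    by rewrite [in LHS]e iotaD.
  by rewrite map_cat.
rewrite !hE swp_i swp_iS.
have E1 : [seq (false, mono (dlt (ix (inl (inord (swp i v)))))) | v <- iota 0 i] = [seq (false, mono (dlt (ix (inl (inord (id v)))))) | v <- iota 0 i].
  by apply/seq.eq_in_map => v; rewrite mem_iota => /andP[_ vi]; rewrite swp_lo.
have E2 : [seq (false, mono (dlt (ix (inl (inord (swp i v)))))) | v <- iota i.+2 (M - i.+2)] = [seq (false, mono (dlt (ix (inl (inord (id v)))))) | v <- iota i.+2 (M - i.+2)].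
  by apply/seq.eq_in_map => v; rewrite mem_iota => /andP[vi _]; rewrite swp_hi.
have okS s : all (@okb R Lm) [seq (false, mono (dlt (ix (inl (inord (id v)))))) | v <- s].
  by apply/allP => x /mapP[v _ ->]; exact: okm_f.
rewrite E1 E2 (pco_symm P) ?okS ?okm_f //= /skew_chi /= scaleN1r.
by [].
Qed.
End Model.

(** * Acyclicity and connectedness under insertion *)

Section Graphs.
Implicit Types (G H : graph) (h : nat -> nat) (u v w i j n : nat) (e : edge).

(** A rank that increases along arrows certifies acyclicity, and ranks of two graphs combine easily
    under insertion, unlike cycles. *)
Definition rankf c G h := forall e, e \in edges G -> (h (arrow c e).1 < h (arrow c e).2)%N.

Lemma rank_acyclic c G h : rankf c G h -> acyclic c G.
Proof.
move=> rh [|x p] // _ _; apply/negP => /= cy.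
have sb : subrel (step c G) (relpre h ltn).
  by move=> a b /hasP[e eG /eqP E]; have := rh e eG; rewrite E.
have tr : transitive (relpre h ltn) by move=> a b d /=; exact: ltn_trans.
have := order_path_min tr (sub_path sb cy).
by move=> /(@seq.allP _ _ _)/(_ x); rewrite mem_rcons inE eqxx => /(_ isT) /=; rewrite ltnn.
Qed.

Lemma arrow_below c N G e : vertices_below N G -> e \in edges G ->
  ((arrow c e).1 < N)%N /\ ((arrow c e).2 < N)%N.
Proof.
move=> vb eG; have /andP[e1 e2] := seq.allP vb e eG.
by rewrite /arrow; case: c; case: (e.2).
Qed.

Lemma acyclic_rank c N G : vertices_below N G -> acyclic c G ->
  exists2 h, rankf c G h & forall v, (h v <= N)%N.
Proof.
case: N => [|N] vb ac.
  exists (fun=> 0%N) => // e eG; by have [] := arrow_below c vb eG.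
pose E : rel 'I_N.+1 := fun a b => step c G a b.
(* The rank is the number of vertices that reach v. The head of an arrow is counted at itself but
   not at the tail, as it would otherwise lie on a cycle. *)
exists (fun v => #|[set x : 'I_N.+1 | connect E x (inord v)]%SET|); last first.
  by move=> v; have := max_card (mem [set x : 'I_N.+1 | connect E x (inord v)]%SET); rewrite card_ord.
move=> e eG; have [a1 a2] := arrow_below c vb eG.
set u := (arrow c e).1 in a1 *; set v := (arrow c e).2 in a2 *.
have uv : E (inord u) (inord v).
  by apply/hasP; exists e => //; rewrite !inordK // /u /v; case: (arrow c e) => ? ?; rewrite eqxx.
apply: proper_card; apply/properP; split.
  by apply/fintype.subsetP => x; rewrite !inE => xu; exact: connect_trans xu (connect1 uv).
exists (inord v); rewrite !inE ?connect0 //; apply/negP => /connectP[p pp lp].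
case: (shortenP pp) lp => p' pp' up' _ lp.
have : path.cycle (step c G) (map val (inord v :: p' : seq 'I_N.+1)).
  by rewrite cycle_map /= rcons_path pp' /= -lp.
by apply/negP/ac => //; rewrite map_inj_uniq //; exact: val_inj.
Qed.

Section Insert.
Context (M : nat) (c : M.-tuple 'I_2).
Local Notation I := (gci c).
Local Notation J := (gcj c).
Context (G G' : graph) (es : seq edge) (oc : ord0 \in c) (ees : es \in reattach I J (edges G)).
Context (vG : vertices_below (size J).+1 G) (vG' : vertices_below (size I) G').
Local Notation H := (seq_mset (es ++ relabel (nth 0%N I) G')).

Definition att e e' := [&& e'.1.1 \in attach I J e.1.1, e'.1.2 \in attach I J e.1.2 & e'.2 == e.2].

Lemma reattach_att (s t : seq edge) : t \in reattach I J s ->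
  [/\ size t = size s, forall e', e' \in t -> exists2 e, e \in s & att e e'
  & forall e, e \in s -> exists2 e', e' \in t & att e e'].
Proof.
elim: s t => [|e s IH] t /=; first by rewrite inE => /eqP->.
move=> /allpairsP[[x t'] /= [/allpairsP[[a b] /= [ua va ->]] tr ->]].
have [sz A B] := IH t' tr; split; first by rewrite /= sz.
  move=> e'; rewrite inE => /orP[/eqP->|/A[e0 e0s ae]]; last by exists e0; rewrite // inE e0s orbT.
  by exists e; rewrite ?inE ?eqxx // /att /= ua va eqxx.
move=> e0; rewrite inE => /orP[/eqP->|/B[e' es' ae]]; last by exists e'; rewrite // inE es' orbT.
by exists (a, b, e.2); rewrite ?inE ?eqxx // /att /= ua va eqxx.
Qed.

Let UIJ : uniq (I ++ J).
Proof. by rewrite (perm_uniq (gcij_perm c)) iota_uniq. Qed.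
Let UI : uniq I. Proof. by move: UIJ; rewrite cat_uniq => /and3P[]. Qed.
Let UJ : uniq J. Proof. by move: UIJ; rewrite cat_uniq => /and3P[]. Qed.

(** The contraction of the inserted block to vertex 0 of the outer graph. *)
Definition fib w := if w \in I then 0%N else (index w J).+1.

Lemma fib_attach w u : (u <= size J)%N -> w \in attach I J u -> fib w = u.
Proof.
rewrite /fib; case: u => [_|j jJ] /=; first by move=> ->.
rewrite inE => /eqP ->; rewrite index_uniq //; case: ifP => // jI.
by move: UIJ; rewrite cat_uniq => /and3P[_ /hasPn/(_ _ (mem_nth 0%N jJ))]; rewrite /= jI.
Qed.
Lemma attach_fib w : (w < M)%N -> w \in attach I J (fib w) /\ (fib w < (size J).+1)%N.
Proof.
have := perm_mem (gcij_perm c) w; rewrite mem_cat mem_iota add0n /= => <-.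
rewrite /fib; case: (boolP (w \in I)) => //= _ wJ.
by rewrite inE nth_index // ltnS index_mem.
Qed.

Lemma mem_edgesH e : (e \in edges H) = (e \in es) || (e \in relabel (nth 0%N I) G').
Proof. by rewrite (perm_mem (edges_mset _)) mem_cat. Qed.

Lemma att_arrow col e e' : e \in edges G -> att e e' ->
  fib (arrow col e').1 = (arrow col e).1 /\ fib (arrow col e').2 = (arrow col e).2.
Proof.
move=> eG /and3P[a1 a2 /eqP a3]; have /andP[e1 e2] := seq.allP vG e eG.
have [f1 f2] := (fib_attach e1 a1, fib_attach e2 a2).
by case: col; rewrite /arrow ?a3; case: (e.2).
Qed.

Lemma insert_acyclic col : acyclic col G -> acyclic col G' -> acyclic col H.
Proof.
move=> aG aG'; have [h rh _] := acyclic_rank vG aG; have [h' rh' bh'] := acyclic_rank vG' aG'.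
have [_ A _] := reattach_att ees.
pose k w := if w \in I then h' (index w I) else 0%N.
have kb w : (k w <= size I)%N by rewrite /k; case: ifP.
(* Lexicographic order of the outer and the inner rank; the factor [(size I).+1] exceeds every value
   of [k]. *)
apply: (@rank_acyclic _ _ (fun w => h (fib w) * (size I).+1 + k w)%N) => e.
rewrite mem_edgesH => /orP[/A[e0 e0G ae]|/mapP[e0 e0G' ->]].
  have [-> ->] := att_arrow col e0G ae; have lt := rh e0 e0G.
  have := leq_mul lt (leqnn (size I).+1); have := kb (arrow col e).1.
  by rewrite mulSn; move: (_ * _)%N (_ * _)%N (k _) (k _) => *; lia.
have lt := rh' e0 e0G'; have [l1 l2] := arrow_below col vG' e0G'.
have E : arrow col (nth 0%N I e0.1.1, nth 0%N I e0.1.2, e0.2) =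
  (nth 0%N I (arrow col e0).1, nth 0%N I (arrow col e0).2) by case: (col) => //=; case: ifP.
by rewrite E /fib /k /= !mem_nth // !index_uniq // ltn_add2l.
Qed.

Definition adj G : rel nat := fun i j => step Black G i j || step Black G j i.
Definition cn G u v := exists2 p, path (adj G) u p & last u p = v.

Lemma cn_trans G0 u v w : cn G0 u v -> cn G0 v w -> cn G0 u w.
Proof. by move=> [p pp <-] [q qq <-]; exists (p ++ q); rewrite ?cat_path ?pp ?last_cat. Qed.

(** A path in the outer graph lifts edge by edge to reattached edges; the ends of consecutive lifts
    lie in one fibre and are joined there, trivially or by a path in [G']. *)
Lemma insert_connected : graph_connected (size J).+1 G -> graph_connected (size I) G' -> graph_connected M H.
Proof.
move=> cG cG'; have [_ _ B] := reattach_att ees.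
have stepH G0 (phi : nat -> nat) x y : (forall e, e \in edges G0 -> (phi e.1.1, phi e.1.2, e.2) \in edges H) ->
    step Black G0 x y -> step Black H (phi x) (phi y).
  move=> sub /hasP[e eG0 /eqP[<- <-]]; apply/hasP; exists (phi e.1.1, phi e.1.2, e.2); [exact: sub|exact: eqxx].
have sub' e : e \in edges G' -> (nth 0%N I e.1.1, nth 0%N I e.1.2, e.2) \in edges H.
  by move=> eG'; rewrite mem_edgesH; apply/orP; right; apply/mapP; exists e.
have inI w z : w \in I -> z \in I -> cn H w z.
  move=> wI zI; have := cG' (index w I) (index z I); rewrite !index_mem => /(_ wI zI)[p pp lp].
  exists (map (nth 0%N I) p); last by rewrite -[w](nth_index 0%N wI) last_map lp nth_index.
  rewrite -[w](nth_index 0%N wI) path_map; apply: sub_path pp => x y.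
  by rewrite /adj /= => /orP[] /(stepH _ _ _ _ sub') ->; rewrite ?orbT.
have inF u w z : w \in attach I J u -> z \in attach I J u -> cn H w z.
  case: u => [|j] /=; first exact: inI.
  by rewrite !inE => /eqP-> /eqP->; exists [::].
have edg x y w z : adj G x y -> w \in attach I J x -> z \in attach I J y -> exists w' z',
    [/\ w' \in attach I J x, z' \in attach I J y & adj H w' z'].
  move=> + _ _; have S a b : step Black G a b -> exists w' z', [/\ w' \in attach I J a, z' \in attach I J b & step Black H w' z'].
    move=> /hasP[e eG /eqP[<- <-]]; have [e' e's /and3P[a1 a2 _]] := B e eG.
    exists e'.1.1, e'.1.2; split => //; apply/hasP; exists e'; last exact: eqxx.
    by rewrite mem_edgesH e's.
  move=> /orP[/S[w' [z' [a1 a2 s]]]|/S[w' [z' [a1 a2 s]]]]; [exists w', z'|exists z', w']; split => //; by rewrite /adj s ?orbT.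
have lift p x w z : path (adj G) x p -> all (fun y => y < (size J).+1)%N (x :: p) -> w \in attach I J x -> z \in attach I J (last x p) -> cn H w z.
  elim: p x w => [|y p IH] x w /=; first by move=> _ _; exact: inF.
  move=> /andP[xy pp] /and3P[xJ yJ pJ] wx zl.
  have [z0 z0y] : exists z0, z0 \in attach I J y.
    case: (y) yJ => [_|j _] /=; last by exists (nth 0%N J j); rewrite inE.
    by exists (nth 0%N I 0); rewrite mem_nth // size_gci.
  have [w' [z' [w'x z'y a]]] := edg _ _ _ _ xy wx z0y.
  apply: cn_trans (inF _ _ _ wx w'x) _; apply: (@cn_trans _ _ z'); first by exists [:: z'] => //=; rewrite a.
  by apply: IH pp _ z'y zl; rewrite /= yJ pJ.
move=> u v uM vM; have [ua uf] := attach_fib uM; have [va vf] := attach_fib vM.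
have [p pp lp] := cG _ _ uf vf.
apply: (lift p (fib u)) => //; last by rewrite lp.
rewrite /= uf /=; elim: p (fib u) pp {lp uf ua} => //= y p IH x /andP[xy /IH ->]; rewrite andbT.
by case/orP: xy => /hasP[e eG /eqP[E1 E2]]; have /andP[l1 l2] := seq.allP vG e eG; rewrite -?E1 -?E2.
Qed.
End Insert.
End Graphs.

(** * The graph complex *)

Section GC.
Context (R : realType).
Implicit Types (gamma : gchain R) (G : graph).

Definition gshape c d gamma := forall N G, gamma N G <> 0 ->
  [/\ (0 < N)%N, vertices_below N G, acyclic c G, graph_connected N G
  & 3 * (N%:Z - 1) - 2 * (size (edges G))%:Z = d].

Definition eqv N gamma (f : nat -> nat) (b : bool) :=
  forall G, gamma N (seq_mset (relabel f G)) = (-1) ^+ b * gamma N G.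

Lemma eqv_comp N gamma f g b b' : eqv N gamma f b -> eqv N gamma g b' -> eqv N gamma (f \o g) (b (+) b').
Proof.
move=> ef eg G; rewrite signr_addb -mulrA -eg -ef; congr gamma; rewrite relabel_mset; congr seq_mset.
by rewrite /rene /relabel -map_comp.
Qed.
Lemma eqv_ext N gamma f g b : f =1 g -> eqv N gamma f b -> eqv N gamma g b.
Proof. by move=> E ef G; rewrite -ef; congr (gamma _ (seq_mset _)); apply: eq_map => e; rewrite !E. Qed.

Definition tp i j n : nat := if n == i then j else if n == j then i else n.

Lemma eqv_tp N gamma i j : (forall i, (i.+1 < N)%N -> eqv N gamma (swp i) true) -> (i < j < N)%N ->
  eqv N gamma (tp i j) true.
Proof.
move=> sw /andP[]; elim: j => // j IH; rewrite ltnS leq_eqVlt => /orP[/eqP<- jN|ij jN].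
  by apply: eqv_ext (sw i jN) => n; rewrite /swp /tp.
have := eqv_comp (sw j jN) (eqv_comp (IH ij (ltnW jN)) (sw j jN)).
apply: eqv_ext => n; rewrite /swp /tp /=.
by repeat (case: eqP => //=; try lia).
Qed.

(** Every permutation is a product of transpositions, and each of these is a conjugate of an
    adjacent one; [gch] asks for adjacent ones, [gc] for all permutations. *)
Lemma eqv_perm N gamma (s : 'S_N) : (forall i, (i.+1 < N)%N -> eqv N gamma (swp i) true) ->
  eqv N gamma (perm_nat s) (odd_perm s).
Proof.
move=> sw; have [ts -> ats] := prod_tpermP s.
elim: ts ats => [|t ts IH] /= => [_|/andP[dt /IH{}IH]].
  rewrite big_nil odd_perm1 => G; rewrite expr0 mul1r -[in RHS](relabel_id G); congr (gamma _ (seq_mset _)).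
  by apply: eq_map => -[[a b] k] /=; rewrite /perm_nat; do 2![case: insubP => [? _ <-|_]; rewrite ?perm1].
rewrite big_cons odd_permM odd_tperm dt.
have T : eqv N gamma (perm_nat (tperm t.1 t.2)) true.
  have [lt|gt|e] := ltngtP (val t.1) (val t.2); last by move: dt; rewrite (val_inj e) eqxx.
    apply: eqv_ext (eqv_tp sw (i := val t.1) (j := val t.2) _); last by rewrite lt ltn_ord.
    move=> n; rewrite /perm_nat /tp; case: insubP => [x _ <-|nN].
      by rewrite permE /=; do 2![rewrite -val_eqE /=; case: eqP => //=].
    by do 2![case: eqP => [e|_]; first by move: nN; rewrite e ltn_ord].
  apply: eqv_ext (eqv_tp sw (i := val t.2) (j := val t.1) _); last by rewrite gt ltn_ord.
  move=> n; rewrite /perm_nat /tp; case: insubP => [x _ <-|nN].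
    rewrite tpermC permE /=; by do 2![rewrite -val_eqE /=; case: eqP => //=].
  by do 2![case: eqP => [e|_]; first by move: nN; rewrite e ltn_ord].
rewrite addbC; apply: eqv_ext (eqv_comp IH T) => n /=.
have V (p : 'S_N) (x : 'I_N) : perm_nat p (val x) = val (p x) by rewrite /perm_nat valK.
have O (p : 'S_N) k : (N <= k)%N -> perm_nat p k = k by rewrite /perm_nat => Nk; rewrite insubN // -leqNgt.
have [nN|Nn] := ltnP n N; last by rewrite !O.
by rewrite -[n]/(val (Ordinal nN)) !V permM.
Qed.

(** Degree and number of vertices fix the number [K] of edges, so only finitely many graphs are
    possible. *)
Lemma gshape_fin c d gamma N : gshape c d gamma -> finite_set [set G | gamma N G <> 0].
Proof.
move=> sh; case: N => [|N].
  by apply: (@sub_finite_set _ _ set0) => // G /= /sh[].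
pose K := (absz (3 * (N.+1%:Z - 1) - d)%R)./2.
pose F (t : K.-tuple ('I_N.+1 * 'I_N.+1 * bool)) : graph := seq_mset [seq (val x.1.1, val x.1.2, x.2) | x <- t].
apply: (@sub_finite_set _ _ (F @` setT)); last by apply: finite_image; exact: finite_finset.
move=> G /= /sh[_ vb _ _ dE].
have sE : size [seq (inord e.1.1 : 'I_N.+1, inord e.1.2 : 'I_N.+1, e.2) | e <- edges G] == K.
  have e : 3 * (N.+1%:Z - 1) - d = ((size (edges G)).*2)%:Z by rewrite -dE -addnn PoszD; ring.
  by rewrite size_map /K e absz_nat doubleK.
exists (Tuple sE) => //; rewrite /F /= -[RHS]seq_mset_id; congr seq_mset.
rewrite -map_comp -[RHS]map_id; apply/seq.eq_in_map => -[[a b] k] ab.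
by have /andP[/= l1 l2] := seq.allP vb _ ab; rewrite /= !inordK.
Qed.

Lemma gcP c d gamma : gc c d gamma <-> gshape c d gamma /\ gch (oddz d) gamma.
Proof.
split=> [[sh eq]|[sh g]]; split => //.
  split.
  - by move=> N; exact: gshape_fin sh.
  - by move=> N G /sh[].
  - by move=> N G /sh[_ _ _ _ <-]; rewrite /oddz; lia.
  - move=> N i G iN; have iN' : (i < N)%N by exact: ltnW.
    have := eq N (tperm (Ordinal iN') (Ordinal iN)) G; rewrite odd_tperm -val_eqE /= neq_ltn ltnSn /= expr1 mulN1r => <-.
    congr (gamma _ (seq_mset _)); apply: eq_map => -[[a b] k] /=.
    suff E n : swp i n = perm_nat (tperm (Ordinal iN') (Ordinal iN)) n by rewrite !E.
    rewrite /perm_nat /swp; case: insubP => [x _ <-|nN].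
      by rewrite permE /=; do 2![rewrite -val_eqE /=; case: eqP => //=].
    by do 2![case: eqP => [e|_]; first by move: nN; rewrite e ?iN ?iN'].
move=> N s G; apply: eqv_perm => i iN H; rewrite expr1 mulN1r; exact: gch_anti g _ _ _ iN.
Qed.

Lemma gcP1 c d gamma : gc c d gamma -> gch (oddz d) gamma.
Proof. by move/gcP => []. Qed.

(** Antisymmetry is not checked on graphs: in the model the operator of the product is an insertion
    of skew families, hence skew, and [arep_swap] reads antisymmetry off it. *)
Lemma gch_pre d d' gamma gamma' : gch d gamma -> gch d' gamma' -> gch (d (+) d') (gc_pre d' gamma gamma').
Proof.
move=> g g'; have [f b pr _] := g; have [f' b' pr' _] := g'.
have fin N := gc_pre_fin d' N f f'.
have bel N G : gc_pre d' gamma gamma' N G <> 0 -> vertices_below N G.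
  move=> /(gc_pre_supp f f')[c [G1 [G2 [es [oc n1 n2 ees ->]]]]].
  by apply: (insert_below _ _ ees); [exact: b|exact: b'].
split => //.
  move=> N G /(gc_pre_supp f f')[c [G1 [G2 [es [oc /pr n1 /pr' n2 _ _]]]]].
  by rewrite -(gcij_size c) oddD n2; move: n1; rewrite /= => /negbRL ->; case: (d); case: (d').
move=> [|N] i G iN //; apply: (@arep_swap R N (d (+) d')) => //.
have := pco_inskew (Lm_ok R N) (pco_arep (Lm_ok R N) (model R N) g) (pco_arep (Lm_ok R N) (model R N) g').
exact: (pco_feq (Lm_ok R N) (arep_insertion (Lm_ok R N) (model R N) g g')).
Qed.

Lemma gchP d (a : R) gamma gamma' : gch d gamma -> gch d gamma' -> gch d (a *: gamma + gamma').
Proof.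
move=> [f b p s] [f' b' p' s'].
have E N G : (a *: gamma + gamma') N G = a * gamma N G + gamma' N G by [].
have nz N G : (a *: gamma + gamma') N G <> 0 -> gamma N G <> 0 \/ gamma' N G <> 0.
  by rewrite E => n; have [e|] := pselect (gamma N G = 0); [right => e'; apply: n; rewrite e e' mulr0 addr0|left].
split.
- move=> N; apply: (@sub_finite_set _ _ ([set G | gamma N G <> 0] `|` [set G | gamma' N G <> 0])).
    by move=> G /= /nz.
  by rewrite finite_setU.
- by move=> N G /nz[/b|/b'].
- by move=> N G /nz[/p|/p'].
- by move=> N i G iN; rewrite !E s // s' // mulrN opprD.
Qed.

Lemma gshapeP c d (a : R) gamma gamma' : gshape c d gamma -> gshape c d gamma' -> gshape c d (a *: gamma + gamma').
Proof.
move=> s s' N G; rewrite -[(_ + _) N G]/(a * gamma N G + gamma' N G) => n.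
by have [e|/s] := pselect (gamma N G = 0); last by []; apply: s' => e'; apply: n; rewrite e e' mulr0 addr0.
Qed.

Lemma gc_lin c d (a : R) gamma gamma' : gc c d gamma -> gc c d gamma' -> gc c d (a *: gamma + gamma').
Proof. by move=> /gcP[s g] /gcP[s' g']; apply/gcP; split; [exact: gshapeP|exact: gchP]. Qed.

Lemma gc0 c d : gc c d (0 : gchain R).
Proof. by split=> [N G []|N s G]; rewrite ?mulr0. Qed.

Lemma gc_pre_gc c d d' gamma gamma' : gc c d gamma -> gc c d' gamma' ->
  gc c (d + d') (gc_pre (oddz d') gamma gamma').
Proof.
move=> /gcP[s g] /gcP[s' g']; apply/gcP; rewrite oddzD; split; last exact: gch_pre.
move=> N G /(gc_pre_supp (gch_fin g) (gch_fin g'))[c0 [G1 [G2 [es [oc /s[_ v1 a1 c1 d1] /s'[_ v2 a2 c2 d2] ees ->]]]]].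
have [sz _ _] := reattach_att ees; have szI := gcij_size c0.
split.
- by have := size_gci oc; lia.
- exact: (insert_below v1 v2 ees).
- first [exact: (insert_acyclic ees v1 v2 a1 a2)|exact: (insert_acyclic oc ees v1 v2 a1 a2)].
- first [exact: (insert_connected oc ees v1 c1 c2)|exact: (insert_connected oc ees v1 v2 c1 c2)].
- rewrite (perm_size (edges_mset _)) size_cat size_map -[size (enum_mset _)]/(size (edges G2)) sz -[size (enum_mset _)]/(size (edges G1)).
  by rewrite -d1 -d2; lia.
Qed.

Lemma gc_br_gc c d d' gamma gamma' : gc c d gamma -> gc c d' gamma' ->
  gc c (d + d') (gc_br (oddz d) (oddz d') gamma gamma').
Proof.
move=> g g'; have -> : gc_br (oddz d) (oddz d') gamma gamma' =
    - (-1) ^+ (oddz d && oddz d') *: gc_pre (oddz d) gamma' gamma + gc_pre (oddz d') gamma gamma'.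
  by rewrite /gc_br addrC scaleNr.
by apply: gc_lin; [rewrite addrC|]; exact: gc_pre_gc.
Qed.
End GC.

(** * Preservation of the vanishing ideals *)

Section Ideal.
Context (R : realType) (m r : nat) (U : set 'rV[R]_m) (Uo : open U).
Local Notation gf := (gfun R m r).
Local Notation smg := (@smooth_gfun R m r U).
Local Notation Ls := (@Lsm R m r U).
Implicit Types (f g : gf) (z : bool).

(** [z = true] selects the zeta, which vanish on E[1]; [z = false] selects the xi, which vanish on
    the dual. Accordingly [~~ z] selects the odd directions along the subbundle. *)
Definition zv z (a : 'I_r) : 'I_(r + r) := if z then rshift r a else lshift r a.
Definition ideal z f : Prop := smg f /\
  forall S : {set 'I_(r + r)}, (forall a : 'I_r, zv z a \notin S) -> f ([ffun=> 0%N], S) = 0.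

Lemma ideal_smg z f : ideal z f -> smg f. Proof. by case. Qed.
Lemma ideal0 z : ideal z 0. Proof. by split=> //; exact: smg0. Qed.
Lemma idealP z (a : R) f g : ideal z f -> ideal z g -> ideal z (a *: f + g).
Proof.
move=> [sf vf] [sg vg]; split; first exact: smgP.
by move=> S h; rewrite -[LHS]/(a *: f _ + g _) vf // vg // scaler0 addr0.
Qed.
Lemma ideal_sum z (I : eqType) (t : seq I) (F : I -> gf) : (forall i : I, i \in t -> ideal z (F i)) -> ideal z (\sum_(i <- t) F i).
Proof.
elim: t => [|i t IH] hF; rewrite ?big_nil ?big_cons; first exact: ideal0.
rewrite -[F i]scale1r; apply: idealP; first by apply: hF; rewrite inE eqxx.
by apply: IH => j jt; apply: hF; rewrite inE jt orbT.
Qed.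
Lemma ideal_parity z b f : ideal z f -> ideal z (parity_part b f).
Proof. by move=> [sf vf]; split; [exact: smg_parity|move=> S h; rewrite /parity_part vf //; case: ifP]. Qed.
Lemma ideal_smF z b f : ideal z f -> ideal z (smF b f).
Proof.
case: b => // -[sf vf]; split; first exact: (smg_smF false sf).
by move=> S h; rewrite /smF /par_inv vf // scaler0.
Qed.
Lemma ideal_d_x z mu f : ideal z f -> ideal z (d_x U mu f).
Proof. by move=> [sf vf]; split; [exact: smg_d_x|move=> S h; rewrite /d_x vf //; exact: partial0]. Qed.
Lemma ideal_d_theta z a f : ideal z f -> ideal z (d_theta (zv (~~ z) a) f).
Proof.
move=> [sf vf]; split; first exact: smg_d_theta.
move=> S h; rewrite /d_theta /=; case: ifP => // _; rewrite vf ?scaler0 // => b.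
rewrite in_setU1 negb_or h andbT /zv; by case: (z); rewrite /= ?eq_lrshift ?eq_rlshift.
Qed.
Lemma ideal_gmul z f g : ideal z f \/ ideal z g -> smg f -> smg g -> ideal z (gmul f g).
Proof.
move=> H sf sg; split; first exact: smg_gmul.
move=> S h; apply/funext => x; rewrite /gmul big1 // => b /forallP/= b0; rewrite big1 // => T /= TS.
have z0 (c : 'I_m -> nat) : (forall i, c i = 0%N) -> [ffun i => c i] = [ffun=> 0%N] :> {ffun 'I_m -> nat}.
  by move=> c0; apply/ffunP => i; rewrite !ffunE.
have bz i : (b i : nat) = 0%N by have := b0 i; rewrite ffunE leqn0 => /eqP.
case: H => -[_ vf].
  rewrite (z0 (fun i => b i)) // vf ?mulr0 ?mul0r // => a; apply: contra (h a); exact: (fintype.subsetP TS).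
rewrite (z0 (fun i => (_ - b i)%N)) ?vf ?mulr0 // => [a|i]; last by rewrite ffunE.
by rewrite inE negb_and h orbT.
Qed.

Definition colz (c : colour) := if c is Black then true else false.

Lemma ideal_at z b s k i v (t : seq gf) : (i < size t)%N -> (v < size t)%N ->
  (v = i -> forall f, ideal z f -> ideal z (@smD R m r U b s k f)) ->
  ideal z (nth 0 t v) -> ideal z (nth 0 (at_ i (smF b) (@smD R m r U b s k) t) v).
Proof.
move=> it vt H I; rewrite nth_at //; case: eqP => [e|_]; first by apply: H => //; rewrite -e.
by case: ifP => // _; exact: ideal_smF.
Qed.

Lemma ideal_mu z v (t : seq gf) : (v < size t)%N -> (forall f, f \in t -> smg f) ->
  ideal z (nth 0 t v) -> ideal z (mu_prod t).
Proof.
case: t => // f t; rewrite /mu_prod; elim: t f v => [|g t IH] f v /=; first by case: v.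
move=> vt H I; have sf : smg f by apply: H; rewrite inE eqxx.
have sg : smg g by apply: H; rewrite !inE eqxx orbT.
have H' x : x \in gmul f g :: t -> smg x.
  by rewrite inE => /orP[/eqP->|xt]; [exact: smg_gmul|apply: H; rewrite !inE xt !orbT].
case: v vt I => [|[|v]] vt I.
- by apply: (IH _ 0%N) => //=; apply: ideal_gmul => //; left.
- by apply: (IH _ 0%N) => //=; apply: ideal_gmul => //; right.
- by apply: (IH _ v.+1).
Qed.

(** At a vertex that no arrow of colour [c] enters, only d_x and d_xi act for black, only d_x and
    d_zeta for red, because the red arrow of an opposite edge starts at its black head. These are
    tangent to the subbundle, so the factor at [v] stays in the ideal, and so does the product. *)
Lemma ideal_rep_edges c es v (t : seq gf) : (v < size t)%N -> all (below (iota 0 (size t))) es ->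
  (forall e, e \in es -> (arrow c e).2 != v) -> (forall f, f \in t -> smg f) ->
  ideal (colz c) (nth 0 t v) -> ideal (colz c) (rep_edges U es t).
Proof.
elim: es t => [|[[i j] b] es IH] t vt; first by move=> _ _; exact: ideal_mu.
rewrite [all _ _]/= {1}/below /= !mem_iota !add0n /= => /andP[/andP[hi hj] bes] ne st I.
rewrite -/(rep_edges U ((i, j, b) :: es) _) rep_edges_cons //; apply: ideal_sum => k _.
have nv := ne (i, j, b) (mem_head _ _).
have H1 : v = j -> forall f, ideal (colz c) f -> ideal (colz c) (@smD R m r U b false k f).
  move=> e f If; move: nv; rewrite e; case: c {IH ne I} If => /=; first by rewrite eqxx.
  by case: b k => k If; [rewrite /= eqxx|move=> _; exact: (@ideal_d_theta false k f If)].
have H2 : v = i -> forall f, ideal (colz c) f -> ideal (colz c) (@smD R m r U b true k f).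
  move=> e f If; move: nv; rewrite e; case: c {IH ne I H1} If => /=.
    by case: b k => k If _; [exact: ideal_d_x|exact: (@ideal_d_theta true k f If)].
  by case: b k => k If; [move=> _; exact: ideal_d_x|rewrite /= eqxx].
have s1 := @in_smg_at R m r U b false k j t hj st.
have z1 : size (at_ j (smF b) (@smD R m r U b false k) t) = size t by exact: size_at.
have hi1 : (i < size (at_ j (smF b) (@smD R m r U b false k) t))%N by rewrite z1.
have z2 : size (at_ i (smF b) (@smD R m r U b true k) (at_ j (smF b) (@smD R m r U b false k) t)) = size t by rewrite size_at.
apply: IH; rewrite ?z2 //.
- by move=> e ees; apply: ne; rewrite inE ees orbT.
- exact: (@in_smg_at R m r U b true k i _ hi1 s1).
- by apply: ideal_at => //; rewrite ?z1 //; exact: ideal_at.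
Qed.

(** A vertex of minimal rank has no predecessor. *)
Lemma source c N G : (0 < N)%N -> vertices_below N G -> acyclic c G ->
  exists2 v, (v < N)%N & forall e, e \in edges G -> (arrow c e).2 != v.
Proof.
case: N => // N _ vb ac; have [h rh _] := acyclic_rank vb ac.
case: (arg_minnP (fun x : 'I_N.+1 => h x) (i0 := ord0) (P := xpredT) isT) => x _ mn.
exists x => // e eG; apply/eqP => E; have := rh e eG; have [a1 _] := arrow_below c vb eG.
by have := mn (Ordinal a1) isT; rewrite /= E leqNgt => /negP.
Qed.

Lemma ideal_rep c d gamma (s : seq gf) : gc c d gamma -> s <> [::] ->
  (forall f, f \in s -> ideal (colz c) f) -> ideal (colz c) (rep U gamma s).
Proof.
move=> g s0 si; have [sh gg] := (gcP _ _ _).1 g.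
have -> := @repE R m r U gamma s (gch_fin gg _).
apply: ideal_sum => G /(mem_gsp (gch_fin gg _))/sh[N0 vb ac _ _].
have [v vN ne] := source N0 vb ac.
rewrite -[_ *: _]addr0; apply: idealP; last exact: ideal0.
apply: (ideal_rep_edges vN (vb_below vb) ne); first by move=> f /si/ideal_smg.
by apply: si; exact: mem_nth.
Qed.

Section Algebra.
Variable c : colour.
Local Notation A := (ideal (colz c)).
Local Notation L := (shifted_algebra U A).

Lemma LA_ok : glieok L.
Proof. by apply: glie_ok_shifted; [exact: ideal0|exact: idealP|move=> b f; exact: ideal_parity]. Qed.

Definition hp_ k f : gf := fun q => if mdegree q == k then f q else 0.
Lemma ideal_hp k f : A f -> A (hp_ k f).
Proof.
move=> [[sf [n nf]] vf]; split.
  split; first by move=> q; rewrite /hp_; case: ifP => // _; exact: smooth0.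
  by exists n => q nq; rewrite /hp_ nf //; case: ifP.
by move=> S h; rewrite /hp_ vf //; case: ifP.
Qed.
Lemma mdegree_odd (q : monom m r) : odd (mdegree q) = odd #|q.2|.
Proof. by rewrite /mdegree oddD oddM. Qed.

Lemma LA_deg : glie_deg_ok L.
Proof.
split.
- by move=> d q [].
- move=> d a u v hu hv; have H := @homP R m r a (d + 2) u v; exact: H.
- move=> d u hu; apply/funext => q; rewrite /= /parity_part; case: eqP => // ne.
  apply: contrapT => e; apply: ne; have := hu q (nesym e); have := mdegree_odd q.
  rewrite /oddz; move: (mdegree q) => k; lia.
- move=> p u Au pu; have [_ [n nu]] := Au.1.
  (* A function has bounded degree, so finitely many homogeneous components suffice; the shift by 2
     is that of A[2]. *)
  exists [seq (k%:Z - 2, hp_ k u : L) | k <- iota 0 n.+1 & odd k == p].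
    move=> x /mapP[k]; rewrite seq.mem_filter => /andP[/eqP kp _] -> /=; split; first exact: ideal_hp.
      by move=> q; rewrite /hp_; case: eqP => [-> _|_ []] //; rewrite subrK.
    by rewrite -kp /oddz; lia.
  apply/funext => q; rewrite big_map big_filter.
  have evS (I : Type) (s : seq I) (P : pred I) (F : I -> gf) : (\sum_(i <- s | P i) F i) q = \sum_(i <- s | P i) F i q.
    by elim: s => [|i s IH]; rewrite ?big_nil // !big_cons -IH; case: ifP.
  rewrite evS; transitivity (\sum_(k <- iota 0 n.+1 | odd k == p) hp_ k u q); last by [].
  have [e|/eqP ne] := eqVneq (u q) 0.
    by rewrite e big1 // => k _; rewrite /hp_ e; case: ifP.
  have le : (mdegree q < n.+1)%N by rewrite ltnS leqNgt; apply/negP => /nu.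
  have od : odd (mdegree q) == p.
    rewrite mdegree_odd; apply/negPn/negP => np; apply: ne.
    by rewrite -pu /= /parity_part (negbTE np).
  rewrite big_mkcond (bigD1_seq (mdegree q)) ?iota_uniq ?mem_iota // od {1}/hp_ eqxx big1 => [|k kq]; first exact/esym/addr0.
  by rewrite /hp_ [mdegree q == k]eq_sym (negbTE kq); case: ifP.
Qed.

Lemma in_sub_sm (s : seq gf) : @in_sub R L s -> @in_sub R Ls s.
Proof. by move=> H f fs; exact: ideal_smg (H f fs). Qed.
Lemma feq_sm (P Q : seq gf -> gf) : @feq R Ls P Q -> @feq R L P Q.
Proof. by move=> E s s0 /in_sub_sm; exact: E. Qed.
Lemma okb_smA x : @okb R L x -> @okb R Ls x.
Proof. by move=> /asboolP[a b]; apply/asboolP; split => //; exact: ideal_smg a. Qed.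
Lemma all_okb_smA (h : seq (bool * gf)) : all (@okb R L) h -> all (@okb R Ls) h.
Proof. by move=> /(@seq.allP _ _ _) H; apply/seq.allP => x /H; exact: okb_smA. Qed.

(** Everything but closedness restricts from all smooth functions to the subalgebra; closedness is
    [ideal_rep]. *)
Lemma pco_rep_A d gamma : gc c d gamma -> @pco R L skew_chi (oddz d) (rep U gamma).
Proof.
move=> g; have [cP mP sP rP] := @pco_rep R m r U Uo _ _ (gcP1 g); split.
- by move=> s s0 ss; exact: ideal_rep g s0 ss.
- by move=> s1 s2 a u v i1 i2 su sv; apply: mP; [exact: in_sub_sm|exact: in_sub_sm|exact: ideal_smg su|exact: ideal_smg sv].
- move=> h1 h2 x y p1 p2 ox oy; apply: sP; [exact: all_okb_smA|exact: all_okb_smA|exact: okb_smA|exact: okb_smA].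
- by move=> h h0 oh; apply: rP => //; exact: all_okb_smA.
Qed.

Lemma cochain_rep d gamma : gc c d gamma -> @cochain R L d (rep U gamma).
Proof.
move=> g; apply/(cochainE LA_ok LA_deg); split; first exact: pco_rep_A.
move=> t t0 /(@seq.allP _ _ _) gt; have [sh gg] := (gcP _ _ _).1 g.
have hG x : x \in t -> @hom R m r (x.1 + 2) x.2 by move=> /gt/asboolP[_ hx]; exact: hx.
have -> := @repE R m r U gamma [seq x.2 | x <- t] (gch_fin gg _); rewrite size_map.
suff H : @hom R m r (\sum_(x <- t) x.1 + d + 1 - (size t)%:Z + 2) (\sum_(G <- gsp gamma (size t)) gamma (size t) G *: rep_edges U (edges G) [seq x.2 | x <- t]) by exact: H.
elim: (gsp _ _) (@mem_gsp R gamma (size t) ^~ (gch_fin gg (size t))) => [|G l IH] H; first by rewrite big_nil; exact: hom0.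
rewrite big_cons; apply: homP; last by apply: IH => G' G'l; apply: H; rewrite inE G'l orbT.
have [_ vb _ _ dE] := sh _ _ (H G (mem_head _ _)).
have hs : homs [seq x.1 + 2 | x <- t] [seq x.2 | x <- t].
  split; first by rewrite !size_map.
  move=> k; rewrite size_map => kt; rewrite !(nth_map (0, 0)) //; apply: hG; exact: mem_nth.
have t0' : [seq x.2 | x <- t] <> [::] by case: (t) t0.
have vb' : all (below (iota 0 (size [seq x.2 | x <- t]))) (edges G) by rewrite size_map; exact: vb_below.
have := @hom_rep_edges R m r U (edges G) _ [seq x.2 | x <- t] t0' vb' hs.
have -> : \sum_(e <- [seq x.1 + 2 | x <- t]) e - 2 * (size (edges G))%:Z = \sum_(x <- t) x.1 + d + 1 - (size t)%:Z + 2.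
  have E : \sum_(e <- [seq x.1 + 2 | x <- t]) e = \sum_(x <- t) x.1 + (size t)%:Z * 2 :> int.
    elim: (t) => [|x t' IHt]; first by rewrite !big_nil mul0r.
    by rewrite /= !big_cons IHt [(size t').+1%:Z]intS; ring.
  rewrite E -dE; ring.
by [].
Qed.
End Algebra.

Lemma par_inv_d_theta i f : par_inv (d_theta i f) = - d_theta i (par_inv f).
Proof.
apply/funext => q; rewrite -[RHS]/(- d_theta i (par_inv f) q) /par_inv /d_theta.
case: ifP => [_|iq]; first by rewrite scaler0 oppr0.
by rewrite /= cardsU1 iq exprS mulN1r scaleNr scalerN opprK !scalerA mulrC.
Qed.

Lemma seq_mset1 (e : edge) : seq_mset [:: e] = [mset e]%mset.
Proof. by apply/msetP => a; rewrite mset_seqE msetnE /= addn0 eq_sym; case: eqP. Qed.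
Lemma edges1 (e : edge) : edges [mset e]%mset = [:: e].
Proof. by apply: perm_small_eq => //; rewrite -seq_mset1; exact: edges_mset. Qed.
Lemma mset1_eq (a b : edge) : ([mset a]%mset == [mset b]%mset :> graph) = (a == b).
Proof.
apply/eqP/eqP => [E|->] //; have := congr1 edges E.
by rewrite !edges1 => -[].
Qed.

Lemma upsilonE N G : upsilon R N G = if N == 2 then
  ((G == [mset (0%N, 1%N, true)]%mset)%:R - (G == [mset (1%N, 0%N, true)]%mset)%:R)
  + ((G == [mset (0%N, 1%N, false)]%mset)%:R - (G == [mset (1%N, 0%N, false)]%mset)%:R) else 0.
Proof. by rewrite /upsilon; case: eqP => // _; rewrite big_bool. Qed.

Lemma gmulN f g : gmul (- f) g = - gmul f g.
Proof.
have := gmulPl (-1) f 0 g; rewrite scaleN1r addr0 => ->; rewrite scaleN1r.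
suff -> : gmul 0 g = 0 by rewrite addr0.
by apply/funext => q; apply/funext => x; rewrite gmulE /conv big1 // => p _; rewrite mulr0 mul0r.
Qed.

(** Upsilon consists of four graphs: the two orientations of each edge type are the two terms in
    each sum of the big bracket. *)
Lemma rep_upsilon (X : set gf) (s : seq gf) : rep U (upsilon R) s = @br_family R (shifted_algebra U X) s.
Proof.
have [s2|ns] := eqVneq (size s) 2; last first.
  rewrite /rep (fs_seq (r := [::])) ?big_nil //; last by move=> G _; rewrite upsilonE (negbTE ns) scale0r.
  by case: s ns => [|a [|b [|? ?]]].
case: s s2 => [|u [|v [|? ?]]] // _.
pose e1 : edge := (0%N, 1%N, true); pose e2 : edge := (1%N, 0%N, true).
pose e3 : edge := (0%N, 1%N, false); pose e4 : edge := (1%N, 0%N, false).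
rewrite /rep (fs_seq (r := [:: [mset e1]; [mset e2]; [mset e3]; [mset e4]]%mset)).
- rewrite !big_cons big_nil !upsilonE !mset1_eq /= !edges1 /= !subr0 !sub0r !addr0 !add0r !scale1r !scaleN1r.
  rewrite /big_bracket sumrB big_split /= !addrA; apply: (congr2 (fun a b : gf => a + b)); first by [].
  (* The coefficient -1 of the odd edge from 1 to 0 cancels against the sign of moving the parity
     involution past d_zeta. *)
  rewrite -sumrN; apply: eq_bigr => a _; by rewrite /odd_at /mu_prod /= /d_zeta par_inv_d_theta gmulN opprK.
- by rewrite /= !inE !mset1_eq.
- move=> G; rewrite !inE !negb_or => /and4P[n1 n2 n3 n4].
  by rewrite upsilonE (negbTE n1) (negbTE n2) (negbTE n3) (negbTE n4) subrr addr0 scale0r.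
Qed.

Lemma gc_upsilon c : gc c 1 (upsilon R).
Proof.
have nz N G : upsilon R N G <> 0 -> N = 2%N /\ exists2 e : edge, G = [mset e]%mset & e.1 = (0%N, 1%N) \/ e.1 = (1%N, 0%N).
  rewrite upsilonE; case: eqP => // -> H; split => //; apply: contrapT => ne; apply: H.
  have n e : (e.1 = (0%N, 1%N) \/ e.1 = (1%N, 0%N)) -> (G == [mset e]%mset) = false.
    by move=> he; apply/eqP => E; apply: ne; exists e.
  by rewrite !n ?subrr ?addr0 //=; auto.
have one := edges1.
apply/gcP; split; last split.
- move=> N G /nz[-> [e -> he]]; rewrite /vertices_below one; split => //.
  + by rewrite /= andbT; case: he => ->.
  + apply: (@rank_acyclic _ _ (fun w => (w == (arrow c e).2 : nat))) => e'; rewrite one inE => /eqP->.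
    by rewrite eqxx; case: c => /=; case: e he => [[i j] b] /= [[-> ->]|[-> ->]]; case: b.
  + have st : step Black [mset e]%mset e.1.1 e.1.2 by apply/hasP; exists e; rewrite ?one ?inE //= eqxx.
    move=> a b; case: a => [|[|a]] //; case: b => [|[|b]] // _ _; try (by exists [::]).
      by exists [:: 1%N] => //=; case: he st => -> /= ->; rewrite ?orbT.
    by exists [:: 0%N] => //=; case: he st => -> /= ->; rewrite ?orbT.
- move=> N; apply: (@sub_finite_set _ _ [set` [:: [mset (0%N, 1%N, true)]; [mset (1%N, 0%N, true)]; [mset (0%N, 1%N, false)]; [mset (1%N, 0%N, false)]]%mset : seq graph]).
    move=> G /= /nz[_ [[[i j] b] -> [[-> ->]|[-> ->]]]]; rewrite !inE !mset1_eq; by case: b.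
  exact: finite_seq.
- by move=> N G /nz[-> [e -> he]]; rewrite /vertices_below one /= andbT; case: he => ->.
- by move=> N G /nz[-> _].
- move=> N [|i] G iN; rewrite !upsilonE; case: eqP => [N2|_]; rewrite ?oppr0 //; last by move: iN; rewrite N2.
  have E (e : edge) : (seq_mset (relabel (swp 0) G) == [mset e]%mset) = (G == [mset (swp 0 e.1.1, swp 0 e.1.2, e.2)]%mset).
    have seq1 := seq_mset1.
    apply/eqP/eqP => [H|->]; last by rewrite -seq1 relabel_mset /rene /= !swpK -seq1; case: e => [[]].
    by rewrite -(relabelK 0 G) H -!seq1 relabel_mset.
  rewrite !E /= /swp /= opprD.
  by congr (_ + _); rewrite opprB.
Qed.
End Ideal.

(** * Chain identities read off from the model *)

Section ChainBracket.
Context (R : realType) (L : glie R) (Lok : glieok L) (A : galg L).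
Implicit Types (gamma : gchain R).

Lemma arep_lin d (a : R) gamma gamma' : gch d gamma -> gch d gamma' ->
  feq (arep A (a *: gamma + gamma')) (a *: arep A gamma + arep A gamma').
Proof.
move=> g g'; have gg := gchP a g g'; have [f _ _ _] := g; have [f' _ _ _] := g'; have [ff _ _ _] := gg.
apply: (feq_ok Lok); first exact: pcoM (pco_arep Lok A gg).
  exact: pcoM (pcoP Lok a (pco_arep Lok A g) (pco_arep Lok A g')).
move=> h h0 oh; rewrite !famE !(arep_us Lok) //; set N := size h.
pose l := undup (gsp gamma N ++ gsp gamma' N).
have z (k : gchain R) : (forall N, finite_set [set G | k N G <> 0]) -> {subset gsp k N <= l} -> forall G, G \notin l -> k N G = 0.
  by move=> fk sb G Gl; apply: (gspP (fk N)); apply: contra Gl; exact: sb.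
have s1 : {subset gsp gamma N <= l} by move=> G; rewrite mem_undup mem_cat => ->.
have s2 : {subset gsp gamma' N <= l} by move=> G; rewrite mem_undup mem_cat => ->; rewrite orbT.
have E (k : gchain R) : (forall G, G \notin l -> k N G = 0) -> hrep A k h = \sum_(G <- l) k N G *: nrep A (edges G) (nm h).
  by move=> zk; apply: fs_seq; rewrite ?undup_uniq // => G /zk ->; rewrite scale0r.
rewrite !E; [|exact: (z _ f' s2)|exact: (z _ f s1)|]; last first.
  by move=> G Gl; rewrite -[LHS]/(a * gamma N G + gamma' N G) (z _ f s1) // (z _ f' s2) // mulr0 addr0.
rewrite scaler_sumr -big_split; apply: eq_bigr => G _ /=.
by rewrite -[(_ + _) N G]/(a * gamma N G + gamma' N G) scalerDl scalerA.
Qed.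

Lemma gch_br d d' gamma gamma' : gch d gamma -> gch d' gamma' -> gch (d (+) d') (gc_br d d' gamma gamma').
Proof.
move=> g g'; have -> : gc_br d d' gamma gamma' =
    - (-1) ^+ (d && d') *: gc_pre d gamma' gamma + gc_pre d' gamma gamma'.
  by rewrite /gc_br addrC scaleNr.
by apply: gchP; [rewrite addbC|]; exact: gch_pre.
Qed.

Lemma arep_br d d' gamma gamma' : gch d gamma -> gch d' gamma' ->
  feq (nr_br d d' (arep A gamma) (arep A gamma')) (arep A (gc_br d d' gamma gamma')).
Proof.
move=> g g'; have -> : gc_br d d' gamma gamma' =
    - (-1) ^+ (d && d') *: gc_pre d gamma' gamma + gc_pre d' gamma gamma'.
  by rewrite /gc_br addrC scaleNr.
have p1 := gch_pre g g'; have p2 : gch (d (+) d') (gc_pre d gamma' gamma) by rewrite addbC; exact: gch_pre.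
apply: feqT (feqS (arep_lin _ p2 p1)) => s s0 ss.
rewrite /nr_br !famE (arep_insertion Lok A g g') // (arep_insertion Lok A g' g) //.
by rewrite scaleNr addrC.
Qed.

(** Inserting [D] into [P] scales either argument and gives 2a P(u, v); inserting [P] into [D] gives
    a P(u, v) once. *)
Lemma nr_unary P D (a : R) (u v : L) : pco skew_chi true P -> pco skew_chi false D ->
  (forall w : L, gsub w -> D [:: w] = a *: w) -> (forall w : L, gsub w -> P [:: w] = 0) ->
  @okb R L (false, u) -> @okb R L (false, v) -> nr_br true false P D [:: u; v] = a *: P [:: u; v].
Proof.
move=> pP pD D1 P1 ou ov; have gu := okb_sub ou; have gv := okb_sub ov; rewrite /= in gu gv.
have oh : all (@okb R L) [:: (false, u); (false, v)] by rewrite /= ou ov.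
have iuv : in_sub [:: u; v] := ok_in oh.
have E1 := ins_us Lok skew_chi false (pcoM pP) (pcoM pD) (pcoC pD) oh.
have E2 := ins_us Lok skew_chi true (pcoM pD) (pcoM pP) (pcoC pP) oh.
have sw : P [:: v; u] = - P [:: u; v].
  by have := pco_symm pP (h1 := [::]) (h2 := [::]) isT isT ov ou; rewrite /skew_chi /= scaleN1r.
have iu : in_sub [:: u] by apply/in_subc. have iv : in_sub [:: v] by apply/in_subc.
have i0 : in_sub ([::] : seq L) by [].
have PZ w w' : in_sub [:: w'] -> gsub w -> P [:: a *: w; w'] = a *: P [:: w; w'].
  move=> iw gw; have := pcoM pP a (s1 := [::]) (s2 := [:: w']) i0 iw gw (gok0 Lok).
  by rewrite addr0 /= (mult0 Lok (s1 := [::]) (pcoM pP) i0 iw) addr0.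
have D0 w : in_sub [:: w] -> D [:: 0; w] = 0 by move=> iw; exact: (mult0 Lok (s1 := [::]) (pcoM pD) i0 iw).
rewrite /nr_br !famE -[[:: u; v]]/(us [:: (false, u); (false, v)]) E1 E2 /insh /= ?famE.
have gD : gsub (D [:: u; v]) by apply: (pcoC pD).
have gP : gsub (P [:: u; v]) by apply: (pcoC pP).
rewrite (P1 _ gD) (D1 _ gP).
rewrite !P1 // !D1 // !D0 // !PZ // sw.
rewrite !(scaler0, addr0, add0r, scale1r, expr0, scalerN, opprK, expr1, scaleN1r, oppr0).
by rewrite addrK.
Qed.

Lemma nr_closed P D D' : pco skew_chi true P -> pco skew_chi false D -> pco skew_chi false D' ->
  feq (@nr_br R L true false P D) 0 -> feq (@nr_br R L true false P D') 0 ->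
  feq (nr_br true false P (nr_br false false D D')) 0.
Proof.
move=> gP gD gD' E E' s s0 ss; have := nr_jacobi Lok gP gD gD' s0 ss.
rewrite /= scale1r famE => e; rewrite [LHS]e.
have p1 := pco_nr Lok gP gD; have p2 := pco_nr Lok gP gD'.
rewrite (nr_feq0 Lok gD p2 E' s0 ss) addr0 nr_anti !famE (nr_feq0 Lok gD' p1 E s0 ss).
by rewrite scaler0 oppr0.
Qed.
End ChainBracket.

Section ChainLevel.
Context (R : realType).
Implicit Types (gamma : gchain R).
Local Notation ups := (upsilon R).
Local Notation Lm := (Lm R).
Local Notation okm' N := (Lm_ok R N).

Lemma gch_ups : gch true ups. Proof. exact: (gcP1 (gc_upsilon R Black)). Qed.

Lemma gch0 d : gch d (0 : gchain R).
Proof. by split=> [N|N G []|N G []|N i G _] //; [rewrite (_ : [set _ | _] = set0) //; apply/seteqP; split => // G []|rewrite oppr0]. Qed.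

Lemma cocycle_arep N gamma : gch false gamma -> gc_diff false gamma = 0 ->
  feq (nr_br true false (arep (model R N) ups) (arep (model R N) gamma)) 0.
Proof.
move=> g e; apply: feqT (arep_br (okm' N) _ gch_ups g) _.
rewrite -/(gc_diff false gamma) e => s s0 ss.
have := arep_lin (okm' N) (model R N) (-1) (gch0 false) (gch0 false) s0 ss.
by rewrite scaler0 addr0 !famE scaleN1r addNr.
Qed.

(** The component with N + 1 vertices is read off in the model with N + 1 vertices; the component
    with no vertex has no model and is compared by hypothesis. *)
Lemma chain_inj d gamma gamma' : gch d gamma -> gch d gamma' -> gamma 0%N = gamma' 0%N ->
  (forall N, feq (arep (model R N) gamma) (arep (model R N) gamma')) -> gamma = gamma'.
Proof.
move=> [f b _ _] [f' b' _ _] e0 E; apply/funext => -[|N] //.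
by apply: (arep_inj f b f' b'); exact: E.
Qed.

Lemma gc_zero c d gamma : gc c d gamma -> gamma 0%N = 0.
Proof. by move=> [sh _]; apply/funext => G; apply: contrapT => /sh[]. Qed.

(** Closedness is verified on operators in every model, where it is the Jacobi identity, and
    reflected back to chains. *)
Lemma gc_cocycle_br c gamma gamma' : gc_cocycle c gamma -> gc_cocycle c gamma' ->
  gc_cocycle c (gc_br false false gamma gamma').
Proof.
move=> [g e] [g' e']; have gg := gc_br_gc g g'; split; first exact: gg.
have h : gch false gamma := gcP1 g; have h' : gch false gamma' := gcP1 g'.
have hb : gch false (gc_br false false gamma gamma') := gch_br h h'.
have hd : gch true (gc_br true false ups (gc_br false false gamma gamma')) := gch_br gch_ups hb.
have gd := gc_br_gc (gc_upsilon R c) gg.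
apply: (chain_inj hd (gch0 true)); first exact: gc_zero gd.
move=> N; apply: feqT (feqS (arep_br (okm' N) (model R N) gch_ups hb)) _.
apply: feqT (nr_feq (okm' N) _ _ (pcoC (pco_arep (okm' N) _ gch_ups)) (pcoC (pco_arep (okm' N) _ hb)) (feqR _) (feqS (arep_br (okm' N) (model R N) h h'))) _.
apply: feqT (nr_closed (okm' N) (pco_arep (okm' N) _ gch_ups) (pco_arep (okm' N) _ h) (pco_arep (okm' N) _ h') (cocycle_arep h e) (cocycle_arep h' e')) _.
move=> s s0 ss; have := arep_lin (okm' N) (model R N) (-1) (gch0 true) (gch0 true) s0 ss.
by rewrite scaler0 addr0 !famE scaleN1r addNr.
Qed.

Lemma gc_cocycle_lin c (a : R) gamma gamma' : gc_cocycle c gamma -> gc_cocycle c gamma' ->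
  gc_cocycle c (a *: gamma + gamma').
Proof.
move=> [g e] [g' e']; have gg := gc_lin a g g'; split => //.
have h := gcP1 g; have h' := gcP1 g'; have hb := gcP1 gg.
have hd := gch_br gch_ups hb; have gd := gc_br_gc (gc_upsilon R c) gg.
apply: (chain_inj hd (gch0 true)); first exact: gc_zero gd.
move=> N; have ok := okm' N; have pu := pco_arep ok (model R N) gch_ups.
have p1 := pco_arep ok (model R N) h; have p2 := pco_arep ok (model R N) h'.
apply: feqT (feqS (arep_br ok (model R N) gch_ups hb)) _.
apply: feqT (nr_feq ok _ _ (pcoC pu) (pcoC (pco_arep ok _ hb)) (feqR _) (arep_lin ok (model R N) a h h')) _.
apply: feqT (nrPr ok _ _ a (pcoM pu) (pcoC pu) (pcoC p1) (pcoC p2)) _.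
move=> s s0 ss; rewrite !famE (cocycle_arep h e s0 ss) (cocycle_arep h' e' s0 ss) scaler0 addr0.
have := arep_lin ok (model R N) (-1) (gch0 true) (gch0 true) s0 ss.
by rewrite scaler0 addr0 !famE scaleN1r addNr.
Qed.

Lemma cocyc0 c : gc_cocycle c (0 : gchain R).
Proof.
split; first exact: gc0.
have hd := gch_br gch_ups (gch0 false); have gd := gc_br_gc (gc_upsilon R c) (gc0 R c 0).
apply: (chain_inj hd (gch0 true)); first exact: gc_zero gd.
move=> N; have ok := okm' N; apply: feqT (feqS (arep_br ok (model R N) gch_ups (gch0 false))) _.
have z (d : bool) : feq (arep (model R N) (0 : gchain R)) 0.
  move=> s s0 ss; have := arep_lin ok (model R N) (-1) (gch0 d) (gch0 d) s0 ss.
  by rewrite scaler0 addr0 !famE scaleN1r addNr.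
apply: feqT (nr_feq0 ok (pco_arep ok (model R N) gch_ups) (pco_arep ok (model R N) (gch0 false)) (z false)) _.
exact: feqS (z true).
Qed.

(* On two generators [x], [y] of the model, [delta gamma] is
   [a ({x,y} + {x,y} - {x,y})] where [a] is the coefficient of the one-vertex graph. *)
Lemma gc_cocycle_unary c gamma : gc_cocycle c gamma -> gamma 1%N = 0.
Proof.
move=> [g e]; have h := gcP1 g; have [sh _] := g.
pose G0 : graph := seq_mset ([::] : seq edge).
have e0 : edges G0 = [::] by apply: perm_small_eq => //; exact: edges_mset.
(* In degree 0 with one vertex, 3(1 - 1) - 2k = 0 forces k = 0, so only the graph without edges is
   possible. *)
have G1 G : gamma 1%N G <> 0 -> G = G0.
  move=> /sh[_ _ _ _ dE]; have : size (edges G) = 0%N by lia.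
  by move/size0nil => eG; rewrite -(seq_mset_id G) -/(edges G) eG.
set a := gamma 1%N G0.
suff a0 : a = 0 by apply/funext => G; apply: contrapT => nz; apply: (nz); rewrite (G1 _ nz).
have ok := okm' 1; set MM := model R 1.
have pu := pco_arep ok MM gch_ups; have pg := pco_arep ok MM h.
have D1 (x : bool * Lm 1) : @okb R (Lm 1) x -> arep MM gamma [:: x.2] = a *: x.2.
  move=> ox; rewrite -[[:: x.2]]/(us [:: x]) (arep_us ok) ?/= ?ox //; last exact: gch_fin h.
  rewrite /hrep (fs_seq (r := [:: G0])) // ?big_seq1 /= ?e0 // => G; rewrite inE => /eqP nG.
  suff -> : gamma 1%N G = 0 by rewrite scale0r.
  by apply: contrapT => /G1.
have U1 (x : bool * Lm 1) : @okb R (Lm 1) x -> arep MM ups [:: x.2] = 0.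
  move=> ox; rewrite -[[:: x.2]]/(us [:: x]) (arep_us ok) ?/= ?ox //; last exact: gch_fin gch_ups.
  by rewrite /hrep (fs_seq (r := [::])) // ?big_nil // => G _; rewrite upsilonE scale0r.
have Dw (w : Lm 1) : gsub w -> arep MM gamma [:: w] = a *: w by move=> _; exact: (D1 (false, w) (okm_f w)).
have Uw (w : Lm 1) : gsub w -> arep MM ups [:: w] = 0 by move=> _; exact: (U1 (false, w) (okm_f w)).
have sz : size (htau R 1 id) = 2%N by rewrite size_map.
have au := @coef_model R 1 id ups [mset (0%N, 1%N, true)]%mset (fun=> erefl) (fun=> erefl) (gch_fin gch_ups) (gch_below gch_ups).
move: au; case: (htau R 1 id) sz => [|[b1 u] [|[b2 v] [|? ?]]] // _ /=.
rewrite relabel_id upsilonE !mset1_eq /= !subr0 addr0 => au.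
have := nr_unary ok pu pg Dw Uw (okm_f u) (okm_f v).
rewrite (cocycle_arep h e) // => E.
have := congr1 (fun f => f (q0 1 [mset (0%N, 1%N, true)]%mset) 0) E.
rewrite -[(a *: _) _ _]/(a * arep MM ups [:: u; v] (q0 1 [mset (0%N, 1%N, true)]%mset) 0).
rewrite au ?mulr1; last by rewrite /vertices_below edges1.
by move=> <-.
Qed.
End ChainLevel.

(** * Filtrations and the product of GRT_1 *)

Section Order.
Context (R : realType).
Implicit Types (f g psi : ser R bool) (w : seq bool).

Definition vord (k : nat) f := forall w, (size w < k)%N -> f w = 0.

Lemma vord_mul a b f g : vord a f -> vord b g -> vord (a + b) (ser_mul f g).
Proof.
move=> hf hg w wl; rewrite /ser_mul big1 // => i _.
have iw : (i <= size w)%N by rewrite -ltnS ltn_ord.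
have [ia|ai] := ltnP i a; first by rewrite hf ?mul0r // size_takel.
by rewrite hg ?mulr0 // size_drop; lia.
Qed.
Lemma ordD a f g : vord a f -> vord a g -> vord a (f + g).
Proof. by move=> hf hg w wa; rewrite -[LHS]/(f w + g w) hf // hg // addr0. Qed.
Lemma ordN a f : vord a f -> vord a (- f).
Proof. by move=> hf w wa; rewrite -[LHS]/(- f w) hf // oppr0. Qed.
Lemma ord_br a b f g : vord a f -> vord b g -> vord (a + b) (ser_br f g).
Proof.
move=> hf hg; apply: ordD; first exact: vord_mul.
by apply: ordN; rewrite addnC; exact: vord_mul.
Qed.
Lemma vord_letter (t : bool) : vord 1 (letter R t).
Proof. by move=> [|x w]. Qed.
Lemma vord_letters (s : seq bool) (rest : seq (ser R bool)) k : vord k (ser_prod rest) ->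
  vord (size s + k) (ser_prod ([seq letter R t | t <- s] ++ rest)).
Proof.
move=> hr; elim: s => //= t s IH; rewrite -add1n -addnA.
by apply: vord_mul => //; exact: vord_letter.
Qed.

(** The derivation replaces one letter by a series of order b + 1, which adds b to the length. *)
Lemma ord_der a b psi f : vord b psi -> vord a f -> vord (a + b) (ihara_der psi f).
Proof.
move=> hp hf w wl; rewrite /ihara_der big1 // => n _; rewrite big1 // => v _; rewrite big1 // => i _.
have [na|an] := ltnP n a; first by rewrite hf ?mul0r // size_tuple.
have hX : vord (b + 1) (if tnth v i then ser_br psi (lX R) else 0).
  by case: ifP => // _; apply: ord_br => //; exact: vord_letter.
have hd : vord (size (drop i.+1 v) + 0) (ser_prod ([seq letter R t | t <- drop i.+1 v] ++ [::])) by exact: vord_letters.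
rewrite cats0 addn0 in hd.
have := @vord_letters (take i v) ((if tnth v i then ser_br psi (lX R) else 0) :: [seq letter R t | t <- drop i.+1 v]) _ (vord_mul hX hd).
move=> /(_ w) => -> //; rewrite ?mulr0 //.
have ni := ltn_ord i; have iv : (i <= size v)%N by rewrite size_tuple ltnW.
by rewrite (size_takel iv) size_drop size_tuple; lia.
Qed.

Lemma ord_ihara a b f g : vord a f -> vord b g -> vord (a + b) (ihara_br f g).
Proof.
move=> hf hg; apply: ordD; last by apply: ordN; rewrite addnC; exact: ord_der.
by apply: ordD; [exact: ord_br|exact: ord_der].
Qed.

Lemma ord_nested (l : seq (ser R bool)) : (forall f, f \in l -> vord 1 f) -> vord (size l) (nested_br (@ihara_br R) l).
Proof.
elim: l => // f [_ H|g l IH H]; first by apply: H; rewrite inE.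
rewrite [size _]/(1 + size (g :: l))%N; apply: ord_ihara; first by apply: H; rewrite inE eqxx.
by apply: IH => x xl; apply: H; rewrite inE xl orbT.
Qed.

Lemma lie_poly_nil f : lie_poly f -> f [::] = 0.
Proof.
elim=> [t|a g h _ Eg _ Eh|g h _ Eg _ Eh] //.
  by rewrite -[LHS]/(a * g [::] + h [::]) Eg Eh mulr0 addr0.
by rewrite -[LHS]/(ser_mul g h [::] - ser_mul h g [::]) /ser_mul !big_ord1 /= Eg Eh !mul0r subr0.
Qed.

Lemma grt_ord psi : grt psi -> vord 1 psi.
Proof. by move=> [/(_ 0%N)/lie_poly_nil E _ _ _] [|x w] // _. Qed.
End Order.

Section Local.
Context (R : realType).
Implicit Types (gamma : gchain R).

Definition vanG k gamma := forall N, (N <= k)%N -> gamma N = 0.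

(** More than a vertices outside, counting the slot, and more than b inside leave more than a + b
    vertices after insertion. *)
Lemma van_pre d a b gamma gamma' : (forall N, finite_set [set G | gamma N G <> 0]) -> (forall N, finite_set [set G | gamma' N G <> 0]) ->
  vanG a gamma -> vanG b gamma' -> vanG (a + b) (gc_pre d gamma gamma').
Proof.
move=> f f' va vb M Mab; apply/funext => H; apply: contrapT => /(gc_pre_supp f f')[c [G [G' [es [oc n1 n2 _ _]]]]].
have sz := gcij_size c.
have l1 : (a < (size (gcj c)).+1)%N by rewrite ltnNge; apply/negP => /va e; apply: n1; rewrite e.
have l2 : (b < size (gci c))%N by rewrite ltnNge; apply/negP => /vb e; apply: n2; rewrite e.
lia.
Qed.

Lemma van_br a b gamma gamma' : (forall N, finite_set [set G | gamma N G <> 0]) -> (forall N, finite_set [set G | gamma' N G <> 0]) ->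
  vanG a gamma -> vanG b gamma' -> vanG (a + b) (gc_br false false gamma gamma').
Proof.
move=> f f' va vb M Mab; rewrite /gc_br -[LHS]/(gc_pre _ _ _ M - _ *: gc_pre _ _ _ M).
rewrite (van_pre _ f f' va vb) // (van_pre _ f' f vb va) ?scaler0 ?subrr //; by rewrite addnC.
Qed.

Lemma gc_pre_local d gamma gamma' k k' M : (forall N, (N <= M)%N -> gamma N = k N) -> (forall N, (N <= M)%N -> gamma' N = k' N) ->
  gc_pre d gamma gamma' M = gc_pre d k k' M.
Proof.
move=> E E'; apply/funext => H; apply: eq_bigr => c oc /=; congr (_ * _).
have sz := gcij_size c; have := size_gci oc => s0.
apply: eq_fsbigr => G _; apply: eq_fsbigr => G' _.
by rewrite -/(gci c) -/(gcj c) E ?E' //; lia.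
Qed.

Section Nest.
Context (c : colour) (g1 g2 : gchain R) (h1 : gc_cocycle c g1) (h2 : gc_cocycle c g2).

Definition gsel (t : bool) := if t then g1 else g2.
Definition nestG (v : seq bool) : gchain R := nested_br (gc_br false false) [seq gsel t | t <- v].

Lemma gsel_coc t : gc_cocycle c (gsel t). Proof. by case: t. Qed.
Lemma nestG_coc v : gc_cocycle c (nestG v).
Proof.
elim: v => [|b [|b' v] IH]; [exact: cocyc0|exact: gsel_coc|].
exact: gc_cocycle_br (gsel_coc b) IH.
Qed.
Lemma coc_fin (g : gchain R) : gc_cocycle c g -> forall N, finite_set [set G | g N G <> 0].
Proof. by move=> [h _]; exact: gch_fin (gcP1 h). Qed.
Lemma coc_van (g : gchain R) : gc_cocycle c g -> vanG 1 g.
Proof.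
move=> h [|[|N]] //; first by move=> _; exact: gc_zero h.1.
by move=> _; exact: gc_cocycle_unary h.
Qed.
Lemma nestG_van v : vanG (size v) (nestG v).
Proof.
elim: v => [|b [|b' v] IH]; [by []|exact: coc_van (gsel_coc b)|].
exact: (van_br (coc_fin (gsel_coc b)) (coc_fin (nestG_coc (b' :: v))) (coc_van (gsel_coc b)) IH).
Qed.

Definition gpart k : gchain R := \sum_(v : k.-tuple bool) bchc R v *: nestG v.
Definition gpartial K : gchain R := \sum_(k < K.+1) gpart k.
(** The Dynkin series of two cocycles. A bracket of k of them is supported on more than k vertices,
    so the component with N vertices is already that of the partial sum up to N. *)
Definition gbch : gchain R := fun N => gpartial N N.

Lemma coc_sum (I : Type) (s : seq I) (F : I -> gchain R) : (forall i, gc_cocycle c (F i)) -> gc_cocycle c (\sum_(i <- s) F i).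
Proof.
move=> hF; elim: s => [|i s IH]; rewrite ?big_nil ?big_cons; first exact: cocyc0.
by rewrite -[F i]scale1r; exact: gc_cocycle_lin.
Qed.
Lemma gpart_coc k : gc_cocycle c (gpart k).
Proof.
apply: coc_sum => v; rewrite -[_ *: _]addr0; apply: gc_cocycle_lin; [exact: nestG_coc|exact: cocyc0].
Qed.
Lemma gpartial_coc K : gc_cocycle c (gpartial K).
Proof. by apply: coc_sum => k; exact: gpart_coc. Qed.
Lemma evG (I : Type) (s : seq I) (F : I -> gchain R) N : (\sum_(i <- s) F i) N = \sum_(i <- s) F i N.
Proof. by elim: s => [|i s IH]; rewrite ?big_nil // !big_cons -IH. Qed.
Lemma gpart_van k : vanG k (gpart k).
Proof.
move=> N Nk; rewrite /gpart evG big1 // => v _; rewrite -[LHS]/(bchc R v *: nestG v N).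
by rewrite nestG_van ?scaler0 // size_tuple.
Qed.
Lemma gpartial_at N K : (N <= K)%N -> gpartial K N = gbch N.
Proof.
elim: K => [|K IH]; first by rewrite leqn0 => /eqP->.
rewrite leq_eqVlt => /orP[/eqP->|NK] //; rewrite ltnS in NK.
rewrite -(IH NK) /gpartial big_ord_recr -[LHS]/((\sum_(k < K.+1) gpart k) N + gpart K.+1 N).
by rewrite gpart_van ?addr0 // ltnW.
Qed.

(** Every condition concerns one number of vertices at a time, where the series agrees with a
    partial sum; the differential on M vertices involves components with at most M vertices. *)
Lemma gbch_coc : gc_cocycle c gbch.
Proof.
split; first split=> [N G|N s G].
- exact: (gpartial_coc N).1.1.
- exact: (gpartial_coc N).1.2.
apply/funext => M; have [_ E] := gpartial_coc M.
transitivity (gc_diff false (gpartial M) M); last by rewrite E.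
rewrite /gc_diff /gc_br -[LHS]/(gc_pre _ _ _ M - _ *: gc_pre _ _ _ M) -[RHS]/(gc_pre _ _ _ M - _ *: gc_pre _ _ _ M).
have Lo N : (N <= M)%N -> gbch N = gpartial M N by move=> NM; rewrite gpartial_at.
have E1 := gc_pre_local false (fun N (_ : (N <= M)%N) => erefl (upsilon R N)) Lo.
have E2 := gc_pre_local true Lo (fun N (_ : (N <= M)%N) => erefl (upsilon R N)).
by rewrite E1 E2.
Qed.

(** Continuity of [Psi] enters here: the tail of the series has many vertices, so its image vanishes
    on short words, while partial sums are handled by linearity and brackets. *)
Lemma Psi_gbch Psi : grt_iso c Psi -> Psi gbch = grt_mul (Psi g1) (Psi g2).
Proof.
move=> [[gr _] lin ker br cont]; apply/funext => w.
have P0 : Psi 0 = 0.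
  have := lin (-1) 0 0 (cocyc0 R c) (cocyc0 R c); by rewrite scaler0 addr0 scaleN1r addNr.
(* [K] is at least the continuity bound for words as long as [w], and at least the length of [w],
   beyond which nested Ihara brackets vanish at [w]. *)
have [M HM] := cont (size w); pose K := maxn M (size w).
have E1 : Psi gbch w = Psi (gpartial K) w.
  have d := gc_cocycle_lin (-1) (gpartial_coc K) gbch_coc.
  have V N G : (N < M)%N -> (-1 *: gpartial K + gbch) N G = 0.
    move=> NM; rewrite -[LHS]/(-1 * gpartial K N G + gbch N G) gpartial_at ?mulN1r ?addNr //.
    by rewrite (leq_trans (ltnW NM)) // leq_maxl.
  have := HM _ d V w (leqnn _); rewrite (lin _ _ _ (gpartial_coc K) gbch_coc) => H.
  by apply/eqP; rewrite -subr_eq0; apply/eqP; rewrite -[RHS]H -[RHS]/(-1 * Psi (gpartial K) w + Psi gbch w) mulN1r addrC.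
have Psum (I : Type) (s : seq I) (F : I -> gchain R) : (forall i, gc_cocycle c (F i)) -> Psi (\sum_(i <- s) F i) = \sum_(i <- s) Psi (F i).
  move=> hF; elim: s => [|i s IH]; rewrite ?big_nil // !big_cons -[F i]scale1r lin // ?scale1r ?IH //; exact: coc_sum.
have ev (I : Type) (s : seq I) (F : I -> ser R bool) : (\sum_(i <- s) F i) w = \sum_(i <- s) F i w.
  by elim: s => [|i s IH]; rewrite ?big_nil // !big_cons -IH.
have PZ (a : R) g : gc_cocycle c g -> Psi (a *: g) = a *: Psi g.
  by move=> hg; have := lin a g 0 hg (cocyc0 R c); rewrite addr0 P0 addr0.
have PN v : v <> [::] -> Psi (nestG v) = nested_br (@ihara_br R) [seq (if t then Psi g1 else Psi g2) | t <- v].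
  elim: v => // b [_ _|b' v IH _]; first by case: b.
  have -> : nestG [:: b, b' & v] = gc_br false false (gsel b) (nestG (b' :: v)) by [].
  rewrite br ?IH //; [by case: b|exact: gsel_coc|exact: nestG_coc].
have Ek k : Psi (gpart k) w = if (k == 0)%N then 0 else \sum_(v : k.-tuple bool) log_exp_exp R v / k%:R *
    nested_br (@ihara_br R) [seq (if t then Psi g1 else Psi g2) | t <- v] w.
  rewrite /gpart Psum; last by move=> v; rewrite -[_ *: _]addr0; apply: gc_cocycle_lin; [exact: nestG_coc|exact: cocyc0].
  rewrite ev; case: eqP => [k0|k0].
    rewrite big1 // => v _; rewrite PZ; last exact: nestG_coc.
    have v0 : tval v = [::] by apply: size0nil; rewrite size_tuple.
    by rewrite /nestG v0 P0 scaler0.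
  apply: eq_bigr => v _; rewrite PZ; last exact: nestG_coc.
  rewrite PN; last by move=> e; apply: k0; rewrite -(size_tuple v) e.
  by rewrite /bchc size_tuple.
rewrite E1 /gpartial Psum; last by move=> k; exact: gpart_coc.
rewrite ev (eq_bigr _ (fun k _ => Ek (nat_of_ord k))) big_ord_recl /= add0r /grt_mul big_add1 /= big_mkord.
have wK : (size w <= K)%N by rewrite leq_maxr.
rewrite [RHS](big_ord_widen K (fun n => \sum_(v : n.+1.-tuple bool) log_exp_exp R v / n.+1%:R *
    nested_br (@ihara_br R) [seq (if t then Psi g1 else Psi g2) | t <- v] w)) //.
rewrite [LHS](bigID (fun i : 'I_K => (i < size w)%N)) /= [X in _ + X]big1 ?addr0 // => i.
rewrite -leqNgt => wi; rewrite big1 // => v _.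
have := @ord_nested R [seq (if t then Psi g1 else Psi g2) | t <- v] _ w; rewrite size_map size_tuple ltnS => -> //.
  by rewrite mulr0.
by move=> f /mapP[t _ ->]; apply: grt_ord; case: t; exact: gr.
Qed.
End Nest.
End Local.

(** * The Lie algebra map and the action of the group *)

Section BracketDifference.
Context (R : realType) (L : glie R) (Lok : glieok L).
Implicit Types (D G : Defs.family L).

Lemma nr_subr D G G' : pco skew_chi false D -> pco skew_chi false G -> pco skew_chi false G' ->
  feq (nr_br false false D (G - G')) (nr_br false false D G - nr_br false false D G').
Proof.
move=> p q q'; have -> : G - G' = -1 *: G' + G by rewrite scaleN1r addrC.
apply: feqT (nrPr Lok false false (-1) (pcoM p) (pcoC p) (pcoC q') (pcoC q)) _.
by rewrite scaleN1r addrC.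
Qed.

(** The mixed terms cancel because the bracket of even elements is antisymmetric. A difference of
    brackets is thus expressed through D' - G' and D - G, which are exact where this is applied. *)
Lemma nr_diff D D' G G' : pco skew_chi false D -> pco skew_chi false D' ->
  pco skew_chi false G -> pco skew_chi false G' ->
  feq (nr_br false false D (D' - G') - nr_br false false G' (D - G))
  (nr_br false false D D' - nr_br false false G G').
Proof.
move=> p p' q q'.
apply: feqT (feqD (nr_subr p p' q') (feqN (nr_subr q' p q))) _.
rewrite (nr_anti false false G' D) (nr_anti false false G' G) /= !scale1r.
have Z (V : zmodType) (a b e : V) : a - b - (- b - - e) = a - e by rewrite opprK opprD opprK addrA subrK.
by rewrite Z.
Qed.

Lemma pco_sub D G : pco skew_chi false D -> pco skew_chi false G -> pco skew_chi false (D - G).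
Proof. by move=> p q; have -> : D - G = -1 *: G + D by [rewrite scaleN1r addrC]; exact: pcoP. Qed.
End BracketDifference.

Section Final.
Context (R : realType) (m r : nat) (U : set 'rV[R]_m) (Uo : open U) (c : colour).
Local Notation A := (@ideal R m r U (colz c)).
Local Notation L := (shifted_algebra U A).
Local Notation Ls := (@Lsm R m r U).
Local Notation fam := (Defs.family L).
Local Notation Lok := (@LA_ok R m r U c).
Local Notation Ldeg := (@LA_deg R m r U c).
Local Notation SA := (@sm_galg R m r U Uo).
Local Notation okL := (@glie_ok_sm R m r U).
Implicit Types (gamma : gchain R) (psi : ser R bool).
Local Notation RL gamma := (rep U gamma : fam).
Local Notation RS gamma := (rep U gamma : Defs.family Ls).

Lemma rep_lin d (a : R) gamma gamma' : gch d gamma -> gch d gamma' ->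
  feq (RL (a *: gamma + gamma')) (a *: RL gamma + RL gamma').
Proof.
move=> g g'; have E : feq (RS (a *: gamma + gamma')) (a *: RS gamma + RS gamma').
  apply: feqT (@rep_arep R m r U Uo _ _ (gchP a g g')) _.
  apply: feqT (arep_lin okL SA a g g') _.
  exact: (feqP a (feqS (@rep_arep R m r U Uo _ _ g)) (feqS (@rep_arep R m r U Uo _ _ g'))).
exact: (feq_sm E).
Qed.

Lemma rep_br d d' gamma gamma' : gch d gamma -> gch d' gamma' ->
  feq (nr_br d d' (RL gamma) (RL gamma')) (RL (gc_br d d' gamma gamma')).
Proof.
move=> g g'; have e := @rep_arep R m r U Uo _ _ g; have e' := @rep_arep R m r U Uo _ _ g'.
have E0 := nr_feq okL d d' (pcoC (@pco_rep R m r U Uo _ _ g)) (pcoC (@pco_rep R m r U Uo _ _ g')) e e'.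
have E1 := feqS (@rep_arep R m r U Uo _ _ (gch_br g g')).
exact: (feq_sm (feqT E0 (feqT (arep_br okL SA g g') E1))).
Qed.

Lemma rep0 : RL (0 : gchain R) = 0.
Proof. by apply/funext => s; rewrite /rep (fs_seq (r := [::])) ?big_nil // => G _; rewrite scale0r. Qed.

Lemma brE : @br_family R L = rep U (upsilon R).
Proof. by apply/funext => s; rewrite (rep_upsilon U A). Qed.
Lemma cbr : cochain 1 (@br_family R L).
Proof. by rewrite brE; exact: cochain_rep Uo _ _ _ (gc_upsilon R c). Qed.

Lemma rep_coc gamma : gc_cocycle c gamma -> ce_cocycle (RL gamma).
Proof.
move=> [g e]; split; first exact: cochain_rep.
rewrite /ce_diff brE; apply: feqT (rep_br (gch_ups R) (gcP1 g)) _.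
by rewrite -[gc_br _ _ _ _]/(gc_diff false gamma) e rep0.
Qed.
Lemma rep_exact gamma : gc_exact c gamma -> ce_exact (RL gamma).
Proof.
move=> [h gh ->]; exists (RL h); first exact: cochain_rep.
rewrite /ce_diff brE; exact: feqS (rep_br (gch_ups R) (gcP1 gh)).
Qed.
(** The chain vanishes on one vertex by [gc_cocycle_unary], so its operator has no unary component
    and can be exponentiated. *)
Lemma rep_good gamma : gc_cocycle c gamma -> good (RL gamma).
Proof.
move=> h; have p : pco skew_chi false (RL gamma) := @pco_rep_A R m r U Uo c 0 gamma h.1.
split; first exact: p.
move=> u _; rewrite /rep (fs_seq (r := [::])) ?big_nil // => G _.
by rewrite /= (gc_cocycle_unary h) scale0r.
Qed.

Lemma exP (a : R) (P Q : fam) : ce_exact P -> ce_exact Q -> ce_exact (a *: P + Q).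
Proof.
move=> [h ch E] [h' ch' E']; exists (a *: h + h'); first exact: (cochainP Lok Ldeg).
apply: feqT (feqP a E E') _; apply: feqS.
by apply: (ce_diffP Lok Ldeg cbr); [exact: pcoC (pcoh Lok Ldeg ch)|exact: pcoC (pcoh Lok Ldeg ch')].
Qed.
Lemma exF (P Q : fam) : feq P Q -> ce_exact P -> ce_exact Q.
Proof. by move=> E [h ch e]; exists h; [exact: ch|exact: feqT (feqS E) e]. Qed.
Lemma ex0 : ce_exact (0 : fam).
Proof. by exists 0; [exact: (cochain0 Lok Ldeg)|exact: feqS (ce_diff0 Lok Ldeg cbr _)]. Qed.
Lemma exD (P Q : fam) : ce_exact P -> ce_exact Q -> ce_exact (P + Q).
Proof. by move=> p q; rewrite -[P]scale1r; exact: exP. Qed.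
Lemma exN (P : fam) : ce_exact P -> ce_exact (- P).
Proof. by move=> p; rewrite -[- P]addr0 -scaleN1r; apply: exP => //; exact: ex0. Qed.

Lemma coc_pco (D : fam) : ce_cocycle D -> pco skew_chi false D.
Proof. by move=> [/(cochainE Lok Ldeg)[]]. Qed.

(** Exact cochains of degree 0 have no unary component, so the absence of one depends on the class
    only. *)
Lemma coc_good (D E : fam) : ce_cocycle D -> good E -> ce_exact (D - E) -> good D.
Proof.
move=> cD [_ uE] [h ch e]; split; first exact: coc_pco.
move=> u gu; have iu : in_sub [:: u] by apply/in_subc.
have n0 : [:: u] <> [::] by [].
have e2 : D [:: u] - E [:: u] = ce_diff true h [:: u] := e [:: u] n0 iu.
rewrite (uE u gu) subr0 in e2; rewrite e2.
exact: (good_exact Lok Ldeg cbr ch).2.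
Qed.

Lemma ce_diff_lin0 (a : R) (D D' : fam) : ce_cocycle D -> ce_cocycle D' -> ce_cocycle (a *: D + D').
Proof.
move=> cD cD'; split; first by apply: (cochainP Lok Ldeg); [exact: cD.1|exact: cD'.1].
apply: feqT (ce_diffP Lok Ldeg cbr false a (pcoC (coc_pco cD)) (pcoC (coc_pco cD'))) _.
by move=> s s0 ss; rewrite !famE cD.2 // cD'.2 // scaler0 addr0.
Qed.

Lemma coc_nr (D D' : fam) : ce_cocycle D -> ce_cocycle D' -> ce_cocycle (nr_br false false D D').
Proof.
move=> cD cD'; split.
  by have := cochain_nr Lok Ldeg cD.1 cD'.1; rewrite addr0.
apply: (nr_closed Lok _ (coc_pco cD) (coc_pco cD') cD.2 cD'.2).
by have /(cochainE Lok Ldeg)[] := cbr.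
Qed.

Lemma ex_nr (D E : fam) : ce_cocycle D -> pco skew_chi false E -> ce_exact E -> ce_exact (nr_br false false D E).
Proof.
move=> cD pE [h ch e]; exists (nr_br false true D h); first exact: (cochain_nr0 Lok Ldeg cD.1 ch).
apply: feqT (nr_feq Lok false false (pcoC (coc_pco cD)) (pcoC pE) (feqR _) e) _.
exact: (nr_exact Lok Ldeg cbr (coc_pco cD) (pcoh Lok Ldeg ch) cD.2).
Qed.

Lemma hom_feqr (F G G' : fam) : feq G G' -> homotopic F G -> homotopic F G'.
Proof.
move=> E [h ch e]; exists h; first exact: ch.
have cl := pcoC (pco_linf_exp Lok (good_exact Lok Ldeg cbr ch)).
exact: (feqT e (linf_comp_feq Lok cl E (feqR _))).
Qed.

Section Iso.
Variables (Psi : gchain R -> ser R bool) (iso : grt_iso c Psi).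

(** By the kernel condition of [grt_iso] the two chains differ by an exact chain, and exactness
    passes to operators. *)
Lemma coh_psi gamma gamma' : gc_cocycle c gamma -> gc_cocycle c gamma' -> Psi gamma = Psi gamma' ->
  ce_exact (RL gamma - RL gamma').
Proof.
move=> h h' e; have [_ lin ker _ _] := iso.
have hh := gc_cocycle_lin (-1) h' h.
have : gc_exact c (-1 *: gamma' + gamma) by apply/ker => //; rewrite lin // e scaleN1r addNr.
move=> /rep_exact; apply: exF; apply: feqT (rep_lin (-1) (gcP1 h'.1) (gcP1 h.1)) _.
by rewrite scaleN1r addrC.
Qed.

Local Notation ind := (induced U c A Psi).

Lemma lie_morphism : induces_lie_morphism U c A Psi.
Proof.
have [[gr sur] lin ker br _] := iso; split.
- by split=> gamma; [exact: rep_coc|exact: rep_exact].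
- split=> [psi /sur[gamma h e]|psi D D' gp [cD [g [h e x]]] [cD' [g' [h' e' x']]]].
    exists (RL gamma); split; first exact: rep_coc.
    by exists gamma; split => //; rewrite /cohomologous subrr; exact: ex0.
  have := exD (exD x (coh_psi h h' (etrans e (esym e')))) (exN x').
  rewrite /cohomologous; congr ce_exact.
  by rewrite addrA subrK opprB addrA subrK.
- move=> a psi psi' D D' gp gp' [cD [g [h e x]]] [cD' [g' [h' e' x']]].
  split; first exact: ce_diff_lin0.
  exists (a *: g + g'); split; [exact: gc_cocycle_lin|by rewrite lin // e e'|].
  apply: exF (exP a x x'); apply: feqS.
  move=> s s0 ss; rewrite /cohomologous !famE (rep_lin a (gcP1 h.1) (gcP1 h'.1)) // !famE.
  by rewrite scalerBr opprD addrACA.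
- move=> psi psi' D D' gp gp' [cD [g [h e x]]] [cD' [g' [h' e' x']]].
  split; first exact: coc_nr.
  exists (gc_br false false g g'); split; [exact: gc_cocycle_br|by rewrite br // e e'|].
  have cg := rep_coc h; have cg' := rep_coc h'.
  have p1 := coc_pco cD; have p2 := coc_pco cD'; have q1 := coc_pco cg; have q2 := coc_pco cg'.
  (* The two arguments are replaced by their graph representatives one after the other, each time at
     the cost of an exact term. *)
  have y := exD (ex_nr cD (pco_sub Lok p2 q2) x') (exN (ex_nr cg' (pco_sub Lok p1 q1) x)).
  apply: exF y; apply: feqT (nr_diff Lok p1 p2 q1 q2) _.
  exact: feqD (feqR _) (feqN (rep_br (gcP1 h.1) (gcP1 h'.1))).
Qed.

Lemma nested_rep (g1 g2 : gchain R) v : gc_cocycle c g1 -> gc_cocycle c g2 ->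
  feq (nestedF (RL g1) (RL g2) v) (RL (nestG g1 g2 v)).
Proof.
move=> h1 h2; elim: v => [|b [|b' v] IH]; first by (have -> : nestG g1 g2 [::] = 0 by []); rewrite rep0; exact: feqR.
  by case: b.
have hb := gsel_coc h1 h2 b; have hv := nestG_coc h1 h2 (b' :: v).
have E : D_ (RL g1) (RL g2) b = RL (gsel g1 g2 b) by case: b {hb}.
rewrite nestedF_cons // E.
apply: feqT (nr_feq Lok false false (pcoC (coc_pco (rep_coc hb))) _ (feqR _) IH) _.
  exact: pcoC (pco_nestedF Lok (rep_good h1) (rep_good h2) _).
exact: (rep_br (gcP1 hb.1) (gcP1 hv.1)).
Qed.

Lemma rep_sum (I : Type) (s : seq I) (F : I -> gchain R) : (forall i, gc_cocycle c (F i)) ->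
  feq (RL (\sum_(i <- s) F i)) (\sum_(i <- s) RL (F i)).
Proof.
move=> hF; elim: s => [|i s IH]; first by rewrite !big_nil rep0.
rewrite !big_cons -[F i]scale1r; apply: feqT (rep_lin 1 (gcP1 (hF i).1) (gcP1 (coc_sum s hF).1)) _.
by rewrite !scale1r; apply: feqD.
Qed.

(** Brackets of operators are operators of brackets, and in each arity both series reduce to the
    same finite sum. *)
Lemma bch_rep (g1 g2 : gchain R) : gc_cocycle c g1 -> gc_cocycle c g2 ->
  feq (bch (RL g1) (RL g2)) (RL (gbch g1 g2)).
Proof.
move=> h1 h2 s s0 ss; rewrite (bchE Lok (rep_good h1) (rep_good h2) s0 ss (leqnn _)).
rewrite -[RHS]/(rep U (gpartial g1 g2 (size s)) s).
rewrite (rep_sum _ (fun k : 'I_(size s).+1 => gpart_coc h1 h2 k) s0 ss) fam_sum; apply: eq_bigr => k _.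
have hv (v : k.-tuple bool) : gc_cocycle c (bchc R v *: nestG g1 g2 v).
  by rewrite -[_ *: _]addr0; apply: gc_cocycle_lin; [exact: nestG_coc|exact: cocyc0].
rewrite (rep_sum _ hv s0 ss) /bchp !fam_sum; apply: eq_bigr => v _.
have hn := nestG_coc h1 h2 v.
have := rep_lin (bchc R v) (gcP1 hn.1) (gch0 R false) s0 ss; rewrite addr0 rep0 addr0 => ->.
exact: (congr1 (fun z : gfun R m r => bchc R v *: z) (nested_rep v h1 h2 s0 ss)).
Qed.

Lemma action : exponentiates_to_action U c A Psi.
Proof.
have [[gr sur] lin ker br _] := iso.
(* A cocycle is chosen for every element of grt; by [hmt] any other choice gives a homotopic
   automorphism. *)
have ch psi : exists g, grt psi -> gc_cocycle c g /\ Psi g = psi.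
  have [gp|ng] := pselect (grt psi); last by exists 0.
  by have [g h e] := sur _ gp; exists g.
have [lift lP] := choice ch.
exists (fun psi => linf_exp (RL (lift psi))).
have P0 : Psi 0 = 0.
  have := lin (-1) 0 0 (cocyc0 R c) (cocyc0 R c); by rewrite scaler0 addr0 scaleN1r addNr.
have aut g : gc_cocycle c g -> linf_aut (linf_exp (RL g)).
  by move=> h; have [c0 e0] := rep_coc h; exact: (linf_aut_exp Lok Ldeg cbr (rep_good h) c0 e0).
have hmt g g' : gc_cocycle c g -> gc_cocycle c g' -> Psi g = Psi g' -> homotopic (linf_exp (RL g)) (linf_exp (RL g')).
  move=> h h' e; apply: (homotopic_exp Lok Ldeg cbr (rep_good h') (rep_coc h') (rep_good h) (rep_coc h)).
  exact: coh_psi.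
split.
- by move=> psi /lP[h _]; exact: aut.
- have g0 : grt (0 : ser R bool) by rewrite -P0; apply: gr; exact: cocyc0.
  have [h e] := lP _ g0.
  apply: hom_feqr (hmt _ 0 h (cocyc0 R c) _); last by rewrite e P0.
  by apply: (linf_exp0 Lok (rep_good (cocyc0 R c))); rewrite rep0.
- move=> psi psi' gp gp'; have [h e] := lP _ gp; have [h' e'] := lP _ gp'.
  (* The series of the two lifts is a cocycle that [Psi] maps to the product. This proves that [grt]
     is closed under [grt_mul], and compares the chosen lift of the product with the series. *)
  have hb := gbch_coc h h'; have eb := Psi_gbch h h' iso; rewrite e e' in eb.
  have gm : grt (grt_mul psi psi') by rewrite -eb; exact: gr.
  split=> //; have [hm em] := lP _ gm.
  apply: hom_feqr (hmt _ _ hm hb _); last by rewrite em eb.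
  apply: feqT (feqS (linf_exp_bch Lok (rep_good h) (rep_good h'))).
  apply: feqS; apply: (linf_exp_feq Lok); last exact: bch_rep.
  exact: (good_bch Lok (rep_good h) (rep_good h')).
- move=> psi D gp [cD [g [h e x]]]; have [hl el] := lP _ gp.
  have gD := coc_good cD (rep_good h) x; split.
  + by move=> u Au; exact: gD.2.
  + by have [c0 e0] := cD; exact: (linf_aut_exp Lok Ldeg cbr gD c0 e0).
  + apply: (homotopic_exp Lok Ldeg cbr gD cD (rep_good hl) (rep_coc hl)).
    have := exD (coh_psi hl h (etrans el (esym e))) (exN x); congr ce_exact.
    by rewrite opprB addrA subrK.
Qed.
End Iso.
End Final.

Theorem theorem1p2 (R : realType) (m r : nat) (U : set 'rV[R]_m) (U_open : open U) :
  (forall Psi : gchain R -> ser R bool, grt_iso Black Psi ->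
     induces_lie_morphism U Black (@lie_quasi R m r U) Psi /\
     exponentiates_to_action U Black (@lie_quasi R m r U) Psi) /\
  (forall Psi : gchain R -> ser R bool, grt_iso Red Psi ->
     induces_lie_morphism U Red (@quasi_lie R m r U) Psi /\
     exponentiates_to_action U Red (@quasi_lie R m r U) Psi).
Proof.
split=> Psi iso; split.
(* By conversion, [lie_quasi] and [quasi_lie] are the ideals attached to the colours [Black] and
   [Red]. *)
- exact: (@lie_morphism R m r U U_open Black Psi iso).
- exact: (@action R m r U U_open Black Psi iso).
- exact: (@lie_morphism R m r U U_open Red Psi iso).
- exact: (@action R m r U U_open Red Psi iso).
Qed.
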